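(* The ConjRelReach problem (defined in the context) is PSPACE-hard and decidable in EXPTIME.
   Context: A Markov decision process (MDP) is a triple $\mathcal{M}=(S,\mathit{Act},\mathbf{P})$ with finite non-empty $S,\mathit{Act}$ and $\mathbf{P}:S\times\mathit{Act}\times S\to[0,1]$ such that each state has a non-empty set $\mathit{Act}(s)$ of enabled actions $\alpha$ with $\sum_{s'}\mathbf{P}(s,\alpha,s')=1$, and $\sum_{s'}\mathbf{P}(s,\alpha,s')=0$ for other actions. A (general) scheduler maps finite paths to distributions over actions enabled in the last state (it may use memory and randomization). $\Pr^\sigma_s(\mathbf{F}\,T)$ is the probability under $\sigma$ from $s$ of eventually reaching $T\subseteq S$. $r\approx_\epsilon r'$ iff $|r-r'|\le\epsilon$; $r\not\approx_\epsilon r'$ iff $|r-r'|>\epsilon$. ConjRelReach: given an MDP $\mathcal{M}$ (rational probabilities), naturals $l,m,n$, rational coefficients $q_{i,j}$ ($1\le i\le m$, $1\le j\le l$), rational bounds $q_1,\dots,q_l$, states $s_{i,j}$, indices $k_{i,j}$ with $\{k_{i,j}\mid i,j\}=\{1,\dots,n\}$, target sets $T_{i,j}\subseteq S$, and comparison operators $\bowtie_j\in\{>,\ge,\approx_\epsilon,\not\approx_\epsilon\mid\epsilon\in\mathbb{Q}_{\ge0}\}$, decide whether there exist general schedulers $\sigma_1,\dots,\sigma_n$ with $\bigwedge_{j=1}^l\sum_{i=1}^m q_{i,j}\Pr^{\sigma_{k_{i,j}}}_{s_{i,j}}(\mathbf{F}\,T_{i,j})\bowtie_j q_j$. *)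

(* Defs.v *)
From HB Require Import structures.
From mathcomp Require Import all_boot all_order all_algebra.
From mathcomp Require Import ring.
From mathcomp Require Import all_classical all_reals all_analysis.

Set Implicit Arguments.
Unset Strict Implicit.
Unset Printing Implicit Defensive.

Import Order.TTheory GRing.Theory Num.Theory.

Local Open Scope classical_set_scope.
Local Open Scope ring_scope.

(** Existence of a measure on infinite words over a finite alphabet with
    prescribed cylinder weights.  A real [u] drawn uniformly from [0, 1[ is
    sent to the word all of whose prefixes [w] satisfy [u \in ival w], where the
    intervals [ival w] have length [W w] and are nested. *)

Section partial_sums.
Context (R : realType) (E : finType) (f : E -> R).
Hypothesis f_ge0 : forall e, 0 <= f e.

Definition psum (k : nat) : R := \sum_(e : E | (enum_rank e < k)%N) f e.

Lemma psum0 : psum 0 = 0.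
Proof. by rewrite /psum big_pred0. Qed.

Lemma psum_card : psum #|E| = \sum_e f e.
Proof. by apply: eq_bigl => e; rewrite ltn_ord. Qed.

Lemma psumS (e : E) : psum (enum_rank e).+1 = psum (enum_rank e) + f e.
Proof.
rewrite /psum (bigD1 e) //= addrC; congr (_ + _).
apply: eq_bigl => e'; rewrite ltnS andbC [RHS]ltn_neqAle.
congr (_ && _); apply/idP/idP; apply: contraNN.
  by move/eqP/val_inj/enum_rank_inj => ->.
by move/eqP => ->.
Qed.

Lemma psum_le k l : (k <= l)%N -> psum k <= psum l.
Proof.
move=> kl; rewrite /psum [leRHS](bigID (fun e => enum_rank e < k)%N) /=.
rewrite -[leLHS]addr0; apply: lerD; last by apply: sumr_ge0.
rewrite le_eqVlt; apply/orP; left; apply/eqP/eq_bigl => e.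
by case: (ltnP (enum_rank e) k) => h; rewrite ?andbF // andbT (leq_trans h kl).
Qed.

Lemma psum_total k : psum k <= \sum_e f e.
Proof.
rewrite -psum_card; case: (leqP k #|E|) => [/psum_le//|h].
suff -> : psum k = psum #|E| by [].
by apply: eq_bigl => e; rewrite ltn_ord (ltn_trans _ h) // ltn_ord.
Qed.

Lemma psum_ex x : 0 <= x < \sum_e f e ->
  exists e, psum (enum_rank e) <= x < psum (enum_rank e) + f e.
Proof.
move=> /andP[x0 x1].
have ex : exists k, x < psum k by exists #|E|; rewrite psum_card.
case: (ex_minnP ex) => -[|k] xk kmin.
  by move: xk; rewrite psum0 ltNge x0.
have kE : (k < #|E|)%N.
  have := kmin #|E|; rewrite psum_card x1 => /(_ isT); exact.
exists (enum_val (Ordinal kE)); rewrite -psumS enum_valK /= xk andbT leNgt.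
by apply/negP => /kmin; rewrite ltnn.
Qed.

Lemma psum_uniq x e e' :
  psum (enum_rank e) <= x < psum (enum_rank e) + f e ->
  psum (enum_rank e') <= x < psum (enum_rank e') + f e' -> e = e'.
Proof.
rewrite -!psumS => /andP[a b] /andP[a' b'].
apply/enum_rank_inj/val_inj/eqP; rewrite eqn_leq; apply/andP; split.
  rewrite leqNgt; apply/negP => /psum_le h.
  by move: b'; rewrite ltNge (le_trans h a).
rewrite leqNgt; apply/negP => /psum_le h.
by move: b; rewrite ltNge (le_trans h a').
Qed.

End partial_sums.

Lemma probability_of_measure d (T : measurableType d) (R : realType)
    (m : {measure set T -> \bar R}) :
  m setT = 1%E -> exists mu : probability T R, forall A, mu A = m A.
Proof.
move=> m1; pose P : probability T R := dirac point.
pose mu : probability T R := mnormalize m P.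
exists mu => A; rewrite [LHS](_ : _ = @mnormalize d T R m P A) //.
by rewrite /mnormalize m1 onee_eq0 /= invr1 mule1.
Qed.

Lemma pushforward_ex d d' (T1 : measurableType d) (T2 : measurableType d')
    (R : realType) (m : {measure set T1 -> \bar R}) (f : T1 -> T2) :
  measurable_fun [set: T1] f ->
  exists m' : {measure set T2 -> \bar R}, forall A, m' A = m (f @^-1` A).
Proof.
move=> mf; pose m' : measurable_fun setT f -> {measure set T2 -> \bar R} :=
  fun=> pushforward m f.
by exists (m' mf mf).
Qed.

Section word_measure.
Context (R : realType) (E : finType) (e0 : E) (W : seq E -> R).
Hypothesis W_nil : W [::] = 1.
Hypothesis W_ge0 : forall w, 0 <= W w.
Hypothesis W_rcons : forall w, \sum_e W (rcons w e) = W w.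

Let lo (w : seq E) : R := \sum_(i < size w)
  psum (fun e => W (rcons (take i w) e)) (enum_rank (nth e0 w i)).

Let ival (w : seq E) (u : R) : bool := lo w <= u < lo w + W w.

Let lo_rcons w e :
  lo (rcons w e) = lo w + psum (fun e => W (rcons w e)) (enum_rank e).
Proof.
rewrite /lo size_rcons big_ord_recr /= nth_rcons ltnn eqxx.
rewrite -cats1 take_size_cat //; congr (_ + _).
apply: eq_bigr => i _; rewrite nth_cat ltn_ord.
by rewrite takel_cat // ltnW.
Qed.

Let ival_sub w e u : ival (rcons w e) u -> ival w u.
Proof.
rewrite /ival lo_rcons -addrA => /andP[a b]; apply/andP; split.
  apply: le_trans a; rewrite lerDl.
  by rewrite -(psum0 (fun e => W (rcons w e))); exact: psum_le.
apply: lt_le_trans b _; rewrite lerD2l -psumS // -[leRHS]W_rcons.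
exact: psum_total.
Qed.

Let ival_ex w u : ival w u -> exists e, ival (rcons w e) u.
Proof.
move=> /andP[a b].
have [|e] := @psum_ex R E (fun e => W (rcons w e)) (u - lo w).
  by rewrite W_rcons subr_ge0 a ltrBlDl.
by exists e; move: p; rewrite /ival lo_rcons lerBrDl ltrBlDl addrA.
Qed.

Let ival_uniq w e e' u : ival (rcons w e) u -> ival (rcons w e') u -> e = e'.
Proof.
have shift (a b c : R) : (a + b <= u < a + b + c) = (b <= u - a < b + c).
  by rewrite lerBrDl ltrBlDl addrA.
rewrite /ival !lo_rcons !shift => we we'.
exact: (psum_uniq (f := fun e => W (rcons w e)) _ we we').
Qed.

Let next (u : R) (w : seq E) : E :=
  odflt e0 [pick e | ival (rcons w e) u].

Let hist (u : R) (n : nat) : seq E :=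
  iter n (fun w => rcons w (next u w)) [::].

Let size_hist u n : size (hist u n) = n.
Proof. by elim: n => //= n IH; rewrite size_rcons IH. Qed.

Let histP u w : ival [::] u -> (hist u (size w) == w) = ival w u.
Proof.
move=> u0; elim/last_ind: w => [|w e IH]; first by rewrite u0.
rewrite size_rcons /= eqseq_rcons.
apply/andP/idP => [[/eqP hw /eqP <-]|we].
  move/eqP: hw (hw); rewrite IH => wu ->; rewrite /next.
  case: pickP => [//|no].
  by have [e' he'] := ival_ex wu; have := no e'; rewrite he'.
have /eqP hw : hist u (size w) == w by rewrite IH; exact: ival_sub we.
rewrite hw eqxx; split => //; rewrite /next; case: pickP => [e' he'|/(_ e)].
  by rewrite /= (ival_uniq he' we).
by rewrite we.
Qed.

Let sample (u : R) (n : nat) : E := next u (hist u n).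

Let hist_sample u n : hist u n = mkseq (sample u) n.
Proof.
elim: n => //= n IH.
by rewrite mkseqS -IH.
Qed.

Lemma word_measure_ex d (T : measurableType d) (F : (nat -> E) -> T)
    (G : set (set T)) :
  @measurable _ T = <<s G >> ->
  (forall A, G A -> exists ws : seq (seq E),
     F @^-1` A = [set x | has (fun w => mkseq x (size w) == w) ws]) ->
  exists mu : probability T R,
    forall A w, measurable A -> F @^-1` A = [set x | mkseq x (size w) = w] ->
      mu A = (W w)%:E.
Proof.
move=> mG GP.
have ival0 u : ival [::] u = (u \in `[0, 1[).
  by rewrite /ival /lo big_ord0 add0r W_nil in_itv.
have mival w : measurable [set u | ival w u].
  rewrite (_ : [set u | _] = [set` `[lo w, lo w + W w[ ]); last first.
    by apply/seteqP; split => u /=; rewrite /ival in_itv.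
  exact: measurable_itv.
pose D := [set u | ival [::] u].
pose s u := if ival [::] u then F (sample u) else F (fun=> e0).
have ms : measurable_fun [set: R] s.
  apply: (measurability G mG) => _ [A GA <-]; rewrite setTI.
  have [ws AE] := GP _ GA.
  have Ax x : A (F x) = has (fun w => mkseq x (size w) == w) ws.
    by have := congr1 (fun B => B x) AE.
  have mhas : measurable [set u | has (fun w => ival w u) ws].
    elim: ws {AE Ax} => [|w ws IH] /=.
      by rewrite (_ : [set _ | _] = set0) //; apply/seteqP; split.
    rewrite (_ : [set _ | _] =
        [set u | ival w u] `|` [set u | has (fun w => ival w u) ws]).
      exact: measurableU.
    by apply/seteqP; split => u /=; [move/orP|move=> ?; apply/orP].
  have -> : s @^-1` A = (D `&` [set u | has (fun w => ival w u) ws])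
                    `|` (~` D `&` [set _ | A (F (fun=> e0))]).
    apply/seteqP; split => u /=; rewrite /s /D /=.
      case: ifPn => u0; last by right; split => //; exact/negP.
      rewrite Ax => h; left; split => //; move: h.
      by under eq_has => w do rewrite -hist_sample histP //.
    move=> [[u0 h]|[/negP/negbTE -> //]].
    rewrite u0 Ax; move: h.
    by under [in X in _ -> X]eq_has => w do rewrite -hist_sample histP //.
  apply: measurableU; first by apply: measurableI => //; exact: mival.
  apply: measurableI; first by apply: measurableC; exact: mival.
  have [h|h] := pselect (A (F (fun=> e0))).
    by rewrite (_ : [set _ | _] = setT) //; apply/seteqP; split.
  by rewrite (_ : [set _ | _] = set0) //; apply/seteqP; split.
have mD : measurable D by exact: mival.
have muI w : lebesgue_measure [set u | ival w u] = (W w)%:E.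
  rewrite (_ : [set u | _] = [set` `[lo w, lo w + W w[ ]); last first.
    by apply/seteqP; split => u /=; rewrite /ival in_itv.
  rewrite lebesgue_measure_itv /= lte_fin ltrDl.
  case: ltgtP (W_ge0 w) => // [_|<-] _ //.
  by rewrite -EFinB addrC addKr.
pose lam : {measure set _ -> \bar R} := mrestr lebesgue_measure mD.
have [m mE] := pushforward_ex lam ms.
have [|mu muE] := @probability_of_measure _ T R m.
  by rewrite mE preimage_setT /lam /= /mrestr setTI muI W_nil.
exists mu => A w mA AE; rewrite muE mE -muI /lam /= /mrestr; congr (lebesgue_measure _).
have Ax x : A (F x) = (mkseq x (size w) = w).
  by have := congr1 (fun B => B x) AE.
apply/seteqP; split => u /=; rewrite /D /s /=.
  by move=> [+ u0]; rewrite u0 Ax -hist_sample -(histP w u0) => /eqP.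
move=> uw; have u0 : ival [::] u.
  by elim/last_ind: w uw {AE Ax} => // w e IH /ival_sub.
by rewrite u0 Ax -hist_sample; split => //; apply/eqP; rewrite histP.
Qed.
End word_measure.

Notation state nS := 'I_nS.+1 (only parsing).
Notation action nA := 'I_nA.+1 (only parsing).

Record mdp (nS nA : nat) := MDP {
  trans : state nS -> action nA -> state nS -> rat;
  trans_itv : forall s a s', 0 <= trans s a s' <= 1;
  trans_sum : forall s a,
    \sum_s' trans s a s' = 1 \/ \sum_s' trans s a s' = 0;
  trans_enabled : forall s, exists a, \sum_s' trans s a s' = 1 }.

Definition enabled nS nA (M : mdp nS nA) (s : state nS) (a : action nA) : bool :=
  \sum_s' trans M s a s' == 1.

(** A finite path [s_0 a_0 s_1 ... a_(n-1) s_n] is the pair of its history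
    [(s_0, a_0) ... (s_(n-1), a_(n-1))] and its last state [s_n]. *)
Definition finite_path nS nA : Type := seq (state nS * action nA) * state nS.

Definition fp_state nS nA (p : finite_path nS nA) (i : nat) : state nS :=
  nth p.2 (map fst p.1) i.

Definition fp_action nS nA (p : finite_path nS nA) (i : nat) : action nA :=
  nth ord0 (map snd p.1) i.

(** Schedulers are total on alternating sequences; their values on sequences that
    use transitions of probability 0 have no influence on the measures below. *)
Record scheduler (R : realType) nS nA (M : mdp nS nA) := Scheduler {
  sched : finite_path nS nA -> action nA -> R;
  sched_ge0 : forall p a, 0 <= sched p a;
  sched_sum : forall p, \sum_a sched p a = 1;
  sched_enabled : forall p a, ~~ enabled M p.2 a -> sched p a = 0 }.

Definition infinite_path (nS nA : nat) : Type := nat -> state nS * action nA.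

HB.instance Definition _ nS nA := gen_eqMixin (infinite_path nS nA).
HB.instance Definition _ nS nA := gen_choiceMixin (infinite_path nS nA).
HB.instance Definition _ nS nA :=
  isPointed.Build (infinite_path nS nA) (fun=> (ord0, ord0)).

Definition cylinder nS nA (p : finite_path nS nA) : set (infinite_path nS nA) :=
  [set w | mkseq w (size p.1) = p.1 /\ (w (size p.1)).1 = p.2].

Definition cylinders nS nA : set (set (infinite_path nS nA)) := range (@cylinder nS nA).

Definition path_space nS nA := g_sigma_algebraType (@cylinders nS nA).

Section path_measure.
Context (R : realType) (nS nA : nat) (M : mdp nS nA).
Context (sigma : scheduler R M) (s0 : state nS).

Definition cylinder_prob (p : finite_path nS nA) : R :=
  (fp_state p 0 == s0)%:R *
  \prod_(i < size p.1)
    (sched sigma (take i p.1, fp_state p i) (fp_action p i) *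
     ratr (trans M (fp_state p i) (fp_action p i) (fp_state p i.+1))).

Definition is_path_measure (mu : probability (path_space nS nA) R) : Prop :=
  forall p, mu (cylinder p) = (cylinder_prob p)%:E.

Let word_prob (w : seq (state nS * action nA)) : R :=
  \prod_(i < size w)
    (sched sigma (take i w, (nth (ord0, ord0) w i).1) (nth (ord0, ord0) w i).2 *
     (if i : nat is j.+1 then
        ratr (trans M (nth (ord0, ord0) w j).1 (nth (ord0, ord0) w j).2
                      (nth (ord0, ord0) w i).1)
      else ((nth (ord0, ord0) w i).1 == s0)%:R)).

Let entry (w : seq (state nS * action nA)) (s : state nS) : R :=
  if w is e :: w' then ratr (trans M (last e w').1 (last e w').2 s)
  else (s == s0)%:R.

Let word_prob_rcons w e : word_prob (rcons w e) =
  word_prob w * (sched sigma (w, e.1) e.2 * entry w e.1).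
Proof.
rewrite /word_prob size_rcons big_ord_recr /=; congr (_ * (_ * _)).
- apply: eq_bigr => i _; rewrite !nth_rcons ltn_ord.
  have -> : take i (rcons w e) = take i w.
    by rewrite -cats1 takel_cat //; apply: ltnW.
  by case: i => -[|j] //= ji; rewrite nth_rcons (ltnW ji).
- by rewrite -cats1 take_size_cat // nth_cat ltnn subnn.
- case: w => [|x w] //=; rewrite nth_rcons ltnn eqxx.
  by rewrite -rcons_cons nth_rcons ltnSn -last_nth.
Qed.

Let entry_rcons w x a s : entry (rcons w (x, a)) s = ratr (trans M x a s).
Proof. by case: w => //= e w; rewrite last_rcons. Qed.

Let cylinder_probE h s : cylinder_prob (h, s) = word_prob h * entry h s.
Proof.
elim/last_ind: h s => [|h [x a] IH] s.
  by rewrite /cylinder_prob /word_prob !big_ord0 mulr1 mul1r.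
have st i : (i <= size h)%N ->
    fp_state (rcons h (x, a), s) i = fp_state (h, x) i.
  rewrite /fp_state /= map_rcons nth_rcons size_map.
  by case: ltngtP => // [ih|->] _; [apply: set_nth_default; rewrite size_map|
                                   rewrite nth_default ?size_map].
have ac i : (i < size h)%N ->
    fp_action (rcons h (x, a), s) i = fp_action (h, x) i.
  by rewrite /fp_action /= map_rcons nth_rcons size_map => ->.
have stl : fp_state (h, x) (size h) = x.
  by rewrite /fp_state nth_default ?size_map.
have stS : fp_state (rcons h (x, a), s) (size h).+1 = s.
  by rewrite /fp_state nth_default // size_map size_rcons.
have acl : fp_action (rcons h (x, a), s) (size h) = a.
  by rewrite /fp_action /= map_rcons nth_rcons size_map ltnn eqxx.
have tk i : (i <= size h)%N -> take i (rcons h (x, a)) = take i h.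
  by move=> ih; rewrite -cats1 takel_cat.
rewrite word_prob_rcons entry_rcons /=.
suff -> : cylinder_prob (rcons h (x, a), s) = cylinder_prob (h, x) *
    (sched sigma (h, x) a * ratr (trans M x a s)) by rewrite IH; ring.
rewrite /cylinder_prob /= size_rcons big_ord_recr /= (st 0) // (st (size h)) //.
rewrite stl stS acl tk // take_size mulrA; congr (_ * _ * _).
by apply: eq_bigr => i _; rewrite tk ?st ?ac // ltnW.
Qed.

Let word_prob_ge0 w : 0 <= word_prob w.
Proof.
apply: prodr_ge0 => i _; apply: mulr_ge0; first exact: sched_ge0.
case: (i : nat) => [|j]; first exact: ler0n.
by rewrite ler0q; have /andP[] := trans_itv M
  (nth (ord0, ord0) w j).1 (nth (ord0, ord0) w j).2 (nth (ord0, ord0) w j.+1).1.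
Qed.

Let word_prob_sum_action w s :
  \sum_a word_prob (rcons w (s, a)) = word_prob w * entry w s.
Proof.
under eq_bigr do rewrite word_prob_rcons mulrA mulrAC /=.
by rewrite -mulr_sumr sched_sum mulr1.
Qed.

Let word_prob_sum w : \sum_e word_prob (rcons w e) = word_prob w.
Proof.
transitivity (\sum_s \sum_a word_prob (rcons w (s, a))).
  by rewrite pair_bigA; apply: eq_bigr => -[].
under eq_bigr do rewrite word_prob_sum_action.
rewrite -mulr_sumr; case/lastP: w => [|w [x a]].
  rewrite (bigD1 s0) //= eqxx big1 => [|s /negbTE ->] //.
  by rewrite addr0 mulr1.
under eq_bigr do rewrite entry_rcons.
rewrite -rmorph_sum /=; have [/eqP ->|h] := boolP (enabled M x a).
  by rewrite rmorph1 mulr1.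
by rewrite word_prob_rcons /= sched_enabled // mul0r !mulr0 mul0r.
Qed.

Let wcyl (w : seq (state nS * action nA)) : set (path_space nS nA) :=
  [set x | mkseq x (size w) = w].

Let cylinderE (h : seq (state nS * action nA)) s :
  cylinder (h, s) = \big[setU/set0]_(a : action nA) wcyl (rcons h (s, a)).
Proof.
rewrite -bigcup_seq; apply/seteqP; split => x /=.
  move=> [xh xs]; exists (x (size h)).2; first exact: mem_index_enum.
  rewrite /= in xh xs.
  by rewrite /wcyl /= size_rcons mkseqS xh -xs -surjective_pairing.
move=> [a _]; rewrite /wcyl /= size_rcons mkseqS => /eqP.
rewrite eqseq_rcons => /andP[/eqP xh /eqP xs].
by split; rewrite //= xs.
Qed.

Let wcyl_rcons h s a :
  wcyl (rcons h (s, a)) = \bigcup_s' cylinder (rcons h (s, a), s').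
Proof.
apply/seteqP; split => x /=; last by case=> s' _ [].
by rewrite /wcyl /= => xh; exists (x (size (rcons h (s, a)))).1.
Qed.

Let measurable_cylinder p : measurable (cylinder p : set (path_space nS nA)).
Proof. by apply: sub_sigma_algebra; exists p. Qed.

Let measurable_wcyl h s a : measurable (wcyl (rcons h (s, a))).
Proof.
by rewrite wcyl_rcons; apply: fin_bigcup_measurable.
Qed.

Lemma path_measure_ex : exists mu, is_path_measure mu.
Proof.
have [|A [[h s] _ <-]|mu muE] := @word_measure_ex R _ (ord0, ord0) word_prob
    _ word_prob_ge0 word_prob_sum _ (path_space nS nA) id (@cylinders nS nA) erefl.
- by rewrite /word_prob big_ord0.
- exists [seq rcons h (s, a) | a <- index_enum (action nA)].
  rewrite preimage_id cylinderE -bigcup_seq; apply/seteqP; split => x /=.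
    move=> [a ain xa]; apply/hasP; exists (rcons h (s, a)); last exact/eqP.
    by apply: map_f.
  by move=> /hasP[w /mapP[a ain ->] /eqP xw]; exists a.
exists mu => -[h s].
rewrite cylinder_probE -word_prob_sum_action cylinderE measure_bigsetU_ord.
- rewrite -sumEFin; apply: eq_bigr => a _.
  by apply: muE => //; exact: measurable_wcyl.
- by move=> a; exact: measurable_wcyl.
apply/trivIsetP => a a' _ _ /eqP aa'; apply/seteqP; split => x //=.
rewrite /wcyl /= !size_rcons => -[-> /eqP].
by rewrite eqseq_rcons => /andP[_ /eqP[]].
Qed.

Let cylinder_agree p (x y : infinite_path nS nA) : cylinder p x -> cylinder p y ->
  forall q : finite_path nS nA, (size q.1 <= size p.1)%N ->
  cylinder q x -> cylinder q y.
Proof.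
move=> [xp xs] [yp ys] q qp [xq xqs].
have xy i : (i < size p.1)%N -> x i = y i.
  by move=> ip; rewrite -(nth_mkseq (ord0, ord0) x ip) xp -yp nth_mkseq.
split.
  rewrite -[RHS]xq; apply/eq_in_map => i; rewrite mem_iota /= => iq.
  by rewrite xy // (leq_trans iq).
move: qp xqs; rewrite leq_eqVlt => /orP[/eqP ->|/xy -> //].
by rewrite xs ys.
Qed.

Let cylinderI : setI_closed (@cylinders nS nA `|` [set set0]).
Proof.
have sub p q : (size q.1 <= size p.1)%N ->
    (@cylinders nS nA `|` [set set0]) (cylinder p `&` cylinder q).
  move=> qp; have [[x [xp xq]]|no] := pselect (cylinder p `&` cylinder q !=set0).
    left; exists p => //; apply/seteqP; split => y; last by case.
    by move=> yp; split => //; exact: (cylinder_agree xp yp qp xq).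
  by right; apply/eqP; rewrite -[_ == _]negbK; apply/negP => /set0P.
move=> A B [[p _ <-]|->] [[q _ <-]|->]; rewrite ?set0I ?setI0; try by right.
by have [|/ltnW] := leqP (size q.1) (size p.1); [|rewrite setIC]; exact: sub.
Qed.

Lemma path_measure_unique mu nu : is_path_measure mu -> is_path_measure nu ->
  forall A, measurable A -> mu A = nu A.
Proof.
move=> muE nuE A mA.
pose G : set (set (path_space nS nA)) := @cylinders nS nA `|` [set set0].
pose g k : set (path_space nS nA) :=
  if (k < nS.+1)%N then cylinder ([::], inord k) else set0.
have Gm : G `<=` measurable.
  by move=> _ [[p _ <-]|->]; [exact: measurable_cylinder|exact: measurable0].
apply: (@g_sigma_algebra_measure_unique _ R (path_space nS nA) G Gm g
  _ _ mu nu) => //.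
- move=> k; rewrite /g; case: ifP => _; last by right.
  by left; exists ([::], inord k).
- apply/seteqP; split => x // _; exists (x 0).1 => //.
  by rewrite /g ltn_ord; split => //=; rewrite inord_val.
- move=> B [[p _ <-]|->]; last by rewrite !measure0.
  exact: etrans (muE p) (esym (nuE p)).
- by move=> k; apply: (le_lt_trans (probability_le1 _ _)); rewrite ?ltry //;
    rewrite /g; case: ifP.
- move: A mA; apply: sub_sigma_algebra2; exact: subsetUl.
Qed.

End path_measure.

(** By [path_measure_unique] the choice is immaterial on measurable sets. *)
Definition path_measure (R : realType) nS nA (M : mdp nS nA)
    (sigma : scheduler R M) (s : state nS) : probability (path_space nS nA) R :=
  projT1 (cid (path_measure_ex sigma s)).

Lemma path_measureP (R : realType) nS nA (M : mdp nS nA)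
    (sigma : scheduler R M) (s : state nS) :
  is_path_measure sigma s (path_measure sigma s).
Proof. exact: projT2 (cid _). Qed.

Lemma measurable_reach nS nA (T : {set state nS}) :
  measurable ([set w | exists i, (w i).1 \in T] : set (path_space nS nA)).
Proof.
rewrite (_ : [set w | _] = \bigcup_n \bigcup_(q in [set q : n.-tuple
    (state nS * action nA) * state nS | q.2 \in T]) cylinder (val q.1, q.2)).
  apply: bigcupT_measurable => n; apply: fin_bigcup_measurable => // q _.
  by apply: sub_sigma_algebra; exists (val q.1, q.2).
apply/seteqP; split => w /=.
  move=> [i wi]; exists i => //.
  exists (Tuple (introT eqP (size_mkseq w i)), (w i).1) => //=.
  by split; rewrite /= size_mkseq.
by move=> [n _ [[h s] /= sT [_ /= ws]]]; exists (size h); rewrite ws.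
Qed.

(** The probability [Pr^sigma_s(F T)] of the reachability event, which is
    measurable by [measurable_reach]. *)
Definition Pr_reach (R : realType) nS nA (M : mdp nS nA)
    (sigma : scheduler R M) (s : state nS) (T : {set state nS}) : R :=
  fine (path_measure sigma s [set w | exists i, (w i).1 \in T]).

Inductive cmp_op :=
| CmpGt
| CmpGe
| CmpApprox of {eps : rat | 0 <= eps}
| CmpNotApprox of {eps : rat | 0 <= eps}.

Definition cmp_holds (R : realType) (c : cmp_op) (r r' : R) : Prop :=
  match c with
  | CmpGt => r > r'
  | CmpGe => r >= r'
  | CmpApprox eps => `|r - r'| <= ratr (sval eps)
  | CmpNotApprox eps => `|r - r'| > ratr (sval eps)
  end.

(** The states, actions, and all index ranges are numbered from 0; the numbers of
    states and actions are [nS.+1] and [nA.+1]. *)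
Record instance := Instance {
  nS : nat;
  nA : nat;
  model : mdp nS nA;
  nconj : nat;
  nsummand : nat;
  nsched : nat;
  coef : 'I_nsummand -> 'I_nconj -> rat;
  bnd : 'I_nconj -> rat;
  init_state : 'I_nsummand -> 'I_nconj -> 'I_nS.+1;
  sched_idx : 'I_nsummand -> 'I_nconj -> 'I_nsched;
  sched_idx_surj : forall k, exists i j, sched_idx i j = k;
  target : 'I_nsummand -> 'I_nconj -> {set 'I_nS.+1};
  op : 'I_nconj -> cmp_op }.

Arguments coef : clear implicits.
Arguments bnd : clear implicits.
Arguments init_state : clear implicits.
Arguments sched_idx : clear implicits.
Arguments target : clear implicits.
Arguments op : clear implicits.

Definition solvable (R : realType) (I : instance) : Prop :=
  exists sigma : 'I_(nsched I) -> scheduler R (model I),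
    forall j : 'I_(nconj I),
      cmp_holds (op I j)
        (\sum_(i < nsummand I) ratr (coef I i j) *
           Pr_reach (sigma (sched_idx I i j)) (init_state I i j) (target I i j))
        (ratr (bnd I j)).

(** Binary expansion, least significant bit first; [k] bounds the recursion. *)
Fixpoint bits_rec (k n : nat) : seq bool :=
  if k is k'.+1 then
    if n is 0%N then [::] else odd n :: bits_rec k' n./2
  else [::].

Definition bits (n : nat) : seq bool := bits_rec n n.

(** Each bit is preceded by [true], and [false] ends the number. *)
Definition encode_nat (n : nat) : seq bool :=
  rcons (flatten [seq [:: true; b] | b <- bits n]) false.

Definition rat_code (r : rat) : seq nat :=
  [:: nat_of_bool (r < 0); `|numq r|%N; `|denq r|%N].

Definition cmp_code (c : cmp_op) : seq nat :=
  match c with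
  | CmpGt => [:: 0%N]
  | CmpGe => [:: 1%N]
  | CmpApprox eps => 2%N :: rat_code (sval eps)
  | CmpNotApprox eps => 3%N :: rat_code (sval eps)
  end.

Definition table (n : nat) (f : 'I_n -> seq nat) : seq nat :=
  flatten [seq f i | i <- enum 'I_n].

Definition set_code (n : nat) (A : {set 'I_n}) : seq nat :=
  table (fun i => [:: nat_of_bool (i \in A)]).

Definition instance_code (I : instance) : seq nat :=
  [:: nS I; nA I; nconj I; nsummand I; nsched I] ++
  table (fun s => table (fun a => table (fun s' =>
    rat_code (trans (model I) s a s')))) ++
  table (fun j => cmp_code (op I j)) ++
  table (fun j => rat_code (bnd I j)) ++
  table (fun i => table (fun j => rat_code (coef I i j))) ++
  table (fun i => table (fun j => [:: init_state I i j : nat])) ++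
  table (fun i => table (fun j => [:: sched_idx I i j : nat])) ++
  table (fun i => table (fun j => set_code (target I i j))).

Definition encode (I : instance) : seq bool :=
  flatten [seq encode_nat n | n <- instance_code I].

Definition uniquely_readable (X : Type) (A : Type) (C : X -> seq A) : Prop :=
  forall x y u v, C x ++ u = C y ++ v -> x = y /\ u = v.

Lemma bits_recK k n : (n <= k)%N ->
  foldr (fun (b : bool) m => b + m.*2)%N 0%N (bits_rec k n) = n.
Proof.
elim: k n => [|k IH] [|n] // nk.
have -> : bits_rec k.+1 n.+1 = odd n.+1 :: bits_rec k n.+1./2 by [].
rewrite -cat1s foldr_cat IH; first exact: odd_double_half.
by rewrite -divn2 -ltnS; apply: leq_trans nk; rewrite ltn_Pdiv.
Qed.

Lemma bits_inj : injective bits.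
Proof.
by move=> m n mn; rewrite -(bits_recK (leqnn m)) -(bits_recK (leqnn n)) -/(bits m) mn.
Qed.

Lemma encode_nat_readable : uniquely_readable encode_nat.
Proof.
move=> m n u v; rewrite /encode_nat => mn.
suff [/bits_inj] : bits m = bits n /\ u = v by [].
move: (bits m) (bits n) mn => s t.
elim: s t => [|b s IH] [|c t] //=; first by case.
by case=> -> /IH[-> ->].
Qed.

Lemma encode_nats_inj :
  injective (fun s : seq nat => flatten [seq encode_nat n | n <- s]).
Proof.
elim=> [|m s IH] [|n t] //=.
- by move=> /(congr1 size) /=; rewrite size_cat size_rcons.
- by move=> /(congr1 size) /=; rewrite size_cat size_rcons.
by move=> /encode_nat_readable[-> /IH ->].
Qed.

Lemma rat_code_readable : uniquely_readable rat_code.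
Proof.
move=> r r' u v [sr nr dr ->]; split => //.
have den x : denq x = `|denq x|%N :> int.
  by rewrite -{1}(gtz0_abs (denq_gt0 x)).
have num x : numq x = (-1) ^+ (x < 0)%R * (`|numq x|%N)%:Z.
  by rewrite [LHS]intEsign numq_lt0.
rewrite -[r]divq_num_den -[r']divq_num_den (den r) (den r') (num r) (num r').
by rewrite nr dr sr.
Qed.

Lemma cmp_code_readable : uniquely_readable cmp_code.
Proof.
move=> [||[e he]|[e he]] [||[e' he']|[e' he']] u v; try by [].
- by move=> [->].
- by move=> [->].
- move=> /(congr1 behead)/(@rat_code_readable e e' u v)[ee ->]; subst e'.
  by rewrite (bool_irrelevance he he').
- move=> /(congr1 behead)/(@rat_code_readable e e' u v)[ee ->]; subst e'.
  by rewrite (bool_irrelevance he he').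
Qed.

Lemma table_readable n (X : Type) (C : X -> seq nat) : uniquely_readable C ->
  uniquely_readable (fun f : 'I_n -> X => table (fun i => C (f i))).
Proof.
move=> CP f g u v; rewrite /table => fg.
suff [h ->] : {in enum 'I_n, f =1 g} /\ u = v.
  by split => //; apply/funext => i; apply: h; rewrite mem_enum.
elim: (enum 'I_n) u v fg => [|i s IH] u v //=.
rewrite -!catA => /CP[fgi /IH[fgs ->]]; split => // j.
by rewrite inE => /orP[/eqP ->|/fgs].
Qed.

Lemma ord_code_readable n : uniquely_readable (fun i : 'I_n => [:: i : nat]).
Proof. by move=> i j u v [/val_inj -> ->]. Qed.

Lemma set_code_readable n : uniquely_readable (@set_code n).
Proof.
have bP : uniquely_readable (fun b : bool => [:: nat_of_bool b]).
  by move=> [] [] u v [].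
move=> A B u v /(table_readable bP (x := fun i => i \in A) (y := fun i => i \in B)).
by case=> AB ->; split => //; apply/setP => i; exact: (congr1 (fun f => f i) AB).
Qed.

Lemma mdp_eq nS nA (M M' : mdp nS nA) : trans M = trans M' -> M = M'.
Proof.
case: M M' => [t i s e] [t' i' s' e'] /= tt'; subst t'.
by congr MDP; exact: Prop_irrelevance.
Qed.

Lemma instance_code_inj : injective instance_code.
Proof.
move=> [sN aN M l m n q b s k kP T o] [sN' aN' M' l' m' n' q' b' s' k' kP' T' o'].
move=> E; have : [:: sN; aN; l; m; n] = [:: sN'; aN'; l'; m'; n'].
  by have := congr1 (take 5) E; rewrite /instance_code /= !take0.
case=> *; subst sN' aN' l' m' n'.
move: {E}(congr1 (drop 5) E); rewrite /instance_code /= !drop0.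
have t2 (n1 n2 : nat) X (C : X -> seq nat) (CP : uniquely_readable C) :=
  @table_readable n1 _ _ (@table_readable n2 _ _ CP).
move=> /(@table_readable _ _ _ (t2 _ _ _ _ rat_code_readable)
  (trans M) (trans M'))[/mdp_eq <-].
move=> /(@table_readable _ _ _ cmp_code_readable o o')[<-].
move=> /(@table_readable _ _ _ rat_code_readable b b')[<-].
move=> /(t2 _ _ _ _ rat_code_readable q q')[<-].
move=> /(t2 _ _ _ _ (@ord_code_readable _) s s')[<-].
move=> /(t2 _ _ _ _ (@ord_code_readable _) k k')[kk]; subst k'.
rewrite -[X in X = _]cats0 -[X in _ = X]cats0.
move=> /(t2 _ _ _ _ (@set_code_readable _) T T')[<- _].
by congr Instance; exact: Prop_irrelevance.
Qed.

Theorem encode_inj : injective encode.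
Proof. by move=> I J /encode_nats_inj/instance_code_inj. Qed.

(** Bit strings that encode no instance are no-instances. *)
Definition ConjRelReach (R : realType) (w : seq bool) : Prop :=
  exists2 I : instance, encode I = w & solvable R I.

Inductive direction := GoLeft | GoRight | Stay.

(** A tape symbol is blank ([None]), an input/output bit, or an auxiliary
    symbol.  The machine has [tm_ntapes.+1] tapes. *)
Record tm := TM {
  tm_state : finType;
  tm_aux : finType;
  tm_ntapes : nat;
  tm_start : tm_state;
  tm_halting : pred tm_state;
  tm_accepting : pred tm_state;
  tm_delta : tm_state -> {ffun 'I_tm_ntapes.+1 -> option (bool + tm_aux)} ->
    tm_state * {ffun 'I_tm_ntapes.+1 -> option (bool + tm_aux) * direction} }.

Definition tm_symbol (M : tm) : Type := option (bool + tm_aux M).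

(** The visited part of a two-way infinite tape: the cells to the left of the head
    (nearest first), the scanned cell, and the cells to its right. *)
Record tape (A : Type) := Tape {
  tape_left : seq A;
  scanned : A;
  tape_right : seq A }.

Definition tape_of (M : tm) (s : seq (tm_symbol M)) : tape (tm_symbol M) :=
  Tape [::] (head None s) (behead s).

Definition tape_write A (t : tape A) (a : A) : tape A :=
  Tape (tape_left t) a (tape_right t).

Definition tape_move (M : tm) (t : tape (tm_symbol M)) (d : direction) :
    tape (tm_symbol M) :=
  match d with
  | GoLeft => Tape (behead (tape_left t)) (head None (tape_left t))
                   (scanned t :: tape_right t)
  | GoRight => Tape (scanned t :: tape_left t) (head None (tape_right t))
                    (behead (tape_right t))
  | Stay => t
  end.

Definition tape_size A (t : tape A) : nat :=
  (size (tape_left t) + size (tape_right t)).+1.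

Definition config (M : tm) : Type :=
  tm_state M * ('I_(tm_ntapes M).+1 -> tape (tm_symbol M)).

Definition tm_init (M : tm) (x : seq bool) : config M :=
  (tm_start M, fun i => tape_of
     (if i == ord0 then [seq Some (inl b) | b <- x] else [::])).

Definition halted (M : tm) (c : config M) : bool := tm_halting c.1.

Definition accepted (M : tm) (c : config M) : bool := tm_accepting c.1.

Definition tm_step (M : tm) (c : config M) : config M :=
  if halted c then c else
  let: (q, act) := tm_delta c.1 [ffun i => scanned (c.2 i)] in
  (q, fun i => tape_move (tape_write (c.2 i) (act i).1) (act i).2).

Definition tm_run (M : tm) (x : seq bool) (t : nat) : config M :=
  iter t (@tm_step M) (tm_init M x).

Definition tm_space (M : tm) (c : config M) : nat :=
  (\sum_i tape_size (c.2 i))%N.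

Fixpoint leading_bits (M : tm) (s : seq (tm_symbol M)) : seq bool :=
  if s is Some (inl b) :: s' then b :: leading_bits s' else [::].

(** The output is the maximal block of bits that starts at the head of the last
    tape. *)
Definition tm_output (M : tm) (c : config M) : seq bool :=
  leading_bits (scanned (c.2 ord_max) ::
                 tape_right (c.2 ord_max)).

Definition language := seq bool -> Prop.

Definition decides_in_time (M : tm) (L : language) (f : nat -> nat) : Prop :=
  forall x, exists2 t, (t <= f (size x))%N &
    halted (tm_run M x t) /\ (accepted (tm_run M x t) <-> L x).

Definition decides_in_space (M : tm) (L : language) (f : nat -> nat) : Prop :=
  forall x, exists2 t, (forall t', tm_space (tm_run M x t') <= f (size x))%N &
    halted (tm_run M x t) /\ (accepted (tm_run M x t) <-> L x).

Definition computes_in_time (M : tm) (g : seq bool -> seq bool)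
    (f : nat -> nat) : Prop :=
  forall x, exists2 t, (t <= f (size x))%N &
    halted (tm_run M x t) /\ tm_output (tm_run M x t) = g x.

Definition poly_bounded (f : nat -> nat) : Prop :=
  exists c d, forall n, (f n <= c * n ^ d + c)%N.

Definition PSPACE (L : language) : Prop :=
  exists M f, poly_bounded f /\ decides_in_space M L f.

Definition EXPTIME (L : language) : Prop :=
  exists M f, poly_bounded f /\ decides_in_time M L (fun n => 2 ^ f n)%N.

Definition poly_time (g : seq bool -> seq bool) : Prop :=
  exists M f, poly_bounded f /\ computes_in_time M g f.

Definition poly_reducible (L L' : language) : Prop :=
  exists2 g, poly_time g & forall x, L x <-> L' (g x).

Definition PSPACE_hard (L : language) : Prop :=
  forall L', PSPACE L' -> poly_reducible L' L.

(* Main.v *)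
(** Hardness: a space-bounded machine accepts iff the first player wins Savitch's midpoint
    game.  This game is played on an MDP that assigns values to variables one after the
    other, the scheduler choosing the existential ones and fair coins the universal ones; the
    rules of the game are clauses, and each clause is one conjunct: its literals are reached
    with probability at least 1.  A single scheduler has to satisfy all of them, hence it wins
    against every outcome of the coins.

    Membership: only the set of states visited so far matters, so schedulers are flows on the
    exponentially large product of the states with these sets, and a flow commits when its
    visited set will not change any more.  Each of the two sides of a negated approximation
    being tried, the conjuncts become few linear inequalities on the flows, which by
    Cramer's rule are violated by an exponentially small gap if they cannot be satisfied.  By
    duality, either they can be satisfied or some weights [lam] in a cube of small dimension
    make the best weighted payoff negative.  The best payoff for given weights is computed by
    value iteration, and the optimal strategies found serve as cuts in a nested bisection
    for [lam], which takes exponential time because its depth is the number of rows. *)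
Require Import Defs.
From mathcomp Require Import reals.
From HB Require Import structures.
From mathcomp Require Import all_boot all_order all_algebra.
From mathcomp Require Import all_classical all_analysis.
From mathcomp Require Import ring lra zify.

Set Implicit Arguments.
Unset Strict Implicit.
Unset Printing Implicit Defensive.

Local Open Scope nat_scope.

(** * Structured programs on Turing machines *)

(** Both bounds are claims about concrete multi-tape machines, so time bounds have to be
    compositional. A calculus [FP] of polynomial-time functions on trees, with unary numbers, is
    compiled to machines; afterwards an algorithm is an ordinary function and its time bound follows
    its syntax. Exponential time arises by first computing two exponentially large unary pads and
    then running a polynomial-time function on the padded input.

    Exactness is the obstacle in the upper bound: strict rows hold with a positive margin of unknown
    size, the bisection is approximate and value iteration is cut off. One gap absorbs all of this.
    A positive margin, however small, can be improved to more than [2 ^ (-E)], and rows met with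
    margin [2 ^ (-E)] up to an error [2 ^ (-2 E)] can be met exactly; here [E] is the first pad.

    A scheduler may be shared by conjuncts with different initial states. Its history records the
    initial state, so the flows for all pairs of a scheduler and an initial state can be chosen
    independently and glued. *)

Definition sym : Type := option (bool + void).
Definition tapes : Type := 'I_5 -> tape sym.

Definition mv (t : tape sym) (d : direction) : tape sym :=
  match d with
  | GoLeft => Tape (behead (tape_left t)) (head None (tape_left t))
                   (scanned t :: tape_right t)
  | GoRight => Tape (scanned t :: tape_left t) (head None (tape_right t))
                    (behead (tape_right t))
  | Stay => t
  end.

Definition upd (X : Type) (s : 'I_5 -> X) i x : 'I_5 -> X :=
  fun j => if j == i then x else s j.

(** Programs on five tapes used as stacks; the control state of the machine is the list of the
    commands that remain. *)
Inductive cmd :=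
| Act of 'I_5 & (sym -> sym) & direction
| Sq of cmd & cmd
| If of 'I_5 & (sym -> bool) & cmd & cmd
| Wh of 'I_5 & (sym -> bool) & cmd
| Halt of bool.

HB.instance Definition _ := gen_eqMixin cmd.
HB.instance Definition _ := gen_choiceMixin cmd.

Definition ctl (k : seq cmd) (s : 'I_5 -> sym) : seq cmd :=
  match k with
  | [::] => [::]
  | Act _ _ _ :: k' => k'
  | Sq a b :: k' => a :: b :: k'
  | If i p a b :: k' => (if p (s i) then a else b) :: k'
  | Wh i p c :: k' => if p (s i) then c :: k else k'
  | Halt b :: k' => k
  end.

Definition act (k : seq cmd) (tp : tapes) : tapes :=
  if k is Act i f d :: _ then
    upd tp i (mv (tape_write (tp i) (f (scanned (tp i)))) d)
  else tp.

Definition cstep (c : seq cmd * tapes) : seq cmd * tapes :=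
  (ctl c.1 (fun i => scanned (c.2 i)), act c.1 c.2).

(** This list is what makes the control finite: a loop puts itself back under its body, so the body
    is only ever run in front of [c :: k], and the list is closed under [ctl] up to the final
    [k]. *)
Fixpoint conts (c : cmd) (k : seq cmd) : seq (seq cmd) :=
  (c :: k) :: match c with
  | Sq a b => conts a (b :: k) ++ conts b k
  | If _ _ a b => conts a k ++ conts b k
  | Wh _ _ a => conts a (c :: k)
  | _ => [::]
  end.

Lemma conts_head c k : c :: k \in conts c k.
Proof. by case: c => *; rewrite inE eqxx. Qed.

Lemma conts_closed c k q s : q \in conts c k -> ctl q s \in k :: conts c k.
Proof.
elim: c k => [i f d|a IHa b IHb|i p a IHa b IHb|i p a IHa|b] k /=.
- by rewrite inE => /eqP -> /=; rewrite inE eqxx.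
- rewrite inE mem_cat => /or3P[/eqP ->|/IHa|/IHb] /=.
  + by rewrite !inE mem_cat conts_head !orbT.
  + rewrite !inE mem_cat => /orP[/eqP ->|->]; last by rewrite !orbT.
    by rewrite conts_head !orbT.
  + by rewrite !inE mem_cat => /orP[/eqP ->|->]; rewrite ?eqxx ?orbT.
- rewrite inE mem_cat => /or3P[/eqP ->|/IHa|/IHb] /=.
  + by rewrite !inE mem_cat; case: (p _); rewrite conts_head !orbT.
  + by rewrite !inE mem_cat => /orP[/eqP ->|->]; rewrite ?eqxx ?orbT.
  + by rewrite !inE mem_cat => /orP[/eqP ->|->]; rewrite ?eqxx ?orbT.
- rewrite inE => /orP[/eqP ->|/IHa] /=.
  + by rewrite !inE; case: (p _); rewrite ?eqxx ?conts_head ?orbT.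
  + by rewrite !inE => /orP[/eqP ->|->]; rewrite ?eqxx ?orbT.
- by rewrite inE => /eqP -> /=; rewrite !inE eqxx orbT.
Qed.

Section machine.
Variable c : cmd.

Definition ctl_states : seq (seq cmd) := [::] :: conts c [::].

Lemma ctl_start : [:: c] \in ctl_states.
Proof. by rewrite inE conts_head orbT. Qed.

Definition halting_cont (k : seq cmd) := if k is Halt _ :: _ then true else false.
Definition accepting_cont (k : seq cmd) := if k is Halt b :: _ then b else false.

Definition machine : tm :=
  @TM (seq_sub ctl_states) void 4 (SeqSub ctl_start)
    (fun q => halting_cont (ssval q)) (fun q => accepting_cont (ssval q))
    (fun q s => (insubd q (ctl (ssval q) s),
       [ffun i => if ssval q is Act j f d :: _ then
                    if i == j then (f (s i), d) else (s i, Stay)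
                  else (s i, Stay)])).

Lemma machine_step (x : config machine) :
  (ssval (tm_step x).1, (tm_step x).2) = cstep (ssval x.1, x.2).
Proof.
case: x => q tp; rewrite /tm_step /cstep /halted /=.
(* [tm_step] freezes halting configurations; [ctl] and [act] do the same when a [Halt] is on top. *)
have halt_fix : halting_cont (ssval q) ->
    ctl (ssval q) (fun i => scanned (tp i)) = ssval q /\ act (ssval q) tp = tp.
  by case: (ssval q) => [|[]].
case: ifPn => [/halt_fix[-> ->]//|_] /=; congr pair.
  rewrite val_insubd /=.
  have -> : ctl (ssval q) [ffun i => scanned (tp i)] =
            ctl (ssval q) (fun i => scanned (tp i)).
    by case: (ssval q) => [|[]] //= *; rewrite ffunE.
  suff -> : ctl (ssval q) (fun i => scanned (tp i)) \in ctl_states by [].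
  have := ssvalP q; rewrite inE => /orP[/eqP -> //|h].
  exact: (conts_closed (fun i => scanned (tp i)) h).
apply/funext => i; rewrite !ffunE.
have nop : tape_move (M := machine) (tape_write (tp i) (scanned (tp i))) Stay = tp i.
  by case: (tp i).
rewrite /act; case: (ssval q) => [|[j f d| | | |] k] //=.
by rewrite /upd; case: eqP => [->|] //=; case: d.
Qed.

Lemma machine_iter x t :
  (ssval (iter t (@tm_step machine) x).1, (iter t (@tm_step machine) x).2) =
  iter t cstep (ssval x.1, x.2).
Proof. by elim: t => //= t <-; rewrite -machine_step. Qed.

End machine.

(** * Tapes as stacks, and running times of programs *)

Definition store : Type := 'I_5 -> seq bool.

(** The top of the stack is under the head. The number of trailing blanks is left open, because
    tapes that differ in visited blank cells represent the same stack. *)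
Definition stack_tape (s : seq bool) (t : tape sym) : Prop :=
  all (pred1 None) (tape_left t) /\
  exists n, scanned t :: tape_right t = [seq Some (inl b) | b <- s] ++ nseq n None.

Definition rep (st : store) (tp : tapes) : Prop := forall i, stack_tape (st i) (tp i).

(** A Hoare triple with a time bound. The pending commands [k] are part of it, so that it can also
    describe a run that starts or stops in the middle of a loop. *)
Variant goes (k : seq cmd) (st : store) (k' : seq cmd) (st' : store) (T : nat) : Prop :=
  Goes of (forall tp, rep st tp -> exists t tp',
    [/\ t <= T, rep st' tp' & iter t cstep (k, tp) = (k', tp')]).

Variant runs (c : cmd) (st st' : store) (T : nat) : Prop :=
  Runs of (forall k, goes (c :: k) st k st' T).

Lemma runs_goes c st st' T k : runs c st st' T -> goes (c :: k) st k st' T.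
Proof. by case. Qed.

Lemma goes_refl k st : goes k st k st 0.
Proof. by split=> tp h; exists 0, tp. Qed.

Lemma goes_trans k2 st2 T1 T2 k1 st1 k3 st3 T :
  goes k1 st1 k2 st2 T1 -> goes k2 st2 k3 st3 T2 -> T1 + T2 <= T ->
  goes k1 st1 k3 st3 T.
Proof.
move=> [h1] [h2] le; split=> tp /h1[t1 [tp1 [l1 r1 e1]]].
have [t2 [tp2 [l2 r2 e2]]] := h2 _ r1.
exists (t2 + t1), tp2; split => //; last by rewrite iterD e1.
by rewrite addnC (leq_trans (leq_add l1 l2)).
Qed.

Lemma goes_le k st k' st' T T' : goes k st k' st' T -> T <= T' -> goes k st k' st' T'.
Proof.
move=> [h] l; split=> tp /h[t [tp' [a b c]]]; exists t, tp'; split => //; exact: leq_trans l.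
Qed.

Lemma goes_step k st k' : (forall tp, rep st tp -> cstep (k, tp) = (k', tp)) ->
  goes k st k' st 1.
Proof. by move=> h; split=> tp r; exists 1, tp; split=> //=; exact: h. Qed.

Lemma goes_step_l k2 k1 st k3 st3 T :
  (forall tp, rep st tp -> cstep (k1, tp) = (k2, tp)) ->
  goes k2 st k3 st3 T -> goes k1 st k3 st3 T.+1.
Proof. by move=> h g; apply: goes_trans (goes_step h) g _. Qed.

Lemma runs_le c st st' T T' : runs c st st' T -> T <= T' -> runs c st st' T'.
Proof. by move=> [h] l; split=> k; exact: goes_le (h k) l. Qed.

Lemma runs_seq st2 T1 T2 a b st1 st3 T :
  runs a st1 st2 T1 -> runs b st2 st3 T2 -> (T1 + T2).+1 <= T ->
  runs (Sq a b) st1 st3 T.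
Proof.
move=> [ha] [hb] le; split=> k.
apply: goes_le le; apply: (@goes_step_l (a :: b :: k)) => //.
exact: goes_trans (ha _) (hb _) (leqnn _).
Qed.

Definition top (p : seq bool -> bool) : sym -> bool :=
  fun x => p (if x is Some (inl b) then [:: b] else [::]).
Definition ne (s : seq bool) : bool := s != [::].
Definition hd1 (s : seq bool) : bool := head false s.

Lemma rep_top p st tp i : rep st tp -> top p (scanned (tp i)) = p (take 1 (st i)).
Proof.
move=> /(_ i)[_ [n]]; case: (st i) => [|b s] /=.
  by case: n => [|n] h; [discriminate h|case: h => -> _].
by move=> h; case: h => -> _; rewrite take0.
Qed.

Lemma runs_if i (p : seq bool -> bool) a b st st' T :
  runs (if p (take 1 (st i)) then a else b) st st' T ->
  runs (If i (top p) a b) st st' T.+1.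
Proof.
move=> [h]; split=> k; apply: goes_step_l (h k).
by move=> tp r; rewrite /cstep /= (rep_top p i r); case: ifP.
Qed.

Lemma goes_while_true i (p : seq bool -> bool) c k st st' T :
  p (take 1 (st i)) -> runs c st st' T ->
  goes (Wh i (top p) c :: k) st (Wh i (top p) c :: k) st' T.+1.
Proof.
move=> pi [h]; apply: goes_step_l (h _).
by move=> tp r; rewrite /cstep /= (rep_top p i r) pi.
Qed.

Lemma goes_while_false i (p : seq bool -> bool) c k st :
  ~~ p (take 1 (st i)) -> goes (Wh i (top p) c :: k) st k st 1.
Proof.
move=> pi.
by apply: goes_step => tp r; rewrite /cstep /= (rep_top p i r) (negbTE pi).
Qed.

Definition push i b : cmd :=
  Sq (Act i id GoLeft) (Act i (fun=> Some (inl b)) Stay).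
(** The cell is blanked before the head leaves it: [stack_tape] wants only blanks to the left of the
    head. *)
Definition pop i : cmd := Act i (fun=> None) GoRight.

Lemma runs_push i b st : runs (push i b) st (upd st i (b :: st i)) 3.
Proof.
split=> k; split=> tp r; have [l [n rn]] := r i.
exists 3; eexists; split; [by []| |by []].
move=> j; rewrite /upd /= /upd; case: (eqVneq j i) => [e|//].
rewrite eqxx; split => /=; first by case: (tape_left _) l => //= x s /andP[].
by exists n; rewrite /tape_write /= rn.
Qed.

Lemma runs_pop i st : runs (pop i) st (upd st i (behead (st i))) 1.
Proof.
split=> k; split=> tp r; have [l [n rn]] := r i.
exists 1; eexists; split; [by []| |by []].
move=> j; rewrite /upd /= /upd; case: (eqVneq j i) => [e|//].
split => //=.
case: (tape_right (tp i)) rn => [|x s] /=.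
  move=> rn; exists 1; case: (st i) rn => [|b [|b' s']] //=.
case: (st i) => [|b s'] /=.
  by case: n => [|[|n]] //= [_ -> ->]; exists n.+1.
by case=> _ ->; exists n.
Qed.
Definition o0 : 'I_5 := @Ordinal 5 0 isT.
Definition o1 : 'I_5 := @Ordinal 5 1 isT.
Definition o2 : 'I_5 := @Ordinal 5 2 isT.
Definition o3 : 'I_5 := @Ordinal 5 3 isT.
Definition o4 : 'I_5 := @Ordinal 5 4 isT.

Definition pour i j : cmd :=
  Wh i (top ne) (Sq (If i (top hd1) (push j true) (push j false)) (pop i)).

Lemma runs_move i j st b s : i != j -> st i = b :: s ->
  runs (Sq (If i (top hd1) (push j true) (push j false)) (pop i)) st
    (upd (upd st j (b :: st j)) i s) 6.
Proof.
move=> ij sE; apply: (runs_seq (T1 := 4) (T2 := 1)) => //.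
  apply: runs_if; rewrite sE /= /hd1 ?take0 /=.
  by case: (b); apply: runs_push.
have := @runs_pop i (upd st j (b :: st j)).
by rewrite [X in behead X](_ : _ = b :: s) // /upd (negbTE ij).
Qed.

Lemma runs_pour i j st : i != j ->
  runs (pour i j) st (upd (upd st i [::]) j (rev (st i) ++ st j)) (8 * size (st i) + 2).
Proof.
move=> ij; split=> k; move sE : (st i) => s; elim: s st sE => [|b s IH] st sE.
  rewrite (_ : upd _ _ _ = st); last first.
    apply/funext => l; rewrite /upd; case: (eqVneq l j) => [e|_]; first by rewrite e.
    by case: (eqVneq l i) => [e|//]; rewrite e.
  by apply: (@goes_le _ _ _ _ 1) => //; apply: (goes_while_false (p := ne)); rewrite sE.
pose st2 := upd (upd st j (b :: st j)) i s.
have -> : upd (upd st i [::]) j (rev (b :: s) ++ st j) =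
          upd (upd st2 i [::]) j (rev s ++ st2 j).
  apply/funext => l; rewrite /st2 /upd; case: (eqVneq l j) => [_|lj].
    by rewrite eqxx eq_sym (negbTE ij) rev_cons cat_rcons.
  by case: eqP.
have st2E : st2 i = s by rewrite /st2 /upd eqxx.
apply: (goes_trans _ (IH _ st2E)).
  by apply: (goes_while_true (p := ne)) (runs_move ij sE); rewrite sE.
by rewrite /=; lia.
Qed.

(** * Stacks of trees *)

Inductive tree := Lf | Nd of tree & tree.

(** A prefix code, so trees can lie on tape 0 one after the other without separators, and pairing
    the two topmost trees is a single push. *)
Fixpoint code (t : tree) : seq bool :=
  if t is Nd l r then true :: code l ++ code r else [:: false].

Definition tsz (t : tree) : nat := size (code t).

Lemma tsz_gt0 t : 0 < tsz t. Proof. by case: t. Qed.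

Lemma tsz_Nd l r : tsz (Nd l r) = (tsz l + tsz r).+1.
Proof. by rewrite /tsz /= size_cat. Qed.

Definition slots (g : store) (s c : seq bool) (i : 'I_5) (a : seq bool) : store :=
  upd (upd (upd g o0 s) o2 c) i a.

(** Tape 2 counts in unary the subtrees still to be read: a node replaces one pending tree by two, a
    leaf settles one. The topmost tree ends when the counter is empty. *)
Definition mvtree_body (i : 'I_5) : cmd :=
  Sq (If o0 (top hd1) (Sq (push i true) (push o2 true)) (Sq (push i false) (pop o2)))
     (pop o0).
Definition mvtree_loop (i : 'I_5) : cmd := Wh o2 (top ne) (mvtree_body i).
Definition mvtree (i : 'I_5) : cmd := Sq (push o2 true) (mvtree_loop i).

Section mvtree.
Variables (g : store) (i : 'I_5).
Hypotheses (i0 : i != o0) (i2 : i != o2).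

Lemma slots0 s c a : slots g s c i a o0 = s.
Proof. by rewrite /slots /upd eq_sym (negbTE i0). Qed.
Lemma slots2 s c a : slots g s c i a o2 = c.
Proof. by rewrite /slots /upd eq_sym (negbTE i2). Qed.
Lemma slotsi s c a : slots g s c i a i = a.
Proof. by rewrite /slots /upd eqxx. Qed.
Lemma upd_slots0 s s' c a : upd (slots g s c i a) o0 s' = slots g s' c i a.
Proof.
by apply/funext => j; rewrite /slots /upd; case: (eqVneq j o0) => // ->;
  rewrite eq_sym (negbTE i0).
Qed.
Lemma upd_slots2 s c c' a : upd (slots g s c i a) o2 c' = slots g s c' i a.
Proof.
by apply/funext => j; rewrite /slots /upd; case: (eqVneq j o2) => // ->;
  rewrite eq_sym (negbTE i2).
Qed.
Lemma upd_slotsi s c a a' : upd (slots g s c i a) i a' = slots g s c i a'.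
Proof. by apply/funext => j; rewrite /slots /upd; case: (eqVneq j i). Qed.

Lemma runs_mvtree_body b s c a :
  runs (mvtree_body i) (slots g (b :: s) (true :: c) i a)
    (slots g s (if b then [:: true, true & c] else c) i (b :: a)) 12.
Proof.
apply: (runs_seq (st2 := slots g (b :: s) (if b then [:: true, true & c] else c) i (b :: a))
  (T1 := 10) (T2 := 1)) => //; last first.
  by have := @runs_pop o0 (slots g (b :: s) (if b then [:: true, true & c] else c) i (b :: a));
    rewrite slots0 upd_slots0.
apply: runs_le (_ : 8 <= 10) => //; apply: runs_if; rewrite slots0 /= ?take0.
case: b => /=.
  apply: (runs_seq (T1 := 3) (T2 := 3)) (runs_push _ _ _) _ _ => //.
  by have := @runs_push o2 true (slots g (true :: s) (true :: c) i (true :: a));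
    rewrite slots2 upd_slots2 slotsi upd_slotsi.
apply: (runs_seq (T1 := 3) (T2 := 3)) (runs_push _ _ _) _ _ => //.
apply: runs_le (_ : 1 <= 3) => //.
by have := @runs_pop o2 (slots g (false :: s) (true :: c) i (false :: a));
    rewrite slots2 upd_slots2 slotsi upd_slotsi.
Qed.

Lemma goes_mvtree_loop t s c a k :
  goes (mvtree_loop i :: k) (slots g (code t ++ s) (true :: c) i a)
       (mvtree_loop i :: k) (slots g s c i (rev (code t) ++ a)) (14 * tsz t).
Proof.
elim: t s c a => [|l IHl r IHr] s c a.
  apply: goes_le (_ : 13 <= _) => //.
  apply: (goes_while_true (p := ne)); first by rewrite slots2.
  exact: (runs_mvtree_body false s c a).
have body : goes (mvtree_loop i :: k) (slots g (code (Nd l r) ++ s) (true :: c) i a)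
   (mvtree_loop i :: k) (slots g (code l ++ (code r ++ s)) [:: true, true & c] i (true :: a)) 13.
  apply: (goes_while_true (p := ne)); first by rewrite slots2.
  by have := runs_mvtree_body true (code l ++ (code r ++ s)) c a; rewrite /= catA.
have -> : rev (code (Nd l r)) ++ a = rev (code r) ++ (rev (code l) ++ (true :: a)).
  by rewrite /= rev_cons rev_cat cat_rcons catA.
apply: (goes_trans body); first exact: goes_trans (IHl _ _ _) (IHr _ _ _) (leqnn _).
by rewrite tsz_Nd; lia.
Qed.

Lemma runs_mvtree t s a :
  runs (mvtree i) (slots g (code t ++ s) [::] i a)
    (slots g s [::] i (rev (code t) ++ a)) (20 * tsz t).
Proof.
apply: (runs_seq (T1 := 3) (T2 := 14 * tsz t + 1)
  (st2 := slots g (code t ++ s) [:: true] i a)).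
- by have := @runs_push o2 true (slots g (code t ++ s) [::] i a);
    rewrite slots2 upd_slots2.
- split=> k; apply: goes_trans (goes_mvtree_loop _ _ _ _ _) _ (leqnn _).
  by apply: (goes_while_false (p := ne)); rewrite slots2.
- by have := tsz_gt0 t; lia.
Qed.

End mvtree.

(** A tree parked on an auxiliary tape is reversed, as reading it off tape 0 leaves it; [pour]
    restores the order. *)
Definition otree (o : option tree) : seq bool := if o is Some t then rev (code t) else [::].

Definition St (s0 s1 s2 s3 s4 : seq bool) : store :=
  fun i => nth [::] [:: s0; s1; s2; s3; s4] i.

Definition codes (S : seq tree) : seq bool := flatten [seq code t | t <- S].

Definition V (S : seq tree) (a b c : option tree) : store :=
  St (codes S) (otree a) [::] (otree b) (otree c).

Ltac store_eq := apply/funext => -[[|[|[|[|[|?]]]]] ?] //=; rewrite /upd /St /slots /upd -?val_eqE /=.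

Lemma runs_eq c st1 st1' st2 st2' T : runs c st1' st2' T -> st1 = st1' -> st2 = st2' ->
  runs c st1 st2 T.
Proof. by move=> h -> ->. Qed.

Lemma runs_to1 t S b c :
  runs (mvtree o1) (V (t :: S) None b c) (V S (Some t) b c) (20 * tsz t).
Proof.
apply: (runs_eq (@runs_mvtree (V S None b c) o1 isT isT t (codes S) [::]));
  rewrite ?cats0; store_eq.
Qed.

Lemma runs_to3 t S a c :
  runs (mvtree o3) (V (t :: S) a None c) (V S a (Some t) c) (20 * tsz t).
Proof.
apply: (runs_eq (@runs_mvtree (V S a None c) o3 isT isT t (codes S) [::]));
  rewrite ?cats0; store_eq.
Qed.

Lemma runs_to4 t S a b :
  runs (mvtree o4) (V (t :: S) a b None) (V S a b (Some t)) (20 * tsz t).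
Proof.
apply: (runs_eq (@runs_mvtree (V S a b None) o4 isT isT t (codes S) [::]));
  rewrite ?cats0; store_eq.
Qed.

Lemma runs_fr1 t S b c :
  runs (pour o1 o0) (V S (Some t) b c) (V (t :: S) None b c) (20 * tsz t).
Proof.
apply: (runs_eq (runs_le (@runs_pour o1 o0 (V S (Some t) b c) isT) _)) => //.
  by rewrite /= size_rev -/(tsz t); have := tsz_gt0 t; lia.
by store_eq; rewrite revK.
Qed.

Lemma runs_fr3 t S a c :
  runs (pour o3 o0) (V S a (Some t) c) (V (t :: S) a None c) (20 * tsz t).
Proof.
apply: (runs_eq (runs_le (@runs_pour o3 o0 (V S a (Some t) c) isT) _)) => //.
  by rewrite /= size_rev -/(tsz t); have := tsz_gt0 t; lia.
by store_eq; rewrite revK.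
Qed.

Lemma runs_fr4 t S a b :
  runs (pour o4 o0) (V S a b (Some t)) (V (t :: S) a b None) (20 * tsz t).
Proof.
apply: (runs_eq (runs_le (@runs_pour o4 o0 (V S a b (Some t)) isT) _)) => //.
  by rewrite /= size_rev -/(tsz t); have := tsz_gt0 t; lia.
by store_eq; rewrite revK.
Qed.

Definition dup_body : cmd :=
  Sq (If o1 (top hd1) (Sq (push o0 true) (push o3 true))
                      (Sq (push o0 false) (push o3 false))) (pop o1).
Definition vdup : cmd :=
  Sq (mvtree o1) (Sq (Wh o1 (top ne) dup_body) (Sq (pour o3 o1) (pour o1 o0))).

Lemma runs_dup_loop s0 s1 s3 s4 :
  runs (Wh o1 (top ne) dup_body) (St s0 s1 [::] s3 s4)
    (St (rev s1 ++ s0) [::] [::] (rev s1 ++ s3) s4) (12 * size s1 + 1).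
Proof.
split=> k; elim: s1 s0 s3 => [|b s IH] s0 s3; first exact: (goes_while_false (p := ne)).
rewrite rev_cons !cat_rcons; apply: (goes_trans _ (IH (b :: s0) (b :: s3)) (T1 := 11)).
  apply: (goes_while_true (p := ne)) => //.
  apply: (runs_seq (st2 := St (b :: s0) (b :: s) [::] (b :: s3) s4) (T1 := 8) (T2 := 1)) => //.
    apply: runs_if; rewrite /= ?take0.
    have p1 c : runs (push o0 c) (St s0 (b :: s) [::] s3 s4)
        (St (c :: s0) (b :: s) [::] s3 s4) 3.
      by apply: (runs_eq (runs_push _ _ _)) => //; store_eq.
    have p2 c : runs (push o3 c) (St (c :: s0) (b :: s) [::] s3 s4)
        (St (c :: s0) (b :: s) [::] (c :: s3) s4) 3.
      by apply: (runs_eq (runs_push _ _ _)) => //; store_eq.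
    by case: b p1 p2 => p1 p2 /=; exact: runs_seq (p1 _) (p2 _) _.
  by apply: (runs_eq (runs_pop _ _)) => //; store_eq.
by rewrite /=; lia.
Qed.

Lemma runs_dup t S c :
  runs vdup (V (t :: S) None None c) (V [:: t, t & S] None None c) (80 * tsz t).
Proof.
have t0 := tsz_gt0 t.
apply: runs_seq (runs_to1 _ _ _ _) _ _.
  apply: runs_seq (runs_dup_loop _ _ _ _) _ (leqnn _).
  rewrite /= revK cats0.
  apply: (runs_seq (st2 := St (codes (t :: S)) (otree (Some t)) [::] [::] (otree c))
    (T1 := 8 * tsz t + 2) (T2 := 20 * tsz t)) (leqnn _).
    apply: (runs_eq (@runs_pour o3 o1 (St (codes (t :: S)) [::] [::] (code t) (otree c)) isT)) => //.
    by store_eq; rewrite cats0.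
  exact: (runs_fr1 t (t :: S) None c).
by rewrite [otree _]/= size_rev -/(tsz t); lia.
Qed.

Definition vdrop : cmd := Sq (mvtree o4) (Wh o4 (top ne) (pop o4)).

Lemma runs_drop t S : runs vdrop (V (t :: S) None None None) (V S None None None) (60 * tsz t).
Proof.
have t0 := tsz_gt0 t.
have loop s0 s k : goes (Wh o4 (top ne) (pop o4) :: k) (St s0 [::] [::] [::] s) k
    (St s0 [::] [::] [::] [::]) (2 * size s + 1).
  elim: s => [|b s IH]; first exact: (goes_while_false (p := ne)).
  apply: (goes_trans (T1 := 2) _ IH); last by rewrite /=; lia.
  apply: (goes_while_true (p := ne)) => //.
  by apply: (runs_eq (runs_pop _ _)) => //; store_eq.
apply: runs_seq (runs_to4 _ _ _ _) _ _.
  by split=> k; exact: loop.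
by rewrite /= size_rev -/(tsz t); lia.
Qed.
Notation VS S := (V S None None None).

Definition vswap : cmd :=
  Sq (mvtree o1) (Sq (mvtree o3) (Sq (pour o1 o0) (pour o3 o0))).
Definition vcons : cmd := push o0 true.
Definition vuncons : cmd := pop o0.

Lemma runs_swap a b S : runs vswap (VS [:: a, b & S]) (VS [:: b, a & S])
  (100 * (tsz a + tsz b)).
Proof.
apply: runs_le.
  apply: runs_seq (runs_to1 _ _ _ _) _ (leqnn _).
  apply: runs_seq (runs_to3 _ _ _ _) _ (leqnn _).
  exact: runs_seq (runs_fr1 _ _ _ _) (runs_fr3 _ _ _ _) (leqnn _).
by have := tsz_gt0 a; lia.
Qed.

Lemma runs_cons a b S x y z : runs vcons (V [:: a, b & S] x y z) (V (Nd a b :: S) x y z) 3.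
Proof.
by apply: (runs_eq (runs_push o0 true (V [:: a, b & S] x y z))) => //; store_eq;
  rewrite /V /St /codes /= ?catA.
Qed.

Lemma runs_uncons a b S x y z : runs vuncons (V (Nd a b :: S) x y z) (V [:: a, b & S] x y z) 1.
Proof.
by apply: (runs_eq (runs_pop o0 (V (Nd a b :: S) x y z))) => //; store_eq;
  rewrite /V /St /codes /= ?catA.
Qed.

Lemma runs_popLf S x y z : runs vuncons (V (Lf :: S) x y z) (V S x y z) 1.
Proof. by apply: (runs_eq (runs_pop o0 (V (Lf :: S) x y z))) => //; store_eq. Qed.

(** The empty list needs a command without effect: a push followed by a pop, under a test that
    always succeeds. *)
Fixpoint vconst_bits (s : seq bool) : cmd :=
  if s is b :: s' then Sq (vconst_bits s') (push o0 b) else If o0 (fun=> true) (Sq (push o0 true) (pop o0)) (Halt true).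

Lemma runs_const t S : runs (vconst_bits (code t)) (VS S) (VS (t :: S)) (10 * (tsz t).+1).
Proof.
suff h s s0 : runs (vconst_bits s) (St s0 [::] [::] [::] [::]) (St (s ++ s0) [::] [::] [::] [::])
    (10 * (size s).+1) by exact: h.
elim: s => [|b s IH] /=.
  apply: (runs_le (T := 6)); last by [].
  apply: (runs_if (p := xpredT)) => /=.
  apply: (runs_eq (runs_seq (runs_push o0 true _) (runs_pop _ _) (leqnn _))) => //; store_eq.
apply: runs_seq IH _ _.
  by apply: (runs_eq (runs_push o0 b _)) => //; store_eq.
by lia.
Qed.

(** * Polynomial-time functions *)

(** Natural numbers are in unary, so that a function running in polynomial time has values
    bounded by a polynomial. *)
Structure encType := EncType { enc_sort :> Type; enc : enc_sort -> tree }.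
Arguments enc {e} x.

(** Different types share tree shapes on purpose: a cons cell is a pair, a successor is a pair with
    the unit, an option is a list of length at most one. [FP_cast] then turns a program for one type
    into a program for another at no cost. *)
Canonical enc_unit := EncType (fun _ : unit => Lf).
Canonical enc_bool := EncType (fun b : bool => if b then Nd Lf Lf else Lf).
Canonical enc_pair (A B : encType) := EncType (fun x : A * B => Nd (enc x.1) (enc x.2)).
Fixpoint enc_list (A : encType) (s : seq A) : tree :=
  if s is x :: s' then Nd (enc x) (enc_list s') else Lf.
Canonical enc_seq (A : encType) := EncType (@enc_list A).
Canonical enc_option (A : encType) :=
  EncType (fun o : option A => if o is Some x then Nd (enc x) Lf else Lf).
Canonical enc_nat := EncType (fun n : nat => iter n (Nd Lf) Lf).

Arguments enc : simpl never.
Arguments tsz : simpl never.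

Notation esz x := (tsz (enc x)).

Lemma esz_gt0 (A : encType) (x : A) : 0 < esz x. Proof. exact: tsz_gt0. Qed.

Lemma esz_pair (A B : encType) (x : A * B) :
  esz x = (esz x.1 + esz x.2).+1.
Proof. exact: tsz_Nd. Qed.

Lemma esz_nil (A : encType) : esz ([::] : seq A) = 1. Proof. by []. Qed.

Lemma esz_cons (A : encType) (x : A) s : esz (x :: s) = (esz x + esz s).+1.
Proof. exact: tsz_Nd. Qed.

Lemma esz_seq (A : encType) (s : seq A) : esz s = (\sum_(x <- s) (esz x).+1).+1.
Proof.
elim: s => [|x s IH]; first by rewrite big_nil.
by rewrite esz_cons IH big_cons; lia.
Qed.

Lemma esz_cat (A : encType) (s t : seq A) : esz (s ++ t) = (esz s + esz t).-1.
Proof. by rewrite !esz_seq big_cat /=; lia. Qed.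

Lemma esz_nat n : esz n = (2 * n).+1.
Proof. by elim: n => // n IH; rewrite -[enc n.+1]/(Nd Lf (enc n)) tsz_Nd IH mulnS. Qed.

Lemma size_esz (A : encType) (s : seq A) : size s <= esz s.
Proof.
by rewrite esz_seq -sum1_size; apply: leqW; apply: leq_sum => x _.
Qed.

Lemma esz_catr (A : encType) (s1 s2 : seq A) x : esz x <= esz (s1 ++ x :: s2).
Proof. by rewrite esz_cat esz_cons; have := tsz_gt0 (enc s1); lia. Qed.

Definition runsF (A B : encType) (f : A -> B) (T : A -> nat) : Prop :=
  exists c, forall x S, runs c (VS (enc x :: S)) (VS (enc (f x) :: S)) (T x).

Definition pbd (A : encType) (f : A -> nat) : Prop :=
  exists k, forall x, f x <= (esz x + 2) ^ k.

(** The size bound on the result is stored next to the time bound, because composition needs it to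
    bound the time of the second function. *)
Definition FP (A B : encType) (f : A -> B) : Prop :=
  (exists2 T, runsF f T & pbd T) /\ pbd (fun x => esz (f x)).

Section pbd.
Context (A : encType).
Implicit Types f g : A -> nat.

Lemma pbd_le f g : pbd g -> (forall x, f x <= g x) -> pbd f.
Proof. by move=> [k h] le; exists k => x; exact: leq_trans (le x) (h x). Qed.

Lemma pbd_const n : pbd (fun _ : A => n).
Proof.
exists n => x; apply: leq_trans (ltnW (ltn_expl n (ltnSn 1))) _.
by case: n => // n; rewrite leq_exp2r // leq_addl.
Qed.

Lemma pbd_mul f g : pbd f -> pbd g -> pbd (fun x => f x * g x).
Proof. by move=> [a ha] [b hb]; exists (a + b) => x; rewrite expnD leq_mul. Qed.

Lemma pbd_add f g : pbd f -> pbd g -> pbd (fun x => f x + g x).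
Proof.
move=> hf hg; apply: (pbd_le (g := fun x => 2 * ((f x).+1 * (g x).+1))); last by move=> x; nia.
have h1 e : pbd e -> pbd (fun x => (e x).+1).
  move=> [k h]; exists k.+1 => x; rewrite expnS.
  have : 0 < (esz x + 2) ^ k by rewrite expn_gt0 addn2.
  have := h x; have := esz_gt0 x; nia.
by apply: pbd_mul; [exact: pbd_const|apply: pbd_mul; exact: h1].
Qed.

Lemma pbd_esz : pbd (fun x : A => esz x).
Proof. by exists 1 => x; rewrite expn1 leq_addr. Qed.

Lemma pbd_comp (B : encType) (f : A -> B) (g : B -> nat) :
  pbd (fun x => esz (f x)) -> pbd g -> pbd (fun x => g (f x)).
Proof.
move=> [a ha] [b hb]; exists (a.+1 * b) => x; apply: leq_trans (hb _) _.
rewrite expnM; have [-> //|b0] := posnP b; rewrite leq_exp2r //.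
have := ha x; rewrite expnS; have := esz_gt0 x.
have : 0 < (esz x + 2) ^ a by rewrite expn_gt0 addn2.
by nia.
Qed.

Lemma pbd_exp f k : pbd f -> pbd (fun x => f x ^ k).
Proof.
elim: k => [|k IH] h; first exact: pbd_const.
by apply: (pbd_le (pbd_mul h (IH h))) => x; rewrite expnS.
Qed.

End pbd.

(** * Composition, pairing and branching in polynomial time *)

Section combinators.
Context (A B C : encType).

Lemma runsF_comp (f : A -> B) (g : B -> C) T1 T2 :
  runsF f T1 -> runsF g T2 -> runsF (fun x => g (f x)) (fun x => (T1 x + T2 (f x)).+1).
Proof.
move=> [c1 h1] [c2 h2]; exists (Sq c1 c2) => x S.
exact: runs_seq (h1 _ _) (h2 _ _) (leqnn _).
Qed.

Lemma runsF_pair (f : A -> B) (g : A -> C) T1 T2 :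
  runsF f T1 -> runsF g T2 ->
  runsF (fun x => (f x, g x))
    (fun x => T1 x + T2 x + 1000 * (esz x + esz (f x) + esz (g x))).
Proof.
move=> [c1 h1] [c2 h2].
(* [g] runs first on the upper copy; after the swap [f] finds the other copy on top, and [vcons]
   receives the components in the right order. *)
exists (Sq vdup (Sq c2 (Sq vswap (Sq c1 vcons)))) => x S.
apply: runs_le.
  apply: runs_seq (runs_dup _ _ _) _ (leqnn _).
  apply: runs_seq (h2 _ _) _ (leqnn _).
  apply: runs_seq (runs_swap _ _ _) _ (leqnn _).
  exact: runs_seq (h1 _ _) (runs_cons _ _ _ _ _ _) (leqnn _).
by have := esz_gt0 x; lia.
Qed.

Lemma FP_comp (f : A -> B) (g : B -> C) : FP f -> FP g -> FP (fun x => g (f x)).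
Proof.
move=> [[T1 r1 b1] s1] [[T2 r2 b2] s2]; split; last exact: pbd_comp s1 s2.
exists (fun x => (T1 x + T2 (f x)).+1); first exact: runsF_comp.
apply: (pbd_le (pbd_add (pbd_const _ 1) (pbd_add b1 (pbd_comp s1 b2)))) => x.
by rewrite add1n.
Qed.

Lemma FP_pair (f : A -> B) (g : A -> C) : FP f -> FP g -> FP (fun x => (f x, g x)).
Proof.
move=> [[T1 r1 b1] s1] [[T2 r2 b2] s2]; split; last first.
  apply: (pbd_le (pbd_add (pbd_const _ 1) (pbd_add s1 s2))) => x.
  by rewrite esz_pair add1n.
eexists; first exact: runsF_pair r1 r2.
apply: pbd_add; first exact: pbd_add.
exact: pbd_mul (pbd_const _ _) (pbd_add (pbd_add (pbd_esz _) s1) s2).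
Qed.

Lemma FP_id : FP (fun x : A => x).
Proof.
split; last exact: pbd_esz.
exists (fun=> 5).
  exists (Sq (push o0 true) (pop o0)) => x S.
  apply: (runs_eq (runs_le (runs_seq (runs_push o0 true _) (runs_pop _ _) (leqnn _)) _)) => //.
  by store_eq.
exact: pbd_const.
Qed.

Lemma FP_cast (f : A -> B) (g : A -> C) : FP f -> (forall x, enc (f x) = enc (g x)) -> FP g.
Proof.
move=> [[T [c h] b] s] e; split; last by apply: pbd_le s _ => x; rewrite e.
by exists T => //; exists c => x S; rewrite -e.
Qed.

Lemma FP_const (y : B) : FP (fun _ : A => y).
Proof.
split; last exact: pbd_const.
exists (fun x : A => 60 * esz x + (10 * (tsz (enc y)).+1).+1).
  exists (Sq vdrop (vconst_bits (code (enc y)))) => x S.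
  by apply: runs_seq (runs_drop _ _) (runs_const _ _) _; lia.
by apply: pbd_add (pbd_const _ _); exact: pbd_mul (pbd_const _ _) (pbd_esz _).
Qed.

Lemma FP_fst : FP (fun x : A * B => x.1).
Proof.
split; last by apply: (pbd_le (pbd_esz _)) => x; rewrite esz_pair; lia.
exists (fun x : A * B => 1000 * esz x).
  exists (Sq vuncons (Sq vswap vdrop)) => -[x y] S.
  apply: runs_le.
    apply: runs_seq (runs_uncons _ _ _ _ _ _) _ (leqnn _).
    exact: runs_seq (runs_swap _ _ _) (runs_drop _ _) (leqnn _).
  by rewrite esz_pair /=; lia.
by exact: pbd_mul (pbd_const _ _) (pbd_esz _).
Qed.

Lemma FP_snd : FP (fun x : A * B => x.2).
Proof.
split; last by apply: (pbd_le (pbd_esz _)) => x; rewrite esz_pair; lia.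
exists (fun x : A * B => 1000 * esz x).
  exists (Sq vuncons vdrop) => -[x y] S.
  apply: runs_le.
    exact: runs_seq (runs_uncons _ _ _ _ _ _) (runs_drop _ _) (leqnn _).
  by rewrite esz_pair /=; lia.
by exact: pbd_mul (pbd_const _ _) (pbd_esz _).
Qed.

Lemma FP_if (b : A -> bool) (f g : A -> C) :
  FP b -> FP f -> FP g -> FP (fun x => if b x then f x else g x).
Proof.
move=> [[T0 [c0 r0] b0] s0] [[T1 [c1 r1] b1] s1] [[T2 [c2 r2] b2] s2]; split; last first.
  by apply: (pbd_le (pbd_add s1 s2)) => x; case: (b x); lia.
exists (fun x => 100 * esz x + T0 x + T1 x + T2 x + 100).
  exists (Sq vdup (Sq c0 (If o0 (top hd1)
    (Sq vuncons (Sq vuncons (Sq vuncons c1))) (Sq vuncons c2)))) => x S.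
  apply: runs_le.
    apply: runs_seq (runs_dup _ _ _) _ (leqnn _).
    apply: runs_seq (r0 _ _) _ (leqnn _).
    apply: (runs_if (T := T1 x + T2 x + 10)); case: (b x) => /=.
      apply: runs_le.
        apply: runs_seq (runs_uncons _ _ _ _ _ _) _ (leqnn _).
        apply: runs_seq (runs_popLf _ _ _ _) _ (leqnn _).
        exact: runs_seq (runs_popLf _ _ _ _) (r1 _ _) (leqnn _).
      by lia.
    apply: runs_le; first exact: runs_seq (runs_popLf _ _ _ _) (r2 _ _) (leqnn _).
    by lia.
  by lia.
apply: pbd_add (pbd_const _ _); apply: pbd_add b2; apply: pbd_add b1; apply: pbd_add b0.
exact: pbd_mul (pbd_const _ _) (pbd_esz _).
Qed.

End combinators.

Lemma FP_case (A B C : encType)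
    (l : A -> seq B) (f0 : A -> C) (f1 : A * (B * seq B) -> C) :
  FP l -> FP f0 -> FP f1 ->
  FP (fun x => if l x is y :: s then f1 (x, (y, s)) else f0 x).
Proof.
move=> [[T0 [c0 r0] b0] s0] [[T1 [c1 r1] b1] s1] [[T2 [c2 r2] b2] s2].
pose f x := match l x with [::] => None | y :: s => Some (x, (y, s)) end.
have sf : pbd (fun x => esz x + esz (l x) + 10).
  exact: pbd_add (pbd_add (pbd_esz _) s0) (pbd_const _ _).
(* The cost of the second branch depends on [(x, (y, s))], which is no larger than [x] and [l x]
   together. *)
have h (g : A * (B * seq B) -> nat) : pbd g -> pbd (fun x => if f x is Some y then g y else 0).
  move=> [k hk]; have [j hj] := pbd_exp k.+1 sf; exists j => x; apply: leq_trans (hj x).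
  rewrite /f; case lx : (l x) => [//|y s]; apply: leq_trans (hk _) _.
  rewrite expnS; apply: leq_trans (leq_pmull _ _); last by rewrite addn_gt0 orbT.
  have [->//|k0] := posnP k; rewrite leq_exp2r //; have := esz_pair (x, (y, s)); have := esz_pair (y, s); have := esz_cons y s; rewrite /=; lia.
split; last first.
  by apply: (pbd_le (pbd_add s1 (h _ s2))) => x; rewrite /f; case: (l x) => //= *; lia.
exists (fun x => 1000 * (esz x + esz (l x)) + T0 x + T1 x +
    (if f x is Some y then T2 y else 0) + 100).
  exists (Sq vdup (Sq c0 (If o0 (top hd1) (Sq vswap (Sq vcons c2)) (Sq vuncons c1)))) => x S.
  apply: runs_le.
    apply: runs_seq (runs_dup _ _ _) _ (leqnn _).
    apply: runs_seq (r0 _ _) _ (leqnn _).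
    apply: (runs_if (T := 100 * (esz x + esz (l x)) + T1 x +
      (if f x is Some y then T2 y else 0) + 10)); rewrite /f; case: (l x) => [|y s] /=.
      apply: runs_le; first exact: runs_seq (runs_popLf _ _ _ _) (r1 _ _) (leqnn _).
      by lia.
    apply: runs_le.
      apply: runs_seq (runs_swap _ _ _) _ (leqnn _).
      exact: runs_seq (runs_cons _ _ _ _ _ _) (r2 (x, (y, s)) S) (leqnn _).
    by lia.
  by lia.
apply: pbd_add (pbd_const _ _); apply: pbd_add (h _ b2); apply: pbd_add b1.
by apply: pbd_add b0; apply: pbd_mul (pbd_const _ _) (pbd_add (pbd_esz _) s0).
Qed.

Section foldl.
Context (A B C : encType).
Variables (l : A -> seq B) (c0 : A -> C) (h : A * B * C -> C).

Definition foldx (x : A) (s : seq B) : C := foldl (fun c b => h (x, b, c)) (c0 x) s.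

(** Stated for arbitrary bounds [Bc] and [Bh], since it serves polynomial and exponential running
    times alike. *)
Lemma runsF_foldl Tl Tc Th (Bc Bh : A -> nat) :
  runsF l Tl -> runsF c0 Tc -> runsF h Th ->
  (forall x s1 s2, l x = s1 ++ s2 -> esz (foldx x s1) <= Bc x) ->
  (forall x s1 b s2, l x = s1 ++ b :: s2 -> Th (x, b, foldx x s1) <= Bh x) ->
  runsF (fun x => foldx x (l x)) (fun x => Tl x + Tc x +
    (size (l x)).+1 * (3000 * (esz x + esz (l x) + Bc x + 1) + Bh x)).
Proof.
move=> [pl rl] [pc rc] [ph rh] hBc hBh.
(* Between rounds the stack holds the remaining list, the accumulator and [x]. A round duplicates
   [x] and parks trees on the auxiliary tapes until the argument [(x, b, c)] of [h] is on top with
   the rest of the list below it. *)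
pose body := Sq vcons (Sq vswap (Sq vdup (Sq (mvtree o1) (Sq (mvtree o3) (Sq (mvtree o4)
  (Sq (pour o1 o0) (Sq (pour o4 o0) (Sq vuncons (Sq vuncons (Sq (pour o3 o0)
  (Sq vcons (Sq (mvtree o1) (Sq (mvtree o3) (Sq (pour o1 o0) (Sq vcons (Sq (pour o3 o0)
  (Sq vswap (Sq ph vswap)))))))))))))))))).
exists (Sq vdup (Sq pc (Sq vswap (Sq vdup (Sq pl (Sq (mvtree o1) (Sq (mvtree o3)
  (Sq (mvtree o4) (Sq (pour o3 o0) (Sq (pour o4 o0) (Sq (pour o1 o0)
  (Sq (Wh o0 (top hd1) body) (Sq vuncons (Sq vswap vdrop)))))))))))))) => x S.
pose K : nat := 2000 * (esz x + esz (l x) + Bc x + 1) + Bh x.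
have loop s1 s2 k : l x = s1 ++ s2 ->
    goes (Wh o0 (top hd1) body :: k) (VS [:: enc s2, enc (foldx x s1), enc x & S]) k
     (VS [:: Lf, enc (foldx x (l x)), enc x & S]) ((size s2).+1 * K).
  elim: s2 s1 => [|b s2 IH] s1 lx.
    rewrite lx cats0; apply: (goes_le (T := 1)); last by rewrite /K; lia.
    exact: (goes_while_false (p := hd1)).
  have lx' : l x = rcons s1 b ++ s2 by rewrite cat_rcons.
  apply: (goes_trans _ (IH _ lx') (T1 := K)); last by rewrite /=; lia.
  apply: (goes_le (T := K.-1.+1)); last by rewrite /K; lia.
  apply: (goes_while_true (p := hd1)) => //.
  apply: runs_le.
    apply: runs_seq (runs_cons _ _ _ _ _ _) _ (leqnn _).
    apply: runs_seq (runs_swap _ _ _) _ (leqnn _).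
    apply: runs_seq (runs_dup _ _ _) _ (leqnn _).
    apply: runs_seq (runs_to1 _ _ _ _) _ (leqnn _).
    apply: runs_seq (runs_to3 _ _ _ _) _ (leqnn _).
    apply: runs_seq (runs_to4 _ _ _ _) _ (leqnn _).
    apply: runs_seq (runs_fr1 _ _ _ _) _ (leqnn _).
    apply: runs_seq (runs_fr4 _ _ _ _) _ (leqnn _).
    apply: runs_seq (runs_uncons _ _ _ _ _ _) _ (leqnn _).
    apply: runs_seq (runs_uncons (enc b) (enc s2) _ _ _ _) _ (leqnn _).
    apply: runs_seq (runs_fr3 _ _ _ _) _ (leqnn _).
    apply: runs_seq (runs_cons _ _ _ _ _ _) _ (leqnn _).
    apply: runs_seq (runs_to1 _ _ _ _) _ (leqnn _).
    apply: runs_seq (runs_to3 _ _ _ _) _ (leqnn _).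
    apply: runs_seq (runs_fr1 _ _ _ _) _ (leqnn _).
    apply: runs_seq (runs_cons _ _ _ _ _ _) _ (leqnn _).
    apply: runs_seq (runs_fr3 _ _ _ _) _ (leqnn _).
    apply: runs_seq (runs_swap _ _ _) _ (leqnn _).
    apply: runs_seq (rh (x, b, foldx x s1) _) _ (leqnn _).
    rewrite (_ : h (x, b, foldx x s1) = foldx x (rcons s1 b)); last by rewrite /foldx foldl_rcons.
    exact: runs_swap.
  have B1 := hBc _ _ _ lx; have B2 := hBc _ _ _ lx'; have B3 := hBh _ _ _ _ lx.
  have B4 := esz_catr s1 s2 b; have B5 : esz (b :: s2) <= esz (l x).
    by rewrite lx esz_cat; have := tsz_gt0 (enc s1); lia.
  have E1 : esz s2 < esz (b :: s2) by rewrite esz_cons; lia.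
  have E2 : esz b < esz (b :: s2) by rewrite esz_cons; have := tsz_gt0 (enc s2); lia.
  have x0 := tsz_gt0 (enc x).
  rewrite (tsz_Nd (enc (b :: s2))) (tsz_Nd (Nd (enc x) (enc b))) (tsz_Nd (enc x) (enc b)) /K.
  move: B3; move: (Th _) => th B3.
  lia.
apply: runs_le.
  apply: runs_seq (runs_dup _ _ _) _ (leqnn _).
  apply: runs_seq (rc _ _) _ (leqnn _).
  apply: runs_seq (runs_swap _ _ _) _ (leqnn _).
  apply: runs_seq (runs_dup _ _ _) _ (leqnn _).
  apply: runs_seq (rl _ _) _ (leqnn _).
  apply: runs_seq (runs_to1 _ _ _ _) _ (leqnn _).
  apply: runs_seq (runs_to3 _ _ _ _) _ (leqnn _).
  apply: runs_seq (runs_to4 _ _ _ _) _ (leqnn _).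
  apply: runs_seq (runs_fr3 _ _ _ _) _ (leqnn _).
  apply: runs_seq (runs_fr4 _ _ _ _) _ (leqnn _).
  apply: runs_seq (runs_fr1 _ _ _ _) _ (leqnn _).
  apply: (runs_seq (st2 := VS [:: Lf, enc (foldx x (l x)), enc x & S])) _ (leqnn _).
    by split=> k; exact: (loop [::]).
  apply: runs_seq (runs_popLf _ _ _ _) _ (leqnn _).
  exact: runs_seq (runs_swap _ _ _) (runs_drop _ _) (leqnn _).
have := hBc x [::] (l x) erefl; have := hBc x (l x) [::] (esym (cats0 _)); rewrite /K.
have x0 := tsz_gt0 (enc x); rewrite -[foldx x [::]]/(c0 x).
have key (n w b : nat) : n.+1 * (2000 * w + b) + 1000 * w <= n.+1 * (3000 * w + b) by nia.
move: (key (size (l x)) (esz x + esz (l x) + Bc x + 1) (Bh x)).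
move: (_ * (2000 * _ + _)) (_ * (3000 * _ + _)) => Z1 Z2; clear -x0; lia.
Qed.
End foldl.

Section derived.
Context (A B C D : encType).

(** A polynomial-time [h] may square the size of the accumulator in each round, so a common
    polynomial bound for all intermediate results has to be supplied. *)
Lemma FP_foldl (l : A -> seq B) (c0 : A -> C) (h : A * B * C -> C) :
  FP l -> FP c0 -> FP h ->
  (exists k, forall x s1 s2, l x = s1 ++ s2 -> esz (foldx c0 h x s1) <= (esz x + 2) ^ k) ->
  FP (fun x => foldl (fun c b => h (x, b, c)) (c0 x) (l x)).
Proof.
move=> [[Tl rl bl] sl] [[Tc rc bc] sc] [[Th rh [kh bh]] sh] [k hk]; split; last first.
  by exists k => x; have := hk x (l x) [::] (esym (cats0 _)).
pose Bc (x : A) := (esz x + 2) ^ k.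
have pBc : pbd Bc by exists k.
pose Bh (x : A) := (esz x + esz (l x) + Bc x + 4) ^ kh.
have pBh : pbd Bh.
  apply: pbd_exp; apply: pbd_add (pbd_const _ _); apply: pbd_add pBc.
  exact: pbd_add (pbd_esz _) sl.
eexists; first apply: (runsF_foldl rl rc rh (Bc := Bc) (Bh := Bh)).
- by move=> x s1 s2 /hk.
- move=> x s1 b s2 lx; apply: leq_trans (bh _) _; rewrite /Bh.
  have [->//|k0] := posnP kh; rewrite leq_exp2r // (esz_pair (x, b, _)) (esz_pair (x, b)) /=.
  by have := hk _ _ _ lx; rewrite -/(Bc x) lx; have := esz_catr s1 s2 b; lia.
apply: pbd_add; first exact: pbd_add.
apply: pbd_mul.
  by apply: (pbd_le (pbd_add (pbd_const _ 1) sl)) => x; rewrite add1n ltnS size_esz.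
apply: pbd_add pBh; apply: pbd_mul (pbd_const _ _) _; apply: pbd_add (pbd_const _ _).
exact: pbd_add (pbd_add (pbd_esz _) sl) pBc.
Qed.

Lemma FP_ext (f g : A -> B) : FP f -> f =1 g -> FP g.
Proof. by move=> h /funext <-. Qed.

Lemma FP_cons (x : A -> B) (s : A -> seq B) : FP x -> FP s -> FP (fun a => x a :: s a).
Proof. by move=> hx hs; apply: FP_cast (FP_pair hx hs) _. Qed.

Lemma FP_Some (x : A -> B) : FP x -> FP (fun a => Some (x a)).
Proof. by move=> hx; apply: FP_cast (FP_pair hx (FP_const A tt)) _. Qed.

End derived.

Lemma FP_option (A B C : encType) (o : A -> option B) (f0 : A -> C) (f1 : A * B -> C) :
  FP o -> FP f0 -> FP f1 ->
  FP (fun x => if o x is Some y then f1 (x, y) else f0 x).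
Proof.
move=> ho h0 h1.
pose l x := if o x is Some y then [:: y] else [::].
have hl : FP l by apply: FP_cast ho _ => x; rewrite /l; case: (o x).
apply: (FP_ext (f := fun x => if l x is y :: s then f1 (x, y) else f0 x)); last first.
  by move=> x; rewrite /l; case: (o x).
apply: (FP_case (f1 := fun z : A * (B * seq B) => f1 (z.1, z.2.1))) => //.
by apply: (FP_comp (g := f1)) h1; apply: FP_pair (FP_fst _ _) (FP_comp (FP_snd _ _) (FP_fst _ _)).
Qed.

Lemma FP_succ (A : encType) (n : A -> nat) : FP n -> FP (fun a => (n a).+1).
Proof. by move=> h; apply: FP_cast (FP_pair (FP_const A tt) h) _. Qed.

Lemma FP_units (A : encType) (n : A -> nat) : FP n -> FP (fun a => nseq (n a) tt).
Proof. by move=> h; apply: FP_cast h _ => x; elim: (n x) => //= m; rewrite /enc /= => ->. Qed.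

(** * Conversion of input and output, and the link to machine classes *)

Definition cin_body : cmd :=
  Sq (If o1 (top hd1)
       (Sq (push o0 false) (Sq (push o0 false) (Sq (push o0 true) (push o0 true))))
       (Sq (push o0 false) (push o0 true)))
     (pop o1).
(** The code of a list is built from its last element, so the input is first reversed onto tape 1;
    the single bit [false] is the empty list. *)
Definition cin : cmd := Sq (pour o0 o1) (Sq (push o0 false) (Wh o1 (top ne) cin_body)).

Lemma runs_push0 b s0 s1 s2 s3 s4 :
  runs (push o0 b) (St s0 s1 s2 s3 s4) (St (b :: s0) s1 s2 s3 s4) 3.
Proof. by apply: (runs_eq (runs_push _ _ _)) => //; store_eq. Qed.

Lemma runs_push1 b s0 s1 s2 s3 s4 :
  runs (push o1 b) (St s0 s1 s2 s3 s4) (St s0 (b :: s1) s2 s3 s4) 3.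
Proof. by apply: (runs_eq (runs_push _ _ _)) => //; store_eq. Qed.

Lemma runs_pop0 s0 s1 s2 s3 s4 :
  runs (pop o0) (St s0 s1 s2 s3 s4) (St (behead s0) s1 s2 s3 s4) 1.
Proof. by apply: (runs_eq (runs_pop _ _)) => //; store_eq. Qed.

Lemma runs_pop1 s0 s1 s2 s3 s4 :
  runs (pop o1) (St s0 s1 s2 s3 s4) (St s0 (behead s1) s2 s3 s4) 1.
Proof. by apply: (runs_eq (runs_pop _ _)) => //; store_eq. Qed.

Lemma runs_cin (x : seq bool) :
  runs cin (St x [::] [::] [::] [::]) (VS [:: enc x]) (40 * (size x).+1).
Proof.
have body b s1 (s2 : seq bool) :
    runs cin_body (St (code (enc s2)) (b :: s1) [::] [::] [::])
      (St (code (enc (b :: s2))) s1 [::] [::] [::]) 20.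
  apply: runs_le.
    apply: (runs_seq (st2 := St (code (enc (b :: s2))) (b :: s1) [::] [::] [::]) (T1 := 17)) _
      (runs_pop1 _ _ _ _ _) (leqnn _).
    apply: (runs_if (p := hd1) (T := 16)); rewrite /= ?take0; case: b => /=.
      apply: runs_le.
        apply: runs_seq (runs_push0 _ _ _ _ _ _) _ (leqnn _).
        apply: runs_seq (runs_push0 _ _ _ _ _ _) _ (leqnn _).
        exact: runs_seq (runs_push0 _ _ _ _ _ _) (runs_push0 _ _ _ _ _ _) (leqnn _).
      by [].
    apply: runs_le.
      exact: runs_seq (runs_push0 _ _ _ _ _ _) (runs_push0 _ _ _ _ _ _) (leqnn _).
    by [].
  by [].
have loop s1 (s2 : seq bool) k :
    goes (Wh o1 (top ne) cin_body :: k) (St (code (enc s2)) s1 [::] [::] [::]) k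
      (St (code (enc (rev s1 ++ s2))) [::] [::] [::] [::]) (21 * size s1 + 1).
  elim: s1 s2 => [|b s1 IH] s2; first exact: (goes_while_false (p := ne)).
  rewrite rev_cons cat_rcons; apply: (goes_trans _ (IH (b :: s2)) (T1 := 21)).
    by apply: (goes_while_true (p := ne)).
  by rewrite /=; lia.
apply: runs_le.
  apply: (runs_seq (st2 := St [::] (rev x) [::] [::] [::]) (T1 := 8 * size x + 2)) _ (leqnn _).
    by apply: (runs_eq (@runs_pour o0 o1 (St x [::] [::] [::] [::]) isT)) => //; store_eq; rewrite ?cats0.
  apply: runs_seq (runs_push0 _ _ _ _ _ _) _ (leqnn _).
  apply: (runs_eq (st2' := St (code (enc (rev (rev x) ++ [::]))) [::] [::] [::] [::])).
  - by split=> k; exact: (loop (rev x) [::]).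
  - by [].
  - by rewrite revK cats0 /V /codes /= cats0.
by rewrite size_rev; lia.
Qed.

Definition cout_body : cmd :=
  Sq (pop o0) (If o0 (top hd1)
    (Sq (pop o0) (Sq (pop o0) (Sq (pop o0) (push o1 true))))
    (Sq (pop o0) (push o1 false))).
(** The last tape, where the output is read, is tape 4; pouring onto it undoes the reversal on tape
    1. *)
Definition cout : cmd :=
  Sq (Wh o0 (top hd1) cout_body) (Sq (pop o0) (pour o1 o4)).

Lemma runs_cout (y : seq bool) :
  runs cout (VS [:: enc y]) (St [::] [::] [::] [::] y) (40 * (size y).+1).
Proof.
have body b s1 (s2 : seq bool) :
    runs cout_body (St (code (enc (b :: s2))) s1 [::] [::] [::])
      (St (code (enc s2)) (b :: s1) [::] [::] [::]) 20.
  apply: runs_le.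
    apply: runs_seq (runs_pop0 _ _ _ _ _) _ (leqnn _).
    apply: (runs_if (p := hd1) (T := 16)); rewrite /= ?take0; case: b => /=.
      apply: runs_le.
        apply: runs_seq (runs_pop0 _ _ _ _ _) _ (leqnn _).
        apply: runs_seq (runs_pop0 _ _ _ _ _) _ (leqnn _).
        exact: runs_seq (runs_pop0 _ _ _ _ _) (runs_push1 _ _ _ _ _ _) (leqnn _).
      by [].
    apply: runs_le.
      exact: runs_seq (runs_pop0 _ _ _ _ _) (runs_push1 _ _ _ _ _ _) (leqnn _).
    by [].
  by [].
have loop s1 (s2 : seq bool) k :
    goes (Wh o0 (top hd1) cout_body :: k) (St (code (enc s2)) s1 [::] [::] [::]) k
      (St [:: false] (rev s2 ++ s1) [::] [::] [::]) (21 * size s2 + 1).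
  elim: s2 s1 => [|b s2 IH] s1; first exact: (goes_while_false (p := hd1)).
  rewrite rev_cons cat_rcons; apply: (goes_trans _ (IH (b :: s1)) (T1 := 21)).
    by apply: (goes_while_true (p := hd1)).
  by rewrite /=; lia.
apply: runs_le.
  apply: (runs_seq (st2 := St [:: false] (rev y ++ [::]) [::] [::] [::])
           (T1 := 21 * size y + 1)) _ (leqnn _).
    split=> k; have := loop [::] y k; congr goes; rewrite /V /codes /=.
    by rewrite cats0.
  apply: runs_seq (runs_pop0 _ _ _ _ _) _ (leqnn _).
  apply: (runs_eq (@runs_pour o1 o4 (St [::] (rev y) [::] [::] [::]) isT)) => //.
    by rewrite cats0.
  by store_eq; rewrite revK cats0.
by rewrite /= size_rev; lia.
Qed.

Lemma stack_tape_of (s : seq bool) :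
  stack_tape s (Tape [::] (head None [seq Some (inl b) | b <- s])
                (behead [seq Some (inl b) | b <- s])).
Proof.
split=> //=; case: s => [|b s]; first by exists 1.
by exists 0; rewrite /= cats0.
Qed.

Lemma rep_init c (x : seq bool) : rep (St x [::] [::] [::] [::]) (tm_init (machine c) x).2.
Proof.
move=> i; rewrite /tm_init /=; case: eqP => [->|/eqP i0]; first exact: stack_tape_of.
have -> : St x [::] [::] [::] [::] i = [::] by case: i i0 => -[|[|[|[|[|]]]]].
exact: (stack_tape_of [::]).
Qed.

Lemma machine_run c (x : seq bool) st k T :
  goes [:: c] (St x [::] [::] [::] [::]) k st T ->
  exists2 t, t <= T & ssval (tm_run (machine c) x t).1 = k /\ rep st (tm_run (machine c) x t).2.
Proof.
move=> [/(_ _ (rep_init c x))[t [tp [tT rtp e]]]]; exists t => //.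
by have := machine_iter (tm_init (machine c) x) t; rewrite /= e -/(tm_run _ _ _) => -[-> ->].
Qed.

Lemma leading_bits_rep (M : tm) (y : seq bool) n :
  leading_bits (M := M) ([seq Some (inl b) | b <- y] ++ nseq n None) = y.
Proof. by elim: y => [|b y IH] /=; [case: n|rewrite IH]. Qed.

Lemma leq_exp_mono k a b : a <= b -> a ^ k <= b ^ k.
Proof. by case: k => // k; rewrite leq_exp2r. Qed.

Lemma poly_boundedI (f : nat -> nat) C D :
  (forall n, f n <= C * n.+1 ^ D) -> poly_bounded f.
Proof.
move=> h; exists (C * 2 ^ D), D => n; apply: leq_trans (h n) _.
rewrite -mulnSr -mulnA leq_mul2l; apply/orP; right.
case: n {h} => [|n]; first by rewrite exp1n muln_gt0 expn_gt0.
apply: (@leq_trans (2 ^ D * n.+1 ^ D)); last by rewrite leq_mul2l leqnSn orbT.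
by rewrite -expnMn; apply: leq_exp_mono; lia.
Qed.

Lemma poly_time_FP (g : seq bool -> seq bool) : FP g -> poly_time g.
Proof.
move=> [[T [c h] [k bT]] [k' bg]].
pose f n := 40 * n.+1 + ((6 * n + 5) ^ k + (40 * ((6 * n + 5) ^ k').+1 + 10)).
have sz (x : seq bool) : esz x + 2 <= 6 * size x + 5.
  by elim: x => // b x IH; rewrite esz_cons /=; case: b; rewrite /tsz /= -/(esz x); move: IH; rewrite /tsz /=; lia.
exists (machine (Sq cin (Sq c (Sq cout (Halt true))))), f; split.
  apply: (poly_boundedI (C := 200 * 6 ^ (k + k').+1) (D := (k + k').+1)) => n.
  rewrite -mulnA -expnMn.
  have N j : j <= (k + k').+1 -> (6 * n + 5) ^ j <= (6 * n.+1) ^ (k + k').+1.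
    move=> jk; apply: (@leq_trans ((6 * n.+1) ^ j)); last by rewrite leq_exp2l // mulnS.
    by case: j {jk} => // j; rewrite leq_exp2r //; lia.
  have := N k (leqW (leq_addr _ _)); have := N k' (leqW (leq_addl _ _)); have := N 1 isT; have := N 0 isT.
  by rewrite expn0 expn1 /f; lia.
move=> x.
have [|t tT [kt rt]] := @machine_run (Sq cin (Sq c (Sq cout (Halt true)))) x
   (St [::] [::] [::] [::] (g x)) [:: Halt true] (f (size x)).
  apply: (@goes_le _ _ _ _ (40 * (size x).+1 + (T x + (40 * (size (g x)).+1 + 1).+1).+1).+1).
    apply: (goes_step_l (k2 := [:: cin; Sq c (Sq cout (Halt true))])) => //.
    apply: goes_trans (runs_goes _ (runs_cin x)) _ (leqnn _).
    apply: (goes_step_l (k2 := [:: c; Sq cout (Halt true)])) => //.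
    apply: goes_trans (runs_goes _ (h x [::])) _ (leqnn _).
    apply: (goes_step_l (k2 := [:: cout; Halt true])) => //.
    apply: goes_trans (runs_goes _ (runs_cout (g x))) _ (leqnn _).
    exact: goes_le (goes_refl _ _) _.
  have B1 := leq_trans (bT x) (leq_exp_mono k (sz x)).
  have B2 := leq_trans (size_esz (g x)) (leq_trans (bg x) (leq_exp_mono k' (sz x))).
  by rewrite /f; move: (T x) B1 (size (g x)) B2 => ? ? ? ?; lia.
exists t => //; split; first by rewrite /halted /= kt.
rewrite /tm_output; have [_ [n /= rn]] := rt o4.
have -> : (ord_max : 'I_(tm_ntapes (machine (Sq cin (Sq c (Sq cout (Halt true)))))).+1) = o4.
  exact: val_inj.
exact: etrans (congr1 (@leading_bits (machine _)) rn) (leading_bits_rep _ _ _).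
Qed.

Lemma EXPTIME_runsF (f : seq bool -> bool) T (L : language) k :
  runsF f T -> (forall x, T x <= 2 ^ ((size x).+2 ^ k)) -> (forall x, f x <-> L x) ->
  EXPTIME L.
Proof.
move=> [c h] bT fL.
pose p := Sq cin (Sq c (If o0 (top hd1) (Halt true) (Halt false))).
exists (machine p), (fun n => (n.+2 ^ (k + 4))); split.
  apply: (poly_boundedI (C := 2 ^ (k + 4)) (D := k + 4)) => n.
  by rewrite -expnMn; apply: leq_exp_mono; lia.
move=> x; have [|t tT [kt rt]] := @machine_run p x (VS [:: enc (f x)]) [:: Halt (f x)]
    (2 ^ ((size x).+2 ^ (k + 4))).
  apply: (@goes_le _ _ _ _ (40 * (size x).+1 + (T x + 1).+1).+1).
    apply: (goes_step_l (k2 := [:: cin; Sq c (If o0 (top hd1) (Halt true) (Halt false))])) => //.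
    apply: goes_trans (runs_goes _ (runs_cin x)) _ (leqnn _).
    apply: (goes_step_l (k2 := [:: c; If o0 (top hd1) (Halt true) (Halt false)])) => //.
    apply: goes_trans (runs_goes _ (h x [::])) _ (leqnn _).
    apply: goes_step => tp r; rewrite /cstep /= (rep_top hd1 o0 r) /=.
    by case: (f x).
  have B1 := bT x; have B2 := ltn_expl (size x).+2 (ltnSn 1); move: (T x) B1 => T1 B1.
  have B3 : 6 + (size x).+2 + (size x).+2 ^ k <= (size x).+2 ^ (k + 4).
    rewrite expnD; have : 0 < (size x).+2 ^ k by rewrite expn_gt0.
    have : 8 * (size x).+2 <= (size x).+2 ^ 4.
      by rewrite expnSr leq_mul2r /= -[8]/(2 ^ 3) leq_exp2r.
    by move: (_ ^ 4) (_ ^ k) => u v; nia.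
  apply: leq_trans (_ : 2 ^ (6 + (size x).+2 + (size x).+2 ^ k) <= _); last by rewrite leq_exp2l.
  have : 0 < 2 ^ (size x).+2 ^ k by rewrite expn_gt0.
  by rewrite !expnD; move: (2 ^ _) (2 ^ _) B1 B2 => u v; nia.
exists t => //; split; first by rewrite /halted /= kt.
by rewrite /accepted /= kt; exact: fL.
Qed.

(** * Lists, booleans and unary numbers in polynomial time *)

Lemma FP_foldl_bd (A B C : encType) (l : A -> seq B) (c0 : A -> C) (h : A * B * C -> C)
    (bd : A -> nat) :
  FP l -> FP c0 -> FP h -> pbd bd ->
  (forall x s1 s2, l x = s1 ++ s2 -> esz (foldx c0 h x s1) <= bd x) ->
  FP (fun x => foldx c0 h x (l x)).
Proof.
move=> hl hc hh [k hk] hbd; apply: FP_foldl => //; exists k => x s1 s2 lx.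
exact: leq_trans (hbd _ _ _ lx) (hk x).
Qed.

Lemma FP_pbd (A B : encType) (f : A -> B) : FP f -> pbd (fun x => esz (f x)).
Proof. by case. Qed.

Lemma esz_rev (A : encType) (s : seq A) : esz (rev s) = esz s.
Proof.
by elim: s => // x s IH; rewrite rev_cons -cats1 esz_cat IH !esz_cons esz_nil; lia.
Qed.

Lemma esz_prefix (A : encType) (s1 s2 : seq A) : esz s1 <= esz (s1 ++ s2).
Proof. by rewrite esz_cat; have := tsz_gt0 (enc s2); lia. Qed.

Lemma FP_catrev (A B : encType) (s t : A -> seq B) :
  FP s -> FP t -> FP (fun x => catrev (s x) (t x)).
Proof.
move=> hs ht.
have E x s1 : foldx t (fun z : A * B * seq B => z.1.2 :: z.2) x s1 = catrev s1 (t x).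
  by rewrite /foldx; elim: s1 (t x) => //= y s1 IH t'; rewrite IH.
apply: (FP_ext (f := fun x => foldx t (fun z : A * B * seq B => z.1.2 :: z.2) x (s x))).
  apply: (FP_foldl_bd (bd := fun x => esz (s x) + esz (t x)) (h := fun z : A * B * seq B => z.1.2 :: z.2)) => //.
  - exact: FP_cons (FP_comp (FP_fst _ _) (FP_snd _ _)) (FP_snd _ _).
  - exact: pbd_add (FP_pbd hs) (FP_pbd ht).
  - move=> x s1 s2 sx; rewrite E catrevE esz_cat esz_rev.
    by have := esz_prefix s1 s2; rewrite -sx; lia.
by move=> x; rewrite E.
Qed.

Lemma FP_rev (A B : encType) (s : A -> seq B) : FP s -> FP (fun x => rev (s x)).
Proof. by move=> hs; apply: FP_catrev hs (FP_const _ [::]). Qed.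

Lemma FP_cat (A B : encType) (s t : A -> seq B) :
  FP s -> FP t -> FP (fun x => s x ++ t x).
Proof.
move=> hs ht; apply: FP_ext (FP_catrev (FP_rev hs) ht) _ => x.
by rewrite catrevE revK.
Qed.

Lemma pbd_map (A B C : encType) (l : A -> seq B) (h : A * B -> C) : FP l -> FP h ->
  pbd (fun x => esz [seq h (x, y) | y <- l x]).
Proof.
move=> hl [_ [k hk]].
apply: (pbd_le (g := fun x => esz (l x) * ((esz x + esz (l x) + 3) ^ k).+1 + 1)).
  apply: pbd_add (pbd_const _ _); apply: pbd_mul (FP_pbd hl) _.
  apply: (pbd_le (g := fun x => 1 + (esz x + esz (l x) + 3) ^ k)); last by [].
  apply: pbd_add (pbd_const _ _) _; apply: pbd_exp; apply: pbd_add (pbd_const _ _).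
  exact: pbd_add (pbd_esz _) (FP_pbd hl).
move=> x; rewrite esz_seq big_map addn1 ltnS.
set K := ((esz x + _ + 3) ^ k).+1.
apply: leq_trans (_ : size (l x) * K <= _); last by rewrite leq_mul2r size_esz orbT.
rewrite mulnC -iter_addn_0 -[size _]count_predT -big_const_seq.
have : forall s1 s2, l x = s1 ++ s2 -> \sum_(y <- s2) (esz (h (x, y))).+1 <= \sum_(y <- s2) K.
  move=> s1 s2; elim: s2 s1 => [|y s2 IH] s1 lx; first by rewrite !big_nil.
  rewrite !big_cons; apply: leq_add; last by apply: (IH (rcons s1 y)); rewrite cat_rcons.
  rewrite ltnS; apply: leq_trans (hk _) _; apply: leq_exp_mono.
  by rewrite esz_pair /= lx; have := esz_catr s1 s2 y; lia.
by move=> /(_ [::] (l x) erefl).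
Qed.

Lemma FP_map (A B C : encType) (l : A -> seq B) (h : A * B -> C) : FP l -> FP h ->
  FP (fun x => [seq h (x, y) | y <- l x]).
Proof.
move=> hl hh.
pose g (z : A * B * seq C) := h z.1 :: z.2.
have E x s1 : foldx (fun=> [::]) g x s1 = rev [seq h (x, y) | y <- s1].
  rewrite /foldx -[RHS]cats0 -catrevE; elim: s1 [::] => //= y s1 IH t; exact: IH.
apply: (FP_ext (f := fun x => rev (foldx (fun=> [::]) g x (l x)))); last first.
  by move=> x; rewrite E revK.
apply: FP_rev; apply: (FP_foldl_bd (bd := fun x => esz [seq h (x, y) | y <- l x]) (h := g)) => //.
- exact: FP_const.
- exact: FP_cons (FP_comp (FP_fst _ _) hh) (FP_snd _ _).
- exact: pbd_map.
- by move=> x s1 s2 lx; rewrite E esz_rev lx map_cat esz_prefix.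
Qed.

Lemma FP_flatten (A B : encType) (l : A -> seq (seq B)) :
  FP l -> FP (fun x => flatten (l x)).
Proof.
move=> hl; pose g (z : A * seq B * seq B) := z.2 ++ z.1.2.
have E x s1 : foldx (fun=> [::]) g x s1 = flatten s1.
  rewrite /foldx -[RHS]cat0s; elim: s1 [::] => [|y s1 IH] t /=; first by rewrite cats0.
  by rewrite IH catA.
apply: (FP_ext (f := fun x => foldx (fun=> [::]) g x (l x))); last by move=> x; exact: E.
apply: (FP_foldl_bd (bd := fun x => esz (l x)) (h := g)) => //.
- exact: FP_const.
- exact: FP_cat (FP_snd _ _) (FP_comp (FP_fst _ _) (FP_snd _ _)).
- exact: FP_pbd.
- move=> x s1 s2 lx; rewrite E lx; apply: leq_trans (esz_prefix s1 s2).
  by elim: s1 {lx} => //= y s1 IH; rewrite esz_cat esz_cons; lia.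
Qed.

Lemma FP_negb (A : encType) (b : A -> bool) : FP b -> FP (fun x => ~~ b x).
Proof.
move=> hb; apply: FP_ext (FP_if hb (FP_const _ false) (FP_const _ true)) _ => x.
by case: (b x).
Qed.

Lemma FP_andb (A : encType) (b c : A -> bool) : FP b -> FP c -> FP (fun x => b x && c x).
Proof.
move=> hb hc; apply: FP_ext (FP_if hb hc (FP_const _ false)) _ => x.
by case: (b x).
Qed.

Lemma FP_orb (A : encType) (b c : A -> bool) : FP b -> FP c -> FP (fun x => b x || c x).
Proof.
move=> hb hc; apply: FP_ext (FP_if hb (FP_const _ true) hc) _ => x.
by case: (b x).
Qed.

Lemma FP_filter (A B : encType) (l : A -> seq B) (p : A * B -> bool) : FP l -> FP p ->
  FP (fun x => [seq y <- l x | p (x, y)]).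
Proof.
move=> hl hp.
apply: FP_ext (FP_flatten (FP_map hl (FP_if hp (FP_cons (FP_snd _ _) (FP_const _ [::])) (FP_const _ [::])))) _ => x /=.
by elim: (l x) => //= y s ->; case: (p _).
Qed.

Lemma FP_has (A B : encType) (l : A -> seq B) (p : A * B -> bool) : FP l -> FP p ->
  FP (fun x => has (fun y => p (x, y)) (l x)).
Proof.
move=> hl hp.
apply: FP_ext (FP_case (FP_filter hl hp) (FP_const _ false) (FP_const _ true)) _ => x /=.
by elim: (l x) => //= y s; case: (p _).
Qed.

Lemma FP_all (A B : encType) (l : A -> seq B) (p : A * B -> bool) : FP l -> FP p ->
  FP (fun x => all (fun y => p (x, y)) (l x)).
Proof.
move=> hl hp; apply: FP_ext (FP_negb (FP_has hl (FP_negb hp))) _ => x.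
by rewrite -all_predC; apply: eq_all => y /=; rewrite negbK.
Qed.

Lemma FP_size (A B : encType) (l : A -> seq B) : FP l -> FP (fun x => size (l x)).
Proof.
move=> hl; apply: FP_cast (FP_map hl (FP_const _ tt)) _ => x.
by elim: (l x) => // y s IH; rewrite /enc /= [enc_list _]IH.
Qed.

Lemma FP_add (A : encType) (m n : A -> nat) : FP m -> FP n -> FP (fun x => m x + n x).
Proof.
move=> hm hn; apply: FP_ext (FP_size (FP_cat (FP_units hm) (FP_units hn))) _ => x.
by rewrite size_cat !size_nseq.
Qed.

Lemma FP_mul (A : encType) (m n : A -> nat) : FP m -> FP n -> FP (fun x => m x * n x).
Proof.
move=> hm hn.
apply: FP_ext (FP_size (FP_flatten (FP_map (FP_units hm)
  (FP_units (FP_comp (FP_fst _ _) hn))))) _ => x /=.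
by elim: (m x) => //= k IH; rewrite size_cat size_nseq IH mulSn.
Qed.

Lemma FP_nat_case (A B : encType) (n : A -> nat) (f0 : A -> B) (f1 : A * nat -> B) :
  FP n -> FP f0 -> FP f1 -> FP (fun x => if n x is m.+1 then f1 (x, m) else f0 x).
Proof.
move=> hn h0 h1.
have h : FP (fun z : A * (unit * seq unit) => f1 (z.1, size z.2.2)).
  apply: (FP_comp (g := f1)) h1; apply: FP_pair (FP_fst _ _) _.
  exact: FP_size (FP_comp (FP_snd _ _) (FP_snd _ _)).
apply: FP_ext (FP_case (FP_units hn) h0 h) _ => x.
by case: (n x) => //= m; rewrite size_nseq.
Qed.

Lemma FP_pred (A : encType) (n : A -> nat) : FP n -> FP (fun x => (n x).-1).
Proof.
move=> hn; apply: FP_ext (FP_nat_case hn (FP_const _ 0) (FP_snd _ _)) _ => x.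
by case: (n x).
Qed.

Lemma FP_behead (A B : encType) (s : A -> seq B) : FP s -> FP (fun x => behead (s x)).
Proof.
move=> hs; apply: FP_ext (FP_case hs (FP_const _ [::]) (FP_comp (FP_snd _ _) (FP_snd _ _))) _ => x.
by case: (s x).
Qed.

Lemma FP_head (A B : encType) (d : A -> B) (s : A -> seq B) : FP d -> FP s ->
  FP (fun x => head (d x) (s x)).
Proof.
move=> hd hs; apply: FP_ext (FP_case hs hd (FP_comp (FP_snd _ _) (FP_fst _ _))) _ => x.
by case: (s x).
Qed.

Lemma FP_drop (A B : encType) (n : A -> nat) (s : A -> seq B) : FP n -> FP s ->
  FP (fun x => drop (n x) (s x)).
Proof.
move=> hn hs; pose g (z : A * unit * seq B) := behead z.2.
have E x u : foldx s g x u = drop (size u) (s x).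
  rewrite /foldx; elim: u (s x) => [|v u IH] t; first by rewrite drop0.
  by rewrite /= IH; case: t.
apply: (FP_ext (f := fun x => foldx s g x (nseq (n x) tt))); last first.
  by move=> x; rewrite E size_nseq.
apply: (FP_foldl_bd (bd := fun x => esz (s x)) (h := g)) => //.
- exact: FP_units.
- exact: FP_behead (FP_snd _ _).
- exact: FP_pbd.
- move=> x s1 s2 _; rewrite E -{2}(cat_take_drop (size s1) (s x)) esz_cat.
  by have := tsz_gt0 (enc (take (size s1) (s x))); lia.
Qed.

Lemma FP_nth (A B : encType) (d : A -> B) (s : A -> seq B) (n : A -> nat) :
  FP d -> FP s -> FP n -> FP (fun x => nth (d x) (s x) (n x)).
Proof.
move=> hd hs hn; apply: FP_ext (FP_head hd (FP_drop hn hs)) _ => x.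
by rewrite -nth0 nth_drop addn0.
Qed.

Lemma FP_sub (A : encType) (m n : A -> nat) : FP m -> FP n -> FP (fun x => m x - n x).
Proof.
move=> hm hn; apply: FP_ext (FP_size (FP_drop hn (FP_units hm))) _ => x.
by rewrite size_drop size_nseq.
Qed.

Lemma FP_leq (A : encType) (m n : A -> nat) : FP m -> FP n -> FP (fun x => m x <= n x).
Proof.
move=> hm hn; apply: FP_ext (FP_nat_case (FP_sub hm hn) (FP_const _ true) (FP_const _ false)) _ => x.
by rewrite /leq; case: (m x - n x).
Qed.

Lemma FP_eqn (A : encType) (m n : A -> nat) : FP m -> FP n -> FP (fun x => m x == n x).
Proof.
move=> hm hn; apply: FP_ext (FP_andb (FP_leq hm hn) (FP_leq hn hm)) _ => x.
by rewrite eqn_leq.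
Qed.

Lemma FP_iota (A : encType) (m n : A -> nat) : FP m -> FP n -> FP (fun x => iota (m x) (n x)).
Proof.
move=> hm hn; pose g (z : A * unit * seq nat) := z.2 ++ [:: m z.1.1 + size z.2].
have E x u : foldx (fun=> [::]) g x u = iota (m x) (size u).
  rewrite /foldx -[RHS](cat0s (iota _ _)) -{1}[m x]addn0 -[0]/(size (@nil nat)).
  elim: u [::] => [|v u IH] t; first by rewrite cats0.
  by rewrite [LHS]/= IH {2}/g /= size_cat /= -catA addnA addn1.
apply: (FP_ext (f := fun x => foldx (fun=> [::]) g x (nseq (n x) tt))); last first.
  by move=> x; rewrite E size_nseq.
apply: (FP_foldl_bd (bd := fun x => (n x).+1 * (2 * (m x + n x) + 4)) (h := g)) => //.
- exact: FP_units.
- exact: FP_const.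
- apply: FP_cat (FP_snd _ _) (FP_cons (FP_add _ (FP_size (FP_snd _ _))) (FP_const _ [::])).
  exact: FP_comp (FP_comp (FP_fst _ _) (FP_fst _ _)) hm.
- have pn (k : A -> nat) : FP k -> pbd k.
    by move=> hk; apply: pbd_le (FP_pbd hk) _ => x; rewrite esz_nat; lia.
  apply: pbd_mul; first by apply: (pbd_le (pbd_add (pbd_const _ 1) (pn _ hn))) => x.
  apply: pbd_add (pbd_const _ _); apply: pbd_mul (pbd_const _ _) _.
  exact: pbd_add (pn _ hm) (pn _ hn).
- move=> x s1 s2 sx; rewrite E esz_seq.
  have s1n : size s1 <= n x by rewrite -(size_nseq (n x) tt) sx size_cat leq_addr.
  apply: (@leq_ltn_trans (\sum_(y <- iota (m x) (size s1)) (2 * (m x + n x) + 2))).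
    rewrite big_seq [leqRHS]big_seq; apply: leq_sum => y; rewrite mem_iota esz_nat; lia.
  rewrite big_const_seq count_predT size_iota iter_addn_0; nia.
Qed.

Lemma FP_eqb (A : encType) (b c : A -> bool) : FP b -> FP c -> FP (fun x => b x == c x).
Proof.
move=> hb hc; apply: FP_ext (FP_if hb hc (FP_negb hc)) _ => x.
by case: (b x); case: (c x).
Qed.

(** Equality of lists as a left fold over [s] that consumes [t] and carries a flag, because folds
    are the available form of recursion. *)
Definition eqs (B : Type) (e : B * B -> bool) (s t : seq B) : bool :=
  let z := foldl (fun c y => if c.2 is y' :: t' then (c.1 && e (y, y'), t') else (false, [::]))
             (true, t) s in
  z.1 && nilp z.2.

Lemma eqsE (T : eqType) (e : T * T -> bool) s t :
  (forall x y, e (x, y) = (x == y)) -> eqs e s t = (s == t).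
Proof.
move=> eE; rewrite /eqs.
have E b : (foldl (fun c y => if c.2 is y' :: t' then (c.1 && e (y, y'), t') else (false, [::]))
    (b, t) s).1 && nilp (foldl (fun c y => if c.2 is y' :: t' then (c.1 && e (y, y'), t') else (false, [::]))
    (b, t) s).2 = b && (s == t).
  elim: s b t => [|x s IH] b [|y t].
  - by [].
  - by rewrite /= !andbF.
  - by rewrite [LHS]IH andbF.
  - by rewrite [LHS]IH eE eqseq_cons andbA.
exact: E.
Qed.

Lemma FP_eqs (A B : encType) (e : B * B -> bool) (s t : A -> seq B) :
  FP e -> FP s -> FP t -> FP (fun x => eqs e (s x) (t x)).
Proof.
move=> he hs ht.
pose g (z : A * B * (bool * seq B)) := if z.2.2 is y' :: t'
  then (z.2.1 && e (z.1.2, y'), t') else (false, [::]).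
suff h : FP (fun x => foldx (fun x => (true, t x)) g x (s x)).
  apply: (FP_ext (f := fun x => (foldx (fun x => (true, t x)) g x (s x)).1 &&
    if (foldx (fun x => (true, t x)) g x (s x)).2 is _ :: _ then false else true)) => [|x].
    apply: FP_andb; first exact: FP_comp h (FP_fst _ _).
    exact: FP_case (FP_comp h (FP_snd _ _)) (FP_const _ true) (FP_const _ false).
  by rewrite /eqs /foldx /g /=; case: (foldl _ _ _) => [? []].
apply: (FP_foldl_bd (bd := fun x => esz (t x) + 10)) => //.
- exact: FP_pair (FP_const _ true) ht.
- apply: (FP_case (l := fun z : A * B * (bool * seq B) => z.2.2)
    (f1 := fun u : (A * B * (bool * seq B)) * (B * seq B) =>
      (u.1.2.1 && e (u.1.1.2, u.2.1), u.2.2))).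
  + exact: FP_comp (FP_snd _ _) (FP_snd _ _).
  + exact: FP_const.
  + apply: FP_pair; last exact: FP_comp (FP_snd _ _) (FP_snd _ _).
    apply: FP_andb.
      exact: FP_comp (FP_comp (FP_fst _ _) (FP_snd _ _)) (FP_fst _ _).
    apply: (FP_comp (g := e)) he; apply: FP_pair.
      exact: FP_comp (FP_comp (FP_fst _ _) (FP_fst _ _)) (FP_snd _ _).
    exact: FP_comp (FP_snd _ _) (FP_fst _ _).
- exact: pbd_add (FP_pbd ht) (pbd_const _ _).
move=> x s1 s2 _; rewrite /foldx; elim: s1 true (t x) => [|y s1 IH] b u /=.
  by rewrite esz_pair /=; case: b; rewrite /tsz /=; lia.
case: u => [|y' u]; rewrite /g /=.
  exact: IH.
by apply: leq_trans (IH _ _) _; rewrite esz_cons; lia.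
Qed.

Import GRing.Theory.

Section compositional.
Context (A : encType).

Lemma FP_fst_of (B C : encType) (f : A -> B * C) : FP f -> FP (fun x => (f x).1).
Proof. by move=> h; apply: FP_comp h (FP_fst _ _). Qed.

Lemma FP_snd_of (B C : encType) (f : A -> B * C) : FP f -> FP (fun x => (f x).2).
Proof. by move=> h; apply: FP_comp h (FP_snd _ _). Qed.

Lemma FP_map2 (B C : encType) (h : A -> B -> C) (l : A -> seq B) :
  FP l -> FP (fun z : A * B => h z.1 z.2) -> FP (fun x => map (h x) (l x)).
Proof. by move=> hl hh; apply: FP_map hl hh. Qed.

Lemma FP_filter2 (B : encType) (h : A -> B -> bool) (l : A -> seq B) :
  FP l -> FP (fun z : A * B => h z.1 z.2) -> FP (fun x => [seq y <- l x | h x y]).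
Proof. by move=> hl hh; apply: FP_filter hl hh. Qed.

Lemma FP_has2 (B : encType) (h : A -> B -> bool) (l : A -> seq B) :
  FP l -> FP (fun z : A * B => h z.1 z.2) -> FP (fun x => has (fun y => h x y) (l x)).
Proof. by move=> hl hh; apply: FP_has hl hh. Qed.

Lemma FP_all2 (B : encType) (h : A -> B -> bool) (l : A -> seq B) :
  FP l -> FP (fun z : A * B => h z.1 z.2) -> FP (fun x => all (fun y => h x y) (l x)).
Proof. by move=> hl hh; apply: FP_all hl hh. Qed.

Lemma FP_comp2 (B C D : encType) (g : B -> C -> D) (f1 : A -> B) (f2 : A -> C) :
  FP (fun z : B * C => g z.1 z.2) -> FP f1 -> FP f2 -> FP (fun x => g (f1 x) (f2 x)).
Proof. by move=> hg h1 h2; apply: (FP_comp (g := fun z : B * C => g z.1 z.2) (FP_pair h1 h2) hg). Qed.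

Lemma FP_rcons (B : encType) (s : A -> seq B) (b : A -> B) :
  FP s -> FP b -> FP (fun x => rcons (s x) (b x)).
Proof.
move=> hs hb; apply: FP_ext (FP_cat hs (FP_cons hb (FP_const _ [::]))) _ => x.
by rewrite cats1.
Qed.

Lemma FP_ltn (m n : A -> nat) : FP m -> FP n -> FP (fun x => m x < n x).
Proof. by move=> hm hn; apply: FP_leq (FP_succ hm) hn. Qed.

(** Numbers are unary, so counting all [k] with [k * n <= m] is affordable. *)
Lemma FP_divn (m n : A -> nat) : FP m -> FP n -> FP (fun x => m x %/ n x).
Proof.
move=> hm hn.
apply: (FP_ext (f := fun x => if n x == 0 then 0 else
  size [seq k <- iota 1 (m x) | k * n x <= m x])) => [|x].
  apply: FP_if (FP_eqn hn (FP_const _ 0)) (FP_const _ 0) _.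
  apply: FP_size; apply: (FP_filter2 (h := fun x k => k * n x <= m x)).
    exact: FP_iota (FP_const _ 1) hm.
  apply: FP_leq (FP_mul (FP_snd _ _) (FP_comp (FP_fst _ _) hn)) (FP_comp (FP_fst _ _) hm).
case: eqP => [->|/eqP]; rewrite ?divn0 // -lt0n => n0.
rewrite size_filter (eq_in_count (a2 := fun k => k < (m x %/ n x).+1)).
  have le : m x %/ n x <= m x by exact: leq_div.
  rewrite -[in iota _ _](subnKC le) iotaD count_cat (eq_in_count (a2 := xpredT)) ?count_predT ?size_iota.
    rewrite (eq_in_count (a2 := pred0)) ?count_pred0 ?addn0 // => k.
    by rewrite mem_iota => /andP[a _]; apply/negbTE; rewrite -leqNgt -add1n.
  by move=> k; rewrite mem_iota add1n => /andP[_ ->].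
by move=> k _; rewrite ltnS leq_divRL.
Qed.

Lemma FP_modn (m n : A -> nat) : FP m -> FP n -> FP (fun x => m x %% n x).
Proof.
move=> hm hn; apply: FP_ext (FP_sub hm (FP_mul (FP_divn hm hn) hn)) _ => x.
by rewrite {1}(divn_eq (m x) (n x)) addKn.
Qed.

Lemma FP_dvdn (m n : A -> nat) : FP m -> FP n -> FP (fun x => m x %| n x).
Proof. by move=> hm hn; apply: FP_eqn (FP_modn hn hm) (FP_const _ 0). Qed.

Lemma FP_minn (m n : A -> nat) : FP m -> FP n -> FP (fun x => minn (m x) (n x)).
Proof. by move=> hm hn; apply: FP_if (FP_ltn hm hn) hm hn. Qed.

Lemma FP_nat_of_bool (b : A -> bool) : FP b -> FP (fun x => nat_of_bool (b x)).
Proof.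
move=> hb; apply: FP_ext (FP_if hb (FP_const _ 1) (FP_const _ 0)) _ => x.
by case: (b x).
Qed.

Lemma FP_expn (m : A -> nat) k : FP m -> FP (fun x => m x ^ k).
Proof.
move=> hm; elim: k => [|k IH]; first exact: FP_const.
by apply: FP_ext (FP_mul hm IH) _ => x; rewrite expnS.
Qed.

End compositional.

(** * Syntax-directed proofs of polynomial time *)

Ltac fp_ext := fail.

Ltac fp_core :=
  match goal with
  | |- FP (fun x => x) => exact: FP_id
  | |- FP (fun _ => ?c) => exact: FP_const
  | _ => assumption
  | |- FP fst => exact: FP_fst
  | |- FP snd => exact: FP_snd
  | |- FP (fun x => addn (@?m x) (@?n x)) => apply: (FP_add (m := m) (n := n))
  | |- FP (fun x => muln (@?m x) (@?n x)) => apply: (FP_mul (m := m) (n := n))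
  | |- FP (fun x => subn (@?m x) (@?n x)) => apply: (FP_sub (m := m) (n := n))
  | |- FP (fun x => minn (@?m x) (@?n x)) => apply: (FP_minn (m := m) (n := n))
  | |- FP (fun x => divn (@?m x) (@?n x)) => apply: (FP_divn (m := m) (n := n))
  | |- FP (fun x => modn (@?m x) (@?n x)) => apply: (FP_modn (m := m) (n := n))
  | |- FP (fun x => dvdn (@?m x) (@?n x)) => apply: (FP_dvdn (m := m) (n := n))
  | |- FP (fun x => expn (@?m x) ?k) => apply: (FP_expn k (m := m))
  | |- FP (fun x => S (@?n x)) => apply: (FP_succ (n := n))
  | |- FP (fun x => predn (@?n x)) => apply: (FP_pred (n := n))
  | |- FP (fun x => leq (S (@?m x)) (@?n x)) => apply: (FP_ltn (m := m) (n := n))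
  | |- FP (fun x => leq (@?m x) (@?n x)) => apply: (FP_leq (m := m) (n := n))
  | |- FP (fun x => @eq_op _ (@?m x) (@?n x)) => first [apply: (FP_eqn (m := m) (n := n)) | apply: (FP_eqb (b := m) (c := n))]
  | |- FP (fun x => nat_of_bool (@?b x)) => apply: (FP_nat_of_bool (b := b))
  | |- FP (fun x => andb (@?m x) (@?n x)) => apply: (FP_andb (b := m) (c := n))
  | |- FP (fun x => orb (@?m x) (@?n x)) => apply: (FP_orb (b := m) (c := n))
  | |- FP (fun x => negb (@?m x)) => apply: (FP_negb (b := m))
  | |- FP (fun x => fst (@?f x)) => apply: (FP_fst_of (f := f))
  | |- FP (fun x => snd (@?f x)) => apply: (FP_snd_of (f := f))
  | |- FP (fun x => pair (@?f x) (@?g x)) => apply: (FP_pair (f := f) (g := g))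
  | |- FP (fun x => cons (@?f x) (@?g x)) => apply: (FP_cons (x := f) (s := g))
  | |- FP (fun x => rcons (@?f x) (@?g x)) => apply: (FP_rcons (s := f) (b := g))
  | |- FP (fun x => cat (@?f x) (@?g x)) => apply: (FP_cat (s := f) (t := g))
  | |- FP (fun x => flatten (@?f x)) => apply: (FP_flatten (l := f))
  | |- FP (fun x => rev (@?f x)) => apply: (FP_rev (s := f))
  | |- FP (fun x => size (@?f x)) => apply: (FP_size (l := f))
  | |- FP (fun x => iota (@?f x) (@?g x)) => apply: (FP_iota (m := f) (n := g))
  | |- FP (fun x => nth (@?d x) (@?s x) (@?n x)) => apply: (FP_nth (d := d) (s := s) (n := n))
  | |- FP (fun x => map (@?h x) (@?l x)) => apply: (FP_map2 (h := h) (l := l)); cbv beta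
  | |- FP (fun x => filter (@?h x) (@?l x)) => apply: (FP_filter2 (h := h) (l := l)); cbv beta
  | |- FP (fun x => has (@?h x) (@?l x)) => apply: (FP_has2 (h := h) (l := l)); cbv beta
  | |- FP (fun x => all (@?h x) (@?l x)) => apply: (FP_all2 (h := h) (l := l)); cbv beta
  | |- FP (fun x => Some (@?f x)) => apply: (FP_Some (x := f))
  | |- FP (fun x => if _ then _ else _) => apply: FP_if
  | H : FP ?h |- FP (fun x => ?h (@?f x)) => apply: (FP_comp (f := f) (g := h) _ H)
  end.
Ltac fp := repeat first [fp_core | fp_ext].

Section FP_encoding.
Context (A : encType).

Lemma FP_bits (n : A -> nat) : FP n -> FP (fun x => bits (n x)).
Proof.
move=> hn; pose g (z : A * unit * (nat * seq bool)) :=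
  if z.2.1 == 0 then z.2 else (z.2.1 %/ 2, rcons z.2.2 (z.2.1 %% 2 == 1)).
pose c0 x := (n x, [::] : seq bool); pose l x := nseq (n x) tt.
(* The bits produced so far followed by those of the remaining number are the result; rounds after
   the number has reached 0 leave the state unchanged. *)
have inv x (u : seq unit) k c : c.1 <= k -> size u <= k ->
    c.2 ++ bits_rec k c.1 = bits (n x) ->
  let c' := foldl (fun c b => g (x, b, c)) c u in
    c'.2 ++ bits_rec (k - size u) c'.1 = bits (n x) /\ c'.1 <= k - size u.
  elim: u k c => [|[] u IH] [|k] //= [m s] /= mk uk E; rewrite ?subn0 //.
  rewrite subSS; apply: IH => //; rewrite /g /=; case: m mk E => [|m] //= mk E.
  - by rewrite divn2; lia.
  - by rewrite -E; case: (k).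
  - by rewrite cat_rcons -E divn2 /= modn2 eqb1.
have bnd x (u : seq unit) : (foldx c0 g x u).1 <= n x /\ size (foldx c0 g x u).2 <= size u.
  elim/last_ind: u => [|u [] [IH1 IH2]] //; rewrite /foldx foldl_rcons -/(foldx c0 g x u).
  rewrite /g /= size_rcons; case: eqP => _ /=; first by split => //; apply: leqW.
  by rewrite size_rcons; split => //; apply: leq_trans (leq_div _ _) IH1.
have esb (b : bool) : esz b <= 3 by case: b.
apply: (FP_ext (f := fun x => (foldx c0 g x (l x)).2)) => [|x]; last first.
  have [] := inv x (l x) (n x) (c0 x) (leqnn _); rewrite ?size_nseq // subnn.
  by rewrite cats0.
apply: (FP_snd_of (f := fun x => foldx c0 g x (l x))); apply: (FP_foldl_bd (bd := fun x => 8 * n x + 4)).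
- exact: FP_units.
- rewrite /c0; fp.
- rewrite /g; fp.
- apply: pbd_add (pbd_const _ 4); apply: pbd_mul (pbd_const _ 8) _.
  by apply: (pbd_le (g := fun x => esz (n x))) => [|x]; [case: hn|rewrite esz_nat; lia].
move=> x s1 s2 lx; have [b1 b2] := bnd x s1.
have: size s1 <= n x by rewrite -(size_nseq (n x) tt) -/(l x) lx size_cat leq_addr.
case: (foldx c0 g x s1) b1 b2 => m s /= b1 b2 b3; rewrite esz_pair esz_nat /=.
suff: esz s <= 4 * size s + 1.
  move: (esz s) (size s) (size s1) b2 b3 => u v w; move: (n x) (m : nat) b1 => a b; lia.
elim: (s) => [|b t IH] //; rewrite esz_cons.
have H u v w : u <= 3 -> v <= 4 * w + 1 -> (u + v).+1 <= 4 * w.+1 + 1 by lia.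
exact: H (esb b) IH.
Qed.

Lemma FP_encode_nat (n : A -> nat) : FP n -> FP (fun x => encode_nat (n x)).
Proof.
move=> hn; apply: FP_rcons (FP_const _ false); apply: FP_flatten.
apply: (FP_map2 (h := fun _ b => [:: true; b])) (FP_bits hn) _.
exact: FP_cons (FP_const _ true) (FP_cons (FP_snd _ _) (FP_const _ [::])).
Qed.

End FP_encoding.

Ltac fp_ext ::=
  match goal with
  | |- FP (fun x => bits (@?f x)) => apply: (FP_bits (n := f))
  | |- FP (fun x => encode_nat (@?f x)) => apply: (FP_encode_nat (n := f))
  end.

(** A finite table: each constant [a] may have its own program, with no uniformity in [a], because
    only the values up to [N] are distinguished. *)
Lemma FP_cases (A C : encType) N (h : nat -> A -> C) (m : A -> nat) :
  FP m -> (forall a, FP (h a)) -> (forall a x, N <= a -> h a x = h N x) ->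
  FP (fun x => h (m x) x).
Proof.
move=> hm hh hN; pose g := fix g k x := if k is k'.+1 then
  (if m x == k' then h k' x else g k' x) else h N x.
have FPg k : FP (g k).
  elim: k => [|k IH]; first exact: hh.
  by apply: FP_if => //; apply: FP_eqn => //; exact: FP_const.
apply: FP_ext (FPg N) _ => x.
have E k : k <= N -> g k x = if m x < k then h (m x) x else h N x.
  elim: k => //= k IH kN; rewrite IH ?(ltnW kN) // ltnS; case: ltngtP => // -> //.
by rewrite E //; case: ltnP => // /hN ->.
Qed.

(** * Binary integers *)

(** Binary numbers are bit lists, least significant bit first, possibly with leading zeros;
    an integer is a pair of them, standing for their difference. *)
Definition bval (u : seq bool) : nat := foldr (fun (b : bool) m => b + m.*2) 0 u.

Definition badd_step (u v : seq bool) (st : bool * seq bool) (i : nat) : bool * seq bool :=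
  let a := nth false u i in let b := nth false v i in let c := st.1 in
  ((a && b) || (c && (a || b)), ((a != b) != c) :: st.2).
Definition badd (u v : seq bool) : seq bool :=
  let st := foldl (badd_step u v) (false, [::]) (iota 0 (size u + size v)) in
  rcons (rev st.2) st.1.
Definition bmul (u v : seq bool) : seq bool :=
  foldl (fun acc b => badd (false :: acc) (if b then v else [::])) [::] (rev u).
(** The scan starts at the least significant bit, so the last difference met decides. *)
Definition bltn (u v : seq bool) : bool :=
  foldl (fun r i => if nth false u i == nth false v i then r else nth false v i) false
    (iota 0 (size u + size v)).

Definition zz : Type := (seq bool * seq bool)%type.
Definition zval (x : zz) : int := ((bval x.1)%:Z - (bval x.2)%:Z)%R.
(** Unlike the absolute value of [zval x], which may be small by cancellation, this is exactly
    additive and multiplicative under [zadd] and [zmul], and it bounds both components. *)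
Definition znorm (x : zz) : nat := bval x.1 + bval x.2.
Definition z0 : zz := ([::], [::]).
Definition zadd (x y : zz) : zz := (badd x.1 y.1, badd x.2 y.2).
Definition zopp (x : zz) : zz := (x.2, x.1).
Definition zmul (x y : zz) : zz :=
  (badd (bmul x.1 y.1) (bmul x.2 y.2), badd (bmul x.1 y.2) (bmul x.2 y.1)).
Definition zlt (x y : zz) : bool := bltn (badd x.1 y.2) (badd y.1 x.2).
Definition znat (n : nat) : zz := (bits n, [::]).
Definition zpow2 (n : nat) : zz := (rcons (nseq n false) true, [::]).
(** [badd] adds the lengths of its arguments even if the values are small, so long computations have
    to cut leading zeros; nothing is lost while [znorm x < 2 ^ B]. *)
Definition ztrim (B : nat) (x : zz) : zz := (take B x.1, take B x.2).
Definition zsum (l : seq zz) : zz := foldl zadd z0 l.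

Lemma bval_cons b u : bval (b :: u) = b + (bval u).*2. Proof. by []. Qed.

Lemma bval_cat u v : bval (u ++ v) = bval u + 2 ^ size u * bval v.
Proof.
by elim: u => [|b u IH] /=; rewrite ?mul1n // IH expnS doubleD -!mul2n mulnA addnA.
Qed.

Lemma bval_lt u : bval u < 2 ^ size u.
Proof. by elim: u => //= b u IH; rewrite expnS; case: b => /=; lia. Qed.

Lemma bval_take B u : bval (take B u) = bval u %% 2 ^ B.
Proof.
have [Bu|uB] := leqP (size u) B.
  by rewrite take_oversize // modn_small // (leq_trans (bval_lt u)) // leq_exp2l.
rewrite -{2}(cat_take_drop B u) bval_cat size_takel ?(ltnW uB) // mulnC addnC modnMDl modn_small //.
by have := bval_lt (take B u); rewrite size_takel // ltnW.
Qed.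

Lemma bval_bits n : bval (bits n) = n. Proof. exact: bits_recK. Qed.

Lemma bval_pow2 n : bval (rcons (nseq n false) true) = 2 ^ n.
Proof.
rewrite -cats1 bval_cat size_nseq muln1 (_ : bval (nseq n false) = 0) //.
by elim: n => //= n ->.
Qed.

Lemma bval_nth u n : bval (take n.+1 u) = bval (take n u) + 2 ^ n * nth false u n.
Proof.
have [un|nu] := leqP (size u) n.
  by rewrite nth_default // muln0 addn0 !take_oversize // leqW.
by rewrite (take_nth false nu) -cats1 bval_cat size_takel ?(ltnW nu) //= addn0.
Qed.

Lemma baddE u v : bval (badd u v) = bval u + bval v.
Proof.
(* After [n] positions the carry has weight [2 ^ n]. *)
have inv n : let st := foldl (badd_step u v) (false, [::]) (iota 0 n) in
    size st.2 = n /\ bval (rev st.2) + 2 ^ n * st.1 = bval (take n u) + bval (take n v).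
  elim: n => [|n [IH1 IH2]]; first by rewrite !take0.
  rewrite -addn1 iotaD foldl_cat add0n /= addn1; move: IH1 IH2.
  case: (foldl _ _ _) => c s /= sz IH2; split; first by rewrite sz.
  rewrite rev_cons -cats1 bval_cat size_rev sz !bval_nth expnS /= addn0.
  move: (bval (rev s)) (bval (take n u)) (bval (take n v)) (2 ^ n) IH2 => a b e w.
  by case: (nth false u n); case: (nth false v n); case: (c) => /=; lia.
have [sz] := inv (size u + size v); rewrite /badd; case: (foldl _ _ _) sz => c s /= sz.
rewrite -cats1 bval_cat size_rev sz /= addn0 => ->.
by rewrite !take_oversize // ?leq_addl ?leq_addr.
Qed.

Lemma bmulE u v : bval (bmul u v) = bval u * bval v.
Proof.
rewrite /bmul -(revK u); elim/last_ind: (rev u) => [|w b IH]; first by [].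
rewrite revK foldl_rcons baddE bval_cons rev_rcons bval_cons -[w in foldl _ _ w]revK IH.
by case: b => /=; rewrite ?mulnDl ?mul1n; lia.
Qed.

Lemma bltnE u v : bltn u v = (bval u < bval v).
Proof.
have inv n : foldl (fun r i => if nth false u i == nth false v i then r else nth false v i) false
    (iota 0 n) = (bval (take n u) < bval (take n v)).
  elim: n => [|n IH]; first by rewrite !take0.
  rewrite -addn1 iotaD foldl_cat add0n /= addn1 {}IH !bval_nth.
  have lt (w : seq bool) : bval (take n w) < 2 ^ n.
    by apply: leq_trans (bval_lt _) _; rewrite leq_exp2l // size_take_min geq_minl.
  have := lt u; have := lt v; move: (bval (take n u)) (bval (take n v)) (2 ^ n) => a b w.
  by case: (nth false u n); case: (nth false v n) => /=; lia.
by rewrite /bltn inv !take_oversize // ?leq_addl ?leq_addr.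
Qed.

Lemma zval_add x y : zval (zadd x y) = (zval x + zval y)%R.
Proof. by rewrite /zval !baddE !PoszD; lia. Qed.
Lemma zval_opp x : zval (zopp x) = (- zval x)%R.
Proof. by rewrite /zval /zopp /= opprB. Qed.
Lemma zval_mul x y : zval (zmul x y) = (zval x * zval y)%R.
Proof. by rewrite /zval !baddE !bmulE !PoszD !PoszM; ring. Qed.
Lemma zltE x y : zlt x y = (zval x < zval y)%R.
Proof. by rewrite /zlt bltnE !baddE /zval; lia. Qed.
Lemma zval_nat n : zval (znat n) = Posz n.
Proof. by rewrite /zval /= bval_bits subr0. Qed.
Lemma zval_pow2 n : zval (zpow2 n) = Posz (2 ^ n).
Proof. by rewrite /zval /= bval_pow2 subr0. Qed.
Lemma zval_trim B x : znorm x < 2 ^ B -> zval (ztrim B x) = zval x.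
Proof.
by move=> h; rewrite /zval /ztrim /= !bval_take !modn_small //; move: h; rewrite /znorm; lia.
Qed.
Lemma znorm_trim B x : znorm (ztrim B x) <= znorm x.
Proof. by rewrite /znorm /ztrim /= !bval_take leq_add ?leq_mod. Qed.
Lemma znorm_add x y : znorm (zadd x y) = znorm x + znorm y.
Proof. by rewrite /znorm !baddE; lia. Qed.
Lemma znorm_mul x y : znorm (zmul x y) = znorm x * znorm y.
Proof. by rewrite /znorm !baddE !bmulE; nia. Qed.
Lemma znorm_opp x : znorm (zopp x) = znorm x. Proof. exact: addnC. Qed.
Lemma znorm_nat n : znorm (znat n) = n. Proof. by rewrite /znorm /= bval_bits addn0. Qed.
Lemma znorm_pow2 n : znorm (zpow2 n) = 2 ^ n. Proof. by rewrite /znorm /= bval_pow2 addn0. Qed.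
Lemma zval_le_norm x : (`|zval x| <= (znorm x)%:Z)%R.
Proof. by rewrite /zval /znorm; lia. Qed.

Lemma zsum_cat l x : zsum (rcons l x) = zadd (zsum l) x.
Proof. exact: foldl_rcons. Qed.
Lemma zval_sum l : zval (zsum l) = (\sum_(x <- l) zval x)%R.
Proof.
elim/last_ind: l => [|l x IH]; first by rewrite big_nil.
by rewrite zsum_cat zval_add IH big_rcons /= addrC.
Qed.
Lemma znorm_sum l : znorm (zsum l) = \sum_(x <- l) znorm x.
Proof.
elim/last_ind: l => [|l x IH]; first by rewrite big_nil.
by rewrite zsum_cat znorm_add IH big_rcons /= addnC.
Qed.

Lemma size_badd u v : size (badd u v) = (size u + size v).+1.
Proof.
rewrite /badd size_rcons size_rev; congr _.+1.
suff h n : size (foldl (badd_step u v) (false, [::]) (iota 0 n)).2 = n by exact: h.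
elim: n => // n IH; rewrite -addn1 iotaD foldl_cat add0n /= addn1; exact: congr1.
Qed.

Lemma esz_bits (u : seq bool) : esz u <= 4 * size u + 1.
Proof.
elim: u => // b u IH; rewrite esz_cons.
have H m n w : m <= 3 -> n <= 4 * w + 1 -> (m + n).+1 <= 4 * w.+1 + 1 by lia.
by apply: H IH; case: b.
Qed.

(** * Binary arithmetic in polynomial time *)

Section FP_binary.
Context (A : encType).
Implicit Types (u v : A -> seq bool) (x y : A -> zz).

Lemma pbd_size (B : encType) (s : A -> seq B) : FP s -> pbd (fun a => size (s a)).
Proof. by move=> [_ h]; apply: pbd_le h _ => a; exact: size_esz. Qed.

Lemma FP_neqb (b c : A -> bool) : FP b -> FP c -> FP (fun a => b a != c a).
Proof. by move=> hb hc; apply: FP_negb; exact: FP_eqb. Qed.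

Lemma FP_badd u v : FP u -> FP v -> FP (fun a => badd (u a) (v a)).
Proof.
move=> hu hv.
pose h (z : A * nat * (bool * seq bool)) := badd_step (u z.1.1) (v z.1.1) z.2 z.1.2.
have hh : FP h by rewrite /h /badd_step; fp; apply: FP_neqb; fp; apply: FP_neqb; fp.
have h2 : FP (fun a => foldx (fun=> (false, [::])) h a (iota 0 (size (u a) + size (v a)))).
  apply: (FP_foldl_bd (bd := fun a => 4 * (size (u a) + size (v a)) + 5)) => //; [fp|fp| |].
    apply: pbd_add (pbd_const _ 5); apply: pbd_mul (pbd_const _ 4) _.
    by apply: pbd_add; exact: pbd_size.
  move=> a s1 s2 e; have: size s1 <= size (u a) + size (v a).
    by rewrite -[_ + _](size_iota 0) e size_cat leq_addr.
  have : size (foldx (fun=> (false, [::])) h a s1).2 = size s1.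
    by elim/last_ind: (s1) => // s k IH; rewrite /foldx foldl_rcons /= size_rcons -IH.
  case: (foldx _ _ _ _) => b w /= sw le; rewrite esz_pair /=.
  have H p q r s : p <= 3 -> q <= 4 * r + 1 -> r <= s -> (p + q).+1 <= 4 * s + 5 by lia.
  by apply: H (esz_bits w) _; [case: b|rewrite sw].
apply: (FP_ext (f := fun a => rcons (rev
  (foldx (fun=> (false, [::])) h a (iota 0 (size (u a) + size (v a)))).2)
  (foldx (fun=> (false, [::])) h a (iota 0 (size (u a) + size (v a)))).1)) => //.
apply: FP_rcons; last exact: FP_fst_of h2.
apply: FP_rev; exact: FP_snd_of h2.
Qed.

Lemma FP_bltn u v : FP u -> FP v -> FP (fun a => bltn (u a) (v a)).
Proof.
move=> hu hv.
pose h (z : A * nat * bool) := if nth false (u z.1.1) z.1.2 == nth false (v z.1.1) z.1.2 then z.2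
  else nth false (v z.1.1) z.1.2.
have hh : FP h by rewrite /h; fp.
apply: (FP_foldl_bd (l := fun a => iota 0 (size (u a) + size (v a))) (c0 := fun=> false) (h := h)
  (bd := fun a => 3)) => //; [fp|fp|exact: pbd_const|].
by move=> a s1 s2 _; case: (foldx _ _ _ _).
Qed.

End FP_binary.

Lemma FP_bmul (A : encType) (u v : A -> seq bool) : FP u -> FP v -> FP (fun a => bmul (u a) (v a)).
Proof.
move=> hu hv.
pose h (z : A * bool * seq bool) := badd (false :: z.2) (if z.1.2 then v z.1.1 else [::]).
have hh : FP h by rewrite /h; apply: FP_badd; fp.
apply: (FP_foldl_bd (l := fun a => rev (u a)) (c0 := fun=> [::]) (h := h)
  (bd := fun a => 4 * (size (u a) * (size (v a) + 2)) + 1)) => //; [fp|fp| |].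
  apply: pbd_add (pbd_const _ 1); apply: pbd_mul (pbd_const _ 4) _; apply: pbd_mul; first exact: pbd_size.
  by apply: pbd_add (pbd_const _ 2); exact: pbd_size.
move=> a s1 s2 e; have: size s1 <= size (u a) by rewrite -(size_rev (u a)) e size_cat leq_addr.
have : size (foldx (fun=> [::]) h a s1) <= size s1 * (size (v a) + 2).
  elim/last_ind: (s1) => // s k IH; rewrite /foldx foldl_rcons /h size_badd /= size_rcons.
  have H p q r t : p <= r * (t + 2) -> q <= t -> p.+1 + q < r.+1 * (t + 2) by nia.
  by apply: H IH _; case: (k).
move=> h1 h2; apply: leq_trans (esz_bits _) _; rewrite leq_add2r leq_mul2l /=.
by apply: leq_trans h1 _; rewrite leq_mul2r h2 orbT.
Qed.

Section FP_integers.
Context (A : encType).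
Implicit Types (x y : A -> zz).

Lemma FP_zadd x y : FP x -> FP y -> FP (fun a => zadd (x a) (y a)).
Proof. by move=> hx hy; apply: FP_pair; apply: FP_badd; fp. Qed.

Lemma FP_zopp x : FP x -> FP (fun a => zopp (x a)).
Proof. by move=> hx; rewrite /zopp; fp. Qed.

Lemma FP_zmul x y : FP x -> FP y -> FP (fun a => zmul (x a) (y a)).
Proof. by move=> hx hy; apply: FP_pair; apply: FP_badd; apply: FP_bmul; fp. Qed.

Lemma FP_zlt x y : FP x -> FP y -> FP (fun a => zlt (x a) (y a)).
Proof. by move=> hx hy; apply: FP_bltn; apply: FP_badd; fp. Qed.

Lemma FP_znat (n : A -> nat) : FP n -> FP (fun a => znat (n a)).
Proof. by move=> hn; rewrite /znat; fp. Qed.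

Lemma FP_nseq (B : encType) (n : A -> nat) (b : B) : FP n -> FP (fun a => nseq (n a) b).
Proof.
move=> hn; apply: (FP_ext (f := fun a => [seq b | _ <- nseq (n a) tt])) => [|a].
  apply: (FP_map2 (h := fun _ _ => b)); [exact: FP_units|exact: FP_const].
by rewrite map_nseq.
Qed.

Lemma FP_zpow2 (n : A -> nat) : FP n -> FP (fun a => zpow2 (n a)).
Proof. by move=> hn; rewrite /zpow2; fp; exact: FP_nseq. Qed.

Lemma FP_take (B : encType) (n : A -> nat) (s : A -> seq B) : FP n -> FP s -> FP (fun a => take (n a) (s a)).
Proof.
move=> hn hs; apply: FP_ext (FP_rev (FP_drop (FP_sub (FP_size hs) hn) (FP_rev hs))) _ => a.
rewrite -{2}(cat_take_drop (n a) (s a)) rev_cat drop_cat size_rev size_drop ltnn subnn drop0.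
exact: revK.
Qed.

Lemma FP_ztrim (n : A -> nat) x : FP n -> FP x -> FP (fun a => ztrim (n a) (x a)).
Proof. by move=> hn hx; apply: FP_pair; apply: FP_take; fp. Qed.

End FP_integers.

Lemma FP_zsum (A : encType) (l : A -> seq zz) : FP l -> FP (fun a => zsum (l a)).
Proof.
move=> hl; pose h (z : A * zz * zz) := zadd z.2 z.1.2.
have hh : FP h by apply: FP_zadd; fp.
apply: (FP_foldl_bd (l := l) (c0 := fun=> z0) (h := h) (bd := fun a => 16 * esz (l a) + 16)) => //; [fp| |].
  apply: pbd_add (pbd_const _ 16); apply: pbd_mul (pbd_const _ 16) _; by case: hl.
move=> a s1 s2 e.
(* Because [badd] adds lengths, the accumulator grows only linearly with the list. *)
have h1 : size (foldx (fun=> z0) h a s1).1 + size (foldx (fun=> z0) h a s1).2 <= 2 * esz s1.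
  elim/last_ind: (s1) => // s k IH; rewrite /foldx foldl_rcons -/(foldx (fun=> z0) h a s) /h /=.
  rewrite !size_badd -cats1 esz_cat esz_cons esz_nil esz_pair.
  have := size_esz k.1; have := size_esz k.2; have := esz_gt0 s; move: IH.
  set p := size _.1; set q := size _.2; move: (size k.1) (size k.2) (esz k.1) (esz k.2) (esz s).
  by move=> a1 a2 a3 a4 a5; lia.
have h2 : esz s1 <= esz (l a) by rewrite e esz_prefix.
case: (foldx _ _ _ _) h1 => p q /= h1; rewrite esz_pair /=.
have := esz_bits p; have := esz_bits q; move: (esz p) (esz q) (size p) (size q) (esz s1) (esz (l a)) h1 h2.
by move=> a1 a2 a3 a4 a5 a6; lia.
Qed.

Lemma pbd_nat (A : encType) (n : A -> nat) : FP n -> pbd n.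
Proof. by move=> hn; apply: pbd_le (FP_pbd hn) _ => x; rewrite esz_nat; lia. Qed.

Ltac fp_hook := fail.

Ltac fp_ext ::=
  match goal with
  | |- FP (fun x => bits (@?f x)) => apply: (FP_bits (n := f))
  | |- FP (fun x => encode_nat (@?f x)) => apply: (FP_encode_nat (n := f))
  | |- FP (fun x => zadd (@?f x) (@?g x)) => apply: (FP_zadd (x := f) (y := g))
  | |- FP (fun x => zmul (@?f x) (@?g x)) => apply: (FP_zmul (x := f) (y := g))
  | |- FP (fun x => zlt (@?f x) (@?g x)) => apply: (FP_zlt (x := f) (y := g))
  | |- FP (fun x => zopp (@?f x)) => apply: (FP_zopp (x := f))
  | |- FP (fun x => znat (@?f x)) => apply: (FP_znat (n := f))
  | |- FP (fun x => zpow2 (@?f x)) => apply: (FP_zpow2 (n := f))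
  | |- FP (fun x => ztrim (@?f x) (@?g x)) => apply: (FP_ztrim (n := f) (x := g))
  | |- FP (fun x => zsum (@?f x)) => apply: (FP_zsum (l := f))
  | |- FP (fun x => nseq (@?f x) (@?b x)) => apply: (FP_nseq (n := f))
  | |- FP (fun x => take (@?f x) (@?g x)) => apply: (FP_take (n := f) (s := g))
  | _ => fp_hook
  end.

Import Order.TTheory GRing.Theory Num.Theory numFieldNormedType.Exports.
Local Open Scope classical_set_scope.
Local Open Scope ring_scope.

(** * Expectations along paths *)

Section expectation.
Context (R : realType) (nS nA : nat) (M : mdp nS nA) (sigma : scheduler R M).
Local Notation path := (finite_path nS nA).
Implicit Types (p : path) (phi psi : path -> R).

Definition ext p (a : 'I_nA.+1) (s : 'I_nS.+1) : path := (rcons p.1 (p.2, a), s).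

(** One step in backward form: functions of paths are pulled back instead of distributions pushed
    forward. Once [Pr_reach_cvg] is available, measures are no longer needed. *)
Definition stepE phi : path -> R := fun p =>
  \sum_a sched sigma p a * \sum_s ratr (trans M p.2 a s) * phi (ext p a s).

(** [Ex n phi s0] is the expectation of [phi] at the path of length [n]. *)
Definition Ex n phi s0 : R := iter n stepE phi ([::], s0).

Lemma ratr_trans_ge0 s a s' : 0 <= ratr (trans M s a s') :> R.
Proof. by rewrite ler0q; case/andP: (trans_itv M s a s'). Qed.

Lemma le_stepE phi psi : (forall p, phi p <= psi p) -> forall p, stepE phi p <= stepE psi p.
Proof.
move=> h p; apply: ler_sum => a _; apply: ler_wpM2l; first exact: sched_ge0.
by apply: ler_sum => s _; apply: ler_wpM2l (h _); exact: ratr_trans_ge0.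
Qed.

Lemma stepE_avg p (c : R) :
  \sum_a sched sigma p a * \sum_s ratr (trans M p.2 a s) * c = c.
Proof.
rewrite -[RHS]mul1r -(sched_sum sigma p) mulr_suml; apply: eq_bigr => a _.
have [/eqP en|/sched_enabled ->] := boolP (enabled M p.2 a); last by rewrite !mul0r.
by rewrite -mulr_suml -rmorph_sum /= en rmorph1 mul1r.
Qed.

Lemma stepE_const (c : R) p : stepE (fun=> c) p = c.
Proof. exact: stepE_avg. Qed.

Lemma stepE_add phi psi p : stepE (fun p => phi p + psi p) p = stepE phi p + stepE psi p.
Proof.
rewrite /stepE -big_split; apply: eq_bigr => a _ /=; rewrite -mulrDr; congr (_ * _).
by rewrite -big_split; apply: eq_bigr => s _; rewrite mulrDr.
Qed.

Lemma stepE_mul (c : R) phi p : stepE (fun p => c * phi p) p = c * stepE phi p.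
Proof.
rewrite /stepE mulr_sumr; apply: eq_bigr => a _ /=; rewrite mulrCA; congr (_ * _).
by rewrite mulr_sumr; apply: eq_bigr => s _; rewrite mulrCA.
Qed.

Lemma le_iterE n phi psi : (forall p, phi p <= psi p) ->
  forall p, iter n stepE phi p <= iter n stepE psi p.
Proof. by move=> h; elim: n => //= n IH; exact: le_stepE. Qed.

Lemma iterE_const n (c : R) p : iter n stepE (fun=> c) p = c.
Proof.
elim: n p => //= n IH p; rewrite -[RHS](stepE_const c p).
by congr (stepE _ p); apply/funext => q; rewrite IH.
Qed.

Lemma iterE_add n phi psi p :
  iter n stepE (fun p => phi p + psi p) p = iter n stepE phi p + iter n stepE psi p.
Proof.
elim: n p => //= n IH p; rewrite -stepE_add.
by congr (stepE _ p); apply/funext => q; rewrite IH.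
Qed.

Lemma iterE_mul n (c : R) phi p : iter n stepE (fun p => c * phi p) p = c * iter n stepE phi p.
Proof.
elim: n p => //= n IH p; rewrite -stepE_mul.
by congr (stepE _ p); apply/funext => q; rewrite IH.
Qed.

Lemma iterE_sum n (I : finType) (c : I -> R) (phi : I -> path -> R) p :
  iter n stepE (fun p => \sum_i c i * phi i p) p = \sum_i c i * iter n stepE (phi i) p.
Proof.
suff h r : iter n stepE (fun p => \sum_(i <- r) c i * phi i p) p =
    \sum_(i <- r) c i * iter n stepE (phi i) p by exact: h.
elim: r => [|i r IH].
  rewrite big_nil -[RHS](iterE_const n 0 p); congr (iter n stepE _ p).
  by apply/funext => q; rewrite big_nil.
rewrite big_cons -IH -iterE_mul -iterE_add; congr (iter n stepE _ p).
by apply/funext => q; rewrite big_cons.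
Qed.

Section cylinders.
Variable s0 : 'I_nS.+1.
Local Notation cp := (cylinder_prob sigma s0).
Local Notation mu := (path_measure sigma s0).

Lemma cylinder_prob_ext p a s :
  cp (ext p a s) = cp p * (sched sigma p a * ratr (trans M p.2 a s)).
Proof.
case: p => h x; rewrite /cylinder_prob /ext /= size_rcons big_ord_recr /=.
have st i : (i <= size h)%N -> fp_state (rcons h (x, a), s) i = fp_state (h, x) i.
  rewrite /fp_state /= map_rcons nth_rcons size_map.
  by case: ltngtP => // [ih|->] _; [apply: set_nth_default; rewrite size_map|
                                   rewrite nth_default ?size_map].
have ac i : (i < size h)%N -> fp_action (rcons h (x, a), s) i = fp_action (h, x) i.
  by rewrite /fp_action /= map_rcons nth_rcons size_map => ->.
have tk i : (i <= size h)%N -> take i (rcons h (x, a)) = take i h.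
  by move=> ih; rewrite -cats1 takel_cat.
have -> : fp_state (rcons h (x, a), s) (size h).+1 = s.
  by rewrite /fp_state nth_default // size_map size_rcons.
have -> : fp_action (rcons h (x, a), s) (size h) = a.
  by rewrite /fp_action /= map_rcons nth_rcons size_map ltnn eqxx.
have stl : fp_state (h, x) (size h) = x by rewrite /fp_state nth_default ?size_map.
rewrite (st 0) // (st (size h)) // stl tk // take_size mulrA; congr (_ * _ * _).
by apply: eq_bigr => i _; rewrite !st ?ac ?tk // ltnW.
Qed.

Lemma cylinder_prob0 s : cp ([::], s) = (s == s0)%:R.
Proof. by rewrite /cylinder_prob big_ord0 mulr1. Qed.

Lemma measurable_cyl p : measurable (cylinder p : set (path_space nS nA)).
Proof. by apply: sub_sigma_algebra; exists p. Qed.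

Lemma measure_fintype_bigcup (I : finType) (F : I -> set (path_space nS nA)) :
  (forall i, measurable (F i)) -> trivIset setT F ->
  mu (\bigcup_i F i) = (\sum_i mu (F i))%E.
Proof.
move=> mF tF; rewrite measure_fin_bigcup //; last exact: finite_finset.
rewrite (_ : [set: I] = [set` index_enum I]); last first.
  by apply/seteqP; split => i //= _; rewrite mem_index_enum.
by rewrite -fsbig_seq ?index_enum_uniq.
Qed.

Definition prefix (n : nat) (w : infinite_path nS nA) : path := (mkseq w n, (w n).1).

Lemma cylinder_ext p : cylinder p = \bigcup_(e : 'I_nA.+1 * 'I_nS.+1) cylinder (ext p e.1 e.2).
Proof.
case: p => h s; apply/seteqP; split => w /=.
  move=> [wh ws]; exists ((w (size h)).2, (w (size h).+1).1) => //.
  split; rewrite /= size_rcons // mkseqS /= in wh ws *.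
  by rewrite wh -ws -surjective_pairing.
move=> [[a s'] _ [/= + _]]; rewrite size_rcons mkseqS => /eqP.
by rewrite eqseq_rcons => /andP[/eqP wh /eqP ws]; split => //=; rewrite ws.
Qed.

Lemma trivIset_ext p :
  trivIset setT (fun e : 'I_nA.+1 * 'I_nS.+1 => cylinder (ext p e.1 e.2)).
Proof.
apply/trivIsetP => -[a s] [a' s'] _ _ /eqP ne; apply/seteqP; split => w //=.
move=> [[/= h1 e1] [/= h2 e2]]; apply: ne.
rewrite !size_rcons in h1 e1 h2 e2; rewrite -e1 -e2; congr pair.
by have := etrans (esym h1) h2 => /eqP; rewrite eqseq_rcons => /andP[_ /eqP[]].
Qed.

(** The link between the path measure and the operator [stepE]: the cylinder of [p] splits into the
    cylinders of its one-step extensions, whose weights are those of [stepE]. *)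
Lemma measure_prefix_in p n k (B : path -> bool) : (size p.1 + k)%N = n ->
  measurable (cylinder p `&` [set w | B (prefix n w)] : set (path_space nS nA)) /\
  mu (cylinder p `&` [set w | B (prefix n w)]) =
    (cp p * iter k stepE (fun q => (B q)%:R) p)%:E.
Proof.
elim: k p => [|k IH] p pn.
  have E : cylinder p `&` [set w | B (prefix n w)] = if B p then cylinder p else set0.
    apply/seteqP; split => w /=.
      move=> [[wp ws]]; rewrite -pn addn0 /prefix wp ws -surjective_pairing => Bp.
      by rewrite Bp.
    case: ifP => // Bp [wp ws]; split => //.
    by rewrite -pn addn0 /prefix wp ws -surjective_pairing.
  rewrite E /=; case: (B p); last by rewrite measure0 mulr0.
  by split; [exact: measurable_cyl|rewrite mulr1; exact: path_measureP].
have pn' a s : (size (ext p a s).1 + k)%N = n by rewrite size_rcons addSnnS.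
rewrite cylinder_ext setI_bigcupl; split.
  by apply: fin_bigcup_measurable => // e _; case: (IH _ (pn' e.1 e.2)).
rewrite measure_fintype_bigcup.
- rewrite iterS /stepE mulr_sumr.
  rewrite (eq_bigr (fun e => (cp p * (sched sigma p e.1 * (ratr (trans M p.2 e.1 e.2) *
     iter k stepE (fun q => (B q)%:R) (ext p e.1 e.2))))%:E)); last first.
    by move=> e _; rewrite (IH _ (pn' _ _)).2 cylinder_prob_ext !mulrA.
  rewrite sumEFin; congr (_%:E).
  rewrite (eq_bigr (fun a => \sum_s cp p * (sched sigma p a * (ratr (trans M p.2 a s) *
     iter k stepE (fun q => (B q)%:R) (ext p a s))))); last first.
    by move=> a _; rewrite !mulr_sumr.
  by rewrite pair_bigA.
- by move=> e; case: (IH _ (pn' e.1 e.2)).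
- apply/trivIsetP => e e' _ _ ne; apply/seteqP; split => w //= -[[w1 _] [w2 _]].
  have := @trivIset_ext p; move/trivIsetP => /(_ e e' I I ne)/seteqP[/(_ w) + _].
  by apply.
Qed.

Lemma measure_prefix n (B : path -> bool) :
  measurable ([set w | B (prefix n w)] : set (path_space nS nA)) /\
  mu [set w | B (prefix n w)] = (Ex n (fun q => (B q)%:R) s0)%:E.
Proof.
have E : [set w | B (prefix n w)] =
    \bigcup_(s : 'I_nS.+1) (cylinder ([::], s) `&` [set w | B (prefix n w)]).
  by apply/seteqP; split => w /=; [move=> h; exists (w 0%N).1|case=> s _ []].
have h s := @measure_prefix_in ([::], s) n n B erefl.
rewrite E; split.
  by apply: fin_bigcup_measurable => // s _; case: (h s).
rewrite measure_fintype_bigcup.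
- rewrite (bigD1 s0) //= (h s0).2 cylinder_prob0 eqxx mul1r big1 ?adde0 // => s /negbTE ns.
  by rewrite (h s).2 cylinder_prob0 ns mul0r.
- by move=> s; case: (h s).
- apply/trivIsetP => s s' _ _ /eqP ne; apply/seteqP; split => w //=.
  by move=> [[[_ /= e1] _] [[_ /= e2] _]]; apply: ne; rewrite -e1 -e2.
Qed.

Definition visited p : {set 'I_nS.+1} := p.2 |: [set s in map fst p.1].

Definition hit (T : {set 'I_nS.+1}) p : bool := visited p :&: T != finset.set0.

Lemma visited_ext p a s : visited (ext p a s) = s |: visited p.
Proof.
apply/setP => x; rewrite /visited /= !inE map_rcons mem_rcons inE.
by rewrite orbC -orbA; congr (_ || _); rewrite orbC.
Qed.

Lemma hit_prefix (T : {set 'I_nS.+1}) n (w : infinite_path nS nA) :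
  reflect (exists2 i, (i <= n)%N & (w i).1 \in T) (hit T (prefix n w)).
Proof.
apply: (iffP (finset.set0Pn _)) => [[s]|[i ni wi]].
  rewrite !inE => /andP[+ sT] => /orP[/eqP es|/mapP[e /mapP[i ii ->] es]].
    by exists n => //; rewrite -[(w n).1]/(prefix n w).2 -es.
  by exists i; rewrite -?es //; move: ii; rewrite mem_iota => /andP[_ /ltnW].
exists (w i).1; rewrite !inE wi andbT; move: ni; rewrite leq_eqVlt => /orP[/eqP ->|ni].
  by rewrite eqxx.
by rewrite -map_comp; apply/orP; right; apply/mapP; exists i; rewrite ?mem_iota.
Qed.

(** Continuity of the measure from below along the increasing events that [T] is met within [n]
    steps. *)
Lemma Pr_reach_cvg T :
  (fun n => Ex n (fun q => (hit T q)%:R) s0) @ \oo --> Pr_reach sigma s0 T.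
Proof.
pose F n : set (path_space nS nA) := [set w | hit T (prefix n w)].
have FE : [set w : path_space nS nA | exists i, (w i).1 \in T] = \bigcup_n F n.
  apply/seteqP; split => w /=; first by move=> [i wi]; exists i => //; apply/hit_prefix; exists i.
  by move=> [n _ /hit_prefix[i _ wi]]; exists i.
have mF n : measurable (F n) by case: (measure_prefix n (hit T)).
have := @nondecreasing_cvg_mu _ _ R mu F mF.
rewrite -FE => /(_ (measurable_reach T)) cv.
rewrite (_ : (fun n => _) = fine \o (mu \o F)); last first.
  by apply/funext => n /=; rewrite (measure_prefix n (hit T)).2.
apply: fine_cvg; rewrite /Pr_reach fineK; last exact: fin_num_measure (measurable_reach T).
apply: cv => i j ij; apply/subsetPset => w /hit_prefix[k ki wk]; apply/hit_prefix.
by exists k => //; exact: leq_trans ij.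
Qed.

End cylinders.
End expectation.

(** * Games as conjunctions of reachability properties *)

Section game.
Context (R : realType) (nS nA : nat) (M : mdp nS nA).
Local Notation path := (finite_path nS nA).
Variable goal : path -> bool.

(** The scheduler can force [goal] after [k] steps, whatever the random outcomes. *)
Fixpoint win (k : nat) (p : path) : Prop :=
  if k is k'.+1 then
    exists a, forall s, trans M p.2 a s != 0 -> win k' (ext p a s)
  else goal p.

Let miss (p : path) : R := (~~ goal p)%:R.

Lemma miss_ge0 k (sigma : scheduler R M) p : 0 <= iter k (stepE sigma) miss p.
Proof.
rewrite -(iterE_const sigma k 0 p); apply: le_iterE => q; exact: ler0n.
Qed.

(** A vanishing sum of nonnegative terms vanishes termwise, so any action of positive probability
    leads only to successors from which a miss still has probability 0. *)
Lemma win_of_sure (sigma : scheduler R M) k p :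
  iter k (stepE sigma) miss p = 0 -> win k p.
Proof.
elim: k p => [|k IH] p /=; first by rewrite /miss; case: (goal p) => // /eqP; rewrite oner_eq0.
move=> E0.
have [a sa] : exists a, 0 < sched sigma p a.
  apply: contrapT => /forallNP h; suff : (1 : R) = 0 by move/eqP; rewrite oner_eq0.
  rewrite -(sched_sum sigma p) big1 // => a _; apply/eqP.
  by rewrite eq_le sched_ge0 andbT leNgt; apply/negP.
exists a => s ps; apply: IH; move/eqP: E0; rewrite psumr_eq0; last first.
  move=> b _; apply: mulr_ge0; first exact: sched_ge0.
  by apply: sumr_ge0 => t _; apply: mulr_ge0 (miss_ge0 _ _ _); exact: ratr_trans_ge0.
move=> /allP/(_ a (mem_index_enum _)) /=; rewrite mulf_eq0 (gt_eqF sa) /=.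
rewrite psumr_eq0; last first.
  by move=> t _; apply: mulr_ge0 (miss_ge0 _ _ _); exact: ratr_trans_ge0.
move=> /allP/(_ s (mem_index_enum _)) /=; rewrite mulf_eq0 fmorph_eq0 (negbTE ps) /=.
by move/eqP.
Qed.

Hypothesis all_enabled : forall s a, enabled M s a.

Lemma det_sched_sum (c : path -> 'I_nA.+1) p : \sum_a (a == c p)%:R = 1 :> R.
Proof. by rewrite (bigD1 (c p)) //= eqxx big1 ?addr0 // => a /negbTE ->. Qed.

Definition det_sched (c : path -> 'I_nA.+1) : scheduler R M :=
  @Scheduler R nS nA M (fun p a => (a == c p)%:R) (fun _ _ => ler0n _ _)
    (det_sched_sum c) (fun p a h => False_ind _ (negP h (all_enabled _ _))).

Lemma sure_of_win N s0 : win N ([::], s0) ->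
  exists sigma : scheduler R M, Ex sigma N miss s0 = 0.
Proof.
move=> w0.
(* The number of remaining rounds is determined by the length of the path, so a single choice
   function of paths covers all rounds. *)
have ch p : exists a, forall k, (size p.1 + k.+1)%N = N -> win k.+1 p ->
    forall s, trans M p.2 a s != 0 -> win k (ext p a s).
  have [[k [pk [a h]]]|no] := pselect (exists k, (size p.1 + k.+1)%N = N /\ win k.+1 p).
    by exists a => k' pk'; have -> : k' = k by lia.
  by exists ord0 => k pk wk; case: no; exists k.
pose c p := projT1 (cid (ch p)); have cP p := projT2 (cid (ch p)).
exists (det_sched c); rewrite /Ex.
suff h k p : (size p.1 + k)%N = N -> win k p -> iter k (stepE (det_sched c)) miss p = 0.
  exact: (h N ([::], s0)).
elim: k p => [|k IH] p pk wp; first by rewrite /= /miss wp.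
rewrite iterS /stepE big1 // => a _ /=; have [->|_] := eqVneq a (c p); last by rewrite mul0r.
rewrite mul1r big1 // => s _; have [->|ps] := eqVneq (trans M p.2 (c p) s) 0.
  by rewrite rmorph0 mul0r.
rewrite IH ?mulr0 //; first by rewrite size_rcons addSnnS.
exact: cP ps.
Qed.

End game.

(** * Reachability in layered MDPs *)

Section levels.
Context (R : realType) (nS nA : nat) (M : mdp nS nA) (lv : 'I_nS.+1 -> nat) (last : nat).
Hypothesis lv_step : forall s a s', trans M s a s' != 0 -> (lv s < last)%N -> lv s' = (lv s).+1.
Hypothesis lv_last : forall s a s', trans M s a s' != 0 -> (last <= lv s)%N -> s' = s.

(** Runs rise one level per step and then stand still in the last one, so the set of visited states
    is final after [last] steps and the limit is attained. *)
Lemma Pr_reach_levels (sigma : scheduler R M) s0 T :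
  Pr_reach sigma s0 T = Ex sigma last (fun p => (hit T p)%:R) s0.
Proof.
set phi := fun p => _.
have stepS k p : (last - lv p.2 <= k)%N ->
    iter k.+1 (stepE sigma) phi p = iter k (stepE sigma) phi p.
  elim: k p => [|k IH] p lp.
    have {}lp : (last <= lv p.2)%N by lia.
    rewrite /= /stepE -[RHS](stepE_avg sigma p); apply: eq_bigr => a _; congr (_ * _).
    apply: eq_bigr => s _; have [->|ps] := eqVneq (trans M p.2 a s) 0.
      by rewrite rmorph0 !mul0r.
    congr (_ * _); rewrite /phi /hit visited_ext (lv_last ps lp).
    by rewrite (finset.setUidPr _) // finset.sub1set /visited !inE eqxx.
  change (stepE sigma (iter k.+1 (stepE sigma) phi) p = stepE sigma (iter k (stepE sigma) phi) p).
  apply: eq_bigr => a _; congr (_ * _).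
  apply: eq_bigr => s _; have [->|ps] := eqVneq (trans M p.2 a s) 0.
    by rewrite rmorph0 !mul0r.
  congr (_ * _); apply: IH => /=; have [l1|l1] := ltnP (lv p.2) last.
    by rewrite (lv_step ps l1); lia.
  by rewrite (lv_last ps l1); lia.
have const n : (last <= n)%N -> Ex sigma n phi s0 = Ex sigma last phi s0.
  move=> /subnK <-; elim: (n - last)%N => // k IH.
  by rewrite -IH addSn /Ex stepS //= (leq_trans (leq_subr _ _)) ?leq_addl.
rewrite -[LHS](cvg_lim (@norm_hausdorff _ _) (Pr_reach_cvg (sigma := sigma) (s0 := s0) (T := T))).
apply: (lim_near_cst (@norm_hausdorff _ _)).
near=> n; apply: const; near: n; exact: nbhs_infty_ge.
Unshelve. all: by end_near.
Qed.

End levels.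

(** * Games with coins and clauses as instances *)

Section quantified.
Variables (al nv : nat) (rnd : nat -> bool) (cl0 : seq (nat * nat * bool))
  (cls0 : seq (seq (nat * nat * bool))).
Local Notation sy := al.+2.
Local Notation NV := nv.+1.
Definition clauses := cl0 :: cls0.

(** A literal [(v, a, true)] says that variable [v] has value [a], and [(v, a, false)]
    that it has not.  State [v * sy + a] of the MDP assigns [a] to [v]. *)
Definition lit_at (l : nat * nat * bool) (v a : nat) : bool :=
  (l.1.1 == v) && (l.2 == (l.1.2 == a)).

(** A literal about an unassigned variable fails for both signs, just as no run has visited a state
    of that variable. *)
Definition sat (w : seq nat) : bool :=
  all (fun cl : seq (nat * nat * bool) => has (fun l => (l.1.1 < size w)%N &&
    (l.2 == (l.1.2 == nth 0%N w l.1.1))) cl) clauses.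

Fixpoint Qg (k : nat) (w : seq nat) : Prop :=
  if k is k'.+1 then
    if rnd (size w) then forall b, (b < 2)%N -> Qg k' (rcons w b)
    else exists a, (a < sy)%N /\ Qg k' (rcons w a)
  else sat w.

(** At an existential variable the action is the value; at a coin both values get probability 1/2
    under every action. The states of the last variable are absorbing. *)
Definition qtr (i a i' : nat) : rat :=
  let v := (i %/ sy)%N in
  if v.+1 == NV then (i' == i)%:R
  else if rnd v.+1 then ((i' == v.+1 * sy)%N%:R + (i' == (v.+1 * sy).+1)%N%:R) / 2
  else (i' == v.+1 * sy + a)%N%:R.

Local Notation ns := (NV * sy).-1.
Local Notation state := 'I_ns.+1.

Lemma state_div_lt (s : state) : (s %/ sy < NV)%N.
Proof. by rewrite ltn_divLR //; exact: (ltn_ord s). Qed.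

Lemma qtr_itv (s : state) (a : 'I_al.+2) (s' : state) : 0 <= qtr s a s' <= 1.
Proof.
rewrite /qtr; case: ifP => _; first by case: eqP.
case: ifP => _; last by case: eqP.
have b01 (b : bool) : 0 <= (b%:R : rat) <= 1 by case: b.
by have /andP[? ?] := b01 (nat_of_ord s' == (s %/ sy).+1 * sy)%N; have /andP[? ?] := b01 (nat_of_ord s' == ((s %/ sy).+1 * sy).+1)%N; lra.
Qed.

Lemma sum_eq_ord n (c : nat) : (c < n)%N -> \sum_(i < n) (i == c :> nat)%:R = 1 :> rat.
Proof.
move=> cn; rewrite (bigD1 (Ordinal cn)) //= eqxx big1 ?addr0 // => i.
by rewrite -val_eqE /= => /negbTE ->.
Qed.

Lemma next_lt (s : state) b : (b < sy)%N -> (s %/ sy).+1 != NV ->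
  ((s %/ sy).+1 * sy + b < ns.+1)%N.
Proof.
move=> bs sN; have lt : ((s %/ sy).+1 < NV)%N by rewrite ltn_neqAle sN state_div_lt.
change ((s %/ sy).+1 * sy + b < NV * sy)%N.
by apply: leq_trans (_ : (s %/ sy).+2 * sy <= _)%N; [rewrite [X in (_ < X)%N]mulSn addnC ltn_add2r|rewrite leq_mul2r].
Qed.

Lemma qtr_sum (s : state) (a : 'I_al.+2) : \sum_(s' : state) qtr s a s' = 1.
Proof.
have [e|sN] := boolP ((s %/ sy).+1 == NV).
  by under eq_bigr do rewrite /qtr e; exact: sum_eq_ord.
under eq_bigr do rewrite /qtr (negbTE sN).
case: (rnd _); last by rewrite sum_eq_ord // next_lt.
rewrite -mulr_suml big_split /= !sum_eq_ord //.
  by have := next_lt (b := 1%N) isT sN; rewrite addn1.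
by have := next_lt (b := 0%N) isT sN; rewrite addn0.
Qed.

Definition qmdp : mdp ns al.+1 :=
  @MDP ns al.+1 (fun s a s' => qtr s a s') qtr_itv
    (fun s a => or_introl (qtr_sum s a)) (fun s => ex_intro _ ord0 (qtr_sum s ord0)).

Definition qtarget (j : nat) : {set state} :=
  [set i : state | has (fun l => lit_at l (i %/ sy) (i %% sy)) (nth [::] clauses j)].

(** The scheduler index has to occur in some conjunct; this is why a first clause [cl0] is kept
    apart from the list of the others. *)
Lemma one_idx (k : 'I_1) : exists (i : 'I_1) (j : 'I_(size clauses)), ord0 = k :> 'I_1.
Proof. by exists ord0, (@ord0 (size cls0)); rewrite (ord1 k). Qed.

Definition qinst : instance :=
  @Instance ns al.+1 qmdp (size clauses) 1 1 (fun _ _ => 1) (fun _ => 1)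
    (fun _ _ => ord0) (fun _ _ => ord0) one_idx (fun _ j => qtarget j) (fun _ => CmpGe).

Local Notation path := (finite_path ns al.+1).
Definition qgoal (p : path) : bool := [forall j : 'I_(size clauses), hit (qtarget j) p].

Definition qrel (p : path) (w : seq nat) : Prop :=
  [/\ rcons [seq nat_of_ord e.1 | e <- p.1] p.2 = [seq v * sy + nth 0 w v | v <- iota 0 (size w)]%N,
      all (fun a => a < sy)%N w & w != [::]].

Lemma qrel_state p w : qrel p w -> (p.2 = ((size w).-1 * sy + nth 0 w (size w).-1) :> nat)%N.
Proof.
move=> [e _ w0]; rewrite -(last_rcons 0%N [seq nat_of_ord e.1 | e <- p.1] p.2) e.
have lw : ((size w).-1 < size w)%N by case: (w) w0.
by rewrite -nth_last size_map size_iota (nth_map 0%N) ?size_iota // nth_iota // add0n.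
Qed.

Lemma qrel_div p w : qrel p w ->
  (p.2 %/ sy = (size w).-1)%N /\ (p.2 %% sy = nth 0 w (size w).-1)%N.
Proof.
move=> r; rewrite (qrel_state r); case: r => _ /allP wsy w0.
have lt : (nth 0 w (size w).-1 < sy)%N.
  by apply: wsy; apply: mem_nth; case: (w) w0.
by rewrite divnMDl // divn_small // addn0 modnMDl modn_small.
Qed.

Lemma qgoal_sat p w : qrel p w -> qgoal p = sat w.
Proof.
move=> [e /allP wsy w0].
have hitE (j : nat) : hit (qtarget j) p = has (fun l => (l.1.1 < size w)%N &&
    (l.2 == (l.1.2 == nth 0%N w l.1.1))) (nth [::] clauses j).
  have vis (s : state) : (s \in visited p) = ((s : nat) \in
      [seq v * sy + nth 0 w v | v <- iota 0 (size w)]%N).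
    rewrite -e mem_rcons inE /visited finset.in_setU finset.in_set1 -val_eqE; congr (_ || _).
    by rewrite finset.in_set -(mem_map val_inj) -map_comp.
  have vdiv v : (v < size w)%N -> ((v * sy + nth 0 w v) %/ sy = v)%N /\
      ((v * sy + nth 0 w v) %% sy = nth 0 w v)%N.
    move=> vw; have lt := wsy _ (mem_nth 0%N vw).
    by rewrite divnMDl // divn_small // addn0 modnMDl modn_small.
  apply/(finset.set0Pn)/hasP => [[s]|[l lc /andP[lw /eqP ll]]].
    rewrite finset.in_setI vis finset.in_set => /andP[/mapP[v + ->] /hasP[l lc]].
    rewrite mem_iota /= add0n => vw; have [-> ->] := vdiv _ vw.
    by move=> /andP[/eqP lv ll]; exists l => //; rewrite lv vw.
  have [d m] := vdiv _ lw.
  have lt : (l.1.1 * sy + nth 0 w l.1.1 < ns.+1)%N.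
    have : (l.1.1 * sy + nth 0 w l.1.1)%N \in [seq v * sy + nth 0 w v | v <- iota 0 (size w)]%N.
      by apply: map_f; rewrite mem_iota.
    by rewrite -e mem_rcons inE => /orP[/eqP ->|/mapP[z _ ->]]; exact: ltn_ord.
  exists (Ordinal lt); rewrite finset.in_setI vis finset.in_set /=; apply/andP; split.
    by apply: map_f; rewrite mem_iota.
  by apply/hasP; exists l => //; rewrite /lit_at d m eqxx ll eqxx.
apply/forallP/allP => [h cl|h j].
  by move=> /(nthP [::])[j js <-]; have := h (Ordinal js); rewrite hitE.
by rewrite hitE; apply: h; rewrite mem_nth.
Qed.

Lemma qrel_ext p w a b (s : state) : qrel p w -> (b < sy)%N ->
  s = (size w * sy + b)%N :> nat -> qrel (ext p a s) (rcons w b).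
Proof.
move=> [e wsy w0] bs sb; split; last by case: (w).
- rewrite /ext /= map_rcons /= e size_rcons -[(size w).+1]addn1 iotaD map_cat /= add0n -cats1; congr (_ ++ _).
    apply/eq_in_map => v; rewrite mem_iota /= add0n => vw.
    by rewrite nth_rcons vw.
  by rewrite nth_rcons ltnn eqxx sb.
- by rewrite all_rcons bs.
Qed.

Lemma win_Qg k p w : qrel p w -> (size w + k)%N = NV -> win qmdp qgoal k p <-> Qg k w.
Proof.
elim: k p w => [|k IH] p w r wk; first by rewrite /= (qgoal_sat r).
have [dE mE] := qrel_div r; have w0 : (0 < size w)%N by case: r => _ _; case: (w).
have wS : ((size w).-1).+1 = size w by rewrite prednK.
have wN : size w != NV by apply/eqP => e; move: wk; rewrite e; lia.
have nlt b : (b < sy)%N -> (size w * sy + b < ns.+1)%N.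
  by move=> bs; have := next_lt (s := p.2) bs; rewrite dE wS; apply.
have step (a : 'I_al.+2) b (bs : (b < sy)%N) :
    win qmdp qgoal k (ext p a (Ordinal (nlt b bs))) <-> Qg k (rcons w b).
  by apply: IH; [exact: qrel_ext|rewrite size_rcons addSnnS].
rewrite /= /qtr dE wS (negbTE wN); case: ifP => rw.
  split=> [[a h] b b2|h].
    have bs : (b < sy)%N by exact: leq_trans b2 _.
    apply/(step a b bs)/h => /=; case: b b2 {bs} => [|[|//]] _.
      by rewrite addn0 eqxx mulf_neq0 // gt_eqF // ltr_pwDl.
    by rewrite addn1 eqxx mulf_neq0 // gt_eqF // ltr_wpDl.
  exists ord0 => s' s'0.
  have [b b2 sb] : exists2 b, (b < 2)%N & s' = (size w * sy + b)%N :> nat.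
    move: s'0; case: (nat_of_ord s' =P (size w * sy)%N) => [->|_]; first by exists 0%N; rewrite ?addn0.
    case: (nat_of_ord s' =P (size w * sy).+1) => [->|_]; first by exists 1%N; rewrite ?addn1.
    by rewrite addr0 mul0r eqxx.
  have bs : (b < sy)%N by exact: leq_trans b2 _.
  have -> : s' = Ordinal (nlt b bs) by exact: val_inj.
  by apply/step; exact: h.
split=> [[a h]|[a [asy h]]].
  exists a; split=> //; apply/(step a a (ltn_ord a))/h => /=.
  by rewrite eqxx oner_neq0.
exists (Ordinal asy) => s'; case: (nat_of_ord s' =P (size w * sy + a)%N) => [sa _|_]; last by rewrite eqxx.
have -> : s' = Ordinal (nlt a asy) by exact: val_inj.
exact/step.
Qed.

Lemma qinst_solvable (R : realType) : solvable R qinst <-> Qg nv [:: 0%N].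
Proof.
have r0 : qrel ([::], ord0) [:: 0%N] by [].
rewrite -(win_Qg r0) ?add1n //.
pose lv (s : state) := (s %/ sy)%N.
have lvS (s : state) (a : 'I_al.+2) (s' : state) : trans qmdp s a s' != 0 -> (lv s < nv)%N -> lv s' = (lv s).+1.
  rewrite /= /qtr /lv => + ln; rewrite eqSS (ltn_eqF ln); case: ifP => _; last first.
    case: (nat_of_ord s' =P _) => [-> _|]; last by rewrite eqxx.
    by rewrite divnMDl // (divn_small (ltn_ord a)) addn0.
  case: (nat_of_ord s' =P (_ * _)%N) => [-> _|_]; first by rewrite mulnK.
  case: (nat_of_ord s' =P (_ * _).+1) => [-> _|_]; last by rewrite addr0 mul0r eqxx.
  have := divnMDl (s %/ sy).+1 1 (isT : (0 < sy)%N); rewrite addn1 => ->.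
  by rewrite (@divn_small 1) // addn0.
have lvN (s : state) (a : 'I_al.+2) (s' : state) : trans qmdp s a s' != 0 -> (nv <= lv s)%N -> s' = s.
  rewrite /= /qtr /lv => + ln.
  have le := state_div_lt s.
  have -> : (s %/ sy).+1 == NV by rewrite eqSS eqn_leq ln -ltnS le.
  by case: (nat_of_ord s' =P _) => [/val_inj -> //|]; rewrite eqxx.
have PrE := fun sigma => @Pr_reach_levels R _ _ qmdp lv nv lvS lvN sigma.
split=> [[sigma h]|w].
  pose sg := sigma ord0.
  apply: (win_of_sure (sigma := sg)); apply/eqP; rewrite eq_le miss_ge0 andbT.
  (* Union bound: the probability of missing some clause is at most the sum of the probabilities of
     missing each one, and these are 0. *)
  pose phi (j : 'I_(size clauses)) (p : path) : R := 1 - (hit (qtarget j) p)%:R.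
  apply: (@le_trans _ _ (iter nv (stepE sg) (fun p => \sum_j 1 * phi j p) ([::], ord0))).
    apply: le_iterE => p; have phi_ge0 j : true -> 0 <= 1 * phi j p.
      by move=> _; rewrite mul1r /phi; case: (hit _ _); rewrite ?subrr ?subr0.
    have [//|g0] := boolP (qgoal p); first by rewrite sumr_ge0.
    move: g0; rewrite negb_forall => /existsP[j /negbTE jp].
    rewrite (bigD1 j) //= mul1r {1}/phi jp subr0 lerDl sumr_ge0 // => i _.
    exact: phi_ge0.
  rewrite iterE_sum big1 // => j _; rewrite mul1r.
  have := h j; rewrite /= big_ord1 rmorph1 mul1r PrE -/sg => hj.
  have e : iter nv (stepE sg) (phi j) ([::], ord0) = 1 - Ex sg nv (fun p => (hit (qtarget j) p)%:R) ord0.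
    have -> : phi j = (fun p => 1 + (-1) * (hit (qtarget j) p)%:R).
      by apply/funext => p; rewrite mulN1r.
    by rewrite iterE_add iterE_const iterE_mul mulN1r.
  apply/eqP; rewrite eq_le e subr_le0 hj /= -e.
  rewrite -(iterE_const sg nv 0 ([::], ord0)); apply: le_iterE => p.
  by rewrite /phi; case: (hit _ _); rewrite ?subrr ?subr0.
have en s a : enabled qmdp s a by apply/eqP/qtr_sum.
have [sg E0] := @sure_of_win R _ _ qmdp qgoal en nv ord0 w.
exists (fun=> sg) => j /=; rewrite big_ord1 rmorph1 mul1r PrE.
apply: (@le_trans _ _ (Ex sg nv (fun p => (~~ qgoal p)%:R + (qgoal p)%:R) ord0)).
  rewrite -[leLHS](iterE_const sg nv 1 ([::], ord0)); apply: le_iterE => p.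
  by case: (qgoal p); rewrite ?addr0 ?add0r.
rewrite /Ex iterE_add [X in X + _]E0 add0r; apply: le_iterE => p.
by have [/forallP/(_ j) -> //|_] := boolP (qgoal p); rewrite ler0n.
Qed.

End quantified.
Local Close Scope ring_scope.
Local Open Scope nat_scope.

(** * Savitch's game for space-bounded machines *)

Section savitch.
Variables (al W0 K : nat) (init : nat -> nat) (F : nat -> nat -> nat -> nat -> nat -> nat)
  (acc : nat -> bool).
Local Notation sy := al.+2.
Local Notation W := W0.+1.
Hypothesis init_lt : forall p, init p < sy.
Hypothesis F_lt : forall c a b d e, F c a b d e < sy.

Definition cellv g p := (g * W.+1 + p).+1.
(** This is variable [(g + 1) * (W + 1)], so the coins are exactly the nonzero multiples of the
    block length. Variable 0 lies outside the blocks and has the value 0 of the initial state. *)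
Definition coinv g := cellv g W.
Definition coin_var v := (W.+1 %| v) && (v != 0).

Definition stepc (c : seq nat) : seq nat :=
  [seq F (minn p 2) (nth 0 c 0) (nth 0 c p.-1) (nth 0 c p) (nth 0 c p.+1) | p <- iota 0 W].
Definition initc : seq nat := [seq init p | p <- iota 0 W].

(** Blocks [0, ..., K.-1] hold the midpoints guessed in Savitch's recursion, each with a coin
    that selects the half to be checked; blocks [K] and [K.+1] hold the endpoints of the
    single step that remains. *)
Definition clA j p a : seq (nat * nat * bool) :=
  (coinv j, 0, true) :: [seq (coinv j', 1, true) | j' <- iota j.+1 (K - j.+1)] ++
  [:: (cellv j p, a, false); (cellv K p, a, true)].
Definition clB j p a : seq (nat * nat * bool) :=
  (coinv j, 1, true) :: [seq (coinv j', 0, true) | j' <- iota j.+1 (K - j.+1)] ++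
  [:: (cellv j p, a, false); (cellv K.+1 p, a, true)].
Definition clI p : seq (nat * nat * bool) :=
  [seq (coinv j, 1, true) | j <- iota 0 K] ++ [:: (cellv K p, init p, true)].
Definition clF : seq (nat * nat * bool) :=
  [seq (coinv j, 0, true) | j <- iota 0 K] ++
  [seq (cellv K.+1 0, a, true) | a <- iota 0 sy & acc a].
(** Beyond the right border [stepc] reads the default 0 of [nth]; variable 0, whose value is 0,
    stands in for the missing neighbour. *)
Definition clS p a0 a1 a2 a3 : seq (nat * nat * bool) :=
  [:: (cellv K 0, a0, false); (cellv K p.-1, a1, false); (cellv K p, a2, false);
      (if p.+1 < W then cellv K p.+1 else 0, a3, false);
      (cellv K.+1 p, F (minn p 2) a0 a1 a2 a3, true)].

Definition cls1 : seq (seq (nat * nat * bool)) :=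
  [seq clI p | p <- iota 0 W] ++
  flatten [seq flatten [seq flatten [seq [:: clA j p a; clB j p a] | a <- iota 0 sy]
    | p <- iota 0 W] | j <- iota 0 K] ++
  flatten [seq flatten [seq flatten [seq flatten [seq [seq clS p a0 a1 a2 a3
    | a3 <- iota 0 sy] | a2 <- iota 0 sy] | a1 <- iota 0 sy] | a0 <- iota 0 sy] | p <- iota 0 W].

Definition wordh (h : seq (seq nat)) : seq nat := 0 :: flatten h.
Definition goodb (b : seq nat) : bool :=
  [&& size b == W.+1, all (fun a => a < sy) b & nth 0 b W < 2].
Definition goodc (c : seq nat) : bool := (size c == W) && all (fun a => a < sy) c.

(** The last coin that selects a second half fixes where the segment under test starts, the last
    coin that selects a first half where it ends. Without such a coin the segment starts in the
    initial configuration, respectively must end in an accepting one, which is the case [None] of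
    [Bh]. *)
Definition Ah (h : seq (seq nat)) : seq nat :=
  foldl (fun A b => if nth 0 b W == 1 then take W b else A) initc h.
Definition Bh (h : seq (seq nat)) : option (seq nat) :=
  foldl (fun A b => if nth 0 b W == 0 then Some (take W b) else A) None h.
Definition reach n (A : seq nat) (o : option (seq nat)) : Prop :=
  if o is Some B then iter n stepc A = B else acc (nth 0 (iter n stepc A) 0).

Local Notation Q := (Qg al coin_var clF cls1).

Lemma size_flatten_blocks n (h : seq (seq nat)) :
  all (fun b => size b == n) h -> size (flatten h) = size h * n.
Proof. by elim: h => //= b h IH /andP[/eqP sb /IH e]; rewrite size_cat sb e mulSn. Qed.

Lemma nth_flatten_blocks n (h : seq (seq nat)) g r :
  all (fun b => size b == n) h -> r < n -> g < size h ->
  nth 0 (flatten h) (g * n + r) = nth 0 (nth [::] h g) r.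
Proof.
elim: h g => //= b h IH [|g] /andP[/eqP sb sh] rn gh; rewrite nth_cat sb.
  by rewrite mul0n add0n rn.
by rewrite mulSn -addnA ltnNge leq_addr /= addKn IH.
Qed.

Lemma Q_cells j k w : (forall i, i < j -> ~~ coin_var (size w + i)) ->
  Q (j + k) w <-> exists u, [/\ size u = j, all (fun a => a < sy) u & Q k (w ++ u)].
Proof.
elim: j w => [|j IH] w nc.
  split=> [q|[u [/size0nil -> _]]]; last by rewrite cats0.
  by exists [::]; rewrite cats0.
have nc' a i : i < j -> ~~ coin_var (size (rcons w a) + i).
  by move=> ij; rewrite size_rcons addSnnS; exact: nc.
have := nc 0 isT; rewrite addn0 addSn /= => /negbTE ->.
split=> [[a [asy /(IH _ (nc' a))[u [su au qu]]]]|[[|a u] [//= [su] /andP[asy au] qu]]].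
  by exists (a :: u); rewrite /= su asy au -cat_rcons.
by exists a; split=> //; apply/(IH _ (nc' a)); exists u; rewrite cat_rcons.
Qed.

(** Cells and coin are quantified in this order: the midpoint has to be announced before the coin
    reveals which half will be checked. *)
Lemma Q_block k h : all goodb h ->
  Q (W.+1 + k) (wordh h) <->
  exists u, goodc u /\ forall b, b < 2 -> Q k (wordh (rcons h (rcons u b))).
Proof.
move=> gh; have sh : size (wordh h) = (size h * W.+1).+1.
  by rewrite /= (@size_flatten_blocks W.+1) //; apply: sub_all gh => b /andP[].
have coinE i : i <= W -> coin_var (size (wordh h) + i) = (i == W).
  move=> iW; rewrite /coin_var sh addSnnS dvdn_addr ?dvdn_mull // addnS andbT.
  apply/idP/eqP => [|->]; last exact: dvdnn.
  by move=> /(dvdn_leq (ltn0Sn i)) Wi; apply/eqP; rewrite eqn_leq iW -ltnS.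
rewrite addSnnS Q_cells; last by move=> i iW; rewrite coinE ?(ltnW iW) // ltn_eqF.
have QS u : size u = W -> Q k.+1 (wordh h ++ u) <->
    forall b, b < 2 -> Q k (wordh (rcons h (rcons u b))).
  move=> su; have cW : coin_var (size (wordh h ++ u)).
    by rewrite size_cat su coinE.
  rewrite [Q k.+1 _]/= [in X in X <-> _]/=; move: cW => /= ->.
  have e b : wordh (rcons h (rcons u b)) = rcons (wordh h ++ u) b.
    by rewrite /wordh -cats1 flatten_cat /= cats0 -[in LHS]cats1 catA cats1.
  by split=> q b /q; rewrite e.
split=> [[u [su au /(QS u su) qu]]|[u [/andP[/eqP su au] qu]]].
  by exists u; rewrite /goodc su eqxx.
by exists u; split=> //; exact/QS.
Qed.

(** Brings the folds [Ah] and [Bh] into the form of the clauses, each of which speaks of a block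
    followed by no block with the same coin. *)
Lemma foldl_last (T : Type) (c : seq nat -> bool) (g : seq nat -> T) (i : T) h (P : T -> Prop) :
  P (foldl (fun X b => if c b then g b else X) i h) <->
  ((forall j, j < size h -> c (nth [::] h j) ->
      (forall j', j < j' < size h -> ~~ c (nth [::] h j')) -> P (g (nth [::] h j))) /\
   ((forall j, j < size h -> ~~ c (nth [::] h j)) -> P i)).
Proof.
elim/last_ind: h => [|h b IH].
  by split=> [Pi|[_ Pi]]; [split=> // |exact: Pi].
have lt j : (j < (size h).+1) = (j < size h) || (j == size h) by rewrite ltnS leq_eqVlt orbC.
rewrite foldl_rcons; case: ifPn => cb.
  split=> [Pb|[h1 _]]; last first.
    have := h1 (size h); rewrite size_rcons nth_rcons ltnn eqxx; apply=> // j' /andP[a].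
    by rewrite ltnS leqNgt a.
  split=> [j|no]; last by have := no (size h); rewrite size_rcons nth_rcons ltnn eqxx cb => /(_ (ltnSn _)).
  rewrite size_rcons lt => /orP[jh|/eqP ->]; last by rewrite nth_rcons ltnn eqxx.
  move=> _ /(_ (size h)); rewrite jh ltnSn nth_rcons ltnn eqxx cb => /(_ isT) //.
rewrite {}IH; split=> [[h1 h2]|[h1 h2]]; split.
- move=> j; rewrite size_rcons lt => /orP[jh|/eqP ->]; last first.
    by rewrite nth_rcons ltnn eqxx (negbTE cb).
  rewrite nth_rcons jh => cj no; apply: h1 => // j' /andP[jj' j'h].
  by have := no j'; rewrite nth_rcons j'h jj' ltnS (ltnW j'h); apply.
- move=> no; apply: h2 => j jh; have := no j; rewrite size_rcons nth_rcons jh; apply.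
  exact: ltnW.
- move=> j jh cj no; have := h1 j; rewrite size_rcons nth_rcons jh; apply=> //.
    exact: ltnW.
  move=> j' /andP[jj']; rewrite ltnS leq_eqVlt => /orP[/eqP ->|j'h].
    by rewrite nth_rcons ltnn eqxx.
  by rewrite nth_rcons j'h; apply: no; rewrite jj'.
- move=> no; apply: h2 => j; rewrite size_rcons lt => /orP[jh|/eqP ->].
    by rewrite nth_rcons jh no.
  by rewrite nth_rcons ltnn eqxx.
Qed.

Section final.
Variables (h : seq (seq nat)) (A B : seq nat) (x y : nat).
Hypotheses (sh : size h = K) (gh : all goodb h) (gA : goodc A) (gB : goodc B).
Let w := wordh (rcons (rcons h (rcons A x)) (rcons B y)).

Lemma val_cell g p : p < W.+1 -> g < K.+2 ->
  cellv g p < size w /\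
  nth 0 w (cellv g p) = nth 0 (nth [::] (rcons (rcons h (rcons A x)) (rcons B y)) g) p.
Proof.
move=> pW gK.
have bl : all (fun b => size b == W.+1) (rcons (rcons h (rcons A x)) (rcons B y)).
  rewrite !all_rcons !size_rcons; have /andP[/eqP -> _] := gA; have /andP[/eqP -> _] := gB.
  by rewrite eqxx /=; apply: sub_all gh => b /andP[].
have sz : size (rcons (rcons h (rcons A x)) (rcons B y)) = K.+2 by rewrite !size_rcons sh.
split; last by rewrite /w /= (@nth_flatten_blocks W.+1) // sz.
rewrite /w /= (size_flatten_blocks bl) sz ltnS.
apply: (@leq_trans (g.+1 * W.+1)); first by rewrite /cellv mulSn addnC ltn_add2r.
by rewrite leq_mul2r gK orbT.
Qed.

(** Read as implications, [clI] and [clA] determine [A], [clF] and [clB] constrain [B], and [clS] is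
    the local transition rule. *)
Lemma sat_final : sat clF cls1 w <->
  [/\ A = Ah h, if Bh h is Some b then B = b else acc (nth 0 B 0) & B = stepc A].
Proof.
have hA p : p < W -> nth 0 (nth [::] (rcons (rcons h (rcons A x)) (rcons B y)) K) p = nth 0 A p.
  move=> pW; rewrite nth_rcons size_rcons sh ltnSn nth_rcons sh ltnn eqxx nth_rcons.
  by have /andP[/eqP -> _] := gA; rewrite pW.
have hB p : p < W -> nth 0 (nth [::] (rcons (rcons h (rcons A x)) (rcons B y)) K.+1) p = nth 0 B p.
  move=> pW; rewrite nth_rcons size_rcons sh ltnn eqxx nth_rcons.
  by have /andP[/eqP -> _] := gB; rewrite pW.
have hj j : j < K -> nth [::] (rcons (rcons h (rcons A x)) (rcons B y)) j = nth [::] h j.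
  by move=> jK; rewrite nth_rcons size_rcons sh (leqW jK) nth_rcons sh jK.
pose lit (l : nat * nat * bool) := (l.1.1 < size w) && (l.2 == (l.1.2 == nth 0 w l.1.1)).
pose bif (b c : bool) := if b then c else ~~ c.
have bifE b c : (b == c) = bif b c by case: b; case: c.
have coinE j a b : j < K -> lit (coinv j, a, b) = bif b (a == nth 0 (nth [::] h j) W).
  move=> jK; have [lt e] := @val_cell j W (ltnSn _) (leqW (leqW jK)).
  by rewrite -[lit _]/((cellv j W < size w) && (b == (a == nth 0 w (cellv j W)))) lt e hj // bifE.
have cellE j p a b : j < K -> p < W -> lit (cellv j p, a, b) = bif b (a == nth 0 (nth [::] h j) p).
  move=> jK pW; have [lt e] := @val_cell j p (leqW pW) (leqW (leqW jK)).
  by rewrite -[lit _]/((cellv j p < size w) && (b == (a == nth 0 w (cellv j p)))) lt e hj // bifE.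
have cAE p a b : p < W -> lit (cellv K p, a, b) = bif b (a == nth 0 A p).
  by move=> pW; have [lt e] := @val_cell K p (leqW pW) (leqnSn _); rewrite -[lit _]/((cellv K p < size w) && (b == (a == nth 0 w (cellv K p)))) lt e hA // bifE.
have cBE p a b : p < W -> lit (cellv K.+1 p, a, b) = bif b (a == nth 0 B p).
  move=> pW; have [lt e] := @val_cell K.+1 p (leqW pW) (ltnSn _).
  by rewrite -[lit _]/((cellv K.+1 p < size w) && (b == (a == nth 0 w (cellv K.+1 p)))) lt e hB // bifE.
have eqA u : size u = W -> A = u <-> forall p, p < W -> nth 0 A p = nth 0 u p.
  move=> su; split=> [->//|e]; apply: (eq_from_nth (x0 := 0)).
    by have /andP[/eqP -> _] := gA.
  by have /andP[/eqP -> _] := gA; exact: e.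
have eqB u : size u = W -> B = u <-> forall p, p < W -> nth 0 B p = nth 0 u p.
  move=> su; split=> [->//|e]; apply: (eq_from_nth (x0 := 0)).
    by have /andP[/eqP -> _] := gB.
  by have /andP[/eqP -> _] := gB; exact: e.
have ltA p : nth 0 A p < sy.
  have [pA|pA] := ltnP p (size A); last by rewrite nth_default.
  by have /andP[_ /allP] := gA; apply; exact: mem_nth.
have ltB p : nth 0 B p < sy.
  have [pA|pA] := ltnP p (size B); last by rewrite nth_default.
  by have /andP[_ /allP] := gB; apply; exact: mem_nth.
have gj j : j < K -> goodb (nth [::] h j) by rewrite -sh => jK; exact: (allP gh _ (mem_nth _ jK)).
have lth j p : j < K -> p < W -> nth 0 (nth [::] h j) p < sy.
  move=> jK pW; have /and3P[/eqP sb /allP ab _] := gj _ jK; apply: ab; apply: mem_nth.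
  by rewrite sb ltnW.
have coin2 j : j < K -> nth 0 (nth [::] h j) W < 2 by move=> /gj/and3P[].
have tk j p : p < W -> nth 0 (take W (nth [::] h j)) p = nth 0 (nth [::] h j) p.
  by move=> pW; rewrite nth_take.
have stk j : j < K -> size (take W (nth [::] h j)) = W.
  by move=> /gj/and3P[/eqP sb _ _]; rewrite size_takel // sb.
have sI : size initc = W by rewrite size_map size_iota.
have flE (T : Type) (f : T -> seq (seq (nat * nat * bool))) s P :
    all P (flatten [seq f i | i <- s]) = all (fun i => all P (f i)) s.
  by elim: s => //= z s IH; rewrite all_cat IH.
have ioP n (P : pred nat) : reflect (forall i, i < n -> P i) (all P (iota 0 n)).
  by apply: (iffP allP) => [h1 i i_n|h1 i]; [apply: h1; rewrite mem_iota|rewrite mem_iota => /h1].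
have satE : sat clF cls1 w <-> [/\ has lit clF,
   (forall p, p < W -> has lit (clI p)),
   (forall j p a, j < K -> p < W -> a < sy -> has lit (clA j p a) /\ has lit (clB j p a)) &
   (forall p a0 a1 a2 a3, p < W -> a0 < sy -> a1 < sy -> a2 < sy -> a3 < sy ->
      has lit (clS p a0 a1 a2 a3))].
  have -> : sat clF cls1 w = has lit clF && all (has lit) cls1 by [].
  have := ioP W; have := ioP sy; rewrite /cls1; move: (iota 0 W) (iota 0 sy) => IW IS SP WP.
  rewrite !all_cat !flE all_map; split.
    move=> /and4P[hF /WP hI /ioP h1 /WP h2]; split=> //.
      move=> j p a jK pW asy; have := h1 j jK; rewrite flE => /WP/(_ p pW).
      by rewrite flE => /SP/(_ a asy)/and3P[].
    move=> p a0 a1 a2 a3 pW l0 l1 l2 l3; have := h2 p pW.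
    rewrite flE => /SP/(_ a0 l0); rewrite flE => /SP/(_ a1 l1); rewrite flE => /SP/(_ a2 l2).
    by rewrite all_map => /SP/(_ a3 l3).
  move=> [-> hI hAB hS] /=; apply/and3P; split; first exact/WP.
    apply/ioP => j jK; rewrite flE; apply/WP => p pW; rewrite flE; apply/SP => a asy.
    by have [h1 h2] := hAB j p a jK pW asy; apply/andP; split=> //; apply/andP; split.
  apply/WP => p pW; rewrite flE; apply/SP => a0 l0; rewrite flE; apply/SP => a1 l1.
  by rewrite flE; apply/SP => a2 l2; rewrite all_map; apply/SP => a3 l3; exact: hS.
have lt2 n : n < 2 -> (n == 0) || (n == 1) by case: n => [|[|]].
have hasc a (P : pred nat) (s : seq nat) : (forall j, j \in s -> j < K) ->
    has lit [seq (coinv j, a, true) | j <- s] = has (fun j => a == nth 0 (nth [::] h j) W) s.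
  move=> sK; rewrite has_map; apply: eq_in_has => j /sK jK /=.
  by rewrite coinE.
have iK j : j \in iota 0 K -> j < K by rewrite mem_iota.
have iK' j0 j : j0 < K -> j \in iota j0.+1 (K - j0.+1) -> j0 < j < K.
  by rewrite mem_iota => jK; rewrite subnKC.
have iK'' j0 j : j0 < K -> j \in iota j0.+1 (K - j0.+1) -> j < K.
  by move=> jK /(iK' _ _ jK)/andP[].
have PA : A = Ah h <-> _ := foldl_last (fun b => nth 0 b W == 1) (take W) initc h (fun X => A = X).
have PB : (if Bh h is Some b then B = b else acc (nth 0 B 0)) <-> _ :=
  foldl_last (fun b => nth 0 b W == 0) (fun b => Some (take W b)) None h
    (fun o => if o is Some b then B = b else acc (nth 0 B 0)).
rewrite satE; split=> [[hF hI hAB hS]|[eA eB eS]].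
  split.
  - apply/PA; rewrite sh; split=> [j jK cj no|no].
      apply/eqA => [|p pW]; first exact: stk.
      have [+ _] := hAB j p (nth 0 (nth [::] h j) p) jK pW (lth _ _ jK pW).
      rewrite /clA /= has_cat coinE // hasc //; last by move=> j'; exact: iK''.
      rewrite (eqP cj) /= => /orP[/hasP[j' /(iK' _ _ jK) jj' /eqP c1]|].
        by have := no _ jj'; rewrite -c1.
      by rewrite orbF cellE // cAE // eqxx /= => /eqP <-; rewrite tk.
    apply/eqA => // p pW; have := hI p pW; rewrite /clI has_cat hasc //.
    move=> /orP[/hasP[j /iK jK /eqP c1]|]; first by have := no j jK; rewrite -c1.
    by rewrite /= orbF cAE // => /eqP <-; rewrite (nth_map 0) ?size_iota // nth_iota.
  - apply/PB; rewrite sh; split=> [j jK cj no|no].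
      apply/eqB => [|p pW]; first exact: stk.
      have [_] := hAB j p (nth 0 (nth [::] h j) p) jK pW (lth _ _ jK pW).
      rewrite /clB /= has_cat coinE // hasc //; last by move=> j'; exact: iK''.
      rewrite (eqP cj) /= => /orP[/hasP[j' /(iK' _ _ jK) jj' /eqP c1]|].
        by have := no _ jj'; rewrite -c1.
      by rewrite orbF cellE // cBE // eqxx /= => /eqP <-; rewrite tk.
    move: hF; rewrite /clF has_cat hasc //.
    move=> /orP[/hasP[j /iK jK /eqP c1]|]; first by have := no j jK; rewrite -c1.
    rewrite has_map => /hasP[a]; rewrite mem_filter => /andP[aa _] /=.
    by rewrite cBE // => /eqP <-.
  - apply/eqB => [|p pW]; first by rewrite size_map size_iota.
    rewrite (nth_map 0) ?size_iota // nth_iota // add0n.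
    have := hS p (nth 0 A 0) (nth 0 A p.-1) (nth 0 A p) (nth 0 A p.+1) pW (ltA _) (ltA _) (ltA _) (ltA _).
    have pW' : p.-1 < W by apply: leq_ltn_trans pW; exact: leq_pred.
    rewrite /clS /= !cAE // cBE // !eqxx /= orbF.
    case: ltnP => pS; first by rewrite cAE // eqxx /= => /eqP ->.
    rewrite /lit /= [nth 0 A p.+1]nth_default; last by have /andP[/eqP -> _] := gA.
    by rewrite bifE eqxx /= => /eqP ->.
have [a1 a2] := PA.1 eA; have [b1 b2] := PB.1 eB; rewrite sh in a1 a2 b1 b2.
split.
- rewrite /clF has_cat hasc //; have [//|no] := boolP (has _ _); rewrite orFb has_map.
  apply/hasP; exists (nth 0 B 0); last by rewrite /= cBE // eqxx.
  have lB : nth 0 B 0 \in iota 0 sy by rewrite mem_iota /= add0n ltB.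
  rewrite mem_filter lB andbT; apply: b2 => j jK.
  by move/hasPn: no => /(_ j); rewrite mem_iota eq_sym; apply.
- move=> p pW; rewrite /clI has_cat hasc //; have [//|no] := boolP (has _ _).
  rewrite /= orbF cAE // a2 ?(nth_map 0) ?size_iota // ?nth_iota // ?eqxx // => j jK.
  by move/hasPn: no => /(_ j); rewrite mem_iota eq_sym; apply.
- move=> j p a jK pW asy; split.
    rewrite /clA /= has_cat coinE // hasc //; last by move=> j'; exact: iK''.
    case: eqP => [//|/eqP c0]; have [//|no] := boolP (has _ _); rewrite /= orbF cellE // cAE //.
    rewrite (a1 j jK) ?tk //; first by case: (_ == _).
      by have /orP[] := lt2 _ (coin2 _ jK); rewrite // eq_sym (negbTE c0).
    move=> j' jj'; move/hasPn: no => /(_ j'); rewrite eq_sym; apply.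
    by rewrite mem_iota subnKC.
  rewrite /clB /= has_cat coinE // hasc //; last by move=> j'; exact: iK''.
  case: eqP => [//|/eqP c0]; have [//|no] := boolP (has _ _); rewrite /= orbF cellE // cBE //.
  rewrite (b1 j jK) ?tk //; first by case: (_ == _).
    by have /orP[] := lt2 _ (coin2 _ jK); rewrite // => /eqP c1; rewrite c1 in c0.
  move=> j' jj'; move/hasPn: no => /(_ j'); rewrite eq_sym; apply.
  by rewrite mem_iota subnKC.
- move=> p x0 x1 x2 x3 pW l0 l1 l2 l3.
  have pW' : p.-1 < W by apply: leq_ltn_trans pW; exact: leq_pred.
  rewrite /clS /= !cAE // cBE // orbF.
  case: eqP => //= ->; case: eqP => //= ->; case: eqP => //= ->.
  have -> : lit (if p.+1 < W then cellv K p.+1 else 0, x3, false) = (x3 != nth 0 A p.+1).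
    case: ltnP => pS; first by rewrite cAE.
    by rewrite /lit /= [nth 0 A p.+1]nth_default; [rewrite bifE|have /andP[/eqP -> _] := gA].
  case: eqP => //= ->.
  by rewrite eS (nth_map 0) ?size_iota // nth_iota // add0n eqxx.
Qed.
End final.

Theorem savitch_game : Q ((K + 2) * W.+1) [:: 0] <-> acc (nth 0 (iter (2 ^ K) stepc initc) 0).
Proof.
have gI : goodc initc.
  by rewrite /goodc size_map size_iota eqxx; apply/allP => a /mapP[p _ ->].
have gS c : goodc (stepc c).
  by rewrite /goodc size_map size_iota eqxx; apply/allP => a /mapP[p _ ->].
(* Generalised to positions of the game: after the blocks [hs] there remain [d] midpoints, and the
   segment under test has length [2 ^ d]. *)
suff h d hs : size hs + d = K -> all goodb hs ->
    Q ((d + 2) * W.+1) (wordh hs) <-> reach (2 ^ d) (Ah hs) (Bh hs) by exact: (h K [::]).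
elim: d hs => [|d IH] hs shd gh.
  rewrite addn0 in shd; rewrite -[(0 + 2) * W.+1]/(W.+1 + (W.+1 + 0)) Q_block //.
  have gb u b : goodc u -> b < 2 -> goodb (rcons u b).
    move=> /andP[/eqP su au] b2; rewrite /goodb size_rcons su eqxx all_rcons au nth_rcons su.
    by rewrite ltnn eqxx b2 !andbT; exact: leq_trans b2 _.
  have gAh : goodc (Ah hs).
    rewrite /Ah; apply/(foldl_last _ _ _ _ (fun c => goodc c)); split=> // j jh _ _.
    have /and3P[/eqP sb ab _] := allP gh _ (mem_nth [::] jh).
    rewrite /goodc size_takel ?sb // eqxx; apply/allP => a /mem_take; exact: (allP ab).
  have gr A b : goodc A -> b < 2 -> all goodb (rcons hs (rcons A b)).
    by move=> gA b2; rewrite all_rcons gb.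
  split=> [[A [gA /(_ 0 isT)]]|r].
    (* The last two blocks are the endpoints of a single step; it is enough to follow the branch in
       which their coins are 0. *)
    rewrite Q_block ?gr // => -[B [gB /(_ 0 isT)]].
    move=> /(sat_final _ _ shd gh gA gB)[eA eB eS].
    by move: eB; rewrite /reach expn0 -[iter 1 _ _]/(stepc _) -eA -eS.
  exists (Ah hs); split=> // b b2; rewrite Q_block ?gr //.
  exists (stepc (Ah hs)); split=> // b' b'2.
  apply/(sat_final _ _ shd gh gAh (gS _)); split=> //.
rewrite -[(d.+1 + 2) * W.+1]/(W.+1 + (d + 2) * W.+1) Q_block //.
have step u b : goodc u -> b < 2 -> Q ((d + 2) * W.+1) (wordh (rcons hs (rcons u b))) <->
    reach (2 ^ d) (if b == 1 then u else Ah hs) (if b == 0 then Some u else Bh hs).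
  move=> gu b2; have /andP[/eqP su au] := gu.
  have gr : all goodb (rcons hs (rcons u b)).
    rewrite all_rcons gh /goodb size_rcons su eqxx all_rcons au nth_rcons su ltnn eqxx b2 !andbT.
    exact: leq_trans b2 _.
  rewrite IH ?size_rcons ?addSnnS //.
  rewrite /Ah /Bh !foldl_rcons nth_rcons su ltnn eqxx -cats1 take_size_cat //.
have dbl (A : seq nat) : iter (2 ^ d.+1) stepc A = iter (2 ^ d) stepc (iter (2 ^ d) stepc A).
  by rewrite expnS mul2n -addnn iterD.
split=> [[u [gu q]]|r].
  have /= e0 := (step u 0 gu isT).1 (q 0 isT); have /= := (step u 1 gu isT).1 (q 1 isT).
  by rewrite /reach dbl; case: (Bh hs) => [B|]; rewrite -e0.
(* The true midpoint of the run. *)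
exists (iter (2 ^ d) stepc (Ah hs)).
have gu : goodc (iter (2 ^ d) stepc (Ah hs)).
  by rewrite -(prednK (expn_gt0 2 d)) iterS.
split=> // -[|[|//]] b2; apply/step => //=.
by move: r; rewrite /reach dbl.
Qed.

End savitch.

(** * Finite orbits *)

Section orbit.
Variables (n m : nat) (f : seq nat -> seq nat).
Let good (c : seq nat) := (size c == n) && all (fun a => a < m.+1) c.
Hypothesis f_good : forall c, good c -> good (f c).

(** A machine that decides in bounded space comes with no time bound; by finiteness of the
    configurations whatever it reaches is reached within their number of steps. *)
Lemma iter_short c t : good c -> exists2 t', t' <= m.+1 ^ n & iter t' f c = iter t f c.
Proof.
move=> gc; pose dec (w : n.-tuple 'I_m.+1) : seq nat := [seq val i | i <- w].
have codP d : good d -> exists w, dec w = d.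
  move=> /andP[/eqP sd /allP ad].
  have sz : size [seq (inord i : 'I_m.+1) | i <- d] == n by rewrite size_map sd.
  exists (Tuple sz); rewrite /dec /= -map_comp; apply: map_id_in => i /ad id.
  by rewrite /= inordK.
have dec_inj : injective dec by move=> u v /(inj_map val_inj) /val_inj.
have gdec w : good (dec w).
  by rewrite /good size_map size_tuple eqxx; apply/allP => _ /mapP[i _ ->]; exact: ltn_ord.
pose g w := projT1 (cid (codP _ (f_good (gdec w)))).
have gE w : dec (g w) = f (dec w) by rewrite /g; case: cid.
have [w wc] := codP _ gc.
have it k : dec (iter k g w) = iter k f c by elim: k => //= k IH; rewrite gE IH.
have con : fconnect g w (iter t g w) by exact: fconnect_iter.
exists (findex g w (iter t g w)); last by rewrite -!it iter_findex.
apply: leq_trans (ltnW (findex_max con)) _; apply: leq_trans (max_card _) _.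
by rewrite card_tuple card_ord.
Qed.

End orbit.

(** * Configurations as words with a local transition rule *)

Section tm_cells.
Variable M : tm.

(** All tapes are folded at their heads and laid on top of each other. The heads then never move: a
    head movement shifts the tape contents by one column, which is a local rule. *)
Definition column : finType :=
  (tm_state M * {ffun 'I_(tm_ntapes M).+1 -> tm_symbol M * tm_symbol M})%type.
Definition blank_col : column := (tm_start M, [ffun=> (None, None)]).
(** Code 0 has to stand for the blank column, since 0 is what [nth 0] returns outside the window;
    proper codes start at 1. *)
Definition dec (n : nat) : column := if n is n'.+1 then nth blank_col (enum column) n' else blank_col.
Definition cod (x : column) : nat := (enum_rank x).+1.
Local Notation al := #|column|.

Lemma codK x : dec (cod x) = x.
Proof. by rewrite /dec /cod nth_enum_rank. Qed.

Lemma cod_lt x : cod x < al.+2.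
Proof. by rewrite /cod ltnS; exact: leqW (ltn_ord _). Qed.

(** Column 0 holds the state and the scanned symbols, column [r.+1] the symbols at distance
    [r.+1] to the left and to the right of the heads. *)
Definition col (c : config M) (r : nat) : column :=
  if r is r'.+1 then
    (tm_start M, [ffun i => (nth None (tape_left (c.2 i)) r', nth None (tape_right (c.2 i)) r')])
  else (c.1, [ffun i => (scanned (c.2 i), scanned (c.2 i))]).

Definition stepcol (pc : nat) (c0 cl c cr : column) : column :=
  if tm_halting c0.1 then c else
  let: (q, a) := tm_delta c0.1 [ffun i => (c0.2 i).1] in
  match pc with
  | 0 => (q, [ffun i => let s := match (a i).2 with
      | GoLeft => (cr.2 i).1 | GoRight => (cr.2 i).2 | Stay => (a i).1 end in (s, s)])
  | 1 => (tm_start M, [ffun i => match (a i).2 with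
      | GoLeft => ((cr.2 i).1, (a i).1) | GoRight => ((a i).1, (cr.2 i).2)
      | Stay => c.2 i end])
  | _ => (tm_start M, [ffun i => match (a i).2 with
      | GoLeft => ((cr.2 i).1, (cl.2 i).2) | GoRight => ((cl.2 i).1, (cr.2 i).2)
      | Stay => c.2 i end])
  end.

Lemma col_step c p :
  col (tm_step c) p = stepcol (minn p 2) (col c 0) (col c p.-1) (col c p) (col c p.+1).
Proof.
have hd (A : Type) (d : A) s : head d s = nth d s 0 by case: s.
have bh (A : Type) (d : A) s k : nth d (behead s) k = nth d s k.+1 by case: s => //=; rewrite nth_nil.
rewrite /stepcol /tm_step /halted /=; case: ifP => // _.
have -> : [ffun i => ([ffun i0 => (scanned (c.2 i0), scanned (c.2 i0))] i).1] =
          [ffun i => scanned (c.2 i)] by apply/ffunP => i; rewrite !ffunE.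
case: (tm_delta _ _) => q a; case: p => [|[|p]] /=; congr pair; apply/ffunP => i;
  rewrite !ffunE /=; by case: (a i).2 => /=; rewrite ?hd ?bh.
Qed.

Definition cellF pc a0 a1 a2 a3 : nat := cod (stepcol pc (dec a0) (dec a1) (dec a2) (dec a3)).
Definition cell_acc (a : nat) : bool := tm_accepting (dec a).1.
Definition cell_init (x : seq bool) (p : nat) : nat := cod (col (tm_init M x) p).

Section window.
Variable W0 : nat.
Local Notation W := W0.+1.
Definition wordc (c : config M) : seq nat := [seq cod (col c p) | p <- iota 0 W].

Lemma dec_wordc c p : tm_space c <= W0 -> dec (nth 0 (wordc c) p) = col c p.
Proof.
move=> sc; have [pW|Wp] := ltnP p W.
  by rewrite (nth_map 0) ?size_iota // nth_iota // codK.
rewrite nth_default ?size_map ?size_iota //=; case: p Wp => // p; rewrite ltnS => Wp.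
congr pair; apply/ffunP => i; rewrite !ffunE.
have : tape_size (c.2 i) <= p.
  by apply: leq_trans Wp; apply: leq_trans sc; rewrite /tm_space (bigD1 i) //= leq_addr.
by rewrite /tape_size => le; rewrite !nth_default //; apply: leq_trans le; apply: leqW;
  rewrite ?leq_addr ?leq_addl.
Qed.

Lemma stepc_wordc c : tm_space c <= W0 -> stepc W0 cellF (wordc c) = wordc (tm_step c).
Proof.
move=> sc; apply/eq_map => p; rewrite /cellF !dec_wordc // col_step //.
Qed.

Lemma iter_wordc x t : (forall t', tm_space (tm_run M x t') <= W0) ->
  iter t (stepc W0 cellF) (initc W0 (cell_init x)) = wordc (tm_run M x t).
Proof. by move=> sc; elim: t => //= t ->; rewrite stepc_wordc. Qed.

Lemma halted_run (c : config M) t : halted c -> iter t (@tm_step M) c = c.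
Proof. by move=> h; elim: t => //= t ->; rewrite /tm_step h. Qed.

(** The exponent is chosen so that [2 ^ (sy * W)] exceeds the number [sy ^ W] of words over
    [sy = al + 2] letters. By then the machine has halted, and from then on it stands still. *)
Lemma accepted_at (L : language) x t : (forall t', tm_space (tm_run M x t') <= W0) ->
  halted (tm_run M x t) -> (accepted (tm_run M x t) <-> L x) ->
  L x <-> cell_acc (nth 0 (iter (2 ^ (al.+2 * W)) (stepc W0 cellF) (initc W0 (cell_init x))) 0).
Proof.
move=> sc ht <-.
have [||t' t'W e] := @iter_short W al.+1 (stepc W0 cellF) _ (initc W0 (cell_init x)) t.
- move=> c _; rewrite /stepc size_map size_iota eqxx; apply/allP => a /mapP[p _ ->].
  exact: cod_lt.
- by rewrite /initc size_map size_iota eqxx; apply/allP => a /mapP[p _ ->]; exact: cod_lt.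
have st : (tm_run M x t').1 = (tm_run M x t).1.
  move: e; rewrite !iter_wordc // => /(congr1 (fun c => dec (nth 0 c 0))).
  by rewrite !dec_wordc //= => -[].
have t'K : t' <= 2 ^ (al.+2 * W).
  apply: leq_trans t'W _; rewrite expnM; apply: leq_exp_mono.
  exact: ltnW (ltn_expl _ (ltnSn 1)).
rewrite iter_wordc // /cell_acc dec_wordc //= /accepted -st.
have -> : tm_run M x (2 ^ (al.+2 * W)) = tm_run M x t'.
  rewrite /tm_run -(subnK t'K) iterD -/(tm_run M x t') halted_run //.
  by rewrite /halted st.
by [].
Qed.

End window.

(** An initial column depends on the input only through an optional bit and the test for position 0,
    so six constants describe all of them. *)
Definition opt_cell (z : bool) (o : option bool) : nat :=
  cod (if z then (tm_start M, [ffun i => if i == ord0 then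
         (omap inl o, omap inl o) else (None, None)])
       else (tm_start M, [ffun i => if i == ord0 then (None, omap inl o) else (None, None)])).

Lemma cell_initE x p : cell_init x p = opt_cell (p == 0) (onth x p).
Proof.
rewrite /cell_init /opt_cell; congr cod; case: p => [|p] /=; congr pair;
  apply/ffunP => i; rewrite !ffunE /=; case: eqP => _ //=.
- by case: x.
- congr pair; first by rewrite nth_nil.
  case: x => [|b x] /=; first by rewrite !nth_nil.
  by rewrite onthE /oapp; elim: x p => [|b' x IH] [|p] //=.
- by rewrite !nth_nil.
Qed.

End tm_cells.

(** * The code of the reduced instance and its computation *)

Lemma table_iota n (g : nat -> seq nat) :
  table (fun i : 'I_n => g i) = flatten [seq g i | i <- iota 0 n].
Proof. by rewrite /table -val_enum_ord -map_comp. Qed.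

Section query_code.
Variables (al nv : nat) (rnd : nat -> bool) (cl0 : seq (nat * nat * bool))
  (cls0 : seq (seq (nat * nat * bool))).
Local Notation sy := al.+2.
Local Notation NV := nv.+1.
Local Notation N := (NV * sy).

Definition qtr_code (i a i' : nat) : seq nat :=
  let v1 := (i %/ sy).+1 in
  if v1 == NV then [:: 0; nat_of_bool (i' == i); 1]
  else if rnd v1 then
    if (i' == v1 * sy) || (i' == (v1 * sy).+1) then [:: 0; 1; 2] else [:: 0; 0; 1]
  else [:: 0; nat_of_bool (i' == v1 * sy + a); 1].

Definition query_code (cls : seq (seq (nat * nat * bool))) : seq nat :=
  [:: N.-1; al.+1; size cls; 1; 1] ++
  flatten [seq flatten [seq flatten [seq qtr_code i a i' | i' <- iota 0 N] | a <- iota 0 sy]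
    | i <- iota 0 N] ++
  [seq 1 | _ <- cls] ++ flatten [seq [:: 0; 1; 1] | _ <- cls] ++
  flatten [seq [:: 0; 1; 1] | _ <- cls] ++ [seq 0 | _ <- cls] ++ [seq 0 | _ <- cls] ++
  flatten [seq [seq nat_of_bool (has (fun l => lit_at l (i %/ sy) (i %% sy)) cl)
    | i <- iota 0 N] | cl <- cls].

Lemma rat_code_bool (b : bool) : rat_code b%:R = [:: 0; nat_of_bool b; 1].
Proof. by case: b. Qed.

Lemma qtr_codeE i a i' : rat_code (qtr al nv rnd i a i') = qtr_code i a i'.
Proof.
rewrite /qtr /qtr_code; case: ifP => _; first exact: rat_code_bool.
case: ifP => _; last exact: rat_code_bool.
case: (i' =P (i %/ sy).+1 * sy) => [->|_].
  have /negbTE -> : (i %/ sy).+1 * sy != ((i %/ sy).+1 * sy).+1 by rewrite neq_ltn ltnSn.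
  by [].
by case: eqP.
Qed.

Lemma qcodeE : instance_code (qinst al nv rnd cl0 cls0) = query_code (cl0 :: cls0).
Proof.
have e0 n (g : 'I_1 -> 'I_n -> seq nat) : table (fun i => table (g i)) = table (g ord0).
  by rewrite {1}/table enum_ordSl enum_ord0 /= cats0.
have e1 (B : Type) (u : seq nat) (s : seq B) :
    table (fun _ : 'I_(size s) => u) = flatten [seq u | _ <- s].
  by rewrite (table_iota _ (fun=> u)); elim: s 0 => //= y s IH n; rewrite IH.
have e2 (B : Type) (u : nat) (s : seq B) : flatten [seq [:: u] | _ <- s] = [seq u | _ <- s].
  by elim: s => //= y s ->.
have cc (u u' v v' : seq nat) : u = u' -> v = v' -> u ++ v = u' ++ v' by move=> -> ->.
rewrite /instance_code /query_code !e0; apply: (cc) => //; apply: (cc).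
  rewrite -(table_iota N); congr table; apply/funext => i.
  rewrite -(table_iota sy); congr table; apply/funext => a.
  rewrite -(table_iota N); congr table; apply/funext => i'.
  exact: qtr_codeE.
apply: (cc); first exact: etrans (e1 _ _ _) (e2 _ _ _).
have e3 (B : Type) (s : seq B) :
    table (fun _ : 'I_(size s) => rat_code 1%R) = flatten [seq [:: 0; 1; 1] | _ <- s].
  by rewrite e1 -[1%R]/((true : nat)%:R)%R rat_code_bool.
do 2![apply: (cc); first exact: e3].
do 2![apply: (cc); first exact: etrans (e1 _ _ _) (e2 _ _ _)].
have e4 (B : Type) d (s : seq B) g :
    table (fun j : 'I_(size s) => g (nth d s j)) = flatten [seq g y | y <- s].
  by rewrite (table_iota _ (fun j => g (nth d s j))) map_comp -/(mkseq _ _) mkseq_nth.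
rewrite -(e4 _ [::] _ (fun cl => [seq nat_of_bool (has (fun l => lit_at l (i %/ sy) (i %% sy)) cl)
  | i <- iota 0 N])); congr table; apply/funext => j.
have e5 n (g : nat -> nat) : table (fun i : 'I_n => [:: g i]) = map g (iota 0 n).
  by rewrite (table_iota _ (fun i => [:: g i])); elim: (iota 0 n) => //= y s ->.
rewrite -(e5 N); congr table; apply/funext => i.
by rewrite /= finset.in_set.
Qed.

End query_code.

(** The machine [M] is fixed, so its rule is a finite table in five arguments; all codes above
    [#|column M|] decode to the blank column and can be merged. *)
Lemma FP_cellF (A : encType) (M : tm) (p a0 a1 a2 a3 : A -> nat) :
  FP p -> FP a0 -> FP a1 -> FP a2 -> FP a3 ->
  FP (fun x => cellF M (minn (p x) 2) (a0 x) (a1 x) (a2 x) (a3 x)).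
Proof.
move=> hp h0 h1 h2 h3; have dE a : #|column M|.+1 <= a -> dec M a = dec M #|column M|.+1.
  by case: a => // a h; rewrite /dec !nth_default -?cardE.
apply: (FP_cases (N := 2) (h := fun p x => cellF M (minn p 2) (a0 x) (a1 x) (a2 x) (a3 x))) => //;
  last by move=> a x /minn_idPr ->.
move=> pc; apply: (FP_cases (N := #|column M|.+1)
  (h := fun a0 x => cellF M (minn pc 2) a0 (a1 x) (a2 x) (a3 x))) => //;
  last by move=> a x /dE e; rewrite /cellF e.
move=> b0; apply: (FP_cases (N := #|column M|.+1)
  (h := fun a1 x => cellF M (minn pc 2) b0 a1 (a2 x) (a3 x))) => //;
  last by move=> a x /dE e; rewrite /cellF e.
move=> b1; apply: (FP_cases (N := #|column M|.+1)
  (h := fun a2 x => cellF M (minn pc 2) b0 b1 a2 (a3 x))) => //;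
  last by move=> a x /dE e; rewrite /cellF e.
move=> b2; apply: (FP_cases (N := #|column M|.+1)
  (h := fun a3 x => cellF M (minn pc 2) b0 b1 b2 a3)) => //;
  last by move=> a x /dE e; rewrite /cellF e.
by move=> b3; exact: FP_const.
Qed.

(** * The reduction *)

Section reduction.
Variables (L : language) (M : tm) (c d : nat).
Hypothesis decL : decides_in_space M L (fun n => c * n ^ d + c).

Local Notation al := #|column M|.
Local Notation sy := al.+2.
Let W0 (x : seq bool) := c * size x ^ d + c.
Let K x := sy * (W0 x).+1.
Let nv x := (K x + 2) * (W0 x).+2.
Let F0 x := clF al (W0 x) (K x) (@cell_acc M).
Let F1 x := cls1 al (W0 x) (K x) (cell_init M x) (@cellF M).
Let red x := qinst al (nv x) (coin_var (W0 x)) (F0 x) (F1 x).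

Lemma red_correct (R : realType) x : L x <-> solvable R (red x).
Proof.
have [t sp [h aL]] := decL x.
apply: iff_trans (accepted_at sp h aL) _; apply: iff_sym.
apply: iff_trans (qinst_solvable _ _ _ _ _ _) _.
by apply: savitch_game => *; exact: cod_lt.
Qed.

Lemma FP_red : FP (fun x => encode (red x)).
Proof.
apply: (FP_ext (f := fun x => flatten [seq encode_nat n
  | n <- query_code al (nv x) (coin_var (W0 x)) (F0 x :: F1 x)])); last first.
  by move=> x; rewrite /encode qcodeE.
have hW : FP W0 by rewrite /W0; fp.
have hK : FP K by rewrite /K; fp.
have hnv : FP nv by rewrite /nv; fp.
have h0 : FP F0 by rewrite /F0 /clF /coinv /cellv; fp.
have hinit : FP (fun z : seq bool * nat => cell_init M z.1 z.2).
  apply: (FP_ext (f := fun z : seq bool * nat => if z.2 < size z.1 then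
      if nth false z.1 z.2 then opt_cell M (z.2 == 0) (Some true) else opt_cell M (z.2 == 0) (Some false)
    else opt_cell M (z.2 == 0) None)) => [|[s p]] /=.
    have ho o : FP (fun z : seq bool * nat => opt_cell M (z.2 == 0) o).
      apply: (FP_ext (f := fun z : seq bool * nat => if z.2 == 0 then opt_cell M true o
        else opt_cell M false o)) => [|z]; [fp|by case: ifP].
    by fp; exact: ho.
  rewrite cell_initE onthE; case: ltnP => h.
    by rewrite (nth_map false) //; case: nth.
  by rewrite nth_default // size_map.
have h1 : FP F1.
  rewrite /F1 /cls1 /clI /clA /clB /clS /coinv /cellv.
  repeat first [fp_core | apply: FP_cellF
    | match goal with |- FP (fun z => cell_init M (@?u z) (@?v z)) =>
        apply: (FP_comp (f := fun z => (u z, v z)) _ hinit) end].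
rewrite /query_code /qtr_code /coin_var /lit_at; fp.
Qed.

Lemma reducible (R : realType) : poly_reducible L (ConjRelReach R).
Proof.
exists (fun x => encode (red x)); first exact: poly_time_FP FP_red.
move=> x; apply: (iff_trans (red_correct R x)); split=> [s|[I /encode_inj <- //]].
by exists (red x).
Qed.

End reduction.

Lemma ConjRelReach_hard (R : realType) : PSPACE_hard (ConjRelReach R).
Proof.
move=> L [M [f [[c [d cd]] dec_f]]]; apply: (@reducible L M c d) => x.
have [t sp h] := dec_f x; exists t => // t'.
exact: leq_trans (sp t') (cd _).
Qed.

Local Open Scope ring_scope.

(** * Linear systems with a gap *)

Section basic_solutions.
Variable R : realFieldType.

Definition feasible k N (M : 'M[R]_(k, N)) (b : 'cV[R]_k) :=
  exists2 x : 'cV[R]_N, (forall j, 0 <= x j ord0) & M *m x = b.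

Section one_matrix.
Variables (k N : nat) (M : 'M[R]_(k, N)).

Definition indep (J : {set 'I_N}) :=
  forall z : 'cV[R]_N, (forall j, j \notin J -> z j ord0 = 0) -> M *m z = 0 -> z = 0.

(** Among solutions with least support: a dependency between its columns would be a direction along
    which some positive coordinate can be driven to 0 while the others stay nonnegative. *)
Lemma min_support b : feasible M b -> exists x : 'cV[R]_N,
  [/\ forall j, 0 <= x j ord0, M *m x = b & indep [set j | x j ord0 != 0]%SET].
Proof.
pose supp (x : 'cV[R]_N) := [set j | x j ord0 != 0]%SET.
move=> [x0 x00 x0b].
pose P n := `[< exists x : 'cV[R]_N, [/\ forall j, 0 <= x j ord0, M *m x = b & #|supp x| = n] >].
have exP : exists n, P n by exists #|supp x0|; apply/asboolP; exists x0.
case: (ex_minnP exP) => n /asboolP[x [x_ge0 xb xn]] nmin.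
exists x; split => // z zs Mz; apply/eqP; apply: contraT => z0.
wlog [j0 zj0] : z zs Mz z0 / exists j, 0 < z j ord0.
  have [j zj] : exists j, z j ord0 != 0.
    apply/existsP; apply: contraNT z0; rewrite negb_exists => /forallP h.
    by apply/eqP/colP => j; rewrite mxE; apply/eqP; rewrite -[_ == _]negbK h.
  move=> hw; case: (ltgtP 0 (z j ord0)) => [h|h|h].
  - by apply: (hw z) => //; exists j.
  - apply: (hw (- z)); rewrite ?oppr_eq0 //.
    + by move=> i /zs; rewrite mxE => ->; rewrite oppr0.
    + by rewrite mulmxN Mz oppr0.
    + by exists j; rewrite mxE oppr_gt0.
  - by rewrite -h eqxx in zj.
case: (@Order.TotalTheory.arg_minP _ _ _ j0 (fun j => 0 < z j ord0) (fun j => x j ord0 / z j ord0) zj0) => i zi imin.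
(* Ratio test: the first coordinate to vanish limits the step. *)
pose t := x i ord0 / z i ord0.
have t_ge0 : 0 <= t by rewrite divr_ge0 // ltW.
have : P #|supp (x - t *: z)|.
  apply/asboolP; exists (x - t *: z); split => //; last first.
    by rewrite mulmxBr -scalemxAr Mz scaler0 subr0.
  move=> j; rewrite !mxE subr_ge0; case: (ltP 0 (z j ord0)) => zj.
    by rewrite -ler_pdivlMr //; exact: imin.
  by apply: le_trans (x_ge0 j); rewrite mulr_ge0_le0.
move/nmin; rewrite -xn leqNgt => /negP[]; apply: proper_card.
apply/fintype.properP; split.
  apply/fintype.subsetP => j; rewrite !finset.inE !mxE; apply: contraNN => /eqP xj.
  by rewrite xj zs ?finset.inE ?xj ?eqxx // mulr0 subr0.
exists i; first rewrite finset.inE.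
  by apply: contraTN zi => /eqP xi; rewrite zs ?ltxx // finset.inE xi eqxx.
by rewrite finset.inE !mxE /t divfK ?subrr ?eqxx // gt_eqF.
Qed.

Let spread m (s : 'I_m -> 'I_N) (u : 'rV[R]_m) : 'cV[R]_N :=
  \col_j \sum_(i | s i == j) u ord0 i.

Let spread_mul m (s : 'I_m -> 'I_N) (u : 'rV[R]_m) :
  M *m spread s u = (u *m (colsub s M)^T)^T.
Proof.
apply/colP => r; rewrite !mxE.
under eq_bigr do rewrite mxE mulr_sumr.
rewrite (exchange_big_dep xpredT) //=; apply: eq_bigr => i _; rewrite !mxE.
rewrite (eq_bigl (pred1 (s i))) ?big_pred1_eq 1?mulrC // => j; exact: eq_sym.
Qed.

Let sel (J : {set 'I_N}) (i : 'I_#|J|) : 'I_N := enum_val i.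

Let spread_out (J : {set 'I_N}) (u : 'rV[R]_#|J|) j : j \notin J -> spread (@sel J) u j ord0 = 0.
Proof.
by move=> jJ; rewrite mxE big_pred0 // => i; apply: contraNF jJ => /eqP <-; exact: enum_valP.
Qed.

Let spread_in (J : {set 'I_N}) (u : 'rV[R]_#|J|) i : spread (@sel J) u (sel i) ord0 = u ord0 i.
Proof.
rewrite mxE (eq_bigl (pred1 i)) ?big_pred1_eq // => j.
by rewrite (inj_eq (@enum_val_inj _ _)).
Qed.

Let spread_supp (J : {set 'I_N}) (z : 'cV[R]_N) : (forall j, j \notin J -> z j ord0 = 0) ->
  spread (@sel J) (\row_(i < #|J|) z (sel i) ord0) = z.
Proof.
move=> zJ; apply/colP => j; have [jJ|jJ] := boolP (j \in J); last by rewrite spread_out ?zJ.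
have -> : j = sel (enum_rank_in jJ j) by rewrite /sel enum_rankK_in.
by rewrite spread_in mxE.
Qed.

Lemma indep_free (J : {set 'I_N}) : indep J -> row_free (colsub (@sel J) M)^T.
Proof.
move=> iJ; rewrite -kermx_eq0; apply/rowV0P => u /sub_kermxP uC.
have /colP h : spread (@sel J) u = 0.
  apply: iJ; first by move=> j; exact: spread_out.
  by rewrite spread_mul uC trmx0.
by apply/rowP => i; rewrite -spread_in h !mxE.
Qed.

(** While fewer than [k] columns are chosen, full row rank provides one outside their span. *)
Lemma extend_indep (J : {set 'I_N}) : indep J -> row_free M ->
  exists2 J' : {set 'I_N}, J \subset J' & indep J' /\ #|J'| = k.
Proof.
move=> iJ fM; have rM : \rank M = k by apply/eqP.
have le K : indep K -> (#|K| <= k)%N.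
  by move=> /indep_free/eqP <-; exact: rank_leq_col.
elim: {J}(k - #|J|)%N {-2}J (leqnn (k - #|J|)) iJ => [|n IH] J kJ iJ.
  exists J => //; split => //; apply/eqP; rewrite eqn_leq le //=.
  by rewrite -subn_eq0 -leqn0.
have [Jk|kltJ] := leqP k #|J|.
  by apply: IH => //; rewrite (eqP (_ : (k - #|J| == 0)%N)) // subn_eq0.
have [j jC] : exists j, ~~ (row j M^T <= (colsub (@sel J) M)^T)%MS.
  apply/existsP; apply: contraTT kltJ; rewrite negb_exists -leqNgt => /forallP h.
  have /mxrankS : (M^T <= (colsub (@sel J) M)^T)%MS.
    by apply/row_subP => j; rewrite -[X in is_true X]negbK h.
  by rewrite mxrank_tr rM => /leq_trans; apply; exact: rank_leq_row.
have jJ : j \notin J.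
  apply: contraNN jC => jJ; have -> : row j M^T = row (enum_rank_in jJ j) (colsub (@sel J) M)^T.
    by apply/rowP => r; rewrite !mxE /sel enum_rankK_in.
  exact: row_sub.
have iJ' : indep (j |: J)%SET.
  move=> z zJ Mz; have [zj|zj] := eqVneq (z j ord0) 0.
    apply: iJ => // i iJ'; have [->//|ij] := eqVneq i j.
    by apply: zJ; rewrite finset.in_setU1 negb_or ij.
  case/negP: jC; pose z' : 'cV[R]_N := \col_i (if i == j then 0 else - z i ord0 / z j ord0).
  have z'J i : i \notin J -> z' i ord0 = 0.
    move=> h; rewrite mxE; case: eqVneq => // ij.
    by rewrite zJ ?oppr0 ?mul0r // finset.in_setU1 negb_or ij.
  have e : M *m z' = (row j M^T)^T.
    have -> : z' = (delta_mx j 0) - (z j ord0)^-1 *: z.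
      apply/colP => i; rewrite !mxE eqxx andbT; case: eqVneq => [->|_].
        by rewrite mulVf // subrr.
      by rewrite sub0r mulrC mulrN.
    rewrite mulmxBr -scalemxAr Mz scaler0 subr0.
    by apply/colP => r; rewrite !mxE (bigD1 j) //= mxE !eqxx mulr1 big1 ?addr0 // => i ij;
      rewrite mxE (negbTE ij) mulr0.
  have := spread_mul (@sel J) (\row_(i < #|J|) z' (sel i) ord0).
  rewrite (spread_supp z'J) e => /(congr1 trmx); rewrite !trmxK => ->.
  exact: submxMl.
have [||J' JJ' hJ'] := IH (j |: J)%SET => //.
  by rewrite finset.cardsU1 jJ add1n; move: kJ kltJ; lia.
by exists J' => //; apply: fintype.subset_trans JJ'; exact: finset.subsetUr.
Qed.

(** Caratheodory's theorem for cones, with the support completed to a basis. *)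
Lemma basic_solution b : row_free M -> feasible M b ->
  exists f : 'I_k -> 'I_N, colsub f M \in unitmx /\
    forall i, 0 <= (invmx (colsub f M) *m b) i ord0.
Proof.
move=> fM /min_support[x [x0 xb /extend_indep/(_ fM)[J sJ [iJ cJ]]]].
have fr := indep_free iJ; move: (@spread_supp J x) fr.
move: (@sel J); rewrite {iJ}cJ => f ssupp fr.
have uf : colsub f M \in unitmx by rewrite -unitmx_tr -row_free_unit.
exists f; split => // i.
have xs : spread f (\row_i x (f i) ord0) = x.
  apply: ssupp => j jJ; apply/eqP; apply: contraNT jJ => xj.
  by apply: (fintype.subsetP sJ); rewrite finset.inE.
rewrite -xb -xs spread_mul trmx_mul trmxK mulKmx // !mxE; exact: x0.
Qed.

End one_matrix.

Lemma feasible_colsub k N (M : 'M[R]_(k, N)) (f : 'I_k -> 'I_N) (y : 'cV[R]_k) b :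
  (forall i, 0 <= y i ord0) -> colsub f M *m y = b ->
  exists x : 'cV[R]_N, [/\ forall j, 0 <= x j ord0, M *m x = b &
    forall j, x j ord0 <= \sum_i y i ord0].
Proof.
move=> y0 yb; exists (\col_j \sum_(i | f i == j) y i ord0); split=> [j||j].
- by rewrite mxE sumr_ge0.
- rewrite -yb; apply/colP => r; rewrite !mxE.
  under eq_bigr do rewrite mxE mulr_sumr.
  rewrite (exchange_big_dep xpredT) //=; apply: eq_bigr => i _; rewrite !mxE.
  rewrite (eq_bigl (pred1 (f i))) ?big_pred1_eq // => j; exact: eq_sym.
- rewrite mxE [leRHS](bigID (fun i => f i == j)) /= lerDl sumr_ge0 //.
Qed.

Lemma intr_ge1 (p : int) : 0 < p -> 1 <= (p%:~R : R).
Proof. by rewrite gtz0_ge1 -(ler_int R) rmorph1. Qed.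

Lemma intr_leN1 (p : int) : p < 0 -> (p%:~R : R) <= -1.
Proof. by rewrite -oppr_gt0 => /intr_ge1; rewrite rmorphN lerNr. Qed.

Lemma det_le k (C : 'M[int]_k) (B : nat) : (forall i j, `|C i j| <= B%:R) ->
  `|\det C| <= (k`! * B ^ k)%:R.
Proof.
move=> CB; apply: le_trans (ler_norm_sum _ _ _) _.
apply: le_trans (ler_sum _ (G := fun=> (B ^ k)%:R) _) _ => [s _|].
  rewrite normrM normrX normrN1 expr1n mul1r normr_prod.
  rewrite natrX -[X in _ ^+ X]card_ord -prodr_const; apply: ler_prod => i _.
  by rewrite normr_ge0 CB.
by rewrite sumr_const perm.card_Sn -mulrnA mulnC.
Qed.

Section integral.
Variables (B : nat).

Definition cramer_bound (k : nat) := (k`! * B ^ k)%N.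
Local Notation Bd k := ((cramer_bound k)%:R : R).

(** One denominator [q], the absolute value of the determinant, serves all right-hand sides of the
    basis; this lets solutions for two of them be compared as integers. *)
Lemma cramer k N (A : 'M[int]_(k, N)) (f : 'I_k -> 'I_N) : (forall i j, `|A i j| <= B%:R) ->
  colsub f (map_mx intr A : 'M[R]_(k, N)) \in unitmx ->
  exists2 q : R, 1 <= q & forall b : 'cV[int]_k, (forall i, `|b i ord0| <= B%:R) ->
  forall i, exists2 p : int, `|p| <= (cramer_bound k)%:R &
    (invmx (colsub f (map_mx intr A)) *m map_mx intr b) i ord0 = p%:~R / q.
Proof.
case: k A f => [|k] A f AB; first by exists 1 => // b _ [].
have -> : colsub f (map_mx intr A) = map_mx intr (colsub f A) :> 'M[R]_k.+1.
  by apply/matrixP => i j; rewrite !mxE.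
set C := colsub f A => uC; pose D := \det C.
have D0 : D != 0.
  by apply: contraTneq uC => D0; rewrite unitmxE det_map_mx -/D D0 unitr0.
exists (`|D|%:~R) => [|b bB i].
  by rewrite -[1]/(1%:~R) ler_int -gtz0_ge1 normr_gt0.
(* The sign of the determinant moves into the numerator, so that [q] is positive. *)
exists (Num.sg D * (\adj C *m b) i ord0).
  rewrite normrM normr_sg D0 mul1r mxE; apply: le_trans (ler_norm_sum _ _ _) _.
  have -> : (cramer_bound k.+1)%:R = \sum_(j < k.+1) (k`! * B ^ k)%:R * B%:R :> int.
    rewrite sumr_const card_ord -natrM -mulrnA /cramer_bound factS expnSr; congr (1 *+ _).
    by rewrite -!mulnA mulnC !mulnA.
  apply: ler_sum => j _; rewrite normrM; apply: ler_pM => //.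
  rewrite mxE /cofactor normrM normrX normrN1 expr1n mul1r; apply: det_le => i' j'.
  by rewrite !mxE.
have sgV : ((Num.sg D)%:~R : R)^-1 = (Num.sg D)%:~R.
  by case: sgrP D0 => //; rewrite ?rmorphN1 ?invrN ?invr1 // rmorph1 invr1.
have E : (D%:~R : R)^-1 = (Num.sg D)%:~R / `|D|%:~R.
  by rewrite {1}[D]numEsg rmorphM invfM sgV.
rewrite /invmx uC -scalemxAl -map_mx_adj -map_mxM mxE det_map_mx -/D E mxE rmorphM /= mulrAC.
by [].
Qed.

(** A basic solution depends on the perturbation [eta] affinely, with coefficients of bounded
    height, so that its sign conditions survive at [eta = 0]. *)
Lemma feasible_gap k N (A : 'M[int]_(k, N)) (b0 b1 : 'cV[int]_k) (eta : R) :
  (forall i j, `|A i j| <= B%:R) -> row_free (map_mx intr A : 'M[R]_(k, N)) ->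
  (forall i, `|b0 i ord0| <= B%:R) -> (forall i, `|b1 i ord0| <= B%:R) ->
  0 <= eta -> eta * Bd k < 1 ->
  feasible (map_mx intr A) (map_mx intr b0 + eta *: map_mx intr b1) ->
  exists x : 'cV[R]_N, [/\ forall j, 0 <= x j ord0, map_mx intr A *m x = map_mx intr b0 &
    forall j, x j ord0 <= k%:R * Bd k].
Proof.
move=> AB fM h0 h1 e0 eB /(basic_solution fM)[f [uf y0]].
have [q q1 qE] := cramer AB uf; have q0 : 0 < q by exact: lt_le_trans q1.
have toR (p : int) : `|p| <= (cramer_bound k)%:R -> - Bd k <= p%:~R <= Bd k.
  by rewrite -ler_norml -intr_norm -[Bd k](rmorph_nat intr) ler_int.
have y1 i : 0 <= (invmx (colsub f (map_mx intr A)) *m map_mx intr b0 : 'cV[R]_k) i ord0.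
  have [p0 P0 E0] := qE b0 h0 i; have [p1 P1 E1] := qE b1 h1 i.
  have lin2 (u v : 'cV[R]_k) : (u + eta *: v) i ord0 = u i ord0 + eta * v i ord0.
    by rewrite !mxE.
  rewrite E0 pmulr_lge0 ?invr_gt0 //.
  have := y0 i; rewrite mulmxDr -scalemxAr lin2 E0 E1 mulrA -mulrDl pmulr_lge0 ?invr_gt0 //.
  have /andP[a1 b1'] := toR _ P1.
  (* A negative integer is at most [-1], whereas the perturbation adds less than 1 to the
     numerator. *)
  have [p0g|p0l|->] := ltgtP p0 0; rewrite ?ler0z ?(ltW p0l) //.
  move=> h; exfalso; have := intr_leN1 p0g; have := ler_wpM2l e0 b1'.
  by move: (eta * _) (eta * _) h eB => u v; lra.
have [x [x0 xb xy]] := feasible_colsub y1 (mulKVmx uf _).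
exists x; split => // j; apply: le_trans (xy j) _.
have -> : k%:R * Bd k = \sum_(i < k) Bd k by rewrite sumr_const card_ord mulr_natl.
apply: ler_sum => i _; have [p pB ->] := qE b0 h0 i.
rewrite ler_pdivrMr //; have /andP[_ pb] := toR _ pB; apply: le_trans pb _.
by rewrite ler_peMr.
Qed.

End integral.

Lemma lp_gap (Row Col : finType) (ent : Row -> Col -> int) (b0 b1 : Row -> int) (B : nat)
    (eta : R) (x : Col -> R) :
  (forall r c, `|ent r c| <= B%:R) -> (forall r, `|b0 r| <= B%:R) -> (forall r, `|b1 r| <= B%:R) ->
  (forall u : Row -> R, (forall c, \sum_r u r * (ent r c)%:~R = 0) -> forall r, u r = 0) ->
  0 <= eta -> eta * (cramer_bound B #|Row|)%:R < 1 ->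
  (forall c, 0 <= x c) ->
  (forall r, \sum_c (ent r c)%:~R * x c = (b0 r)%:~R + eta * (b1 r)%:~R) ->
  exists x' : Col -> R, [/\ forall c, 0 <= x' c,
    forall r, \sum_c (ent r c)%:~R * x' c = (b0 r)%:~R &
    forall c, x' c <= #|Row|%:R * (cramer_bound B #|Row|)%:R].
Proof.
move=> eB b0B b1B rk e0 eBd x0 xE.
pose A := \matrix_(i < #|Row|, j < #|Col|) ent (enum_val i) (enum_val j).
pose v0 := \col_(i < #|Row|) b0 (enum_val i); pose v1 := \col_(i < #|Row|) b1 (enum_val i).
have sumE (T : finType) (F : T -> R) : \sum_(i < #|T|) F (enum_val i) = \sum_t F t.
  by rewrite -big_enum_val; apply: eq_bigl.
have fA : row_free (map_mx intr A : 'M[R]_(_, _)).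
  rewrite -kermx_eq0; apply/rowV0P => u /sub_kermxP uA.
  have h : forall r, u ord0 (enum_rank r) = 0.
    apply: rk => c; have := congr1 (fun v : 'rV[R]_#|Col| => v ord0 (enum_rank c)) uA.
    rewrite !mxE => h; rewrite -[RHS]h -[LHS]sumE; apply: eq_bigr => i _.
    by rewrite !mxE enum_valK enum_rankK.
  by apply/rowP => i; rewrite mxE -[i]enum_valK.
have [||||x' [x'0 x'E x'B]] := @feasible_gap B _ _ A v0 v1 eta _ fA _ _ e0 eBd.
- by move=> i j; rewrite mxE.
- by move=> i; rewrite mxE.
- by move=> i; rewrite mxE.
- exists (\col_j x (enum_val j)) => [j|]; first by rewrite mxE.
  apply/colP => i; rewrite !mxE -xE -[RHS]sumE; apply: eq_bigr => j _; by rewrite !mxE.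
exists (fun c => x' (enum_rank c) ord0); split=> // r.
have := congr1 (fun v : 'cV[R]__ => v (enum_rank r) ord0) x'E.
rewrite !mxE enum_rankK => h; rewrite -[RHS]h -[LHS]sumE; apply: eq_bigr => j _.
by rewrite !mxE enum_rankK enum_valK.
Qed.

End basic_solutions.

(** * Value iteration with optional commitment *)

Section value_iteration.
Context (R : realType) (nS nA : nat) (M : mdp nS nA).
Local Notation S := 'I_nS.+1.
Local Notation A := 'I_nA.+1.
Local Notation Z := (S * {set S})%type.

Definition succ (z : Z) (s : S) : Z := (s, (s |: z.2)%SET).
Definition prb (z : Z) (a : A) (s : S) : R := ratr (trans M z.1 a s).
Definition avg (f : Z -> R) (z : Z) (a : A) : R := \sum_s prb z a s * f (succ z s).

Lemma prb_ge0 z a s : 0 <= prb z a s.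
Proof. by rewrite /prb ler0q; have /andP[] := trans_itv M z.1 a s. Qed.

Lemma prb_sum z a : enabled M z.1 a -> \sum_s prb z a s = 1.
Proof. by move=> /eqP h; rewrite /prb -rmorph_sum h rmorph1. Qed.

Lemma le_avg f g z a : (forall z, f z <= g z) -> avg f z a <= avg g z a.
Proof. by move=> h; apply: ler_sum => s _; rewrite ler_wpM2l ?prb_ge0. Qed.

Lemma avgB f g z a : avg f z a - avg g z a = avg (fun z => f z - g z) z a.
Proof. by rewrite -sumrB; apply: eq_bigr => s _; rewrite mulrBr. Qed.

Variable c : Z -> R.

Fixpoint vi (t : nat) (z : Z) : R :=
  if t is t'.+1 then \big[Num.max/c z]_(a | enabled M z.1 a) avg (vi t') z a else c z.

Lemma vi_ge_c t z : c z <= vi t z.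
Proof. by case: t => //= t; exact: bigmax_ge_id. Qed.

Lemma vi_ge_avg t z a : enabled M z.1 a -> avg (vi t) z a <= vi t.+1 z.
Proof. by move=> en; apply: (bigmax_sup a). Qed.

Lemma vi_cases t z :
  vi t.+1 z = c z \/ exists2 a, enabled M z.1 a & vi t.+1 z = avg (vi t) z a.
Proof.
rewrite /=; elim/big_rec: _ => [|a y en [->|[b eb ->]]]; first by left.
  by rewrite /Num.max; case: ifP => _; [left|right; exists a].
by right; rewrite /Num.max; case: ifP => _; [exists b|exists a].
Qed.

Lemma viS t z : vi t z <= vi t.+1 z.
Proof.
elim: t z => [|t IH] z; first exact: vi_ge_c.
case: (vi_cases t z) => [->|[a en ->]]; first exact: vi_ge_c.
by apply: le_trans (vi_ge_avg _ en); exact: le_avg.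
Qed.

Lemma vi_mono z : {homo (vi^~ z) : m n / (m <= n)%N >-> m <= n}.
Proof. by apply: homo_leq => [//|x y w|t]; [exact: le_trans|exact: viS]. Qed.

Variable K : R.
Hypothesis c_ge0 : forall z, 0 <= c z.
Hypothesis c_le : forall z, c z <= K.

Lemma vi_le t z : vi t z <= K.
Proof.
elim: t z => [|t IH] z //; case: (vi_cases t z) => [->//|[a en ->]].
rewrite -[leRHS]mul1r -(prb_sum en) mulr_suml; apply: ler_sum => s _.
by rewrite ler_wpM2l ?prb_ge0.
Qed.

Definition vlim (z : Z) : R := lim (vi^~ z @ \oo).

Lemma vi_cvg z : vi^~ z @ \oo --> vlim z.
Proof.
apply: nondecreasing_is_cvgn; first exact: vi_mono.
by exists K => _ [t _ <-]; exact: vi_le.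
Qed.

Lemma vi_le_vlim t z : vi t z <= vlim z.
Proof.
apply: nondecreasing_cvgn_le; first exact: vi_mono.
by apply/cvg_ex; exists (vlim z); exact: vi_cvg.
Qed.

Lemma vlim_le z y : (forall t, vi t z <= y) -> vlim z <= y.
Proof.
move=> h; apply: (limr_le (F := \oo)); last by near=> t; exact: h.
by apply/cvg_ex; exists (vlim z); exact: vi_cvg.
Unshelve. all: by end_near. Qed.

Lemma avg_le_vlim z a : enabled M z.1 a -> avg vlim z a <= vlim z.
Proof.
move=> en; have h : (fun t => avg (vi t) z a) @ \oo --> avg vlim z a.
  apply: cvg_big => [|s _]; first exact: add_continuous.
  apply: cvgM; first exact: cvg_cst.
  exact: vi_cvg.
rewrite -(cvg_lim (@Rhausdorff R) h); apply: limr_le; first by apply/cvg_ex; eexists; exact: h.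
near=> t; exact: le_trans (vi_ge_avg _ en) (vi_le_vlim _ _).
Unshelve. all: by end_near. Qed.

Definition opt (z : Z) (a : A) : bool := enabled M z.1 a && (vlim z == avg vlim z a).

Definition opt_step (z z' : Z) : bool :=
  [exists a, opt z a && (0 < prb z a z'.1)] && (z' == succ z z'.1).

Lemma succ_opt z a s : opt z a -> 0 < prb z a s -> opt_step z (succ z s).
Proof. by move=> o h; rewrite /opt_step eqxx andbT; apply/existsP; exists a; rewrite o. Qed.

(** On a set closed under optimal moves where committing is never optimal, an error that
    is positive everywhere could not decrease any more once the suboptimal choices are
    ruled out. *)
Lemma commit_reachable z0 : exists2 z, connect opt_step z0 z & vlim z = c z.
Proof.
apply: contrapT => no.
have ncW z : connect opt_step z0 z -> c z < vlim z.
  move=> zW; rewrite lt_neqAle; apply/andP; split; last exact: (vi_le_vlim 0 z).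
  by apply/eqP => e; apply: no; exists z.
have clo z a s : connect opt_step z0 z -> opt z a -> 0 < prb z a s -> connect opt_step z0 (succ z s).
  by move=> zW o h; apply: connect_trans zW (connect1 _); exact: succ_opt o h.
(* Attaining the limit at time [t.+1] would require an optimal action whose successors all attain
   theirs at time [t]; committing is excluded here by [ncW]. *)
have vi_lt t z : connect opt_step z0 z -> vi t z < vlim z.
  elim: t z => [|t IH] z zW; first exact: ncW.
  rewrite lt_neqAle vi_le_vlim andbT; apply/eqP => e.
  case: (vi_cases t z) => [e'|[a en e']]; first by have := ncW _ zW; rewrite -e e' ltxx.
  have oa : opt z a.
    rewrite /opt en eq_le avg_le_vlim // andbT -e e'.
    by apply: le_avg => z'; exact: vi_le_vlim.
  have : avg (fun z' => vlim z' - vi t z') z a = 0.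
    by move/andP: oa => [_ /eqP o]; rewrite -avgB -o -e' e subrr.
  move=> /eqP; rewrite psumr_eq0 => [/allP h|s _]; last first.
    by rewrite mulr_ge0 ?prb_ge0 // subr_ge0 vi_le_vlim.
  have: \sum_s prb z a s = 0.
    apply: big1 => s _; apply/eqP; apply: contraT => ps.
    have pp : 0 < prb z a s by rewrite lt_def ps prb_ge0.
    have /implyP/(_ isT) := h s (mem_index_enum _).
    rewrite mulf_eq0 (negbTE ps) /= subr_eq0 => /eqP e2.
    by have := IH _ (clo _ _ _ zW oa pp); rewrite -e2 ltxx.
  by rewrite prb_sum // => /eqP; rewrite oner_eq0.
pose sub z := \big[Num.max/c z]_(a | enabled M z.1 a && ~~ opt z a) avg vlim z a.
have /choice[T hT] : forall z, exists t, connect opt_step z0 z -> sub z < vi t z.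
  move=> z; have [zW|] := boolP (connect opt_step z0 z); last by exists 0%N.
  have lt : sub z < vlim z.
    apply/bigmax_ltP; split; first exact: ncW.
    by move=> a /andP[en]; rewrite /opt en /= lt_neqAle avg_le_vlim // andbT eq_sym.
  apply: contrapT => h; move: lt; rewrite ltNge => /negP; apply; apply: vlim_le => t.
  by rewrite leNgt; apply/negP => h'; apply: h; exists t.
(* From [t0] on, committing and suboptimal actions are worth less than the current value, so each
   step of [vi] averages along an optimal action. *)
pose t0 := (\max_z T z)%N.
have good t z : (t0 <= t)%N -> connect opt_step z0 z -> sub z < vi t z.
  move=> tt zW; apply: lt_le_trans (hT z zW) _; apply: vi_mono.
  by apply: leq_trans tt; exact: leq_bigmax.
pose W := [set z | connect opt_step z0 z]%SET.
have z0W : z0 \in W by rewrite finset.inE.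
case: (@Order.TotalTheory.arg_minP _ _ _ z0 (fun z => z \in W) (fun z => vlim z - vi t0 z) z0W) => zm zmW zmin.
pose mu := vlim zm - vi t0 zm.
have mu0 : 0 < mu by rewrite subr_gt0; apply: vi_lt; rewrite finset.inE in zmW.
have ge_mu k z : z \in W -> mu <= vlim z - vi (t0 + k) z.
  elim: k z => [|k IH] z zW; first by rewrite addn0; exact: zmin.
  have zc : connect opt_step z0 z by rewrite finset.inE in zW.
  have := good (t0 + k.+1)%N z (leq_addr _ _) zc; rewrite addnS.
  case: (vi_cases (t0 + k) z) => [->|[a en ->]].
    by rewrite ltNge /sub bigmax_ge_id.
  have [oa|noa] := boolP (opt z a); last first.
    rewrite ltNge => /negP[]; apply: (bigmax_sup a); first by rewrite en noa.
    by apply: le_avg => z'; exact: vi_le_vlim.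
  move=> _; have /andP[_ /eqP ->] := oa; rewrite avgB -[mu]mul1r -(prb_sum en) mulr_suml.
  apply: ler_sum => s _; have := prb_ge0 z a s; rewrite le_eqVlt => /predU1P[<-|ps].
    by rewrite !mul0r.
  by rewrite ler_pM2l // IH // finset.inE; exact: clo zc oa ps.
suff : vlim z0 <= vlim z0 - mu by rewrite lerBrDr gerDl leNgt mu0.
apply: vlim_le => t; apply: le_trans (vi_mono z0 (leq_addl t0 t)) _.
by have := ge_mu t _ z0W; lra.
Qed.

(** Visited sets grow along a path, so on a simple path the pairs (state, number of visited
    states) are distinct. *)
Lemma short_path (e : rel Z) z z' : (forall u v, e u v -> v = succ u v.1) -> connect e z z' ->
  exists p, [/\ path e z p, last z p = z' & (size p < nS.+1 * nS.+2)%N].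
Proof.
move=> es /connectP[p0 pp ->]; case/shortenP: pp => p pp up _.
exists p; split => //; pose g (u : Z) : S * 'I_nS.+2 := (u.1, inord #|u.2|).
have sub (u : Z) q : path e u q -> {in q, forall v : Z, u.2 \subset v.2}.
  elim: q u => //= v q IH u /andP[/es uv vq] w; rewrite in_cons => /predU1P[->|wq].
    by rewrite uv finset.subsetUr.
  by apply: fintype.subset_trans (IH _ vq _ wq); rewrite uv finset.subsetUr.
have cd (V : {set S}) : (#|V| < nS.+2)%N by rewrite ltnS -[X in (_ <= X)%N](card_ord nS.+1) max_card.
have gi (u v : Z) : u.2 \subset v.2 -> g u = g v -> u = v.
  case: u v => [s V] [s' V'] /= VV' euv; have /= -> := congr1 fst euv.
  have := congr1 (fun w => val w.2) euv; rewrite /= !inordK // => cV.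
  by congr pair; apply/eqP; rewrite finset.eqEcard VV' cV leqnn.
suff ug : uniq (map g (z :: p)).
  have := uniq_leq_size ug (s2 := enum {: S * 'I_nS.+2}).
  rewrite -cardE card_prod !card_ord /= size_map; apply => w _.
  by rewrite mem_enum.
elim: p z pp up {p0} => //= v q IH z /andP[zv vq] /andP[zq uq].
rewrite (IH v) // andbT -[X in _ \notin X]/(map g (v :: q)); apply/mapP => -[w wq gw].
move: zq; rewrite (gi z w) ?wq //; apply: (sub z (v :: q)) => //=.
by rewrite zv.
Qed.

Variables (p : R) (n : nat).
Hypothesis p01 : 0 < p <= 1.
Hypothesis p_min : forall z a s, 0 < prb z a s -> p <= prb z a s.
Local Notation L := (nS.+1 * nS.+2)%N.

(** Along a path of optimal moves to a state where committing is optimal, which is followed with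
    probability at least [p ^ L], the error drops to 0; on all other branches it is at most [E]. *)
Lemma vi_contract t E : (forall z, vlim z - vi t z <= E) -> 0 <= E ->
  forall z, vlim z - vi (t + L) z <= (1 - p ^+ L) * E.
Proof.
move=> hE E0 z; have [z' + zc] := commit_reachable z.
move=> /short_path[|q [pq lq sq]]; first by move=> u v /andP[_ /eqP].
have /andP[p0 p1] := p01.
have pk k : 0 <= 1 - p ^+ k by rewrite subr_ge0 exprn_ile1 // ltW.
have key : forall q z, path opt_step z q -> vlim (last z q) = c (last z q) ->
    vlim z - vi (t + size q) z <= (1 - p ^+ size q) * E.
  elim=> [|v w IH] u /=.
    by move=> _ ->; rewrite addn0 expr0 subrr mul0r subr_le0; exact: vi_ge_c.
  move=> /andP[/andP[/existsP[a /andP[/andP[en /eqP oa] pa]] /eqP vu] pw] lw; rewrite addnS.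
  apply: (@le_trans _ _ (avg (fun z => vlim z - vi (t + size w) z) u a)).
    by rewrite -avgB -oa lerB ?vi_ge_avg.
  have hw := IH v pw lw; rewrite vu in hw.
  have hP := p_min pa; have := prb_sum en; rewrite (bigD1 v.1) //= => hs.
  rewrite /avg (bigD1 v.1) //=.
  apply: (@le_trans _ _ (prb u a v.1 * ((1 - p ^+ size w) * E) + \sum_(i | i != v.1) prb u a i * E)).
    apply: lerD; first by rewrite ler_wpM2l // ltW.
    apply: ler_sum => s _; rewrite ler_wpM2l ?prb_ge0 //; apply: le_trans (hE _).
    by rewrite lerB // vi_mono // leq_addr.
  rewrite -mulr_suml (_ : \sum_(i | _) _ = 1 - prb u a v.1); last by rewrite -hs addrAC subrr add0r.
  have := pk (size w); rewrite exprS; have : 0 <= p ^+ size w by rewrite exprn_ge0 // ltW.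
  move: (p ^+ size w) (prb u a v.1) hP => x y hP x0 hx.
  have hx0 : p * x <= y * x by rewrite ler_wpM2r.
  rewrite mulrA -mulrDl ler_wpM2r //; lra.
have kq := key q z pq; rewrite lq in kq.
apply: le_trans (le_trans _ (kq zc)) _.
  by rewrite lerB // vi_mono // leq_add2l ltnW.
by rewrite ler_wpM2r // lerB // ler_wiXn2l ?(ltW p0) ?p1 ?(ltnW sq).
Qed.

Lemma vi_rate j m : 1 <= j%:R * p ^+ L -> forall z, vlim z <= vi (L * (j * m)) z + K / 2 ^+ m.
Proof.
move=> jp; have /andP[p0 p1] := p01; have pL : 0 <= p ^+ L <= 1 by rewrite exprn_ge0 ?exprn_ile1 // ltW.
have K0 (z : Z) : 0 <= K by apply: le_trans (c_le z).
have it k z : vlim z - vi (k * L) z <= (1 - p ^+ L) ^+ k * K.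
  elim: k z => [|k IH] z.
    by rewrite mul0n expr0 mul1r; apply: le_trans (vlim_le (fun t => vi_le t z)); rewrite gerBl.
  rewrite mulSn addnC exprS -mulrA; apply: vi_contract => //.
  by rewrite mulr_ge0 ?(K0 z) // exprn_ge0 // subr_ge0; case/andP: pL.
move=> z; have := it (j * m)%N z; rewrite mulnC exprM -lerBlDl => h.
apply: le_trans h _; rewrite mulrC ler_wpM2l ?(K0 z) // -exprVn.
have u0 : 0 <= 1 - p ^+ L by rewrite subr_ge0; case/andP: pL.
apply: lerXn2r; rewrite ?nnegrE ?exprn_ge0 ?invr_ge0 ?ler0n //.
move: (p ^+ L) pL u0 jp => u /andP[a b] u0 jp {K0 it z}.
(* By Bernoulli [(1 + u) ^ j] is at least 2, and its product with [(1 - u) ^ j] is at most 1; hence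
   every [j] contractions halve the error. *)
have bern : 1 + j%:R * u <= (1 + u) ^+ j.
  elim: (j) => [|i IH]; first by rewrite mul0r addr0 expr0.
  rewrite exprS; apply: le_trans (ler_wpM2l _ IH); last by rewrite addr_ge0.
  by rewrite -natr1; have : 0 <= i%:R :> R by []; move: (i%:R : R) => y; nra.
have p1' : (1 - u) ^+ j * (1 + u) ^+ j <= 1.
  by rewrite -exprMn exprn_ile1 //; nra.
have q0 : 0 <= (1 - u) ^+ j by rewrite exprn_ge0.
have : 2 <= (1 + u) ^+ j by apply: le_trans bern; lra.
by move: ((1 + u) ^+ j) ((1 - u) ^+ j) p1' q0 => x y; nra.
Qed.

End value_iteration.

(** * Flows and schedulers *)

Section flows.
Context (R : realType) (nS nA : nat) (M : mdp nS nA).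
Local Notation S := 'I_nS.+1.
Local Notation A := 'I_nA.+1.
Local Notation Z := (S * {set S})%type.
Local Notation path := (finite_path nS nA).
Local Notation prb := (@prb R nS nA M).
Local Notation avg := (@avg R nS nA M).

Definition zof (p : path) : Z := (p.2, visited p).

Lemma zof_ext p a s : zof (ext p a s) = succ (zof p) s.
Proof. by rewrite /zof visited_ext. Qed.

(** [y z a] is the expected number of times action [a] is chosen in [z] before committing,
    and [w z] the probability of committing in [z]. *)
Definition inflow (y : Z -> A -> R) (z : Z) : R :=
  \sum_z' \sum_a y z' a * ((z == succ z' z.1)%:R * prb z' a z.1).

Definition flow (z0 : Z) (y : Z -> A -> R) (w : Z -> R) : Prop :=
  [/\ forall z a, 0 <= y z a, forall z, 0 <= w z,
      forall z a, ~~ enabled M z.1 a -> y z a = 0 &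
      forall z, \sum_a y z a + w z = (z == z0)%:R + inflow y z].

Lemma inflow_avg (x : Z -> R) y :
  \sum_z x z * inflow y z = \sum_z \sum_a y z a * avg x z a.
Proof.
rewrite /inflow; under eq_bigr do rewrite mulr_sumr.
rewrite exchange_big /=; apply: eq_bigr => z' _.
under eq_bigr do rewrite mulr_sumr.
rewrite exchange_big /=; apply: eq_bigr => a _.
rewrite /avg mulr_sumr; transitivity (\sum_s \sum_V x (s, V) * (y z' a *
    (((s, V) == succ z' s)%:R * prb z' a s))).
  by rewrite pair_bigA /=; apply: eq_bigr => -[].
apply: eq_bigr => s _; rewrite (bigD1 (succ z' s).2) //= eqxx mul1r big1 ?addr0.
  by rewrite mulrC mulrA.
by move=> V /negbTE VV; rewrite -pair_eqE /= eqxx VV /= mul0r !mulr0.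
Qed.

Lemma sum_ind (x : Z -> R) z0 : \sum_z x z * (z == z0)%:R = x z0.
Proof.
rewrite (bigD1 z0) //= eqxx mulr1 big1 ?addr0 // => z /negbTE ->; exact: mulr0.
Qed.

(** The balance equations summed against a potential [x]; the inflow term turns into averages of
    [x]. *)
Lemma flow_value z0 y w (x : Z -> R) : flow z0 y w ->
  \sum_z x z * w z = x z0 + \sum_z \sum_a y z a * (avg x z a - x z).
Proof.
move=> [y0 w0 ye fl]; have : \sum_z x z * (\sum_a y z a + w z) =
    \sum_z x z * ((z == z0)%:R + inflow y z) by apply: eq_bigr => z _; rewrite fl.
under eq_bigr do rewrite mulrDr; rewrite big_split /=.
under [X in _ = X]eq_bigr do rewrite mulrDr; rewrite big_split /= sum_ind inflow_avg.
under [X in _ -> _ = _ + X]eq_bigr do under eq_bigr do rewrite mulrBr.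
under [X in _ -> _ = _ + X]eq_bigr do rewrite sumrB -mulr_suml mulrC.
rewrite sumrB => h; apply: (addrI (\sum_z x z * \sum_a y z a)); rewrite h.
by rewrite addrCA; congr (_ + _); rewrite addrC subrK.
Qed.

(** A superharmonic majorant of the commitment reward is a dual solution; it will be applied to
    [vlim] and to constants. *)
Lemma weak_duality z0 y w (c x : Z -> R) : flow z0 y w -> (forall z, c z <= x z) ->
  (forall z a, enabled M z.1 a -> avg x z a <= x z) -> \sum_z w z * c z <= x z0.
Proof.
move=> fl cx sx; have [y0 w0 ye _] := fl.
apply: (@le_trans _ _ (\sum_z x z * w z)).
  by apply: ler_sum => z _; rewrite mulrC ler_wpM2r.
rewrite (flow_value x fl) gerDl; apply: sumr_le0 => z _; apply: sumr_le0 => a _.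
have [en|/ye ->] := boolP (enabled M z.1 a); last by rewrite mul0r.
by rewrite mulr_ge0_le0 // subr_le0; exact: sx.
Qed.

Lemma flow_convex z0 (I : finType) (e : I -> R) y w : (forall i, 0 <= e i) -> \sum_i e i = 1 ->
  (forall i, flow z0 (y i) (w i)) ->
  flow z0 (fun z a => \sum_i e i * y i z a) (fun z => \sum_i e i * w i z).
Proof.
move=> e0 e1 fl; split=> [z a|z|z a en|z].
- by apply: sumr_ge0 => i _; rewrite mulr_ge0 //; case: (fl i).
- by apply: sumr_ge0 => i _; rewrite mulr_ge0 //; case: (fl i).
- by rewrite big1 // => i _; case: (fl i) => _ _ ->; rewrite ?mulr0.
have -> : inflow (fun z a => \sum_i e i * y i z a) z = \sum_i e i * inflow (y i) z.
  rewrite /inflow; under [RHS]eq_bigr do rewrite mulr_sumr.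
  rewrite [RHS]exchange_big /=; apply: eq_bigr => z' _.
  under [RHS]eq_bigr do rewrite mulr_sumr.
  rewrite [RHS]exchange_big /=; apply: eq_bigr => a _.
  by rewrite mulr_suml; apply: eq_bigr => i _; rewrite -mulrA.
rewrite exchange_big /= -big_split /= -[X in _ = X + _]mul1r -{1}e1 mulr_suml -big_split /=.
by apply: eq_bigr => i _; case: (fl i) => _ _ _ h; rewrite -mulr_sumr -!mulrDr h.
Qed.

(** Value of a time-dependent strategy that follows the choices [ch] for [t] steps and
    then commits; [None] means committing at once. *)
Fixpoint run_value (ch : nat -> Z -> option A) (c : Z -> R) (t : nat) (z : Z) : R :=
  if t is t'.+1 then
    if ch t z is Some a then avg (run_value ch c t') z a else c z
  else c z.

(** The first action occurs once at [z0], and the flows of the successors are added with their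
    transition probabilities. The same flow evaluates every reward [c], so it serves all rows at
    once. *)
Lemma run_flow (ch : nat -> Z -> option A) t z0 :
  (forall t z a, ch t z = Some a -> enabled M z.1 a) ->
  exists y w, flow z0 y w /\ forall c, \sum_z w z * c z = run_value ch c t z0.
Proof.
move=> chE; have stop z : exists y w, flow z y w /\ forall c, \sum_z w z * c z = c z.
  exists (fun _ _ => 0), (fun z' => (z' == z)%:R); split; last first.
    by move=> c; under eq_bigr do rewrite mulrC; rewrite sum_ind.
  split=> // z'.
  rewrite big1 // add0r [X in _ + X](_ : _ = 0) ?addr0 // /inflow.
  by rewrite big1 // => u _; rewrite big1 // => a _; rewrite mul0r.
elim: t z0 => [|t IH] z0; first exact: stop.
rewrite /=; case e: (ch t.+1 z0) => [a|]; last exact: stop.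
have en := chE _ _ _ e.
have /choice[yf /choice[wf yw]] := fun s => IH (succ z0 s).
pose P s := prb z0 a s.
exists (fun z b => ((z == z0) && (b == a))%:R + \sum_s P s * yf s z b), (fun z => \sum_s P s * wf s z).
have P0 s : 0 <= P s by exact: prb_ge0.
have ind1 : \sum_b (b == a)%:R = 1 :> R.
  by rewrite (bigD1 a) //= !eqxx big1 ?addr0 // => b /negbTE ->.
split; last first.
  move=> c; rewrite /avg; under eq_bigr do rewrite mulr_suml.
  rewrite exchange_big /=; apply: eq_bigr => s _.
  by under eq_bigr do rewrite -mulrA; rewrite -mulr_sumr; case: (yw s) => _ ->.
split=> [z b|z|z b nb|z].
- rewrite addr_ge0 ?ler0n // sumr_ge0 // => s _; rewrite mulr_ge0 //.
  by case: (yw s) => -[].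
- by rewrite sumr_ge0 // => s _; rewrite mulr_ge0 //; case: (yw s) => -[].
- rewrite big1 ?addr0; last by move=> s _; case: (yw s) => -[_ _ h _] _; rewrite h ?mulr0.
  by case: eqP => //= zz; case: eqP => //= bb; move: nb; rewrite zz bb en.
have -> : inflow (fun z b => ((z == z0) && (b == a))%:R + \sum_s P s * yf s z b) z =
    (z == succ z0 z.1)%:R * P z.1 + \sum_s P s * inflow (yf s) z.
  rewrite /inflow; under eq_bigr do under eq_bigr do rewrite mulrDl.
  under eq_bigr do rewrite big_split /=.
  rewrite big_split /=; congr (_ + _).
    rewrite (bigD1 z0) //= (bigD1 a) //= !eqxx mul1r !big1 ?addr0 //.
      by move=> u /negbTE uz; rewrite big1 // => b _; rewrite uz mul0r.
    by move=> b /negbTE ->; rewrite mul0r.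
  under [RHS]eq_bigr do rewrite mulr_sumr.
  rewrite [RHS]exchange_big /=; apply: eq_bigr => z' _.
  under [RHS]eq_bigr do rewrite mulr_sumr.
  rewrite [RHS]exchange_big /=; apply: eq_bigr => b _.
  by rewrite mulr_suml; apply: eq_bigr => i _; rewrite -mulrA.
have -> : (z == succ z0 z.1)%:R * P z.1 = \sum_s P s * (z == succ z0 s)%:R.
  rewrite (bigD1 z.1) //= mulrC big1 ?addr0 // => s /negbTE sz.
  by rewrite {1}[z]surjective_pairing -pair_eqE /= eq_sym sz /= mulr0.
rewrite -big_split /= big_split /= exchange_big /= -!addrA; congr (_ + _).
  by case: (z =P z0) => [_|_] /=; [exact: ind1|rewrite big1].
rewrite -big_split /=; apply: eq_bigr => s _; rewrite -mulr_sumr -!mulrDr.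
by case: (yw s) => -[_ _ _ h] _; rewrite h.
Qed.

Section occupation.
Variables (sigma : scheduler R M) (s0 : S).
Local Notation E := (fun t phi => Ex sigma t phi s0).
Let at_z z (p : path) : R := (zof p == z)%:R.
Local Notation z0 := (zof ([::], s0)).

Lemma Ex_zof t (f : Z -> R) : E t (f \o zof) = \sum_z f z * E t (at_z z).
Proof.
rewrite /Ex -iterE_sum; congr (iter t _ _ _); apply/funext => p /=.
by under eq_bigr do rewrite /at_z eq_sym; rewrite sum_ind.
Qed.

(** Expected numbers of uses of each action before time [t], with commitment at time [t] wherever
    the run is; they form a flow on the product although the scheduler may use the whole history. *)
Lemma occupation t : exists y w, flow z0 y w /\ forall c, \sum_z w z * c z = E t (c \o zof).
Proof.
pose act z a (p : path) : R := at_z z p * sched sigma p a.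
have act0 z a p : 0 <= act z a p by rewrite mulr_ge0 ?ler0n ?sched_ge0.
have Ege0 i phi : (forall p, 0 <= phi p) -> 0 <= E i phi.
  by move=> h; rewrite -(iterE_const sigma i 0 ([::], s0)); exact: le_iterE.
exists (fun z a => \sum_(i < t) E i (act z a)), (fun z => E t (at_z z)).
split; last by move=> c; rewrite Ex_zof; apply: eq_bigr => z _; rewrite mulrC.
split=> [z a|z|z a en|z].
- by apply: sumr_ge0 => i _; apply: Ege0.
- by apply: Ege0 => p; exact: ler0n.
- apply: big1 => i _; rewrite -(iterE_const sigma i 0 ([::], s0)); congr (iter i _ _ _).
  apply/funext => p; rewrite /act /at_z; case: eqP => [zp|_]; last exact: mul0r.
  by rewrite sched_enabled ?mulr0 // -[p.2]/((zof p).1) zp.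
have sumact i : \sum_a E i (act z a) = E i (at_z z).
  under eq_bigr do rewrite -[E i _]mul1r; rewrite -iterE_sum; congr (iter i _ _ _).
  by apply/funext => p; under eq_bigr do rewrite mul1r; rewrite -mulr_sumr sched_sum mulr1.
rewrite exchange_big /=; under eq_bigr do rewrite sumact.
rewrite -(big_ord_recr _ (fun i => E i (at_z z))) big_ord_recl /=; congr (_ + _).
  by rewrite /Ex /= /at_z eq_sym.
rewrite /inflow; under [RHS]eq_bigr do under eq_bigr do rewrite mulr_suml.
under [RHS]eq_bigr do rewrite exchange_big /=.
rewrite [RHS]exchange_big /=; apply: eq_bigr => i _.
rewrite /bump /= add1n /Ex iterSr; pose k z' a : R := (z == succ z' z.1)%:R * prb z' a z.1.
transitivity (\sum_(u : Z * A) k u.1 u.2 * iter i (stepE sigma) (act u.1 u.2) ([::], s0)).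
  rewrite -iterE_sum; congr (iter i _ _ _); apply/funext => p; rewrite /stepE.
  rewrite -(pair_bigA _ (fun z' a => k z' a * act z' a p)) /= exchange_big /=.
  apply: eq_bigr => a _; transitivity (\sum_z' sched sigma p a * (k z' a * at_z z' p)); last first.
    by apply: eq_bigr => z' _; rewrite /act mulrCA; congr (_ * _); exact: mulrC.
  rewrite -mulr_sumr; congr (_ * _).
  under [RHS]eq_bigr do rewrite /at_z eq_sym; rewrite sum_ind /k.
  rewrite (bigD1 z.1) //= [X in _ + X]big1 ?addr0; last first.
    move=> s /negbTE sz; rewrite /at_z zof_ext; case: eqP => [/(congr1 fst) /= e|_]; last exact: mulr0.
    by rewrite e eqxx in sz.
  by rewrite /at_z zof_ext mulrC eq_sym.
rewrite -(pair_bigA _ (fun z' a => k z' a * iter i (stepE sigma) (act z' a) ([::], s0))) /=.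
by apply: eq_bigr => z' _; apply: eq_bigr => a _; rewrite mulrC.
Qed.

End occupation.

Section realization.
Variables (s0 : S) (y : Z -> A -> R) (w : Z -> R) (kap : Z -> A).
Local Notation z0 := (zof ([::], s0)).
Hypothesis fl : flow z0 y w.
Hypothesis kap_en : forall z, enabled M z.1 (kap z).

Let tot z := \sum_a y z a + w z.
Let pa z a := y z a / tot z.
(** Without any flow through [z] the strategy commits there, so that the probabilities always sum to
    1. *)
Let pc z := if tot z == 0 then 1 else w z / tot z.

Let y_ge0 z a : 0 <= y z a. Proof. by case: fl. Qed.
Let w_ge0 z : 0 <= w z. Proof. by case: fl. Qed.
Let tot_ge0 z : 0 <= tot z. Proof. by rewrite addr_ge0 ?sumr_ge0. Qed.
Let pa_ge0 z a : 0 <= pa z a. Proof. by rewrite divr_ge0. Qed.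
Let pc_ge0 z : 0 <= pc z. Proof. by rewrite /pc; case: ifP => // _; rewrite divr_ge0. Qed.

Let pa_tot z a : tot z * pa z a = y z a.
Proof.
rewrite /pa; have [t0|t0] := eqVneq (tot z) 0; last by rewrite mulrCA divff ?mulr1.
rewrite t0 mul0r; move/eqP: t0; rewrite /tot paddr_eq0 ?sumr_ge0 // => /andP[+ _].
by rewrite psumr_eq0 // => /allP/(_ a (mem_index_enum _)) /= /eqP.
Qed.

Let p_sum z : \sum_a pa z a + pc z = 1.
Proof.
rewrite /pa /pc; have [t0|t0] := eqVneq (tot z) 0.
  by rewrite t0 big1 ?add0r // => a _; rewrite invr0 mulr0.
by rewrite -mulr_suml -mulrDl divff.
Qed.

Let pa_en z a : ~~ enabled M z.1 a -> pa z a = 0.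
Proof. by move=> en; rewrite /pa; case: fl => _ _ -> // _; rewrite mul0r. Qed.

(** Likelihood of the actions along a (reversed) history when the strategy has not
    committed, respectively has committed. *)
Fixpoint weights (h : seq (S * A)) : R * R :=
  if h is (s, a) :: h' then
    let: (u, v) := weights h' in let z := zof (rev h', s) in
    (u * pa z a, (v + u * pc z) * (a == kap z)%:R)
  else (1, 0).

Let wu (p : path) := (weights (rev p.1)).1.
Let wc (p : path) := (weights (rev p.1)).2.

Let wu_ext p a s : wu (ext p a s) = wu p * pa (zof p) a.
Proof. by rewrite /wu /ext /= rev_rcons /= revK -surjective_pairing; case: (weights _). Qed.

Let wc_ext p a s : wc (ext p a s) = (wc p + wu p * pc (zof p)) * (a == kap (zof p))%:R.
Proof. by rewrite /wc /wu /ext /= rev_rcons /= revK -surjective_pairing; case: (weights _). Qed.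

Let w_ge0' h : 0 <= (weights h).1 /\ 0 <= (weights h).2.
Proof.
elim: h => [|[s a] h]; first by split; rewrite ?ler01.
rewrite /=; case: (weights h) => u v /= [u0 v0].
split; first exact: mulr_ge0.
apply: mulr_ge0 (ler0n _ _); apply: addr_ge0 => //; exact: mulr_ge0.
Qed.

Let wu_ge0 p : 0 <= wu p. Proof. by case: (w_ge0' (rev p.1)). Qed.
Let wc_ge0 p : 0 <= wc p. Proof. by case: (w_ge0' (rev p.1)). Qed.

(** Whether the strategy has committed is not visible in the path, so the scheduler plays the
    conditional distribution of the next action given the history; on histories of weight 0 it plays
    [kap]. *)
Let mix p a : R :=
  if wu p + wc p == 0 then (a == kap (zof p))%:R
  else (wu p * pa (zof p) a + (wc p + wu p * pc (zof p)) * (a == kap (zof p))%:R) / (wu p + wc p).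

Let kap_sum z : \sum_a (a == kap z)%:R = 1 :> R.
Proof. by rewrite (bigD1 (kap z)) //= eqxx big1 ?addr0 // => a /negbTE ->. Qed.

Let mix_ge0 p a : 0 <= mix p a.
Proof.
rewrite /mix; case: ifP => _; first exact: ler0n.
apply: divr_ge0; last exact: addr_ge0.
apply: addr_ge0; first exact: mulr_ge0.
apply: mulr_ge0 (ler0n _ _); apply: addr_ge0 => //; exact: mulr_ge0.
Qed.

Let mix_sum p : \sum_a mix p a = 1.
Proof.
have [n0|n0] := eqVneq (wu p + wc p) 0.
  by under eq_bigr do rewrite /mix n0 eqxx; exact: kap_sum.
under eq_bigr do rewrite /mix (negbTE n0).
rewrite -mulr_suml big_split /= -!mulr_sumr kap_sum mulr1 addrCA -mulrDr p_sum mulr1 addrC.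
exact: divff.
Qed.

Let mix_en p a : ~~ enabled M p.2 a -> mix p a = 0.
Proof.
move=> en; have ak : a == kap (zof p) = false.
  by apply/eqP => ak; move: en; rewrite ak (kap_en (zof p)).
by rewrite /mix ak pa_en // !mulr0 addr0 mul0r if_same.
Qed.

Let sigma : scheduler R M := Scheduler mix_ge0 mix_sum mix_en.

(** [stepE] without the action probabilities, which sit in the weights [wu + wc] instead. These
    weights split into the uncommitted and the committed part, while the scheduler itself does
    not. *)
Let T (psi : path -> R) (p : path) : R :=
  \sum_a \sum_s prb (zof p) a s * psi (ext p a s).

Let T_add phi psi p : T (fun p => phi p + psi p) p = T phi p + T psi p.
Proof.
rewrite /T -big_split; apply: eq_bigr => a _; rewrite -big_split; apply: eq_bigr => s _.
exact: mulrDr.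
Qed.

Let le_T phi psi : (forall p, phi p <= psi p) -> forall p, T phi p <= T psi p.
Proof.
by move=> h p; apply: ler_sum => a _; apply: ler_sum => s _; rewrite ler_wpM2l ?prb_ge0.
Qed.

Let iterT_add n phi psi p :
  iter n T (fun p => phi p + psi p) p = iter n T phi p + iter n T psi p.
Proof.
elim: n p => //= n IH p; rewrite -T_add; congr (T _ p); apply/funext => q; exact: IH.
Qed.

Let le_iterT n phi psi : (forall p, phi p <= psi p) -> forall p, iter n T phi p <= iter n T psi p.
Proof. by move=> h; elim: n => //= n IH; exact: le_T. Qed.

Let stepE_T phi p : (wu p + wc p) * stepE sigma phi p = T (fun q => (wu q + wc q) * phi q) p.
Proof.
rewrite /stepE mulr_sumr; apply: eq_bigr => a _; rewrite mulrA mulr_sumr.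
apply: eq_bigr => s _; rewrite wu_ext wc_ext /= /mix /prb mulrCA; congr (_ * (_ * _)).
have [n0|n0] := eqVneq (wu p + wc p) 0; last by rewrite mulrCA divff // mulr1.
move/eqP: n0; rewrite paddr_eq0 // => /andP[/eqP -> /eqP ->].
by rewrite !(mul0r, addr0).
Qed.

Let Ex_T n phi p : (wu p + wc p) * iter n (stepE sigma) phi p =
  iter n T (fun q => (wu q + wc q) * phi q) p.
Proof.
elim: n p => //= n IH p; rewrite stepE_T; congr (T _ p); apply/funext => q; exact: IH.
Qed.

Let step f z := \sum_a pa z a * avg f z a.

Let T_wu n f p : iter n T (fun q => wu q * f (zof q)) p = wu p * iter n step f (zof p).
Proof.
elim: n p => //= n IH p; rewrite {2}/step mulr_sumr.
rewrite (_ : iter n T _ = fun q => wu q * iter n step f (zof q)); last by apply/funext.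
apply: eq_bigr => a _; rewrite mulrA /avg mulr_sumr; apply: eq_bigr => s _.
by rewrite wu_ext zof_ext mulrCA.
Qed.

(** Probability of being in [z] uncommitted after [n] steps, computed forwards. *)
Let q n z := iter n (fun v => inflow (fun u a => v u * pa u a)) (fun u => (u == z0)%:R) z.

Let q_step n f : \sum_z f z * q n z = iter n step f z0.
Proof.
elim: n f => [|n IH] f /=; first exact: sum_ind.
rewrite inflow_avg -iterS iterSr -IH; apply: eq_bigr => z _.
by rewrite [RHS]mulrC /step mulr_sumr; apply: eq_bigr => a _; rewrite -mulrA.
Qed.

Let q_ge0 n z : 0 <= q n z.
Proof.
elim: n z => [|n IH] z /=; first exact: ler0n.
apply: sumr_ge0 => u _; apply: sumr_ge0 => a _.
apply: mulr_ge0; first exact: mulr_ge0 (IH u) (pa_ge0 u a).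
apply: mulr_ge0; [exact: ler0n|exact: prb_ge0].
Qed.

Let occ n z := \sum_(i < n) q i z.

(** Only an inequality: a solution of the balance equations may contain circulations that are not
    fed from the start, and the actual occupation is the least solution. *)
Let occ_le n z : occ n z <= tot z.
Proof.
elim: n z => [|n IH] z; first by rewrite /occ big_ord0.
have -> : tot z = (z == z0)%:R + inflow y z by case: fl => _ _ _; apply.
rewrite /occ big_ord_recl lerD2l.
have -> : \sum_(i < n) q (lift ord0 i) z = inflow (fun u a => occ n u * pa u a) z.
  rewrite /inflow [LHS](eq_bigr (fun i : 'I_n => inflow (fun u a => q i u * pa u a) z)) //.
  rewrite exchange_big /=; apply: eq_bigr => u _; rewrite exchange_big /=; apply: eq_bigr => a _.
  by rewrite /occ !mulr_suml.
apply: ler_sum => u _; apply: ler_sum => a _; apply: ler_wpM2r.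
  apply: mulr_ge0; [exact: ler0n|exact: prb_ge0].
rewrite -pa_tot; apply: ler_wpM2r => //; exact: IH.
Qed.

Let mass n := \sum_z q n z.

Let massS n : mass n - mass n.+1 = \sum_z q n z * pc z.
Proof.
have -> : mass n.+1 = \sum_z \sum_a q n z * pa z a.
  rewrite /mass; under eq_bigr do rewrite -[q _ _]mul1r.
  rewrite /q /= inflow_avg; apply: eq_bigr => z _; apply: eq_bigr => a _.
  have [en|/pa_en ->] := boolP (enabled M z.1 a); last by rewrite !mulr0 mul0r.
  rewrite [avg _ _ _](_ : _ = 1) ?mulr1 // /avg; under eq_bigr do rewrite mulr1.
  exact: prb_sum.
rewrite /mass -sumrB; apply: eq_bigr => z _; rewrite -mulr_sumr.
by rewrite -{1}[q n z]mulr1 -mulrBr -(p_sum z) addrC addKr.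
Qed.

Let mass_occ n : \sum_z occ n z * pc z = 1 - mass n.
Proof.
elim: n => [|n IH].
  rewrite big1 => [|z _]; last by rewrite /occ big_ord0 mul0r.
  rewrite /mass (_ : \sum_z _ = 1) ?subrr // -[RHS](sum_ind (fun=> 1) z0).
  by apply: eq_bigr => z _; rewrite mul1r.
under eq_bigr do rewrite /occ big_ord_recr /= mulrDl.
by rewrite big_split /= IH -massS addrCA subrr addr0 || (rewrite big_split /= IH -massS; ring).
Qed.

Let w_total : \sum_z w z = 1.
Proof.
have := flow_value (fun=> 1) fl; under eq_bigr do rewrite mul1r.
move=> ->; rewrite big1 ?addr0 // => z _; rewrite big1 // => a _.
have [en|en] := boolP (enabled M z.1 a); last by case: fl => _ _ -> // _; rewrite mul0r.
rewrite [avg _ _ _](_ : _ = 1) ?subrr ?mulr0 // /avg; under eq_bigr do rewrite mulr1.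
exact: prb_sum.
Qed.

Let occ_pc n z : occ n z * pc z <= w z.
Proof.
rewrite /pc; have [t0|t0] := eqVneq (tot z) 0.
  by rewrite mulr1; apply: le_trans (occ_le n z) _; rewrite t0.
rewrite mulrA ler_pdivrMr; last by rewrite lt_def t0 tot_ge0.
by rewrite [leLHS]mulrC; apply: ler_wpM2l => //; exact: occ_le.
Qed.

(** The uncommitted mass decreases and its sum over time is bounded by the total flow, so it tends
    to 0 like [1 / n]: the strategy commits almost surely. *)
Let mass_le n : n%:R * mass n <= \sum_z tot z.
Proof.
have anti : {homo mass : i j / (i <= j)%N >-> j <= i}.
  apply: homo_leq => [//|x u v a b|i]; first exact: le_trans b a.
  rewrite -subr_ge0 massS; apply: sumr_ge0 => z _; exact: mulr_ge0 (q_ge0 _ _) (pc_ge0 _).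
apply: (@le_trans _ _ (\sum_z occ n z)); last by apply: ler_sum => z _; exact: occ_le.
rewrite /occ exchange_big /= mulr_natl -[X in _ *+ X](card_ord n) -sumr_const.
by apply: ler_sum => i _; apply: anti; exact: ltnW.
Qed.

(** Every commitment secures its reward, since under [kap] the expected value of [c] does not
    decrease, and the mass that is still uncommitted after [n] steps is negligible. The scheduler is
    fixed before [c] and [r], hence works for all rows. *)
Lemma realize : exists sigma : scheduler R M, forall (c : Z -> R) (r : {set S} -> R),
  (forall z, 0 <= c z <= avg c z (kap z)) -> (forall z, c z <= r z.2) ->
  forall e, 0 < e -> exists n0, forall n, (n0 <= n)%N ->
    \sum_z w z * c z <= Ex sigma n (fun p => r (visited p)) s0 + e.
Proof.
exists sigma => c r cc cr e e0; pose C := \sum_z c z.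
have c0 z : 0 <= c z by case/andP: (cc z).
have cC z : c z <= C by rewrite /C (bigD1 z) //= lerDl sumr_ge0.
have C0 : 0 <= C by exact: sumr_ge0.
pose Y := \sum_z tot z; have Y0 : 0 <= Y by exact: sumr_ge0.
exists (Num.truncn (C * Y / e)).+1 => n hn.
have n0 : 0 < n%:R :> R by rewrite ltr0n (leq_trans _ hn).
have small : C * mass n <= e.
  rewrite -(ler_pM2l n0) mulrCA; apply: le_trans (ler_wpM2l C0 (mass_le n)) _.
  rewrite -ler_pdivrMr //; apply: le_trans (ltW (truncnS_gt _)) _; last by rewrite ler_nat.
rewrite -lerBlDr; apply: le_trans (_ : \sum_z occ n z * pc z * c z <= _).
  rewrite lerBlDl -lerBlDr -sumrB; apply: le_trans small.
  have -> : mass n = \sum_z (w z - occ n z * pc z) by rewrite sumrB w_total mass_occ; ring.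
  rewrite mulr_sumr; apply: ler_sum => z _; rewrite -mulrBl mulrC ler_wpM2r //.
  by rewrite subr_ge0.
have ExT := Ex_T n (fun p => r (visited p)) ([::], s0).
have -> : Ex sigma n (fun p => r (visited p)) s0 =
    iter n T (fun q => (wu q + wc q) * r (visited q)) ([::], s0).
  by rewrite -ExT /wu /wc /= addr0 mul1r.
(* The uncommitted part of the weight is dropped; the committed part collects at least the rewards
   of all commitments made so far. *)
apply: (@le_trans _ _ (iter n T (fun q => wc q * c (zof q)) ([::], s0))); last first.
  by apply: le_iterT => p; apply: ler_pM => //; rewrite lerDr.
elim: (n) => [|m IH].
  by rewrite /= big1 ?mulr_ge0 // => z _; rewrite /occ big_ord0 !mul0r.
rewrite iterSr; apply: le_trans (_ : iter m T (fun q => wc q * c (zof q) +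
    wu q * (pc (zof q) * c (zof q))) ([::], s0) <= _); last first.
  apply: le_iterT => p; rewrite /T (bigD1 (kap (zof p))) //= -[leLHS]addr0; apply: lerD.
    under eq_bigr do rewrite wc_ext eqxx mulr1 zof_ext mulrCA.
    rewrite -mulr_sumr mulrA -mulrDl ler_wpM2l ?addr_ge0 ?mulr_ge0 //.
    by case/andP: (cc (zof p)).
  apply: sumr_ge0 => a _; apply: sumr_ge0 => s _.
  apply: mulr_ge0; [exact: prb_ge0|exact: mulr_ge0].
rewrite iterT_add (T_wu m (fun z => pc z * c z)) -q_step /wu /= mul1r.
under eq_bigr do rewrite /occ big_ord_recr /= !mulrDl.
rewrite big_split /= lerD ?IH //; apply: ler_sum => z _.
by rewrite [leRHS]mulrC mulrA.
Qed.

End realization.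

End flows.

(** * States in which the visited set can be frozen *)

Section safety.
Context (R : realType) (nS nA : nat) (M : mdp nS nA).
Local Notation S := 'I_nS.+1.
Local Notation A := 'I_nA.+1.
Local Notation Z := (S * {set S})%type.
Local Notation path := (finite_path nS nA).

(** [s \in safe V] when some strategy from [s] never leaves [V]: committing in such a state
    freezes the set of visited states. *)
Definition stays (V X : {set S}) (s : S) (a : A) : bool :=
  enabled M s a && [forall s', (trans M s a s' != 0) ==> (s' \in V) && (s' \in X)].
Definition safe_step (V X : {set S}) : {set S} := [set s | [exists a, stays V X s a]]%SET.
Definition safe (V : {set S}) : {set S} := iter nS.+1 (safe_step V) [set: S]%SET.

Lemma safe_step_mono V : {homo safe_step V : X Y / X \subset Y}.
Proof.
move=> X Y /fintype.subsetP XY; apply/fintype.subsetP => s; rewrite !finset.inE.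
move=> /existsP[a /andP[en /forallP h]]; apply/existsP; exists a; rewrite /stays en.
by apply/forallP => s'; apply/implyP => /(implyP (h s'))/andP[-> /XY].
Qed.

Lemma safe_fix V : safe_step V (safe V) = safe V.
Proof.
(* Iterating downwards from the full set complements iterating the dual operator upwards from the
   empty set, so as many rounds as there are states reach the greatest fixpoint. *)
have it n : iter n (safe_step V) [set: S]%SET = (~: iter n (funsetC (safe_step V)) finset.set0)%SET.
  by elim: n => [|n IH] /=; rewrite ?finset.setC0 // /funsetC finset.setCK IH.
have E : safe V = cofixset (safe_step V) by rewrite /cofixset /fixset card_ord -it.
by rewrite E cofixsetK //; exact: safe_step_mono.
Qed.

Lemma stay_ex (z : Z) : exists a, enabled M z.1 a && ((z.1 \in safe z.2) ==> stays z.2 (safe z.2) z.1 a).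
Proof.
have [zs|zs] := boolP (z.1 \in safe z.2).
  by move: zs; rewrite -{1}safe_fix finset.inE => /existsP[a ha]; exists a; rewrite ha andbT; case/andP: ha.
by have [a ea] := trans_enabled M z.1; exists a; rewrite andbT; apply/eqP.
Qed.

Definition stay (z : Z) : A := xchoose (stay_ex z).

Lemma stay_enabled z : enabled M z.1 (stay z).
Proof. by case/andP: (xchooseP (stay_ex z)). Qed.

(** Only a commitment in a safe state is paid: elsewhere no continuation can guarantee that [z.2] is
    the final visited set. *)
Definition reward (r : {set S} -> R) (z : Z) : R := if z.1 \in safe z.2 then r z.2 else 0.

Lemma reward_stay r z : (forall V, 0 <= r V) -> 0 <= reward r z <= @avg R _ _ M (reward r) z (stay z).
Proof.
move=> r0; have rw0 u : 0 <= reward r u by rewrite /reward; case: ifP.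
rewrite rw0 /=; rewrite {1}/reward; case: ifP => zs; last first.
  by apply: sumr_ge0 => s _; rewrite mulr_ge0 ?prb_ge0.
have /andP[en /implyP/(_ zs)/andP[_ /forallP h]] := xchooseP (stay_ex z); rewrite -/(stay z) in en h.
rewrite /avg -[leLHS]mul1r -(prb_sum R en) mulr_suml; apply: ler_sum => s _.
have [p0|p0] := eqVneq (trans M z.1 (stay z) s) 0.
  by rewrite /prb p0 rmorph0 !mul0r.
have /andP[sV sX] := implyP (h s) p0.
have -> : succ z s = (s, z.2).
  by congr pair; apply/finset.setUidPr; rewrite finset.sub1set.
by rewrite /reward /= sX.
Qed.

Variable (p : R).
Hypothesis p01 : 0 < p <= 1.
Hypothesis p_min : forall s a s', trans M s a s' != 0 -> p <= ratr (trans M s a s').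
Variable sigma : scheduler R M.

Let card (q : path) : R := #|visited q|%:R.

Lemma card_ext q a s : card q <= card (ext q a s).
Proof. by rewrite ler_nat visited_ext; apply/subset_leq_card/finset.subsetUr. Qed.

Let card_step q : card q <= stepE sigma card q.
Proof.
rewrite -[leLHS](stepE_const sigma _ q); apply: ler_sum => a _; apply: ler_wpM2l; first exact: sched_ge0.
by apply: ler_sum => s _; apply: ler_wpM2l (card_ext _ _ _); exact: ratr_trans_ge0.
Qed.

Let card_iter k q : card q <= iter k (stepE sigma) card q.
Proof.
elim: k q => //= k IH q; apply: le_trans (card_step q) _; exact: le_stepE.
Qed.

(** A state outside the [k]-th approximation of the safe set has, for every enabled action, a
    successor that is new or lies outside the approximation before; so within [k] steps the visited
    set grows with probability at least [p ^ k], whatever the scheduler does. *)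
Lemma unsafe_grows k q : q.2 \notin iter k (safe_step (visited q)) [set: S]%SET ->
  card q + p ^+ k <= iter k (stepE sigma) card q.
Proof.
have /andP[p0 p1] := p01.
elim: k q => [|k IH] q /=; first by rewrite finset.inE.
rewrite finset.inE negb_exists => /forallP h.
rewrite -[leLHS](stepE_avg sigma q); apply: ler_sum => a _.
have [en|/sched_enabled ->] := boolP (enabled M q.2 a); last by rewrite !mul0r.
apply: ler_wpM2l; first exact: sched_ge0.
have [s0 ts ns] : exists2 s, trans M q.2 a s != 0 &
    ~~ ((s \in visited q) && (s \in iter k (safe_step (visited q)) [set: S]%SET)).
  have := h a; rewrite /stays en /= negb_forall => /existsP[s].
  by rewrite negb_imply => /andP[]; exists s.
pose f s := iter k (stepE sigma) card (ext q a s).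
have f0 s : card q <= f s by exact: le_trans (card_ext _ _ _) (card_iter _ _).
have f1 : card q + p ^+ k <= f s0.
  have [sV|sV] := boolP (s0 \in visited q); last first.
    apply: le_trans (card_iter k (ext q a s0)); rewrite /card visited_ext (finset.cardsU1 s0) sV natrD addrC.
    by rewrite lerD2r exprn_ile1 // ltW.
  have vE : visited (ext q a s0) = visited q.
    by rewrite visited_ext; apply/finset.setUidPr; rewrite finset.sub1set.
  have -> : card q = card (ext q a s0) by rewrite /card vE.
  by apply: IH; rewrite vE; move: ns; rewrite sV.
rewrite -/f -mulr_suml.
apply: (@le_trans _ _ (\sum_s ratr (trans M q.2 a s) * card q + p * p ^+ k)).
  rewrite -mulr_suml -exprS (_ : \sum_s _ = 1) ?mul1r ?lexx //.
  by rewrite -rmorph_sum (eqP en) rmorph1.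
rewrite (bigD1 s0) //= [leRHS](bigD1 s0) //= addrAC; apply: lerD; last first.
  by apply: ler_sum => s _; apply: ler_wpM2l (f0 s); exact: ratr_trans_ge0.
have := p_min ts; have := f1; have : 0 <= p ^+ k by rewrite exprn_ge0 // ltW.
have := ratr_trans_ge0 R M q.2 a s0.
rewrite -/(f s0); move: (ratr (trans M q.2 a s0) : R) (f s0) (card q) (p ^+ k) => x y u v x0 v0 h1 h2.
apply: le_trans (ler_wpM2l x0 h1); rewrite mulrDr lerD2l; exact: ler_wpM2r.
Qed.

(** The expected number of visited states is monotone and bounded, so its increments over [nS.+1]
    steps tend to 0, and these dominate a fixed multiple of the probability of being unsafe. *)
Lemma unsafe_vanishes s0 e : 0 < e -> exists t0, forall t, (t0 <= t)%N ->
  Ex sigma t (fun q => (q.2 \notin safe (visited q))%:R) s0 <= e.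
Proof.
move=> e0; have /andP[p0 p1] := p01.
pose a t := Ex sigma t card s0.
have a_mono : {homo a : m n / (m <= n)%N >-> m <= n}.
  apply: homo_leq => [//|x u v|t]; first exact: le_trans.
  by rewrite /a /Ex iterSr; apply: le_iterE => q; exact: card_step.
have a_cvg : cvgn a.
  apply: nondecreasing_is_cvgn => //; exists nS.+1%:R => _ [t _ <-].
  rewrite /a /Ex -[leRHS](iterE_const sigma t _ ([::], s0)); apply: le_iterE => q.
  by rewrite ler_nat -[X in (_ <= X)%N](card_ord nS.+1) max_card.
have h t : p ^+ nS.+1 * Ex sigma t (fun q => (q.2 \notin safe (visited q))%:R) s0 <= a (t + nS.+1)%N - a t.
  rewrite lerBrDl /a /Ex iterD -iterE_mul -iterE_add; apply: le_iterE => q.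
  have [hq|hq] := boolP (q.2 \in safe (visited q)).
    by rewrite mulr0 addr0; exact: card_iter.
  by rewrite mulr1; exact: unsafe_grows.
have pn : 0 < p ^+ nS.+1 by exact: exprn_gt0.
have d0 : (fun t => a (t + nS.+1)%N - a t) @ \oo --> (0 : R).
  rewrite -(subrr (limn a)); apply: cvgB => //.
  by rewrite (cvg_shiftn nS.+1).
have : \forall t \near \oo, `|a (t + nS.+1)%N - a t| <= e * p ^+ nS.+1.
  move/cvgr0_norm_le : d0; apply; exact: mulr_gt0.
move=> [t0 _ ht]; exists t0 => t tt.
rewrite -(ler_pM2l pn) [leRHS]mulrC; apply: le_trans (h t) _.
by apply: le_trans (ler_norm _) _; exact: ht.
Qed.

End safety.

(** Allows one scheduler to follow a different strategy for each initial state, which it finds at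
    the beginning of its history. *)
Lemma eq_Ex (R : realType) nS nA (M : mdp nS nA) (s1 s2 : scheduler R M) n phi s0 :
  (forall p, fp_state p 0 = s0 -> sched s1 p =1 sched s2 p) -> Ex s1 n phi s0 = Ex s2 n phi s0.
Proof.
move=> h; rewrite /Ex; have : fp_state (([::], s0) : finite_path nS nA) 0 = s0 by [].
elim: n ([::], s0) => //= n IH p ps; apply: eq_bigr => a _; rewrite h //; congr (_ * _).
apply: eq_bigr => s _; congr (_ * _); apply: IH.
by case: p ps => [[|[x b] l] t].
Qed.

Lemma sum_pair (V : nmodType) (I J : finType) (F : I * J -> V) :
  \sum_u F u = \sum_i \sum_j F (i, j).
Proof. by rewrite pair_bigA /=; apply: eq_bigr => -[]. Qed.

(** * Rows of payoffs: from schedulers to flows and back *)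

Section rows.
Context (R : realType) (nS nA : nat) (M : mdp nS nA) (nk ms nc d : nat).
Local Notation S := 'I_nS.+1.
Local Notation A := 'I_nA.+1.
Local Notation Z := (S * {set S})%type.
Local Notation path := (finite_path nS nA).
Variables (ini : 'I_ms -> 'I_nc -> S) (idx : 'I_ms -> 'I_nc -> 'I_nk)
  (tgt : 'I_ms -> 'I_nc -> {set S}).
Variables (jx : 'I_d -> 'I_nc) (cf : 'I_d -> 'I_ms -> int) (thr : 'I_d -> int) (big : nat).
Hypothesis cf_big : forall i, \sum_m `|cf i m| <= big%:R.
Local Notation Q := ('I_nk * S)%type.

Definition row_val (sigma : 'I_nk -> scheduler R M) (i : 'I_d) : R :=
  \sum_m (cf i m)%:~R * Pr_reach (sigma (idx m (jx i))) (ini m (jx i)) (tgt m (jx i)).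

(** Contribution to row [i] of a run [q] that ends with the visited set [V], shifted to be
    nonnegative. *)
Definition pay (i : 'I_d) (q : Q) (V : {set S}) : int :=
  \sum_(m | (idx m (jx i), ini m (jx i)) == q) cf i m * (V :&: tgt m (jx i) != finset.set0)%:R + big%:R.
Local Notation payR i q := (fun V => (pay i q V)%:~R : R).

(** Compensates for the shift by [big] in [pay], which occurs once for every pair of a scheduler and
    an initial state. *)
Definition threshold (i : 'I_d) : int := thr i + (#|{: Q}| * big)%:R.

Definition achieves (y : Q -> Z -> A -> R) (w : Q -> Z -> R) (th : 'I_d -> R) : Prop :=
  (forall q, flow M (zof (nA := nA) ([::], q.2)) (y q) (w q)) /\
  forall i, th i <= \sum_q \sum_z w q z * reward M (payR i q) z.

Lemma pay_bound i q V : 0 <= pay i q V <= (2 * big)%:R.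
Proof.
have := cf_big i; rewrite (bigID (fun m => (idx m (jx i), ini m (jx i)) == q)) /= => hb.
have h : `|\sum_(m | (idx m (jx i), ini m (jx i)) == q)
    cf i m * (V :&: tgt m (jx i) != finset.set0)%:R| <= big%:R.
  apply: le_trans hb; apply: le_trans (ler_norm_sum _ _ _) _.
  rewrite -[leLHS]addr0; apply: lerD; last by apply: sumr_ge0.
  by apply: ler_sum => m _; rewrite normrM ler_piMr //; case: (_ != _); rewrite ?normr1 ?normr0.
rewrite /pay natrM; move: h; rewrite ler_norml => /andP[h1 h2].
by apply/andP; split; lra.
Qed.

Lemma payR_ge0 i q V : 0 <= payR i q V.
Proof. by rewrite ler0z; case/andP: (pay_bound i q V). Qed.

Lemma payR_le i q V : payR i q V <= 2 * big%:R.
Proof.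
have /andP[_] := pay_bound i q V; rewrite -(ler_int R) => /le_trans; apply.
by rewrite rmorph_nat natrM.
Qed.

Lemma row_cvg sigma i :
  (fun n => \sum_(q : Q) Ex (sigma q.1) n (fun p => payR i q (visited p)) q.2) @ \oo -->
  row_val sigma i + (#|{: Q}| * big)%:R.
Proof.
pose v n m := Ex (sigma (idx m (jx i))) n (fun p => (hit (tgt m (jx i)) p)%:R) (ini m (jx i)).
have E n : \sum_(q : Q) Ex (sigma q.1) n (fun p => payR i q (visited p)) q.2 =
    \sum_m (cf i m)%:~R * v n m + (#|{: Q}| * big)%:R.
  have -> : (#|{: Q}| * big)%:R = \sum_(q : Q) big%:R :> R.
    by rewrite sumr_const -mulrnA mulnC.
  rewrite [X in _ = X + _](partition_big (fun m => (idx m (jx i), ini m (jx i)))  xpredT) //=.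
  rewrite -big_split /=; apply: eq_bigr => q _.
  transitivity (\sum_m ((((idx m (jx i), ini m (jx i)) == q)%:R * (cf i m)%:~R) *
      Ex (sigma q.1) n (fun p => (hit (tgt m (jx i)) p)%:R) q.2) + big%:R).
    rewrite -(iterE_const (sigma q.1) n big%:R ([::], q.2)) /Ex -iterE_sum -iterE_add.
    congr (iter n _ _ _); apply/funext => p; rewrite /pay rmorphD /= rmorph_nat; congr (_ + _).
    rewrite rmorph_sum big_mkcond /=; apply: eq_bigr => m _; rewrite rmorphM rmorph_nat /hit.
    by case: eqP => _; rewrite ?mul1r ?mul0r.
  congr (_ + _); rewrite [RHS]big_mkcond /=; apply: eq_bigr => m _.
  by case: eqP => [<-|_]; rewrite ?mul1r // !mul0r.
rewrite (_ : (fun n => _) = fun n => \sum_m (cf i m)%:~R * v n m + (#|{: Q}| * big)%:R); last exact/funext.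
apply: cvgD; last exact: cvg_cst.
apply: cvg_big => [|m _]; first exact: add_continuous.
by apply: cvgM; [exact: cvg_cst|exact: Pr_reach_cvg].
Qed.

Variable p : R.
Hypothesis p01 : 0 < p <= 1.
Hypothesis p_min : forall s a s', trans M s a s' != 0 -> p <= ratr (trans M s a s').

(** The runs are stopped after a long time [t]. Half of [e] pays for the distance to the limit, the
    other half for runs that are stopped in an unsafe state and lose their reward. *)
Lemma achieves_of_schedulers sigma (g : 'I_d -> R) e :
  (forall i, (thr i)%:~R + g i <= row_val sigma i) -> 0 < e ->
  exists y w, achieves y w (fun i => (threshold i)%:~R + g i - e).
Proof.
move=> hg e0; have e20 : 0 < e / 2 by rewrite divr_gt0.
(* The total loss per unit of probability of being unsafe; adding 1 keeps the division legal. *)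
pose C : R := #|{: Q}|%:R * (2 * big%:R) + 1.
have C0 : 0 < C by rewrite ltr_wpDl // !mulr_ge0.
have /choice[tu htu] := fun q : Q =>
  unsafe_vanishes p01 p_min (sigma q.1) q.2 (divr_gt0 e20 C0).
have /choice[ti hti] : forall i, exists t0, forall t, (t0 <= t)%N ->
    (threshold i)%:~R + g i - e / 2 <=
    \sum_(q : Q) Ex (sigma q.1) t (fun p => payR i q (visited p)) q.2.
  move=> i; have /cvgrPdist_le/(_ _ e20)[t0 _ h] := @row_cvg sigma i.
  exists t0 => t tt; have := h t tt => /=; rewrite ler_distl => /andP[_].
  have := hg i; rewrite /threshold rmorphD /= rmorph_nat.
  set X := \sum_q _; set Y := (_ * _)%:R; lra.
pose t := maxn (\max_q tu q) (\max_i ti i).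
have /choice[y /choice[w hyw]] := fun q : Q => occupation (sigma q.1) q.2 t.
exists y, w; split=> [q|i]; first by case: (hyw q).
have hi := hti i t (leq_trans (leq_bigmax i) (leq_maxr _ _)).
suff : \sum_(q : Q) Ex (sigma q.1) t (fun p => payR i q (visited p)) q.2 - e / 2 <=
    \sum_q \sum_z w q z * reward M (payR i q) z by lra.
pose u (q : Q) := Ex (sigma q.1) t (fun p => (p.2 \notin safe M (visited p))%:R : R) q.2.
apply: (@le_trans _ _ (\sum_(q : Q) (Ex (sigma q.1) t (fun p => payR i q (visited p)) q.2 -
    2 * big%:R * u q))).
  rewrite sumrB lerD2l lerN2 -mulr_sumr.
  apply: (@le_trans _ _ (2 * big%:R * \sum_(q : Q) (e / 2 / C))).
    rewrite ler_wpM2l ?mulr_ge0 //; apply: ler_sum => q _; apply: htu.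
    exact: leq_trans (leq_bigmax q) (leq_maxl _ _).
  have -> : 2 * big%:R * \sum_(q : Q) (e / 2 / C) = e / 2 * ((C - 1) / C).
    by rewrite sumr_const -mulr_natl /C; field; exact: lt0r_neq0.
  by rewrite ler_piMr ?(ltW e20) // ler_pdivrMr // mul1r gerBl.
apply: ler_sum => q _; case: (hyw q) => _ ->.
rewrite lerBlDr /u /Ex -iterE_mul -iterE_add; apply: le_iterE => s /=.
rewrite /reward /zof /=; case: ifP => hs; first by rewrite mulr0 addr0.
by rewrite mulr1 add0r; exact: payR_le.
Qed.

(** No margin is lost in this direction: the shortfall in [realize] vanishes as time grows, and
    reachability probabilities are limits. *)
Lemma schedulers_of_achieves y w (g : 'I_d -> R) :
  achieves y w (fun i => (threshold i)%:~R + g i) ->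
  exists sigma, forall i, (thr i)%:~R + g i <= row_val sigma i.
Proof.
move=> [fl hth].
have /choice[tau htau] := fun q : Q => realize (fl q) (@stay_enabled _ _ M).
have sum1 k pth : \sum_a sched (tau (k, fp_state pth 0)) pth a = 1 by exact: sched_sum.
(* Gluing: scheduler [k] follows the strategy that belongs to [k] and to the first state of its
   history. *)
pose sigma k : scheduler R M := @Scheduler R nS nA M
  (fun pth => sched (tau (k, fp_state pth 0)) pth)
  (fun pth a => sched_ge0 (tau (k, fp_state pth 0)) pth a) (fun pth => sum1 k pth)
  (fun pth a h => @sched_enabled _ _ _ _ (tau (k, fp_state pth 0)) pth a h).
exists sigma => i; apply/ler_addgt0Pr => e e0.
have e1 : 0 < e / (#|{: Q}|%:R + 1) by rewrite divr_gt0 // ltr_wpDl.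
have /choice[n0 hn0] : forall q : Q, exists n0, forall n, (n0 <= n)%N ->
    \sum_z w q z * reward M (payR i q) z <=
    Ex (sigma q.1) n (fun p => payR i q (visited p)) q.2 + e / (#|{: Q}|%:R + 1).
  move=> q; have [||n0 h] := htau q (reward M (payR i q)) (payR i q) _ _ _ e1.
  - by move=> z; apply: reward_stay => V; exact: payR_ge0.
  - by move=> z; rewrite /reward; case: ifP => // _; exact: payR_ge0.
  exists n0 => n /h; rewrite (@eq_Ex _ _ _ _ (sigma q.1) (tau q)) // => pth ps a.
  by rewrite /sigma /= ps -surjective_pairing.
have hl := @row_cvg sigma i.
suff : (threshold i)%:~R + g i <= row_val sigma i + (#|{: Q}| * big)%:R + e.
  rewrite /threshold rmorphD /= rmorph_nat; set Y := (_ * _)%:R; lra.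
rewrite -lerBlDr -(cvg_lim (@Rhausdorff R) hl); apply: limr_ge.
  by apply/cvg_ex; eexists; exact: hl.
exists (\max_q n0 q)%N => // n /= hn; rewrite lerBlDr; apply: le_trans (hth i) _.
apply: (@le_trans _ _ (\sum_(q : Q) (Ex (sigma q.1) n (fun p => payR i q (visited p)) q.2 +
    e / (#|{: Q}|%:R + 1)))).
  apply: ler_sum => q _; apply: hn0; exact: leq_trans (leq_bigmax q) hn.
rewrite big_split /= lerD2l sumr_const -[leLHS]mulr_natr -mulrA ler_piMr ?(ltW e0) //.
by rewrite mulrC ler_pdivrMr ?mul1r ?lerDl // ltr_wpDl.
Qed.

(** * The integer linear program of the rows and its gap *)

Section gap.
Variables (D B : nat) (PI : S -> A -> S -> int) (st : 'I_d -> bool).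
Hypothesis D0 : (0 < D)%N.
Hypothesis PIE : forall s a s', (PI s a s')%:~R = D%:R * ratr (trans M s a s') :> R.
Hypothesis DB : (2 * D <= B)%N.
Hypothesis bigB : (2 * big <= B)%N.
Hypothesis thrB : forall i, `|threshold i| <= B%:R.

Local Notation z0 q := (zof (nA := nA) ([::], snd q)).
Definition lp_row : finType := ((Q * Z) + ('I_d + unit))%type.
Definition lp_col : finType := ((Q * Z * A) + ((Q * Z) + ('I_d + (unit + unit))))%type.

Definition rewardI i q (z : Z) : int := if z.1 \in safe M z.2 then pay i q z.2 else 0.

Lemma rewardIE i q z : (rewardI i q z)%:~R = reward M (payR i q) z.
Proof. by rewrite /rewardI /reward; case: ifP. Qed.

(** The flow equations and the rows, homogenised by an unknown [tau >= 1]; the last columns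
    are slack variables. *)
Definition lp_ent (r : lp_row) (c : lp_col) : int :=
  match r, c with
  | inl u, inl (v, a) =>
      if (u.1 == v.1) && enabled M v.2.1 a then
        D%:R * (u.2 == v.2)%:R - (u.2 == succ v.2 u.2.1)%:R * PI v.2.1 a u.2.1 else 0
  | inl u, inr (inl v) => D%:R * (u == v)%:R
  | inl u, inr (inr (inr (inl _))) => - (D%:R * (u.2 == z0 u.1)%:R)
  | inr (inl i), inr (inl v) => rewardI i v.1 v.2
  | inr (inl i), inr (inr (inl j)) => - (i == j)%:R
  | inr (inl i), inr (inr (inr (inl _))) => - threshold i
  | inr (inr _), inr (inr (inr (inl _))) => 1
  | inr (inr _), inr (inr (inr (inr _))) => -1
  | _, _ => 0
  end.
Definition lp_rhs (r : lp_row) : int :=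
  match r with inl _ => 0 | inr (inl i) => (st i)%:R | inr (inr _) => 1 end.
Definition lp_dir (r : lp_row) : int := if r is inr (inl _) then -1 else 0.

Lemma lp_sum r (x : lp_col -> R) : \sum_c (lp_ent r c)%:~R * x c =
  \sum_u \sum_a (lp_ent r (inl (u, a)))%:~R * x (inl (u, a)) +
  (\sum_u (lp_ent r (inr (inl u)))%:~R * x (inr (inl u)) +
  (\sum_i (lp_ent r (inr (inr (inl i))))%:~R * x (inr (inr (inl i))) +
  ((lp_ent r (inr (inr (inr (inl tt)))))%:~R * x (inr (inr (inr (inl tt)))) +
   (lp_ent r (inr (inr (inr (inr tt)))))%:~R * x (inr (inr (inr (inr tt))))))).
Proof.
rewrite big_sumType /= sum_pair; congr (_ + _); rewrite big_sumType /=; congr (_ + _).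
rewrite big_sumType /=; congr (_ + _); rewrite big_sumType /= ; congr (_ + _).
  by rewrite (big_pred1 tt) // => -[].
by rewrite (big_pred1 tt) // => -[].
Qed.

Lemma lp_flow (x : lp_col -> R) q z :
  \sum_c (lp_ent (inl (q, z)) c)%:~R * x c =
  D%:R * (\sum_a (enabled M z.1 a)%:R * x (inl ((q, z), a)) + x (inr (inl (q, z))) -
    (z == z0 q)%:R * x (inr (inr (inr (inl tt)))) -
    @inflow R _ _ M (fun z a => (enabled M z.1 a)%:R * x (inl ((q, z), a))) z).
Proof.
rewrite lp_sum /= [X in _ + (_ + (X + _))]big1 ?add0r ?mul0r ?addr0; last by move=> i _; rewrite mul0r.
have -> : \sum_u (D%:R * ((q, z) == u)%:R)%:~R * x (inr (inl u)) = D%:R * x (inr (inl (q, z))).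
  rewrite (bigD1 (q, z)) //= eqxx mulr1 rmorph_nat big1 ?addr0 // => u /negbTE uz.
  by rewrite eq_sym uz mulr0 mul0r.
have -> : \sum_u \sum_a (if (q == u.1) && enabled M u.2.1 a then
      D%:R * (z == u.2)%:R - (z == succ u.2 z.1)%:R * PI u.2.1 a z.1 else 0)%:~R * x (inl (u, a)) =
    D%:R * (\sum_a (enabled M z.1 a)%:R * x (inl ((q, z), a)) -
    @inflow R _ _ M (fun z a => (enabled M z.1 a)%:R * x (inl ((q, z), a))) z).
  rewrite sum_pair /=.
  rewrite (bigD1 q) //= [X in _ + X]big1 ?addr0; last first.
    move=> q' /negbTE qq; rewrite big1 // => z' _; rewrite big1 // => a _.
    by rewrite eq_sym qq mul0r.
  have -> : \sum_a (enabled M z.1 a)%:R * x (inl (q, z, a)) =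
      \sum_z' (z == z')%:R * \sum_a (enabled M z'.1 a)%:R * x (inl (q, z', a)).
    rewrite [RHS](bigD1 z) //= eqxx mul1r [X in _ = _ + X]big1 ?addr0 // => z' /negbTE zz.
    by rewrite eq_sym zz mul0r.
  rewrite /inflow -sumrB mulr_sumr; apply: eq_bigr => z' _.
  rewrite mulr_sumr -sumrB mulr_sumr; apply: eq_bigr => a _.
  rewrite eqxx /=; case: ifP => en; last by rewrite rmorph0 !(mul0r, mulr0) subrr mulr0.
  rewrite rmorphB /= !rmorphM /= !rmorph_nat PIE /prb; ring.
rewrite rmorphN rmorphM /= !rmorph_nat; ring.
Qed.

Lemma lp_payoff (x : lp_col -> R) i :
  \sum_c (lp_ent (inr (inl i)) c)%:~R * x c =
  \sum_q \sum_z x (inr (inl (q, z))) * reward M (payR i q) z -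
  x (inr (inr (inl i))) - (threshold i)%:~R * x (inr (inr (inr (inl tt)))).
Proof.
rewrite lp_sum /= big1 ?add0r ?mul0r ?addr0; last by move=> u _; rewrite big1 // => a _; rewrite mul0r.
rewrite rmorphN /= mulNr addrA; congr (_ + _ - _).
  rewrite sum_pair /=.
  by apply: eq_bigr => q _; apply: eq_bigr => z _; rewrite rewardIE mulrC.
rewrite (bigD1 i) //= eqxx rmorphN rmorph1 mulN1r big1 ?addr0 // => j /negbTE ji.
by rewrite eq_sym ji oppr0 mul0r.
Qed.

Lemma lp_scale (x : lp_col -> R) :
  \sum_c (lp_ent (inr (inr tt)) c)%:~R * x c =
  x (inr (inr (inr (inl tt)))) - x (inr (inr (inr (inr tt)))).
Proof.
rewrite lp_sum /= big1 ?add0r; last by move=> u _; rewrite big1 // => a _; rewrite mul0r.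
rewrite big1 ?add0r; last by move=> u _; rewrite mul0r.
by rewrite big1 ?add0r ?rmorphN ?rmorph1 ?mul1r ?mulN1r // => u _; rewrite mul0r.
Qed.

Lemma lp_bound r c : `|lp_ent r c| <= B%:R.
Proof.
have B1 : 1 <= B%:R :> int by rewrite ler1n (leq_trans _ DB) // muln_gt0.
have b1 (b : bool) : `|b%:R| <= 1 :> int by case: b.
have DB1 (b : bool) : `|D%:R * b%:R| <= B%:R :> int.
  rewrite normrM ger0_norm //; apply: le_trans (ler_piMr _ (b1 b)) _; rewrite ?ler0n //.
  by rewrite ler_nat (leq_trans _ DB) // leq_pmull.
have B0 : 0 <= B%:R :> int by exact: ler0n.
case: r => [u|[i|[]]]; case: c => [[v a]|[v|[j|[[]|[]]]]] //=;
  rewrite ?normrN ?normr0 ?normr1 //; last 2 first.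
- rewrite /rewardI; case: ifP => _; last by rewrite normr0.
  have /andP[h0 h1] := pay_bound i v.1 v.2.2; rewrite ger0_norm //.
  by apply: le_trans h1 _; rewrite ler_nat.
- by apply: le_trans (b1 _) _.
case: ifP => _; last by rewrite normr0.
apply: le_trans (ler_normB _ _) _; apply: (@le_trans _ _ (D%:R + D%:R)); last first.
  by rewrite -natrD addnn -mul2n ler_nat.
apply: lerD; first by rewrite normrM ger0_norm // ler_piMr.
have h : 0 <= PI v.2.1 a u.2.1 <= D%:R.
  have /andP[t0 t1] := trans_itv M v.2.1 a u.2.1.
  apply/andP; split; rewrite -(ler_int R) PIE ?rmorph_nat ?rmorph0.
    by rewrite mulr_ge0 ?ler0q.
  by rewrite ler_piMr // -(rmorph1 (@ratr R)) ler_rat.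
case/andP: h => h0 h1; rewrite normrM [X in _ * X]ger0_norm //.
by apply: le_trans (ler_piMl _ (b1 _)) _.
Qed.

(** The system is triangular: the slack columns annihilate the multipliers of the rows and of the
    scale equation, and the commitment columns then those of the flow equations. *)
Lemma lp_rank (u : lp_row -> R) : (forall c, \sum_r u r * (lp_ent r c)%:~R = 0) -> forall r, u r = 0.
Proof.
move=> h; have sumE c : \sum_r u r * (lp_ent r c)%:~R = \sum_v u (inl v) * (lp_ent (inl v) c)%:~R +
    (\sum_i u (inr (inl i)) * (lp_ent (inr (inl i)) c)%:~R + u (inr (inr tt)) * (lp_ent (inr (inr tt)) c)%:~R).
  by rewrite big_sumType /=; congr (_ + _); rewrite big_sumType /=; congr (_ + _); rewrite (big_pred1 tt) // => -[].
have ui i : u (inr (inl i)) = 0.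
  have := h (inr (inr (inl i))); rewrite sumE /= big1 ?add0r ?mulr0 ?addr0; last by move=> v _; rewrite mulr0.
  rewrite (bigD1 i) //= eqxx rmorphN rmorph1 mulrN1 big1 ?addr0; first by move/eqP; rewrite oppr_eq0 => /eqP.
  by move=> j /negbTE ->; rewrite oppr0 mulr0.
have ut : u (inr (inr tt)) = 0.
  have := h (inr (inr (inr (inr tt)))); rewrite sumE /= big1 ?add0r; last by move=> v _; rewrite mulr0.
  rewrite big1 ?add0r; last by move=> v _; rewrite mulr0.
  by rewrite rmorphN rmorph1 mulrN1 => /eqP; rewrite oppr_eq0 => /eqP.
case=> [v|[i|[]]] //; have := h (inr (inl v)); rewrite sumE /= ut mul0r addr0.
rewrite [X in _ + X]big1 ?addr0; last by move=> i _; rewrite ui mul0r.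
rewrite (bigD1 v) //= eqxx mulr1 rmorph_nat big1 ?addr0; last by move=> w /negbTE ->; rewrite mulr0 mulr0.
by move=> /eqP; rewrite mulf_eq0 pnatr_eq0 (gtn_eqF D0) orbF => /eqP.
Qed.

Definition gap_bound : nat := cramer_bound B #|lp_row|.

(** The scale [tau] of a basic solution is bounded by the program alone, so the new margin [1 / tau]
    of strict rows no longer depends on [del], and the error [eta] disappears. *)
Lemma achieves_gap y w (del eta : R) :
  achieves y w (fun i => (threshold i)%:~R + del * (st i)%:R - eta) ->
  0 < del <= 1 -> 0 <= eta -> eta * gap_bound%:R < del ->
  exists y' w' tau, 1 <= tau <= #|lp_row|%:R * gap_bound%:R /\
    achieves y' w' (fun i => (threshold i)%:~R + (st i)%:R / tau).
Proof.
move=> [fl hth] /andP[d0 d1] e0 eB.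
pose val i := \sum_q \sum_z w q z * reward M (payR i q) z.
(* Dividing by [del] turns the unknown margin into 1 and hides it in the scale [1 / del]; the error
   becomes [eta / del], which is below the threshold of [lp_gap]. *)
pose x (c : lp_col) : R := match c with
  | inl ((q, z), a) => y q z a / del
  | inr (inl (q, z)) => w q z / del
  | inr (inr (inl i)) => (val i - (threshold i)%:~R - del * (st i)%:R + eta) / del
  | inr (inr (inr (inl _))) => del^-1
  | inr (inr (inr (inr _))) => del^-1 - 1
  end.
have x0 c : 0 <= x c.
  case: c => [[[q z] a]|[[q z]|[i|[[]|[]]]]] /=; rewrite ?divr_ge0 ?invr_ge0 ?(ltW d0) //.
  - by case: (fl q).
  - by case: (fl q).
  - by have := hth i; rewrite -/(val i) => h; lra.
  - by rewrite subr_ge0 invf_ge1.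
have xE r : \sum_c (lp_ent r c)%:~R * x c = (lp_rhs r)%:~R + (eta / del) * (lp_dir r)%:~R.
  case: r => [[q z]|[i|[]]].
  - rewrite lp_flow /= mulr0 addr0; case: (fl q) => _ _ ye hz.
    have -> : \sum_a (enabled M z.1 a)%:R * (y q z a / del) = (\sum_a y q z a) / del.
      rewrite mulr_suml; apply: eq_bigr => a _; case: (boolP (enabled M z.1 a)) => [_|/ye ->].
        by rewrite mul1r.
      by rewrite !mul0r.
    rewrite (_ : inflow M _ z = inflow M (y q) z / del); last first.
      rewrite /inflow mulr_suml; apply: eq_bigr => z' _; rewrite mulr_suml; apply: eq_bigr => a _.
      case: (boolP (enabled M z'.1 a)) => [_|/ye ->]; last by rewrite !mul0r.
      by rewrite mul1r mulrAC.
    by have := hz z; move: (\sum_a y q z a) (inflow M (y q) z) => u v /eqP; rewrite -subr_eq0 => /eqP h;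
      rewrite -mulrDl -mulrBl -mulrBl opprD addrA in h *; rewrite h mul0r mulr0.
  - rewrite lp_payoff /= rmorphN rmorph1 rmorph_nat.
    have -> : \sum_q \sum_z w q z / del * reward M (payR i q) z = val i / del.
      rewrite /val mulr_suml; apply: eq_bigr => q _; rewrite mulr_suml; apply: eq_bigr => z _.
      by rewrite mulrAC.
    by field; exact: lt0r_neq0.
  - by rewrite lp_scale /= mulr0 addr0 rmorph1 opprB addrCA subrr addr0.
have [|||x' [x'0 x'E x'B]] := lp_gap lp_bound (b0 := lp_rhs) (b1 := lp_dir) _ _ lp_rank
  (divr_ge0 e0 (ltW d0)) _ x0 xE.
- have B1 : 1 <= B%:R :> int by rewrite ler1n (leq_trans _ DB) // muln_gt0.
  by case=> [?|[i|[]]] /=; rewrite ?normr0 ?normr1 //; case: (st i); rewrite ?normr1 ?normr0.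
- have B1 : 1 <= B%:R :> int by rewrite ler1n (leq_trans _ DB) // muln_gt0.
  by case=> [?|[i|[]]] /=; rewrite ?normrN ?normr0 ?normr1.
- by rewrite mulrAC ltr_pdivrMr // mul1r.
pose tau := x' (inr (inr (inr (inl tt)))).
have tau1 : 1 <= tau.
  have := x'E (inr (inr tt)); rewrite lp_scale /= rmorph1 => /eqP; rewrite subr_eq => /eqP.
  by rewrite -/tau => ->; rewrite lerDl.
have t0 : 0 < tau by exact: lt_le_trans tau1.
exists (fun q z a => (enabled M z.1 a)%:R * x' (inl ((q, z), a)) / tau), (fun q z => x' (inr (inl (q, z))) / tau), tau.
rewrite tau1 x'B; split=> //; split=> [q|i].
  split=> [z a|z|z a /negbTE ->|z]; rewrite ?mul0r // ?divr_ge0 ?mulr_ge0 ?ler0n ?(ltW t0) //.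
  have := x'E (inl (q, z)); rewrite lp_flow /= rmorph0 -/tau => /eqP.
  rewrite mulf_eq0 pnatr_eq0 (gtn_eqF D0) /= => /eqP h.
  rewrite (_ : inflow M (fun _ _ => _) z = inflow M (fun z a => (enabled M z.1 a)%:R * x' (inl (q, z, a))) z / tau); last first.
    by rewrite /inflow mulr_suml; apply: eq_bigr => z' _; rewrite mulr_suml; apply: eq_bigr => a _; rewrite mulrAC.
  rewrite -mulr_suml -mulrDl; apply: (mulIf (lt0r_neq0 t0)).
  rewrite [RHS]mulrDl !divfK ?(lt0r_neq0 t0) //; move: h; set u := \sum_a _; set v := inflow _ _ _; lra.
have := x'E (inr (inl i)); rewrite lp_payoff /= rmorph_nat -/tau => h.
have -> : \sum_q \sum_z x' (inr (inl (q, z))) / tau * reward M (payR i q) z =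
    (\sum_q \sum_z x' (inr (inl (q, z))) * reward M (payR i q) z) / tau.
  rewrite mulr_suml; apply: eq_bigr => q _; rewrite mulr_suml; apply: eq_bigr => z _.
  by rewrite mulrAC.
rewrite ler_pdivlMr // mulrDl divfK ?(lt0r_neq0 t0) //.
have := x'0 (inr (inr (inl i))); move: h; set u := \sum_q _; set v := x' _; lra.
Qed.

End gap.

End rows.

Local Close Scope ring_scope.
Local Open Scope nat_scope.

(** * Nested bisection *)

Section search.
Variables (d T B : nat) (orc : seq zz -> seq zz).

(** Nested bisection for a point [lam] of the cube [0, 1]^d (in units of [1 / 2 ^ T], with a
    constant coordinate in front) that makes the oracle's vector negative.  The frame of
    level [j] holds an interval of length [2 ^ r / 2 ^ T] for [lam_j], its left end, and for
    both ends a cut, i.e. a nonnegative combination of answers that excludes the end.  Two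
    such cuts at distance [1 / 2 ^ T] combine to a cut without coordinate [j]. *)
Definition frame : Type := (nat * zz * seq zz * seq zz)%type.
Definition sstate : Type := (seq frame * option (seq zz) * option bool)%type.

Definition at0 (c : seq zz) (k : nat) : zz := nth z0 c k.
Definition zdot (m : nat) (u v : seq zz) : zz := zsum [seq zmul (at0 u k) (at0 v k) | k <- iota 0 m].

Definition mid (f : frame) : zz := zadd f.1.1.2 (zpow2 f.1.1.1.-1).
Definition point (st : seq frame) : seq zz := zpow2 T :: rev [seq mid f | f <- st].
(** The faces of the cube are the first cuts: they exclude the ends without any answer of the
    oracle, hence with mass 0. *)
Definition low_cut (j : nat) : seq zz := [seq if k == j then zopp (znat 1) else z0 | k <- iota 0 d.+1].
Definition high_cut (j : nat) : seq zz :=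
  [seq if k == j then znat 1 else if k == 0 then zopp (znat 1) else z0 | k <- iota 0 d.+1].
(** Fourier-Motzkin elimination: coordinate [j] is negative in [lo] and positive in [hi], so both
    multipliers are positive. *)
Definition combine (j : nat) (lo hi : seq zz) : seq zz :=
  [seq zadd (zmul (zopp (at0 lo j)) (at0 hi k)) (zmul (at0 hi j) (at0 lo k)) | k <- iota 0 d.+1].
Definition trimc (c : seq zz) : seq zz := [seq ztrim B x | x <- c].

Definition descend (st : seq frame) : sstate :=
  if size st < d then
    ((T, z0, low_cut (size st).+1, high_cut (size st).+1) :: st, None, None)
  else if zlt (zdot d.+1 (point st) (orc (point st))) z0 then (st, None, Some false)
  else (st, Some (trimc (orc (point st))), None).

Definition shrink (c : seq zz) (j : nat) (f : frame) : frame :=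
  if zlt z0 (at0 c j) then (f.1.1.1.-1, f.1.1.2, f.1.2, c)
  else (f.1.1.1.-1, ztrim B (mid f), c, f.2).

(** A cut that does not involve [lam_j] is valid for the whole interval and is passed on to the
    level above. Otherwise the sign of its coefficient tells which half it excludes. *)
Definition return_to (c : seq zz) (f : frame) (st : seq frame) : sstate :=
  let j := (size st).+1 in
  if ~~ zlt z0 (at0 c j) && ~~ zlt (at0 c j) z0 then (st, Some c, None)
  else let f' := shrink c j f in
    if f'.1.1.1 == 0 then (st, Some (trimc (combine j f'.1.2 f'.2)), None)
    else (f' :: st, None, None).

(** The recursion over the coordinates runs with an explicit stack, so that the search is the
    iteration of one step. *)
Definition sstep (s : sstate) : sstate :=
  if s.2 is Some _ then s else
  if s.1.2 is Some c then
    if s.1.1 is f :: st then return_to c f st else (s.1, Some true)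
  else descend s.1.1.

Definition sinit : sstate := ([::], None, None).
Definition srun (N : nat) : sstate := iter N sstep sinit.

End search.
Lemma combine_arith (R : realFieldType) (a b G mh ml x y z e : R) : (a * b <= G * (a * mh + b * ml) ->
  b * - (e * ml) <= b * (y + z * - a) -> a * - (e * mh) <= a * (x + (z + 1) * b) ->
  - ((e + G) * (a * mh + b * ml)) <= a * x + b * y)%R.
Proof. by move=> h1 h2 h3; lra. Qed.

(** * Termination of the search *)

Section search_time.
Variables (d T B : nat) (orc : seq zz -> seq zz).

Hypothesis T0 : 0 < T.

(** Steps spent on [i] open coordinates: [T] halvings, each with a search below and a return, and
    one step to open the frame. *)
Fixpoint cost (i : nat) : nat := if i is i'.+1 then T * (cost i').+1 + 1 else 1.

Fixpoint stack_cost (st : seq frame) : nat :=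
  if st is f :: st' then (f.1.1.1).-1 * (cost (d - (size st').+1)).+1 + 1 + stack_cost st' else 0.

(** Bounds the number of steps that are left. *)
Definition potential (s : sstate) : nat :=
  if s.2 is Some _ then 0
  else (if s.1.2 is Some _ then 0 else cost (d - size s.1.1)) + stack_cost s.1.1 + 1.

Lemma cost_bound i : (cost i).+1 <= (T + 2) ^ i.+1.
Proof.
elim: i => [|i IH] /=; first by rewrite expn1 addn2.
rewrite expnS; have := leq_mul (leqnn (T + 2)) IH; move: (_ ^ _) => W; nia.
Qed.

Lemma potential_step s : s.2 = None -> potential (sstep d T B orc s) < potential s.
Proof.
case: s => [[st [c|]] [//|]] _.
  case: st => [|f st]; first by [].
  change (potential (return_to d B c f st) < potential (f :: st, Some c, None)).
  rewrite /return_to; case: ifP => _.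
    by rewrite /potential /=; move: (_ * _) (stack_cost st) => u v; lia.
  move: (trimc B _) => cc; case: eqP => [_|/eqP].
    by rewrite /potential /=; move: (_ * _) (stack_cost st) => u v; lia.
  rewrite /potential /=.
  have -> : (shrink B c (size st).+1 f).1.1.1 = f.1.1.1.-1 by rewrite /shrink; case: ifP.
  case: (f.1.1.1.-1) => // r _ /=; move: (cost _) (stack_cost _) => u v; rewrite mulSn; lia.
change (potential (descend d T B orc st) < potential (st, None, None)).
rewrite /descend; case: ifP => sd.
  rewrite /potential /=; have -> : d - size st = (d - (size st).+1).+1 by rewrite subnSK.
  rewrite /=; move: (cost _) (stack_cost _) => u v; rewrite -{2}(prednK T0) mulSn; lia.
case: ifP => _; rewrite /potential /=; first by rewrite addn1.
have : 0 < cost (d - size st) by case: (d - size st) => //= i; rewrite addn1.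
lia.
Qed.

Lemma srun_halts N : (T + 2) ^ d.+1 <= N -> exists b, (srun d T B orc N).2 = Some b.
Proof.
move=> h; suff : potential (srun d T B orc N) = 0.
  by rewrite /potential; case: (srun _ _ _ _ _).2 => [b _|]; [exists b|rewrite addn1].
have bd : forall n, potential (srun d T B orc n) <= (T + 2) ^ d.+1 - n.
  elim=> [|n IH]; first by rewrite /potential /= !subn0 !addn0 addn1 cost_bound.
  rewrite /srun iterS -/(srun d T B orc n).
  case E : (srun d T B orc n).2 => [b|]; first by rewrite /sstep E /potential E.
  by have := potential_step E; move: IH; lia.
by apply/eqP; rewrite -leqn0; apply: leq_trans (bd N) _; lia.
Qed.

End search_time.

Lemma double_sum_le x y W : 2 * 2 * x <= W -> 2 * 2 * y <= W -> 2 * (y + x) <= W.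
Proof. lia. Qed.

(** * Correctness of the search *)

Section search_correct.
Variables (R : realFieldType) (d T B X : nat) (orc : seq zz -> seq zz).
Variables (BIG G0 : R) (cone : R -> (nat -> R) -> Prop).
Local Open Scope ring_scope.

Definition cv (c : seq zz) (k : nat) : R := (zval (at0 c k))%:~R.
Definition valid_point (lam : seq zz) : Prop :=
  [/\ size lam = d.+1, cv lam 0 = 2 ^+ T & forall k, 0 <= cv lam k <= 2 ^+ T].

Hypothesis BIG0 : 0 <= BIG.
Hypothesis cone_comb : forall a a' m m' v v', 0 <= a -> 0 <= a' -> cone m v -> cone m' v' ->
  cone (a * m + a' * m') (fun k => a * v k + a' * v' k).
Hypothesis cone_zero : cone 0 (fun=> 0).
Hypothesis cone_ge0 : forall m v, cone m v -> 0 <= m.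
Hypothesis cone_bd : forall m v k, cone m v -> `|v k| <= BIG * m.
Hypothesis cone_const : forall m v, cone m v -> v 0%N = G0 * m.
Hypothesis orc_cone : forall lam, valid_point lam -> cone 1 (cv (orc lam)).
Hypothesis orc_norm : forall lam k, valid_point lam -> (znorm (at0 (orc lam) k) <= X)%N.
Hypothesis T0 : (0 < T)%N.
Hypothesis X0 : (0 < X)%N.
(** An elimination multiplies coefficients of two cuts, so the size bound is squared from each level
    to the one above; the factor 2 pays for the addition. *)
Let Y (j : nat) : nat := ((2 * X) ^ (2 ^ (d - j)))%N.
Hypothesis YB : (Y 0 <= 2 ^ B)%N.
Hypothesis TB : (T < B)%N.

Lemma cv_trim c k : (znorm (at0 c k) < 2 ^ B)%N -> cv (trimc B c) k = cv c k.
Proof.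
rewrite /cv /at0 /trimc; have [kc|ck] := ltnP k (size c).
  by rewrite (nth_map z0) // => /zval_trim ->.
by rewrite !nth_default ?size_map.
Qed.

Lemma norm_trim c k : (znorm (at0 (trimc B c) k) <= znorm (at0 c k))%N.
Proof.
rewrite /at0 /trimc; have [kc|ck] := ltnP k (size c).
  by rewrite (nth_map z0) // znorm_trim.
by rewrite !nth_default ?size_map.
Qed.

Definition small_cut (j : nat) (c : seq zz) : Prop := forall k, (2 * znorm (at0 c k) <= Y j)%N.

Let Y_le j : (Y j <= Y 0)%N.
Proof. by rewrite leq_pexp2l ?muln_gt0 ?X0 // leq_pexp2l // leq_sub2l. Qed.

Let Y_sq j : (j < d)%N -> Y j = (Y j.+1 * Y j.+1)%N.
Proof. by move=> jd; rewrite /Y (_ : (d - j = (d - j.+1).+1)%N) ?expnS ?mul2n -?addnn ?expnD //; lia. Qed.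

Let Y2 j : (2 <= Y j)%N.
Proof.
apply: (@leq_trans (2 ^ 1)%N) => //; apply: (@leq_trans ((2 * X) ^ 1)%N); first by rewrite leq_exp2r // leq_pmulr.
by rewrite leq_pexp2l ?muln_gt0 ?X0 // expn_gt0.
Qed.

Let small_trim j c : small_cut j c -> small_cut j (trimc B c) /\ forall k, cv (trimc B c) k = cv c k.
Proof.
move=> h; split=> k; first by apply: leq_trans (h k); rewrite leq_mul2l norm_trim.
apply: cv_trim; have := h k; have := Y_le j; have := YB; have : (0 < 2 ^ B)%N by rewrite expn_gt0.
by move: (Y j) (Y 0) (2 ^ B)%N (znorm _) => a b c' e; lia.
Qed.

(** [c] is dominated by an element of mass [m] of the cone, up to multiples of the
    constraints [0 <= lam_k <= 1], and does not involve the coordinates above [j]. *)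
Definition cut (j : nat) (c : seq zz) (m : R) : Prop := exists (v b : nat -> R),
  [/\ cone m v, forall k, 0 <= b k,
      forall k, (0 < k <= d)%N -> cv c k <= v k + b k &
      cv c 0 <= v 0%N - \sum_(1 <= k < d.+1) b k] /\
  (forall k, (j < k <= d)%N -> cv c k = 0).

Definition bounded (j : nat) (c : seq zz) (m : R) : Prop :=
  forall k, (0 < k <= j)%N -> `|cv c k| <= BIG * m.

Definition lin (j : nat) (lam c : seq zz) : R := \sum_(k < j.+1) cv lam k * cv c k.
(** Each elimination joins cuts at ends one unit apart and costs at most [BIG] per unit of mass. *)
Definition err (j : nat) : R := (d - j)%:R * BIG.

Definition ret_ok (st : seq frame) (c : seq zz) : Prop := exists m,
  [/\ 0 < m, cut (size st) c m, bounded (size st) c m, small_cut (size st) c &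
      - (err (size st) * m) <= lin (size st) (point T st) c].

(** The final alternative separates faces of the cube, which have no mass and coefficient 1 up to
    sign, from cuts made of answers, whose coefficients are controlled by their mass. *)
Definition end_ok (st : seq frame) (c : seq zz) (x m : R) : Prop :=
  let j := (size st).+1 in
  [/\ cut j c m, bounded (size st) c m, small_cut j c,
      - (err j * m) <= lin (size st) (point T st) c + x * cv c j &
      m = 0 /\ `|cv c j| = 1 \/ 0 < m /\ `|cv c j| <= BIG * m].

(** Both ends may be massless only in a fresh frame, where [r = T]; as [T] is positive, two faces
    are never combined with each other, and the result of an elimination has positive mass. *)
Definition pre_ok (st : seq frame) (f : frame) : Prop :=
  let r := f.1.1.1 in let j := (size st).+1 in
  [/\ (r <= T)%N, (znorm f.1.1.2 + 2 ^ r <= 2 ^ T)%N & 0 <= zval f.1.1.2] /\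
  exists mlo mhi : R, let lo : R := (zval f.1.1.2)%:~R in
  [/\ end_ok st f.1.2 lo mlo, end_ok st f.2 (lo + 2 ^+ r) mhi,
      cv f.1.2 j < 0, 0 < cv f.2 j & r = T \/ 0 < mlo + mhi].

Definition frame_ok st f : Prop := (0 < f.1.1.1)%N /\ pre_ok st f.

Fixpoint stack_ok (st : seq frame) : Prop :=
  if st is f :: st' then frame_ok st' f /\ stack_ok st' else True.

Definition feasible_end : Prop := exists m v, [/\ 0 < m, cone m v &
  forall k, (0 < k <= d)%N -> - ((G0 + d%:R * BIG / 2 ^+ T) * m) <= v k].
Definition infeasible_end : Prop := exists lam, valid_point lam /\
  \sum_(k < d.+1) cv lam k * cv (orc lam) k < 0.

Definition state_ok (s : sstate) : Prop :=
  [/\ stack_ok s.1.1, (size s.1.1 <= d)%N,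
      forall c, s.1.2 = Some c -> ret_ok s.1.1 c &
      forall b, s.2 = Some b -> if b then feasible_end else infeasible_end].

Lemma zval_pow2R n : (zval (zpow2 n))%:~R = 2 ^+ n :> R.
Proof. by rewrite zval_pow2 -pmulrn natrX. Qed.

Lemma cv_dot m u v : (zval (zdot m u v))%:~R = \sum_(k < m) cv u k * cv v k :> R.
Proof.
rewrite /zdot zval_sum rmorph_sum big_map -(big_mkord xpredT (fun k => cv u k * cv v k)).
by rewrite /index_iota subn0; apply: eq_bigr => k _; rewrite zval_mul rmorphM.
Qed.

Lemma size_point st : size (point T st) = (size st).+1.
Proof. by rewrite /= size_rev size_map. Qed.

Lemma point_cons f st k : at0 (point T (f :: st)) k =
  if k == (size st).+1 then mid f else at0 (point T st) k.
Proof.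
rewrite /at0 /point /= rev_cons -rcons_cons nth_rcons /= size_rev size_map.
by case: ltngtP => // h; rewrite nth_default //= size_rev size_map ltnW.
Qed.

Lemma mid_ok st f : frame_ok st f ->
  (znorm (mid f) + 2 ^ f.1.1.1.-1 <= 2 ^ T)%N /\
  zval (mid f) = zval f.1.1.2 + (2 ^ f.1.1.1.-1)%N%:Z.
Proof.
move=> [r0 [[_ h _] _]]; rewrite /mid znorm_add zval_add znorm_pow2 zval_pow2; split=> //.
by rewrite -addnA addnn -mul2n -expnS prednK.
Qed.

Lemma point_ok st : stack_ok st -> size st = d -> valid_point (point T st).
Proof.
move=> ok sd; split; first by rewrite size_point sd.
  by rewrite /cv zval_pow2R.
elim: st ok {sd} => [_|f st IH [fo so]] k.
  rewrite /cv; case: k => [|k]; last by rewrite /at0 nth_default //= lexx exprn_ge0.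
  by rewrite zval_pow2R lexx exprn_ge0.
rewrite /cv point_cons; case: eqP => _; last exact: IH.
have [h e] := mid_ok fo; case: fo => _ [[_ _ lo0] _].
have lo1 : 0 <= zval (mid f) by rewrite e addr_ge0.
rewrite ler0z lo1 /= -zval_pow2R ler_int zval_pow2.
apply: le_trans (ler_norm _) _; apply: le_trans (zval_le_norm _) _.
by rewrite lez_nat; apply: leq_trans h; exact: leq_addr.
Qed.

Lemma lin_cons f st c j : (j <= size st)%N -> lin j (point T (f :: st)) c = lin j (point T st) c.
Proof.
move=> js; apply: eq_bigr => k _; rewrite /cv point_cons.
by rewrite ltn_eqF // ltnS (leq_trans _ js) // -ltnS.
Qed.

Lemma lin_top f st c :
  lin (size st).+1 (point T (f :: st)) c = lin (size st) (point T st) c + (zval (mid f))%:~R * cv c (size st).+1.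
Proof.
by rewrite /lin big_ord_recr /= -/(lin (size st) (point T (f :: st)) c) lin_cons // /cv point_cons eqxx.
Qed.

Lemma art_low j k : (k <= d)%N -> cv (low_cut d j) k = - (k == j)%:R.
Proof.
move=> kd; rewrite /cv /at0 /low_cut (nth_map 0%N) ?size_iota // nth_iota // add0n.
by case: eqP => _; rewrite ?zval_opp ?zval_nat ?rmorphN //= oppr0.
Qed.

Lemma art_high j k : (0 < j)%N -> (k <= d)%N -> cv (high_cut d j) k = (k == j)%:R - (k == 0%N)%:R.
Proof.
move=> j0 kd; rewrite /cv /at0 /high_cut (nth_map 0%N) ?size_iota // nth_iota // add0n.
case: eqP => [->|_]; first by rewrite zval_nat (gtn_eqF j0) subr0.
by case: eqP => _; rewrite sub0r ?zval_opp ?zval_nat ?rmorphN //= oppr0.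
Qed.

Lemma small_map j (F : nat -> zz) : (forall k, (2 * znorm (F k) <= Y j)%N) ->
  small_cut j [seq F k | k <- iota 0 d.+1].
Proof.
move=> h k; have [kd|dk] := ltnP k d.+1.
  by rewrite /at0 (nth_map 0%N) ?size_iota // nth_iota.
by rewrite /at0 nth_default ?size_map ?size_iota // (leq_trans _ (Y2 j)).
Qed.

Lemma push_ok st : stack_ok st -> (size st < d)%N ->
  frame_ok st (T, z0, low_cut d (size st).+1, high_cut d (size st).+1).
Proof.
move=> so sd; split=> //; split=> //=.
exists 0, 0; rewrite art_low // art_high // eqxx /= subr0; split=> //; last by left.
- split.
  + exists (fun=> 0), (fun=> 0); split; [split=> //|].
    * by move=> k /andP[_ kd]; rewrite art_low // addr0 oppr_le0.
    * by rewrite art_low // big1 ?subr0 // oppr0.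
    * by move=> k /andP[jk kd]; rewrite art_low // gtn_eqF ?oppr0.
  + by move=> k /andP[k0 ks]; rewrite art_low ?(leq_trans ks (ltnW sd)) // ltn_eqF // oppr0 normr0 mulr0.
  + apply: small_map => k; case: eqP => _; last exact: leq_trans (Y2 _).
    by rewrite znorm_opp znorm_nat; exact: Y2.
  + rewrite mulr0 oppr0 mul0r addr0; apply: sumr_ge0 => k _.
    rewrite art_low ?ltn_eqF ?oppr0 ?mulr0 //; have := ltn_ord k; rewrite ltnS => h.
    exact: leq_trans h (ltnW sd).
  + by left; rewrite art_low // eqxx normrN1.
split.
- exists (fun=> 0), (fun k => (k == (size st).+1)%:R); split; [split=> //|].
  + by move=> k /andP[k0 kd]; rewrite art_high // (gtn_eqF k0) subr0 add0r.
  + rewrite art_high // (ltn_eqF) // sub0r sub0r lerN2 (bigD1_seq (size st).+1) ?iota_uniq //=; last first.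
      by rewrite mem_index_iota.
    by rewrite eqxx big1 ?addr0 // => k /negbTE ->.
  + by move=> k /andP[jk kd]; rewrite art_high // (gtn_eqF jk) (gtn_eqF (leq_ltn_trans (leq0n _) jk)) subr0.
- move=> k /andP[k0 ks]; rewrite art_high ?(leq_trans ks (ltnW sd)) // ltn_eqF // (gtn_eqF k0).
  by rewrite subr0 normr0 mulr0.
- apply: small_map => k; do 2?[case: eqP => _]; rewrite ?znorm_opp ?znorm_nat ?Y2 //.
- rewrite mulr0 oppr0 add0r /lin big_ord_recl /= big1 ?addr0; last first.
    move=> k _; rewrite art_high //; last by rewrite /bump /= add1n (leq_trans (ltn_ord k)) // ltnW.
    by rewrite ltn_eqF ?ltnS ?ltn_ord // /bump /= add1n /= subr0 mulr0.
  rewrite art_high // ltn_eqF // sub0r mulrN1 art_high // eqxx subr0 mulr1.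
  by rewrite /cv zval_pow2R addNr.
- by left; rewrite art_high // eqxx subr0 normr1.
Qed.

Lemma oracle_ok st : stack_ok st -> size st = d ->
  0 <= \sum_(k < d.+1) cv (point T st) k * cv (orc (point T st)) k ->
  ret_ok st (trimc B (orc (point T st))).
Proof.
move=> so sd h; have vp := point_ok so sd; have co := orc_cone vp.
have [sm cvE] : small_cut d (trimc B (orc (point T st))) /\
    forall k, cv (trimc B (orc (point T st))) k = cv (orc (point T st)) k.
  apply: small_trim => k; rewrite /Y subnn expn0 expn1 leq_mul2l; exact: orc_norm.
exists 1; rewrite sd; split=> //.
- exists (cv (orc (point T st))), (fun=> 0); split; [split=> //|].
  + by move=> k _; rewrite cvE addr0.
  + by rewrite big1 // subr0 cvE.
  + by move=> k /andP[a b]; have := leq_trans a b; rewrite ltnn.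
- by move=> k _; rewrite cvE; exact: cone_bd.
- rewrite /err subnn mul0r mul0r oppr0 /lin; under eq_bigr do rewrite cvE.
  exact: h.
Qed.

Let err_mono j m : 0 <= m -> err j.+1 * m <= err j * m.
Proof. by move=> m0; rewrite ler_wpM2r // ler_wpM2r // ler_nat leq_sub2l. Qed.

Let Y_mono j : (Y j.+1 <= Y j)%N.
Proof. by rewrite leq_pexp2l ?muln_gt0 ?X0 // leq_pexp2l // leq_sub2l. Qed.

Lemma pop_ok f st c : ret_ok (f :: st) c -> cv c (size st).+1 = 0 -> ret_ok st c.
Proof.
move=> [m [m0 [v [b [cb cz]]] bd sm li]] c0; exists m; split=> //.
- exists v, b; split=> // k /andP[jk kd]; have [->//|kj] := eqVneq k (size st).+1.
  by apply: cz; rewrite /= kd andbT ltn_neqAle eq_sym kj.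
- by move=> k /andP[k0 ks]; apply: bd; rewrite k0 leqW.
- by move=> k; apply: leq_trans (sm k) (Y_mono _).
apply: le_trans (le_trans _ li) _; first by rewrite lerN2 err_mono // ltW.
by rewrite lin_top c0 mulr0 addr0.
Qed.

Lemma shrink_ok f st c : frame_ok st f -> ret_ok (f :: st) c -> cv c (size st).+1 != 0 ->
  pre_ok st (shrink B c (size st).+1 f) /\
  exists mlo mhi, [/\ 0 < mlo + mhi,
    end_ok st (shrink B c (size st).+1 f).1.2 (zval (shrink B c (size st).+1 f).1.1.2)%:~R mlo &
    end_ok st (shrink B c (size st).+1 f).2 ((zval (shrink B c (size st).+1 f).1.1.2)%:~R +
      2 ^+ (shrink B c (size st).+1 f).1.1.1) mhi].
Proof.
move=> fo [m [m0 cb bd sm li]] c0.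
have [nmid vmid] := mid_ok fo.
have rp : (2 ^ f.1.1.1 = 2 ^ f.1.1.1.-1 + 2 ^ f.1.1.1.-1)%N.
  by case: fo => r0 _; rewrite addnn -mul2n -expnS prednK.
have vm : (zval (mid f))%:~R = (zval f.1.1.2)%:~R + 2 ^+ f.1.1.1.-1 :> R.
  by rewrite vmid rmorphD /= -pmulrn natrX.
have ec : end_ok st c (zval (mid f))%:~R m.
  split=> //.
  - by move=> k /andP[k0 ks]; apply: bd; rewrite k0 leqW.
  - by move: li; rewrite /= lin_top.
  - by right; split=> //; apply: bd; rewrite /= leqnn.
have [r0 [[rT nlo lo0] [mlo [mhi [elo ehi clo chi rm]]]]] := fo.
have mge x y z : end_ok st x y z -> 0 <= z.
  by case=> _ _ _ _ [[-> _]|[/ltW]].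
rewrite /shrink zltE -(ltr_int R) -/(cv c _).
have [cp|cn] := boolP (_ < cv c (size st).+1); rewrite /=.
  have e1 : end_ok st c ((zval f.1.1.2)%:~R + 2 ^+ f.1.1.1.-1) m.
    by move: ec; rewrite vm.
  have m1 : 0 < mlo + m by rewrite ltr_wpDl // (mge _ _ _ elo).
  split; last by exists mlo, m.
  split; first by split=> //; [exact: leq_trans (leq_pred _) rT|
    by apply: leq_trans nlo; rewrite /= leq_add2l rp leq_addr].
  by exists mlo, m; split=> //; right.
have cl : cv c (size st).+1 < 0 by rewrite lt_neqAle c0 leNgt.
have tE : zval (ztrim B (mid f)) = zval (mid f).
  apply: zval_trim; apply: leq_ltn_trans (leq_trans (leq_addr _ _) nmid) _.
  by rewrite ltn_exp2l.
have tN := znorm_trim B (mid f).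
have e2 : end_ok st f.2 ((zval (mid f))%:~R + 2 ^+ f.1.1.1.-1) mhi.
  by rewrite vm -addrA -!natrX -natrD -rp natrX.
have m2 : 0 < m + mhi by rewrite ltr_wpDr // (mge _ _ _ ehi).
rewrite tE; split; last by exists m, mhi.
split; first split=> /=.
- exact: leq_trans (leq_pred _) rT.
- by apply: leq_trans nmid; rewrite leq_add2r.
- by rewrite tE vmid addr_ge0.
by exists m, mhi; rewrite /= tE; split=> //; right.
Qed.

Lemma combine_ok f st : (size st < d)%N -> pre_ok st f -> f.1.1.1 = 0%N -> (exists mlo mhi, [/\ 0 < mlo + mhi,
    end_ok st f.1.2 (zval f.1.1.2)%:~R mlo &
    end_ok st f.2 ((zval f.1.1.2)%:~R + 2 ^+ f.1.1.1) mhi]) ->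
  ret_ok st (trimc B (combine d (size st).+1 f.1.2 f.2)).
Proof.
move=> sd [_ [_ [_ [_ _ clo chi _]]]] r0 [ml [mh [mm [cl bl sl il ml0] [ch bh sh ih mh0]]]].
set j := (size st).+1 in clo chi cl ch sl sh il ih ml0 mh0 *.
set lo := f.1.2 in clo cl bl sl il ml0 *; set hi := f.2 in chi ch bh sh ih mh0 *.
pose a := - cv lo j; pose b := cv hi j.
have a0 : 0 < a by rewrite oppr_gt0.
have cE k : (k <= d)%N -> cv (combine d j lo hi) k = a * cv hi k + b * cv lo k.
  move=> kd; rewrite /cv /combine /at0 (nth_map 0%N) ?size_iota // nth_iota // add0n.
  by rewrite zval_add !zval_mul zval_opp rmorphD !rmorphM rmorphN.
have sm : small_cut (size st) (combine d j lo hi).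
  apply: small_map => k; rewrite znorm_add !znorm_mul znorm_opp Y_sq //.
  have := leq_mul (sl j) (sh k); have := leq_mul (sh j) (sl k).
  rewrite !(mulnACA 2 _ 2); exact: double_sum_le.
have [sm' tE] := small_trim sm.
have mlg : 0 <= ml by case: ml0 => [[->]|[/ltW]].
have mhg : 0 <= mh by case: mh0 => [[->]|[/ltW]].
have mpos : 0 < a * mh + b * ml.
  have [ml1|ml1] := eqVneq ml 0; first by rewrite ml1 mulr0 addr0 mulr_gt0 //; move: mm; rewrite ml1 add0r.
  by rewrite ltr_wpDl ?mulr_ge0 ?(ltW a0) // mulr_gt0 // lt_def ml1.
have [vl [bl' [[vlc bl0 vlk vl1] zl]]] := cl; have [vh [bh' [[vhc bh0 vhk vh1] zh]]] := ch.
exists (a * mh + b * ml); split=> //.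
- exists (fun k => a * vh k + b * vl k), (fun k => a * bh' k + b * bl' k); split; [split|].
  + by apply: cone_comb => //; exact: ltW.
  + by move=> k; rewrite addr_ge0 // mulr_ge0 // ltW.
  + move=> k kd; rewrite tE cE; last by case/andP: kd.
    have := ler_wpM2l (ltW a0) (vhk k kd); have := ler_wpM2l (ltW chi) (vlk k kd); rewrite -/b; lra.
  + rewrite tE cE // big_split /= -!mulr_sumr.
    have := ler_wpM2l (ltW a0) vh1; have := ler_wpM2l (ltW chi) vl1; rewrite -/b.
    set p := \sum_(_ <= _ < _) _; set q := \sum_(_ <= _ < _) _; lra.
  + move=> k /andP[sk kd]; rewrite tE cE //.
    have [kj|kj] := eqVneq k j; first by rewrite kj /a /b mulNr mulrC addNr.
    by rewrite zl ?zh ?mulr0 ?addr0 // kd andbT ltn_neqAle eq_sym kj.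
- move=> k kk; rewrite tE cE; last by case/andP: kk => _ h; apply: leq_trans h (ltnW sd).
  apply: le_trans (ler_normD _ _) _; rewrite !normrM (gtr0_norm a0) (gtr0_norm chi).
  have := ler_wpM2l (ltW a0) (bh k kk); have := ler_wpM2l (ltW chi) (bl k kk); rewrite -/b; lra.
have -> : lin (size st) (point T st) (trimc B (combine d j lo hi)) =
    a * lin (size st) (point T st) hi + b * lin (size st) (point T st) lo.
  rewrite /lin !mulr_sumr -big_split /=; apply: eq_bigr => k _; rewrite tE cE; last first.
    by apply: leq_trans (ltnW sd); rewrite -ltnS.
  by rewrite mulrDr; congr (_ + _); rewrite mulrCA.
(* The price [a * b] of the elimination is charged to a cut of positive mass, whose coefficient is
   at most [BIG] times that mass. *)
have ab : a * b <= BIG * (a * mh + b * ml).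
  case: mh0 => [[h0 h1]|[h0 h1]].
    case: ml0 => [[l0 _]|[l0 l1]]; first by move: mm; rewrite h0 l0 addr0 ltxx.
    have al : a <= BIG * ml by apply: le_trans l1; rewrite /a ler_norm_opp || (rewrite -normrN ler_norm).
    have := ler_wpM2r (ltW chi) al; rewrite -/b h0 mulr0 add0r; lra.
  have bb : b <= BIG * mh by apply: le_trans h1; exact: ler_norm.
  have := ler_wpM2l (ltW a0) bb; have : 0 <= BIG * (b * ml) by rewrite !mulr_ge0 // ltW.
  by lra.
have := ler_wpM2l (ltW a0) ih; have := ler_wpM2l (ltW chi) il; rewrite r0 expr0 -/b.
have -> : cv lo j = - a by rewrite opprK.
have -> : err (size st) = err j + BIG.
  by rewrite /err /j -(subnSK sd) -natr1 mulrDl mul1r.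
by move=> h1 h2; exact: combine_arith ab h1 h2.
Qed.

(** Only the constant coordinate of the last cut survives, so [v k] is at least [- b k], and the
    multipliers [b] are bounded through that coordinate. Its part [G0] appears as an additional
    error that the scaling of the answers has to make harmless. *)
Lemma feasible_ok c : (0 < d)%N -> ret_ok [::] c -> feasible_end.
Proof.
move=> d0 [m [m0 [v [b [[vc b0 vk v0] z]]] _ _ li]]; exists m, v; split=> // k kd.
have c0 : - (d%:R * BIG / 2 ^+ T * m) <= cv c 0.
  move: li; rewrite /lin big_ord_recl big_ord0 addr0 /err subn0 {1}/cv zval_pow2R => li.
  have T0' : (0 : R) < 2 ^+ T by rewrite exprn_gt0.
  rewrite mulrAC -mulNr ler_pdivrMr // [leRHS]mulrC; exact: li.
have bk : b k <= \sum_(1 <= i < d.+1) b i.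
  rewrite (bigD1_seq k) ?iota_uniq //= ?mem_index_iota //.
  by rewrite lerDl sumr_ge0.
have := vk k kd; rewrite z //; move: v0; rewrite (cone_const vc) mulrDl; lra.
Qed.

Lemma step_ok s : (0 < d)%N -> state_ok s -> state_ok (sstep d T B orc s).
Proof.
case: s => [[st0 mo] vd] d0 [/= so sd ro vo]; rewrite /sstep /=; case E2 : vd vo => [b0|] vo; first by split.
case: mo ro => [c|] ro.
  case: st0 so sd ro => [|f st] so sd ro.
    by split=> //= b [<-]; apply: (@feasible_ok c) => //; exact: ro.
  have rc := ro _ erefl; move: so sd rc; rewrite /= => -[fo so] sd rc.
  rewrite /return_to !zltE -!(ltr_int R) -/(cv c _) -!leNgt.
  case: ifP => [/andP[c1 c2]|cn].
    split=> //=; first exact: ltnW.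
    move=> c' [<-]; apply: pop_ok rc _; apply/eqP; rewrite eq_le; apply/andP; split=> //.
  have c0 : cv c (size st).+1 != 0.
    by apply: contraFneq cn => ->; rewrite lexx.
  have [po ex] := shrink_ok fo rc c0.
  case: eqP => [r0|/eqP r0]; split=> //=; first exact: ltnW.
    by move=> c' [<-]; exact: combine_ok.
  by split=> //; split=> //; rewrite lt0n.
rewrite /descend; case: ifP => sz.
  by split=> //=; split=> //; exact: push_ok.
have szd : size st0 = d by apply/eqP; rewrite eqn_leq sd leqNgt sz.
rewrite zltE -(ltr_int R) cv_dot /= [(zval z0)%:~R](_ : _ = 0) //.
have [neg|pos] := boolP (_ < 0).
  split=> //= b [<-]; exists (point T st0); split=> //; exact: point_ok.
by split=> //= c [<-]; apply: oracle_ok => //; rewrite leNgt.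
Qed.

Lemma search_correct N : (0 < d)%N -> ((T + 2) ^ d.+1 <= N)%N ->
  exists2 b, (srun d T B orc N).2 = Some b & if b then feasible_end else infeasible_end.
Proof.
move=> d0 hN; have [b hb] := srun_halts B orc T0 hN; exists b => //.
suff : state_ok (srun d T B orc N) by case=> _ _ _ /(_ b hb).
rewrite /srun; elim: N {hN b hb} => [|N IH] /=; first by split.
exact: step_ok.
Qed.

End search_correct.

(** * The search as a polynomial-time function *)

Lemma FP_app3 (A B C D F : encType) (g : B -> C -> D -> F) (f1 : A -> B) (f2 : A -> C) (f3 : A -> D) :
  FP (fun z : B * C * D => g z.1.1 z.1.2 z.2) -> FP f1 -> FP f2 -> FP f3 ->
  FP (fun x => g (f1 x) (f2 x) (f3 x)).
Proof.
by move=> hg h1 h2 h3; apply: (FP_comp (g := fun z : B * C * D => g z.1.1 z.1.2 z.2)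
  (FP_pair (FP_pair h1 h2) h3) hg).
Qed.

Lemma FP_app4 (A B C D F G : encType) (g : B -> C -> D -> F -> G) (f1 : A -> B) (f2 : A -> C)
    (f3 : A -> D) (f4 : A -> F) :
  FP (fun z : B * C * D * F => g z.1.1.1 z.1.1.2 z.1.2 z.2) -> FP f1 -> FP f2 -> FP f3 -> FP f4 ->
  FP (fun x => g (f1 x) (f2 x) (f3 x) (f4 x)).
Proof.
by move=> hg h1 h2 h3 h4; apply: (FP_comp (g := fun z : B * C * D * F => g z.1.1.1 z.1.1.2 z.1.2 z.2)
  (FP_pair (FP_pair (FP_pair h1 h2) h3) h4) hg).
Qed.

Lemma FP_app5 (A B C D F G H : encType) (g : B -> C -> D -> F -> G -> H) (f1 : A -> B) (f2 : A -> C)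
    (f3 : A -> D) (f4 : A -> F) (f5 : A -> G) :
  FP (fun z : B * C * D * F * G => g z.1.1.1.1 z.1.1.1.2 z.1.1.2 z.1.2 z.2) ->
  FP f1 -> FP f2 -> FP f3 -> FP f4 -> FP f5 ->
  FP (fun x => g (f1 x) (f2 x) (f3 x) (f4 x) (f5 x)).
Proof.
by move=> hg h1 h2 h3 h4 h5;
  apply: (FP_comp (g := fun z : B * C * D * F * G => g z.1.1.1.1 z.1.1.1.2 z.1.1.2 z.1.2 z.2)
  (FP_pair (FP_pair (FP_pair (FP_pair h1 h2) h3) h4) h5) hg).
Qed.

Lemma FP_foldl2 (A B C : encType) (l : A -> seq B) (c0 : A -> C) (h : A -> B -> C -> C) (bd : A -> nat) :
  FP l -> FP c0 -> FP (fun z : A * B * C => h z.1.1 z.1.2 z.2) -> pbd bd ->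
  (forall x s1 s2, l x = s1 ++ s2 -> esz (foldl (fun c b => h x b c) (c0 x) s1) <= bd x) ->
  FP (fun x => foldl (fun c b => h x b c) (c0 x) (l x)).
Proof. by move=> hl hc hh hb hbd; apply: (FP_foldl_bd hl hc hh hb). Qed.

Lemma FP_foldl_inv (A B C : encType) (l : A -> seq B) (c0 : A -> C) (h : A -> B -> C -> C)
    (bd : A -> nat) (P : A -> C -> Prop) :
  FP l -> FP c0 -> FP (fun z : A * B * C => h z.1.1 z.1.2 z.2) -> pbd bd ->
  (forall x, P x (c0 x)) -> (forall x b c, P x c -> P x (h x b c)) ->
  (forall x c, P x c -> esz c <= bd x) ->
  FP (fun x => foldl (fun c b => h x b c) (c0 x) (l x)).
Proof.
move=> hl hc hh hb P0 PS Pb; apply: (FP_foldl2 hl hc hh hb) => x s _ _; apply: Pb.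
by elim: s (c0 x) (P0 x) => //= b s IH c /(PS x b); exact: IH.
Qed.

Lemma esz_seq_bd (A : encType) (s : seq A) N K :
  size s <= N -> all (fun u => esz u <= K) s -> esz s <= N * K.+1 + 1.
Proof.
rewrite esz_seq addn1 ltnS => sN h; apply: (@leq_trans (size s * K.+1)); last by rewrite leq_mul2r sN orbT.
elim: s h {sN} => [|x s IH] /=; first by rewrite big_nil.
by move=> /andP[xK /IH h]; rewrite big_cons mulSn; apply: leq_add.
Qed.

Lemma esz_ztrim B x : esz (ztrim B x) <= 8 * B + 3.
Proof.
have h (u : seq bool) : esz (take B u) <= 4 * B + 1.
  by apply: leq_trans (esz_bits _) _; rewrite leq_add2r leq_mul2l size_take_min geq_minl.
rewrite esz_pair /=; have := h x.1; have := h x.2; move: (esz _) (esz _) => u v; lia.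
Qed.

Section FP_search.
Context (A : encType) (d T B : A -> nat) (orc : A -> seq zz -> seq zz).
Hypothesis hd : FP d.
Hypothesis hT : FP T.
Hypothesis hB : FP B.
Hypothesis horc : FP (fun z : A * seq zz => orc z.1 z.2).

Lemma FP_zdot (X : encType) (m : X -> nat) (u v : X -> seq zz) : FP m -> FP u -> FP v ->
  FP (fun x => zdot (m x) (u x) (v x)).
Proof. by move=> hm hu hv; rewrite /zdot /at0; fp. Qed.

Lemma FP_mid : FP mid.
Proof. by rewrite /mid; fp. Qed.

Lemma FP_point (X : encType) (f : X -> A) (st : X -> seq frame) : FP f -> FP st ->
  FP (fun x => point (T (f x)) (st x)).
Proof. by move=> hf hst; have hm := FP_mid; rewrite /point; fp. Qed.

Lemma FP_trimc (X : encType) (f : X -> A) (c : X -> seq zz) : FP f -> FP c ->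
  FP (fun x => trimc (B (f x)) (c x)).
Proof. by move=> hf hc; rewrite /trimc; fp. Qed.

Lemma FP_shrink (X : encType) (f : X -> A) (c : X -> seq zz) (j : X -> nat) (g : X -> frame) :
  FP f -> FP c -> FP j -> FP g -> FP (fun x => shrink (B (f x)) (c x) (j x) (g x)).
Proof. by move=> hf hc hj hg; have hm := FP_comp hg FP_mid; rewrite /shrink /at0; fp. Qed.

Ltac fp_search := repeat first [fp_core | fp_ext | match goal with
  | |- FP (fun x => zdot (@?m x) (@?u x) (@?v x)) => apply: (FP_zdot (m := m) (u := u) (v := v))
  | |- FP (fun x => trimc (B (@?f x)) (@?c x)) => apply: (FP_trimc (f := f) (c := c))
  | |- FP (fun x => shrink (B (@?f x)) (@?c x) (@?j x) (@?g x)) => apply: (FP_shrink (f := f) (c := c) (j := j) (g := g))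
  end].

Lemma FP_descend (X : encType) (f : X -> A) (st : X -> seq frame) : FP f -> FP st ->
  FP (fun x => descend (d (f x)) (T (f x)) (B (f x)) (orc (f x)) (st x)).
Proof.
move=> hf hst; have hp := FP_point hf hst; have ho : FP (fun x => orc (f x) (point (T (f x)) (st x))) := FP_comp (FP_pair hf hp) horc.
by rewrite /descend /low_cut /high_cut; fp_search.
Qed.

Lemma FP_return (X : encType) (f : X -> A) (c : X -> seq zz) (g : X -> frame) (st : X -> seq frame) :
  FP f -> FP c -> FP g -> FP st ->
  FP (fun x => return_to (d (f x)) (B (f x)) (c x) (g x) (st x)).
Proof.
move=> hf hc hg hst; have hs := FP_shrink hf hc (FP_succ (FP_size hst)) hg.
rewrite /return_to /combine /at0; fp_search.
Qed.

Lemma FP_sstep (X : encType) (f : X -> A) (s : X -> sstate) : FP f -> FP s ->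
  FP (fun x => sstep (d (f x)) (T (f x)) (B (f x)) (orc (f x)) (s x)).
Proof.
move=> hf hs.
apply: (FP_option (o := fun x => (s x).2)
  (f0 := fun x => if (s x).1.2 is Some c then
    if (s x).1.1 is g :: st then return_to (d (f x)) (B (f x)) c g st else ((s x).1, Some true)
    else descend (d (f x)) (T (f x)) (B (f x)) (orc (f x)) (s x).1.1)
  (f1 := fun z => s z.1)); [by fp| |by fp].
apply: (FP_option (o := fun x => (s x).1.2)
  (f0 := fun x => descend (d (f x)) (T (f x)) (B (f x)) (orc (f x)) (s x).1.1)
  (f1 := fun z => if (s z.1).1.1 is g :: st then return_to (d (f z.1)) (B (f z.1)) z.2 g st
     else ((s z.1).1, Some true))); [by fp|by apply: FP_descend; fp|].
apply: (FP_case (l := fun z : X * seq zz => (s z.1).1.1)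
  (f0 := fun z => ((s z.1).1, Some true))
  (f1 := fun z => return_to (d (f z.1.1)) (B (f z.1.1)) z.1.2 z.2.1 z.2.2)); [by fp|by fp|].
by apply: FP_return; fp.
Qed.

Hypothesis orc_size : forall x lam, size (orc x lam) <= (d x).+1.

Let K1 x := 8 * B x + 100.
Let K2 x := (d x).+1 * (K1 x).+1 + 1.
Let okf x (f : frame) : bool :=
  [&& f.1.1.1 <= T x, esz f.1.1.2 <= K1 x, esz f.1.2 <= K2 x & esz f.2 <= K2 x].
(** Left ends and cuts are truncated to [B] bits or constant, and the depth is at most [d], so the
    state stays polynomial however many steps are made. *)
Let oks x (s : sstate) : Prop :=
  [/\ size s.1.1 <= d x, all (okf x) s.1.1 & forall c, s.1.2 = Some c -> esz c <= K2 x].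

Let esz_trim x c : size c <= (d x).+1 -> esz (trimc (B x) c) <= K2 x.
Proof.
move=> h; apply: esz_seq_bd; rewrite ?size_map // all_map; apply/allP => u _ /=.
by apply: leq_trans (esz_ztrim _ _) _; rewrite leq_add2l.
Qed.

Let esz_art x (F : nat -> zz) : (forall k, esz (F k) <= 100) ->
  esz [seq F k | k <- iota 0 (d x).+1] <= K2 x.
Proof.
move=> h; apply: esz_seq_bd; rewrite ?size_map ?size_iota // all_map; apply/allP => u _ /=.
by apply: leq_trans (h _) _; rewrite leq_addl.
Qed.

Let oks_step x s : oks x s -> oks x (sstep (d x) (T x) (B x) (orc x) s).
Proof.
case: s => [[st m] v] [/= sd ast hm]; rewrite /sstep /=; case: v => [b|]; first by split.
case: m hm => [c|] hm.
  case: st sd ast => [|f st] /= sd ast; first by split=> //= c' [<-]; exact: hm.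
  have /andP[/and4P[f1 f2 f3 f4] ast'] := ast; have hc := hm c erefl.
  rewrite /return_to; case: ifP => _; first by split=> //=; exact: ltnW.
  have : esz (trimc (B x) (combine (d x) (size st).+1 (shrink (B x) c (size st).+1 f).1.2
    (shrink (B x) c (size st).+1 f).2)) <= K2 x by apply: esz_trim; rewrite size_map size_iota.
  move: (trimc _ _) => t ht; case: ifP => _.
    by split=> //=; [exact: ltnW|move=> _ [<-]].
  split=> //=; rewrite ast' andbT /okf /shrink; case: ifP => _ /=; apply/and4P; split=> //;
    rewrite ?(leq_trans (leq_pred _)) //.
  by apply: leq_trans (esz_ztrim _ _) _; rewrite leq_add2l.
rewrite /descend; case: ifP => sz.
  split=> //=; rewrite ast andbT; apply/and4P; split=> //=.
  - by apply: (@leq_trans 100); [|exact: leq_addl].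
  - by apply: esz_art => k; case: eqP.
  - by apply: esz_art => k; do 2?[case: eqP].
case: ifP => _; split=> //= c [<-]; apply: esz_trim; exact: orc_size.
Qed.

Lemma FP_srun (N : A -> nat) : FP N ->
  FP (fun x => foldl (fun s _ => sstep (d x) (T x) (B x) (orc x) s) (sinit) (iota 0 (N x))).
Proof.
move=> hN; pose K3 x := (d x) * ((2 * T x).+1 + K1 x + K2 x + K2 x + 3).+1 + 1.
apply: (@FP_foldl_inv _ _ _ (fun x => iota 0 (N x)) (fun=> sinit)
  (fun x (_ : nat) s => sstep (d x) (T x) (B x) (orc x) s) (fun x => K3 x + K2 x + 20) oks);
  [by fp|by fp|by apply: FP_sstep; fp| | | |].
- have p1 : pbd K1 by apply: pbd_add (pbd_mul (pbd_const _ _) _) (pbd_const _ _); exact: pbd_nat.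
  have p2 : pbd K2.
    apply: pbd_add (pbd_mul _ _) (pbd_const _ _).
      by apply: pbd_nat; fp.
    by apply: pbd_le (pbd_add p1 (pbd_const _ 1)) _ => x; rewrite addn1.
  apply: pbd_add (pbd_add _ p2) (pbd_const _ _).
  apply: pbd_add (pbd_mul (pbd_nat hd) _) (pbd_const _ _).
  apply: (pbd_le (g := fun x => 2 * T x + 1 + K1 x + K2 x + K2 x + 3 + 1)); last by move=> x; rewrite !addn1.
  by repeat first [exact: pbd_const | exact: p1 | exact: p2
    | exact: pbd_mul (pbd_const _ _) (pbd_nat hT) | apply: pbd_add].
- by move=> x; split.
- by move=> x _ s; exact: oks_step.
move=> x [[st m] v] [/= sd ast hm]; rewrite !esz_pair /=.
have h1 : esz st <= K3 x.
  apply: esz_seq_bd => //; apply: sub_all ast => f /and4P[f1 f2 f3 f4].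
  have H a1 a2 a3 a4 : a1 <= T x -> a2 <= K1 x -> a3 <= K2 x -> a4 <= K2 x ->
    ((((2 * a1).+1 + a2).+1 + a3).+1 + a4).+1 <= (2 * T x).+1 + K1 x + K2 x + K2 x + 3 by lia.
  by apply: leq_trans (H _ _ _ _ f1 f2 f3 f4); rewrite -esz_nat -!esz_pair.
have h2 : esz m <= K2 x + 4.
  case: m hm => [c|] hm; last by rewrite (_ : esz None = 1) // addnC.
  have H u K : u <= K -> (u + 1).+1 <= K + 4 by lia.
  by rewrite [esz _]tsz_Nd; exact: H (hm c erefl).
have h3 : esz v <= 6 by case: v => [[]|].
by move: h1 h2 h3; move: (esz _) (esz _) (esz _) => u1 u2 u3; lia.
Qed.

End FP_search.

(** * The decision procedure *)

(** The input comes with two numbers in unary, so that time polynomial in the whole is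
    exponential in the instance.  Clamping by these numbers, as in [dn] and [tpow], only
    keeps the values polynomial: the bounds are never attained. *)
Definition inp : Type := (seq nat * (nat * nat))%type.

Section algorithm.
Variable x : inp.

Definition rd (o : nat) : nat := nth 0 x.1 o.
Definition pad1 : nat := x.2.1.
Definition pad2 : nat := x.2.2.
Definition nn : nat := (rd 0).+1.
Definition na : nat := (rd 1).+1.
Definition nc : nat := rd 2.
Definition ms : nat := rd 3.
Definition nk : nat := rd 4.

(** The operators are the only entries of variable length: one number, or four if a tolerance
    follows. *)
Definition op_at (j : nat) : nat :=
  foldl (fun o _ => o + (if rd o <= 1 then 1 else 4)) (5 + 3 * (nn * na * nn)) (iota 0 j).
Definition bnd_at : nat := op_at nc.
Definition coef_at : nat := bnd_at + 3 * nc.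
Definition ini_at : nat := coef_at + 3 * (ms * nc).
Definition idx_at : nat := ini_at + ms * nc.
Definition tgt_at : nat := idx_at + ms * nc.
Definition end_at : nat := tgt_at + ms * nc * nn.

(** A common denominator of all rational numbers of the instance. *)
Definition dn : nat :=
  foldl (fun acc v => if v == 0 then acc else minn (acc * v) pad1) 1 x.1.
Definition ratn (o : nat) : nat := rd o.+1 * (dn %/ rd o.+2).
Definition ratz (o : nat) : zz := if rd o == 0 then znat (ratn o) else zopp (znat (ratn o)).
Definition tw (s a s' : nat) : nat := ratn (5 + 3 * ((s * na + a) * nn + s')).
Definition en (s a : nat) : bool := has (fun s' => tw s a s' != 0) (iota 0 nn).

(** The pair of a state [s] and a set of states with characteristic number [c] is coded as
    [c * nn + s]. *)
Definition tpow (s : nat) : nat := foldl (fun m _ => minn (m + m) pad1) 1 (iota 0 s).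
Definition zn : nat := tpow nn * nn.
Definition bit (c s : nat) : bool := (c %/ tpow s) %% 2 == 1.
Definition zsuc (z s : nat) : nat :=
  (z %/ nn + (if bit (z %/ nn) s then 0 else tpow s)) * nn + s.

Definition safe_code (X : seq bool) (z : nat) : bool :=
  has (fun a => en (z %% nn) a && all (fun s' => (tw (z %% nn) a s' == 0) ||
    (bit (z %/ nn) s' && nth false X (z %/ nn * nn + s'))) (iota 0 nn)) (iota 0 na).
Definition safe_tab : seq bool :=
  foldl (fun X _ => [seq safe_code X z | z <- iota 0 zn]) (nseq zn true) (iota 0 nn).

Definition tot : nat := size (flatten [seq nseq v tt | v <- x.1]).
Definition big : nat := dn * ms * tot.

Definition dd : nat := 2 * nc.
Definition opc (j : nat) : nat := rd (op_at j).

(** Conjunct [j] gives the rows [2 * j] and [2 * j + 1]; the signs [0], [1], [2] stand for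
    [0], [+] and [-], and bit [j] of [b] tells which side of an inequation is tried. *)
Definition row_sign (b i : nat) : nat :=
  if opc (i %/ 2) <= 1 then (if i %% 2 == 1 then 0 else 1)
  else if opc (i %/ 2) == 2 then (if i %% 2 == 1 then 2 else 1)
  else if i %% 2 == 1 then 0 else if bit b (i %/ 2) then 1 else 2.
(** An approximation loosens both of its rows by the tolerance; a negated one tightens its single
    row. The rows with sign 0 read [0 >= 0]. *)
Definition eps_sign (i : nat) : nat :=
  if opc (i %/ 2) <= 1 then 0 else if opc (i %/ 2) == 2 then 2
  else if i %% 2 == 1 then 0 else 1.
Definition row_strict (i : nat) : bool :=
  ((opc (i %/ 2) == 0) || (3 <= opc (i %/ 2))) && (i %% 2 == 0).
Definition signed (g : nat) (z : zz) : zz := if g == 0 then z0 else if g == 1 then z else zopp z.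
Definition row_coef (b i m : nat) : zz := signed (row_sign b i) (ratz (coef_at + 3 * (m * nc + i %/ 2))).
Definition row_thr (b i : nat) : zz :=
  zadd (signed (row_sign b i) (ratz (bnd_at + 3 * (i %/ 2)))) (signed (eps_sign i) (ratz (op_at (i %/ 2)).+1)).
Definition hits (m j c : nat) : bool :=
  has (fun s => bit c s && (rd (tgt_at + ((m * nc + j) * nn + s)) != 0)) (iota 0 nn).
Definition payz (b i q c : nat) : zz :=
  zadd (zsum [seq if (rd (idx_at + (m * nc + i %/ 2)) == q %/ nn) &&
      (rd (ini_at + (m * nc + i %/ 2)) == q %% nn) && hits m (i %/ 2) c
    then row_coef b i m else z0 | m <- iota 0 ms]) (znat big).
Definition row_th (b i : nat) : zz := zadd (row_thr b i) (znat (nk * nn * big)).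

Definition rew_tab (b : nat) : seq (seq zz) :=
  [seq [seq ztrim pad2 (if nth false safe_tab (y %% zn) then payz b i (y %/ zn) (y %% zn %/ nn) else z0)
    | i <- iota 0 dd] | y <- iota 0 (nk * nn * zn)].

Definition vat (tab : seq (seq zz)) (y i : nat) : zz := at0 (nth [::] tab y) i.
Definition ldot (lam v : seq zz) : zz := zsum [seq zmul (at0 lam i.+1) (at0 v i) | i <- iota 0 dd].
(** Value iteration carries the whole payoff vectors of the optimal strategies, not just their
    values for [lam], because these vectors are the cuts. *)
Definition best (lam : seq zz) (cs : seq (seq zz)) : seq zz :=
  head [::] [seq v <- cs | all (fun u => ~~ zlt (ldot lam v) (ldot lam u)) cs].
Definition vavg (tab : seq (seq zz)) (y a : nat) : seq zz :=
  [seq zsum [seq zmul (znat (tw (y %% zn %% nn) a s')) (vat tab (y %/ zn * zn + zsuc (y %% zn) s') i)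
    | s' <- iota 0 nn] | i <- iota 0 dd].
Definition vcands (b : nat) (st : zz * seq (seq zz)) (y : nat) : seq (seq zz) :=
  [seq zmul st.1 e | e <- nth [::] (rew_tab b) y] ::
  [seq vavg st.2 y a | a <- [seq a <- iota 0 na | en (y %% zn %% nn) a]].
(** The table after [t] steps is scaled by [dn ^ t], which keeps it integral; committing therefore
    multiplies the rewards by the current scale. *)
Definition vstep (b : nat) (lam : seq zz) (st : zz * seq (seq zz)) : zz * seq (seq zz) :=
  let D := ztrim pad2 (zmul (znat dn) st.1) in
  (D, [seq [seq ztrim pad2 (at0 (best lam (vcands b (D, st.2) y)) i) | i <- iota 0 dd]
       | y <- iota 0 (nk * nn * zn)]).
(** The number of steps in [vi_rate]: path length [nn * nn.+1], [pad1] contractions for a halving of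
    the error, and [8 * pad1] halvings. *)
Definition horizon : nat := nn * nn.+1 * (pad1 * (8 * pad1)).
Definition vtab (b : nat) (lam : seq zz) : zz * seq (seq zz) :=
  foldl (fun st _ => vstep b lam st) (ztrim pad2 (znat 1), rew_tab b) (iota 0 horizon).

Definition start_at (q : nat) : nat := q * zn + (tpow (q %% nn) * nn + q %% nn).
(** The constant coordinate is the scale itself, as a reserve for the error of value iteration. The
    factor [2 ^ (2 E + 1)] makes this reserve negligible against the margin [2 ^ (-E)] asked of
    strict rows. *)
Definition oracle_of (b : nat) (st : zz * seq (seq zz)) : seq zz :=
  st.1 :: [seq zadd (zmul (zpow2 (2 * pad1).+1)
    (zadd (zsum [seq vat st.2 (start_at q) i | q <- iota 0 (nk * nn)]) (zopp (zmul st.1 (row_th b i)))))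
    (if row_strict i then zopp (zmul (zpow2 pad1.+1) st.1) else z0) | i <- iota 0 dd].
Definition oracle (b : nat) (lam : seq zz) : seq zz := oracle_of b (vtab b lam).

Definition search (b : nat) : sstate :=
  foldl (fun s _ => sstep dd (8 * pad1) pad2 (oracle b) s) sinit (iota 0 pad2).
Definition found (b : nat) : bool := if (search b).2 is Some r then r else false.
(** The bisection is correct in positive dimension, so an empty conjunction is answered directly. *)
Definition decide : bool := (nc == 0) || has found (iota 0 (tpow nc)).

End algorithm.

(** * The decision procedure as a polynomial-time function of the padded input *)

Ltac fp_alg := fail.
Ltac fp_hook ::= fp_alg.

Lemma FP_rd : FP (fun z : inp * nat => rd z.1 z.2). Proof. by rewrite /rd; fp. Qed.
Lemma FP_pad1 : FP pad1. Proof. by rewrite /pad1; fp. Qed.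
Lemma FP_pad2 : FP pad2. Proof. by rewrite /pad2; fp. Qed.

Ltac fp_alg ::= match goal with
  | |- FP (fun u => rd (@?x u) (@?o u)) => apply: (FP_comp2 (g := rd) (f1 := x) (f2 := o) FP_rd)
  | |- FP (fun u => pad1 (@?x u)) => apply: (FP_comp (f := x) (g := pad1) _ FP_pad1)
  | |- FP (fun u => pad2 (@?x u)) => apply: (FP_comp (f := x) (g := pad2) _ FP_pad2)
  | |- FP rd => exact: FP_rd | |- FP pad1 => exact: FP_pad1 | |- FP pad2 => exact: FP_pad2
  | |- FP (fun u => nn (@?x u)) => rewrite /nn
  | |- FP (fun u => na (@?x u)) => rewrite /na
  | |- FP (fun u => nc (@?x u)) => rewrite /nc
  | |- FP (fun u => ms (@?x u)) => rewrite /ms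
  | |- FP (fun u => nk (@?x u)) => rewrite /nk
  | |- FP (fun u => dd (@?x u)) => rewrite /dd
  end.

Lemma FP_op_at : FP (fun z : inp * nat => op_at z.1 z.2).
Proof.
rewrite /op_at; apply: (@FP_foldl2 _ _ _ (fun z : inp * nat => iota 0 z.2)
  (fun z => 5 + 3 * (nn z.1 * na z.1 * nn z.1)) (fun z _ o => o + (if rd z.1 o <= 1 then 1 else 4))
  (fun z => 2 * (5 + 3 * (nn z.1 * na z.1 * nn z.1) + 4 * z.2) + 1)); [by fp|by fp|by fp| |].
  by apply: (pbd_nat (n := fun z : inp * nat => 2 * (5 + 3 * (nn z.1 * na z.1 * nn z.1) + 4 * z.2) + 1)); fp.
move=> z s1 s2 /(congr1 size); rewrite size_iota size_cat => zs.
rewrite esz_nat -addn1 leq_add2r leq_mul2l /=; move: (5 + _) => o.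
apply: (@leq_trans (o + 4 * size s1)); last by rewrite leq_add2l leq_mul2l zs leq_addr orbT.
elim: s1 o {zs} => [|v s1 IH] o /=; first by rewrite addn0.
by apply: leq_trans (IH _) _; rewrite mulnS addnA leq_add2r leq_add2l; case: ifP.
Qed.

Lemma FP_dn : FP dn.
Proof.
rewrite /dn; apply: (@FP_foldl_inv _ _ _ (fun x : inp => x.1) (fun=> 1)
  (fun x v acc => if v == 0 then acc else minn (acc * v) (pad1 x)) (fun x => 2 * (pad1 x + 1) + 1)
  (fun x acc => acc <= pad1 x + 1)); [by fp|by fp|by fp| |by move=> x; rewrite addn1| |].
- by apply: (pbd_nat (n := fun x : inp => 2 * (pad1 x + 1) + 1)); fp.
- move=> x v c hc; case: ifP => // _; rewrite geq_min; apply/orP; right; exact: leq_addr.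
- by move=> x c hc; rewrite esz_nat -addn1 leq_add2r leq_mul2l hc orbT.
Qed.

Lemma FP_tpow : FP (fun z : inp * nat => tpow z.1 z.2).
Proof.
rewrite /tpow; apply: (@FP_foldl_inv _ _ _ (fun z : inp * nat => iota 0 z.2) (fun=> 1)
  (fun z (_ : nat) m => minn (m + m) (pad1 z.1)) (fun z => 2 * (pad1 z.1 + 1) + 1)
  (fun z acc => acc <= pad1 z.1 + 1)); [by fp|by fp|by fp| |by move=> x; rewrite addn1| |].
- by apply: (pbd_nat (n := fun z : inp * nat => 2 * (pad1 z.1 + 1) + 1)); fp.
- by move=> x v c hc; rewrite geq_min; apply/orP; right; exact: leq_addr.
- by move=> x c hc; rewrite esz_nat -addn1 leq_add2r leq_mul2l hc orbT.
Qed.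

Ltac fp_alg ::= match goal with
  | |- FP (fun u => rd (@?x u) (@?o u)) => apply: (FP_comp2 (g := rd) (f1 := x) (f2 := o) FP_rd)
  | |- FP (fun u => pad1 (@?x u)) => apply: (FP_comp (f := x) (g := pad1) _ FP_pad1)
  | |- FP (fun u => pad2 (@?x u)) => apply: (FP_comp (f := x) (g := pad2) _ FP_pad2)
  | |- FP (fun u => dn (@?x u)) => apply: (FP_comp (f := x) (g := dn) _ FP_dn)
  | |- FP (fun u => op_at (@?x u) (@?o u)) => apply: (FP_comp2 (g := op_at) (f1 := x) (f2 := o) FP_op_at)
  | |- FP (fun u => tpow (@?x u) (@?o u)) => apply: (FP_comp2 (g := tpow) (f1 := x) (f2 := o) FP_tpow)
  | |- FP (fun u => nn (@?x u)) => rewrite /nn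
  | |- FP (fun u => na (@?x u)) => rewrite /na
  | |- FP (fun u => nc (@?x u)) => rewrite /nc
  | |- FP (fun u => ms (@?x u)) => rewrite /ms
  | |- FP (fun u => nk (@?x u)) => rewrite /nk
  | |- FP (fun u => dd (@?x u)) => rewrite /dd
  | |- FP (fun u => ratn _ _) => rewrite /ratn
  | |- FP (fun u => ratz _ _) => rewrite /ratz
  | |- FP (fun u => bit _ _ _) => rewrite /bit
  | |- FP (fun u => zn _) => rewrite /zn
  | |- FP (fun u => zsuc _ _ _) => rewrite /zsuc
  | |- FP (fun u => opc _ _) => rewrite /opc
  | |- FP (fun u => bnd_at _) => rewrite /bnd_at
  | |- FP (fun u => coef_at _) => rewrite /coef_at
  | |- FP (fun u => ini_at _) => rewrite /ini_at
  | |- FP (fun u => idx_at _) => rewrite /idx_at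
  | |- FP (fun u => tgt_at _) => rewrite /tgt_at
  | |- FP (fun u => signed _ _) => rewrite /signed
  end.

Lemma FP_tw : FP (fun z : inp * nat * nat * nat => tw z.1.1.1 z.1.1.2 z.1.2 z.2).
Proof. by rewrite /tw; fp. Qed.

Lemma FP_bit : FP (fun z : inp * nat * nat => bit z.1.1 z.1.2 z.2).
Proof. by rewrite /bit; fp. Qed.

Lemma FP_zsuc : FP (fun z : inp * nat * nat => zsuc z.1.1 z.1.2 z.2).
Proof. by rewrite /zsuc; fp. Qed.

Lemma FP_zn : FP zn. Proof. by rewrite /zn; fp. Qed.

Ltac fp_alg1 := match goal with
  | |- FP (fun u => rd (@?x u) (@?o u)) => apply: (FP_comp2 (g := rd) (f1 := x) (f2 := o) FP_rd)
  | |- FP (fun u => pad1 (@?x u)) => apply: (FP_comp (f := x) (g := pad1) _ FP_pad1)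
  | |- FP (fun u => pad2 (@?x u)) => apply: (FP_comp (f := x) (g := pad2) _ FP_pad2)
  | |- FP (fun u => dn (@?x u)) => apply: (FP_comp (f := x) (g := dn) _ FP_dn)
  | |- FP (fun u => op_at (@?x u) (@?o u)) => apply: (FP_comp2 (g := op_at) (f1 := x) (f2 := o) FP_op_at)
  | |- FP (fun u => tpow (@?x u) (@?o u)) => apply: (FP_comp2 (g := tpow) (f1 := x) (f2 := o) FP_tpow)
  | |- FP (fun u => tw (@?x u) (@?s u) (@?a u) (@?t u)) =>
      apply: (FP_app4 (g := tw) (f1 := x) (f2 := s) (f3 := a) (f4 := t) FP_tw)
  | |- FP (fun u => bit (@?x u) (@?s u) (@?a u)) => apply: (FP_app3 (g := bit) (f1 := x) (f2 := s) (f3 := a) FP_bit)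
  | |- FP (fun u => zsuc (@?x u) (@?s u) (@?a u)) => apply: (FP_app3 (g := zsuc) (f1 := x) (f2 := s) (f3 := a) FP_zsuc)
  | |- FP (fun u => zn (@?x u)) => apply: (FP_comp (f := x) (g := zn) _ FP_zn)
  | |- FP (fun u => nn _) => rewrite /nn
  | |- FP (fun u => na _) => rewrite /na
  | |- FP (fun u => nc _) => rewrite /nc
  | |- FP (fun u => ms _) => rewrite /ms
  | |- FP (fun u => nk _) => rewrite /nk
  | |- FP (fun u => dd _) => rewrite /dd
  | |- FP (fun u => ratn _ _) => rewrite /ratn
  | |- FP (fun u => ratz _ _) => rewrite /ratz
  | |- FP (fun u => opc _ _) => rewrite /opc
  | |- FP (fun u => bnd_at _) => rewrite /bnd_at
  | |- FP (fun u => coef_at _) => rewrite /coef_at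
  | |- FP (fun u => ini_at _) => rewrite /ini_at
  | |- FP (fun u => idx_at _) => rewrite /idx_at
  | |- FP (fun u => tgt_at _) => rewrite /tgt_at
  | |- FP (fun u => signed _ _) => rewrite /signed
  end.
Ltac fp_alg ::= fp_alg1.

Lemma FP_en : FP (fun z : inp * nat * nat => en z.1.1 z.1.2 z.2).
Proof. by rewrite /en; fp. Qed.

Lemma FP_head0 (A : encType) (s : A -> seq (seq zz)) : FP s -> FP (fun x => head [::] (s x)).
Proof. by move=> hs; apply: FP_head hs; exact: FP_const. Qed.

Ltac fp_alg2 := match goal with
  | |- FP (fun u => en (@?x u) (@?s u) (@?a u)) => apply: (FP_app3 (g := en) (f1 := x) (f2 := s) (f3 := a) FP_en)
  | |- FP (fun u => head [::] (@?s u)) => apply: (FP_head0 (s := s))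
  | |- FP (fun u => at0 _ _) => rewrite /at0
  end.
Ltac fp_alg ::= first [fp_alg1 | fp_alg2].

Lemma FP_safe_tab : FP safe_tab.
Proof.
rewrite /safe_tab; apply: (@FP_foldl_inv _ _ _ (fun x : inp => iota 0 (nn x)) (fun x => nseq (zn x) true)
  (fun x (_ : nat) X => [seq safe_code x X z | z <- iota 0 (zn x)]) (fun x => zn x * 4 + 1)
  (fun x X => size X <= zn x)); [by fp|by fp; exact: FP_const|by rewrite /safe_code; fp| | | |].
- by apply: (pbd_nat (n := fun x => zn x * 4 + 1)); fp.
- by move=> x; rewrite size_nseq.
- by move=> x _ c _; rewrite size_map size_iota.
- by move=> x c hc; apply: esz_seq_bd => //; apply/allP => -[].
Qed.

Lemma FP_big : FP big. Proof. by rewrite /big /tot; fp. Qed.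

Ltac fp_alg3 := match goal with
  | |- FP (fun u => safe_tab (@?x u)) => apply: (FP_comp (f := x) (g := safe_tab) _ FP_safe_tab)
  | |- FP (fun u => big (@?x u)) => apply: (FP_comp (f := x) (g := big) _ FP_big)
  end.
Ltac fp_alg ::= first [fp_alg1 | fp_alg2 | fp_alg3].

Lemma FP_row_sign : FP (fun z : inp * nat * nat => row_sign z.1.1 z.1.2 z.2).
Proof. by rewrite /row_sign; fp. Qed.
Lemma FP_eps_sign : FP (fun z : inp * nat => eps_sign z.1 z.2).
Proof. by rewrite /eps_sign; fp. Qed.
Lemma FP_row_strict : FP (fun z : inp * nat => row_strict z.1 z.2).
Proof. by rewrite /row_strict; fp. Qed.
Lemma FP_hits : FP (fun z : inp * nat * nat * nat => hits z.1.1.1 z.1.1.2 z.1.2 z.2).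
Proof. by rewrite /hits; fp. Qed.

Ltac fp_alg4 := match goal with
  | |- FP (fun u => row_sign (@?x u) (@?s u) (@?a u)) => apply: (FP_app3 (g := row_sign) (f1 := x) (f2 := s) (f3 := a) FP_row_sign)
  | |- FP (fun u => eps_sign (@?x u) (@?s u)) => apply: (FP_comp2 (g := eps_sign) (f1 := x) (f2 := s) FP_eps_sign)
  | |- FP (fun u => row_strict (@?x u) (@?s u)) => apply: (FP_comp2 (g := row_strict) (f1 := x) (f2 := s) FP_row_strict)
  | |- FP (fun u => hits (@?x u) (@?s u) (@?a u) (@?t u)) =>
      apply: (FP_app4 (g := hits) (f1 := x) (f2 := s) (f3 := a) (f4 := t) FP_hits)
  end.
Ltac fp_alg ::= first [fp_alg1 | fp_alg2 | fp_alg3 | fp_alg4].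

Lemma FP_row_coef : FP (fun z : inp * nat * nat * nat => row_coef z.1.1.1 z.1.1.2 z.1.2 z.2).
Proof. by rewrite /row_coef; fp. Qed.
Lemma FP_row_th : FP (fun z : inp * nat * nat => row_th z.1.1 z.1.2 z.2).
Proof. by rewrite /row_th /row_thr; fp. Qed.

Ltac fp_alg5 := match goal with
  | |- FP (fun u => row_coef (@?x u) (@?s u) (@?a u) (@?t u)) =>
      apply: (FP_app4 (g := row_coef) (f1 := x) (f2 := s) (f3 := a) (f4 := t) FP_row_coef)
  | |- FP (fun u => row_th (@?x u) (@?s u) (@?a u)) => apply: (FP_app3 (g := row_th) (f1 := x) (f2 := s) (f3 := a) FP_row_th)
  end.
Ltac fp_alg ::= first [fp_alg1 | fp_alg2 | fp_alg3 | fp_alg4 | fp_alg5].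

Lemma FP_payz : FP (fun z : inp * nat * nat * nat * nat => payz z.1.1.1.1 z.1.1.1.2 z.1.1.2 z.1.2 z.2).
Proof. by rewrite /payz; fp. Qed.

Ltac fp_alg6 := match goal with
  | |- FP (fun u => payz (@?x u) (@?b u) (@?s u) (@?a u) (@?t u)) =>
      apply: (FP_app5 (g := payz) (f1 := x) (f2 := b) (f3 := s) (f4 := a) (f5 := t) FP_payz)
  end.
Ltac fp_alg ::= first [fp_alg1 | fp_alg2 | fp_alg3 | fp_alg4 | fp_alg5 | fp_alg6].

Lemma FP_rew_tab : FP (fun z : inp * nat => rew_tab z.1 z.2).
Proof. by rewrite /rew_tab; fp. Qed.

Lemma FP_ldot : FP (fun z : inp * seq zz * seq zz => ldot z.1.1 z.1.2 z.2).
Proof. by rewrite /ldot; fp. Qed.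

Ltac fp_alg7 := match goal with
  | |- FP (fun u => ldot (@?x u) (@?s u) (@?a u)) => apply: (FP_app3 (g := ldot) (f1 := x) (f2 := s) (f3 := a) FP_ldot)
  | |- FP (fun u => rew_tab (@?x u) (@?s u)) => apply: (FP_comp2 (g := rew_tab) (f1 := x) (f2 := s) FP_rew_tab)
  end.
Ltac fp_alg ::= first [fp_alg1 | fp_alg2 | fp_alg3 | fp_alg4 | fp_alg5 | fp_alg6 | fp_alg7].

Lemma FP_best : FP (fun z : inp * seq zz * seq (seq zz) => best z.1.1 z.1.2 z.2).
Proof.
rewrite /best; apply: FP_head0.
apply: (@FP_filter2 _ _ (fun (z : inp * seq zz * seq (seq zz)) v =>
  all (fun u => ~~ zlt (ldot z.1.1 z.1.2 v) (ldot z.1.1 z.1.2 u)) z.2) (fun z => z.2)); fp.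
Qed.
Lemma FP_vavg : FP (fun z : inp * seq (seq zz) * nat * nat => vavg z.1.1.1 z.1.1.2 z.1.2 z.2).
Proof. by rewrite /vavg /vat; fp. Qed.
Lemma FP_oracle_of : FP (fun z : inp * nat * (zz * seq (seq zz)) => oracle_of z.1.1 z.1.2 z.2).
Proof. by rewrite /oracle_of /vat /start_at; fp. Qed.

Ltac fp_alg8 := match goal with
  | |- FP (fun u => best (@?x u) (@?s u) (@?a u)) => apply: (FP_app3 (g := best) (f1 := x) (f2 := s) (f3 := a) FP_best)
  | |- FP (fun u => vavg (@?x u) (@?s u) (@?a u) (@?t u)) =>
      apply: (FP_app4 (g := vavg) (f1 := x) (f2 := s) (f3 := a) (f4 := t) FP_vavg)
  | |- FP (fun u => oracle_of (@?x u) (@?s u) (@?a u)) => apply: (FP_app3 (g := oracle_of) (f1 := x) (f2 := s) (f3 := a) FP_oracle_of)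
  end.
Ltac fp_alg ::= first [fp_alg1 | fp_alg2 | fp_alg3 | fp_alg4 | fp_alg5 | fp_alg6 | fp_alg7 | fp_alg8].

Lemma FP_vcands : FP (fun z : inp * nat * (zz * seq (seq zz)) * nat => vcands z.1.1.1 z.1.1.2 z.1.2 z.2).
Proof.
rewrite /vcands; fp.
apply: (@FP_filter2 _ _ (fun (z : inp * nat * (zz * seq (seq zz)) * nat) a =>
  en z.1.1.1 (z.2 %% zn z.1.1.1 %% nn z.1.1.1) a) (fun z => iota 0 (na z.1.1.1))); fp.
Qed.

Ltac fp_alg9 := match goal with
  | |- FP (fun u => vcands (@?x u) (@?s u) (@?a u) (@?t u)) =>
      apply: (FP_app4 (g := vcands) (f1 := x) (f2 := s) (f3 := a) (f4 := t) FP_vcands)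
  end.
Ltac fp_alg ::= first [fp_alg1 | fp_alg2 | fp_alg3 | fp_alg4 | fp_alg5 | fp_alg6 | fp_alg7 | fp_alg8 | fp_alg9].

Lemma FP_vtab : FP (fun z : inp * nat * seq zz => vtab z.1.1 z.1.2 z.2).
Proof.
rewrite /vtab; pose W x := dd x * (8 * pad2 x + 3).+1 + 1.
pose ok x (s : seq (seq zz)) := (size s <= nk x * nn x * zn x) && all (fun u => esz u <= W x) s.
(* Entries are truncated on creation, so the size of the table does not depend on the number of
   rounds. *)
have okm x (F : nat -> nat -> zz) :
    ok x [seq [seq ztrim (pad2 x) (F y i) | i <- iota 0 (dd x)] | y <- iota 0 (nk x * nn x * zn x)].
  rewrite /ok size_map size_iota leqnn all_map; apply/allP => y _ /=.
  apply: esz_seq_bd; first by rewrite size_map size_iota.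
  by rewrite all_map; apply/allP => i _; exact: esz_ztrim.
apply: (@FP_foldl_inv _ _ _ (fun z : inp * nat * seq zz => iota 0 (horizon z.1.1))
  (fun z => (ztrim (pad2 z.1.1) (znat 1), rew_tab z.1.1 z.1.2))
  (fun z (_ : nat) st => vstep z.1.1 z.1.2 z.2 st)
  (fun z => 8 * pad2 z.1.1 + 3 + (nk z.1.1 * nn z.1.1 * zn z.1.1 * (W z.1.1 + 1) + 1) + 1)
  (fun z st => esz st.1 <= 8 * pad2 z.1.1 + 3 /\ ok z.1.1 st.2)).
- by rewrite /horizon; fp.
- by fp.
- by rewrite /vstep; fp.
- apply: (pbd_nat (n := fun z : inp * nat * seq zz =>
    8 * pad2 z.1.1 + 3 + (nk z.1.1 * nn z.1.1 * zn z.1.1 * (W z.1.1 + 1) + 1) + 1)).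
  by rewrite /W; fp.
- by move=> z; split; [exact: esz_ztrim|exact: okm].
- by move=> z _ st _; split; [exact: esz_ztrim|exact: okm].
move=> z [u s] [/= hu /andP[ss hs]]; rewrite esz_pair /= addn1 ltnS leq_add //.
by have := esz_seq_bd ss hs; rewrite (addn1 (W _)).
Qed.

Lemma FP_oracle (A : encType) (x : A -> inp) (b : A -> nat) (lam : A -> seq zz) :
  FP x -> FP b -> FP lam -> FP (fun u => oracle (x u) (b u) (lam u)).
Proof.
move=> hx hb hl; have hv := FP_app3 (g := vtab) FP_vtab hx hb hl.
by rewrite /oracle; fp.
Qed.

Lemma FP_search_alg : FP (fun z : inp * nat => search z.1 z.2).
Proof.
rewrite /search.
apply: (@FP_srun _ (fun z : inp * nat => dd z.1) (fun z => 8 * pad1 z.1) (fun z => pad2 z.1)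
  (fun z => oracle z.1 z.2) _ _ _ _ _ (fun z => pad2 z.1)); try by fp.
  by apply: FP_oracle; fp.
by move=> z lam; rewrite /= size_map size_iota.
Qed.

Lemma FP_decide : FP decide.
Proof.
rewrite /decide; fp; rewrite /found.
apply: (FP_option (o := fun z : inp * nat => (search z.1 z.2).2) (f0 := fun=> false) (f1 := fun z => z.2)).
- by apply: FP_snd_of; exact: FP_search_alg.
- exact: FP_const.
- exact: FP_snd.
Qed.

(** * Meaning of the tables and of the oracle *)

Lemma iota_rcons n : iota 0 n.+1 = rcons (iota 0 n) n.
Proof. by rewrite -addn1 iotaD cats1. Qed.

Lemma bval_iota (g : nat -> bool) n : bval [seq g i | i <- iota 0 n] = \sum_(i < n) g i * 2 ^ i.
Proof.
elim: n => [|n IH]; first by rewrite big_ord0.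
rewrite big_ord_recr iota_rcons map_rcons -cats1 bval_cat size_map size_iota IH /=.
by rewrite addn0 mulnC.
Qed.

Lemma bval_bit (u : seq bool) s : (bval u %/ 2 ^ s) %% 2 == nth false u s :> nat.
Proof.
elim: s u => [|s IH] [|b u] /=; rewrite ?div0n ?mod0n ?expn0 ?divn1 //.
  by rewrite -muln2 modnMDl_bool // || (rewrite addnC -muln2 modnMDl; case: b).
by rewrite expnS divnMA (_ : (b + (bval u).*2) %/ 2 = bval u) ?IH //; case: b; rewrite divn2 ?half_bit_double //;
  rewrite (half_bit_double _ true).
Qed.

Lemma argmax_ex (F : seq zz -> int) (v : seq zz) cs : exists2 u, u \in v :: cs &
  all (fun w => F w <= F u)%R (v :: cs).
Proof.
elim: cs v => [|w cs IH] v; first by exists v; rewrite ?inE //= lexx.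
have [u uc /= /andP[wu hu]] := IH w; have [vu|uv] := leP (F v) (F u).
  by exists u; rewrite ?inE; [rewrite -in_cons uc orbT|rewrite /= vu wu].
exists v; rewrite ?mem_head //= lexx (le_trans wu (ltW uv)) /=.
by apply: sub_all hu => t /le_trans; apply; exact: ltW.
Qed.

Lemma row_conj_lt c (i : 'I_(2 * c)) : i %/ 2 < c.
Proof. by have := ltn_ord i; lia. Qed.

Definition row_conj c (i : 'I_(2 * c)) : 'I_c := Ordinal (row_conj_lt i).

Section decoding.
Context (R : realType) (nS nA : nat) (M : mdp nS nA) (k0 m0 c0 : nat) (x : inp).
Local Notation S := 'I_nS.+1.
Local Notation A := 'I_nA.+1.
Local Notation Z := (S * {set S})%type.
Local Notation Q := ('I_k0 * S)%type.
Variables (ini : 'I_m0 -> 'I_c0 -> S) (idx : 'I_m0 -> 'I_c0 -> 'I_k0) (tgt : 'I_m0 -> 'I_c0 -> {set S}).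

Hypothesis nnE : nn x = nS.+1.
Hypothesis naE : na x = nA.+1.
Hypothesis ncE : nc x = c0.
Hypothesis msE : ms x = m0.
Hypothesis nkE : nk x = k0.
Hypothesis iniE : forall (m : 'I_m0) (j : 'I_c0), rd x (ini_at x + (m * c0 + j)) = ini m j.
Hypothesis idxE : forall (m : 'I_m0) (j : 'I_c0), rd x (idx_at x + (m * c0 + j)) = idx m j.
Hypothesis tgtE : forall (m : 'I_m0) (j : 'I_c0) (s : S), (rd x (tgt_at x + ((m * c0 + j) * nS.+1 + s)) != 0) = (s \in tgt m j).
Local Notation D := (dn x).
Hypothesis D0 : 0 < D.
Hypothesis twE : forall (s : S) (a : A) (s' : S), ((tw x s a s')%:R = D%:R * ratr (trans M s a s') :> R)%R.
Hypothesis pow_pad : 2 ^ nS.+1 <= pad1 x.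

Lemma tpowE s : s <= nS.+1 -> tpow x s = 2 ^ s.
Proof.
rewrite /tpow; elim: s => [|s IH] sn //.
rewrite iota_rcons foldl_rcons IH; last exact: ltnW.
rewrite addnn -mul2n -expnS; apply/minn_idPl; apply: leq_trans pow_pad.
by rewrite leq_exp2l.
Qed.

Definition cset (V : {set S}) : nat := bval [seq inord i \in V | i <- iota 0 nS.+1].

Lemma csetE V : cset V = \sum_(s : S) (s \in V) * 2 ^ s.
Proof. by rewrite /cset bval_iota; apply: eq_bigr => s _; rewrite inord_val. Qed.

Lemma cset_lt V : cset V < 2 ^ nS.+1.
Proof. by have := bval_lt [seq inord i \in V | i <- iota 0 nS.+1]; rewrite size_map size_iota. Qed.

Lemma bit_cset V (s : S) : bit x (cset V) s = (s \in V).
Proof.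
rewrite /bit tpowE; last exact: ltnW.
rewrite (eqP (bval_bit _ _)) (nth_map 0) ?size_iota // nth_iota // inord_val.
by case: (s \in V).
Qed.

Lemma cset_add V (s : S) : cset (s |: V)%SET = cset V + (if s \in V then 0 else 2 ^ s).
Proof.
have [sV|sV] := boolP (s \in V); first by rewrite addn0 (finset.setUidPr _) // finset.sub1set.
rewrite !csetE [in LHS](bigD1 s) //= [in RHS](bigD1 s) //= finset.setU11 mul1n (negbTE sV) mul0n add0n addnC.
congr (_ + _); apply: eq_bigr => t ts; by rewrite finset.in_setU1 (negbTE ts).
Qed.

Lemma cset1 (s : S) : cset [set s]%SET = 2 ^ s.
Proof.
have := cset_add finset.set0 s; rewrite finset.setU0 finset.in_set0 => ->.
by rewrite csetE big1 // => t _; rewrite finset.in_set0.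
Qed.

Definition zcode (z : Z) : nat := cset z.2 * nS.+1 + z.1.

Lemma znE : zn x = 2 ^ nS.+1 * nS.+1.
Proof. by rewrite /zn nnE tpowE. Qed.

Lemma zcode_lt z : zcode z < zn x.
Proof. by rewrite znE /zcode; have := cset_lt z.2; have := ltn_ord z.1; nia. Qed.

Lemma zcode_mod z : zcode z %% nn x = z.1.
Proof. by rewrite nnE /zcode modnMDl modn_small. Qed.

Lemma zcode_div z : zcode z %/ nn x = cset z.2.
Proof. by rewrite nnE /zcode divnMDl // divn_small ?addn0. Qed.

Lemma zsucE z (s : S) : zsuc x (zcode z) s = zcode (succ z s).
Proof.
rewrite /zsuc zcode_div bit_cset nnE /zcode /succ /= cset_add tpowE; last exact: ltnW.
by [].
Qed.

Lemma tw_eq0 (s : S) (a : A) (s' : S) : (tw x s a s' == 0) = (trans M s a s' == 0%R).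
Proof.
by rewrite -(pnatr_eq0 R) twE mulf_eq0 pnatr_eq0 (gtn_eqF D0) /= fmorph_eq0.
Qed.

Lemma has_ord n (p : pred nat) : has p (iota 0 n) = [exists i : 'I_n, p i].
Proof.
apply/hasP/existsP => [[i]|[i pi]]; last by exists (i : nat) => //; rewrite mem_iota ltn_ord.
by rewrite mem_iota add0n => /= ilt pi; exists (Ordinal ilt).
Qed.

Lemma all_ord n (p : pred nat) : all p (iota 0 n) = [forall i : 'I_n, p i].
Proof.
apply/allP/forallP => [h i|h i]; first by apply: h; rewrite mem_iota ltn_ord.
by rewrite mem_iota add0n => /= ilt; exact: (h (Ordinal ilt)).
Qed.

Lemma enE (s : S) (a : A) : en x s a = enabled M s a.
Proof.
rewrite /en nnE has_ord /enabled; apply/existsP/eqP => [[s' h]|h].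
  have [//|/eqP] := trans_sum M s a; rewrite psumr_eq0 => [/allP/(_ s' (mem_index_enum _))|t _].
    by rewrite /= -tw_eq0 (negbTE h).
  by case/andP: (trans_itv M s a t).
apply/existsP; rewrite -negb_forall; apply/negP => /forallP h0; move: h.
rewrite big1 => [/eqP|s' _]; first by rewrite eq_sym oner_eq0.
by apply/eqP; rewrite -tw_eq0; exact: h0.
Qed.

Lemma safe_tabE z : nth false (safe_tab x) (zcode z) = (z.1 \in safe M z.2).
Proof.
rewrite /safe_tab /safe nnE; have it : forall n (z : Z),
    nth false (foldl (fun X _ => [seq safe_code x X z | z <- iota 0 (zn x)]) (nseq (zn x) true) (iota 0 n))
      (zcode z) = (z.1 \in iter n (safe_step M z.2) [set: S]%SET).
  elim=> [|n IH] u; first by rewrite nth_nseq zcode_lt finset.in_setT.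
  rewrite iota_rcons foldl_rcons; move: IH; set X := foldl _ _ (iota 0 n) => IH.
  rewrite (nth_map 0) ?size_iota ?zcode_lt // nth_iota ?zcode_lt // add0n /=.
  rewrite finset.inE /safe_code naE has_ord; apply: eq_existsb => a.
  rewrite zcode_mod zcode_div enE /stays nnE all_ord; congr (_ && _); apply: eq_forallb => s'.
  rewrite tw_eq0 bit_cset; have := IH (s', u.2); rewrite /zcode /= => ->.
  by case: (trans M u.1 a s' == 0%R).
exact: it.
Qed.

Variable b : nat.
Local Notation jrow := (@row_conj c0).

Definition cfz (i : 'I_(2 * c0)) (m : 'I_m0) : int := zval (row_coef x b i m).
Definition thz (i : 'I_(2 * c0)) : int := zval (row_thr x b i).

Lemma nth_le_tot o : rd x o <= tot x.
Proof.
have -> : tot x = sumn x.1.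
  by rewrite /tot; elim: x.1 => //= v l IH; rewrite size_cat size_nseq IH.
rewrite /rd; elim: x.1 o => [|v l IH] [|o] //=; first exact: leq_addr.
by apply: leq_trans (IH o) _; exact: leq_addl.
Qed.

Lemma ratn_le o : ratn x o <= D * tot x.
Proof. by rewrite mulnC leq_mul ?nth_le_tot ?leq_div. Qed.

Lemma norm_ratz o : znorm (ratz x o) <= D * tot x.
Proof. by rewrite /ratz; case: ifP => _; rewrite ?znorm_opp znorm_nat ratn_le. Qed.

Lemma norm_signed g z : znorm (signed g z) <= znorm z.
Proof. by rewrite /signed; do 2?[case: ifP => _]; rewrite ?znorm_opp. Qed.

Lemma cfz_big i : (\sum_m `|cfz i m| <= (big x)%:R)%R.
Proof.
apply: (@le_trans _ _ (\sum_(m < m0) (D * tot x)%:R)%R).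
  apply: ler_sum => m _; apply: le_trans (zval_le_norm _) _; rewrite natz lez_nat.
  exact: leq_trans (norm_signed _ _) (norm_ratz _).
by rewrite sumr_const card_ord -mulrnA ler_nat /big msE mulnAC.
Qed.

Definition qcode (q : Q) : nat := q.1 * nS.+1 + q.2.
Local Notation payI := (pay ini idx tgt jrow cfz (big x)).

Lemma payzE (i : 'I_(2 * c0)) q V : zval (payz x b i (qcode q) (cset V)) = payI i q V.
Proof.
rewrite /payz zval_add zval_nat zval_sum big_map /pay; congr (_ + _)%R; last by rewrite natz.
rewrite msE -{1}(subn0 m0) -/(index_iota 0 m0) (big_mkord xpredT) [RHS]big_mkcond; apply: eq_bigr => m _.
have := ltn_ord q.2 => qs; rewrite ncE nnE /qcode divnMDl // (divn_small qs) addn0 modnMDl (modn_small qs).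
have -> : i %/ 2 = jrow i by [].
rewrite idxE iniE /= -[(idx _ _, ini _ _) == q]/((idx _ _ == q.1) && (ini _ _ == q.2)).
have -> : hits x m (jrow i) (cset V) = (V :&: tgt m (jrow i) != finset.set0)%SET.
  rewrite /hits nnE has_ord; apply/existsP/finset.set0Pn => [[s]|[s]].
    by rewrite bit_cset ncE tgtE => /andP[a h]; exists s; rewrite finset.in_setI a.
  by rewrite finset.in_setI => /andP[a h]; exists s; rewrite bit_cset ncE tgtE a.
rewrite !(inj_eq val_inj); case: (_ == _) => //=; case: (_ == _) => //=.
by case: (_ != _); rewrite ?mulr1 ?mulr0.
Qed.

Lemma norm_payz (i : nat) q c : znorm (payz x b i q c) <= 2 * big x.
Proof.
rewrite /payz znorm_add znorm_nat mul2n -addnn leq_add2r znorm_sum big_map.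
apply: (@leq_trans (\sum_(m <- iota 0 (ms x)) D * tot x)).
  apply: leq_sum => m _; case: ifP => // _; exact: leq_trans (norm_signed _ _) (norm_ratz _).
by rewrite big_const_seq count_predT size_iota iter_addn_0 /big mulnAC.
Qed.

Definition ycode (q : Q) (z : Z) : nat := qcode q * zn x + zcode z.

Lemma ycode_mod q z : ycode q z %% zn x = zcode z.
Proof. by rewrite /ycode modnMDl modn_small // zcode_lt. Qed.

Lemma ycode_div q z : ycode q z %/ zn x = qcode q.
Proof.
have h := zcode_lt z; rewrite /ycode divnMDl ?(leq_ltn_trans _ h) //.
by rewrite divn_small ?addn0.
Qed.

Lemma qcode_lt q : qcode q < nk x * nn x.
Proof. by rewrite nkE nnE /qcode; have := ltn_ord q.1; have := ltn_ord q.2; nia. Qed.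

Lemma ycode_lt q z : ycode q z < nk x * nn x * zn x.
Proof. by have := qcode_lt q; have := zcode_lt z; rewrite /ycode; nia. Qed.

Lemma rewE q z (i : 'I_(2 * c0)) : 2 * big x < 2 ^ pad2 x ->
  zval (vat (rew_tab x b) (ycode q z) i) = rewardI M ini idx tgt jrow cfz (big x) i q z /\
  znorm (vat (rew_tab x b) (ycode q z) i) <= 2 * big x.
Proof.
move=> hb; rewrite /vat /rew_tab (nth_map 0) ?size_iota ?ycode_lt // nth_iota ?ycode_lt // add0n.
have hi : i < dd x by rewrite /dd ncE.
rewrite /at0 (nth_map 0) ?size_iota // nth_iota // add0n ycode_mod ycode_div zcode_div safe_tabE /rewardI.
case: ifP => _; last first.
  by split; [rewrite zval_trim //; exact: leq_ltn_trans hb | exact: leq_trans (znorm_trim _ _) _].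
have hp := norm_payz i (qcode q) (cset z.2).
rewrite zval_trim ?payzE; last exact: leq_ltn_trans hb.
by split=> //; exact: leq_trans (znorm_trim _ _) hp.
Qed.

Hypothesis big_pad : D ^ horizon x * (2 * big x).+2 <= 2 ^ pad2 x.

Section one_objective.
Variable lam : seq zz.

Lemma zval_sum_ord (F : nat -> zz) n :
  zval (zsum [seq F i | i <- iota 0 n]) = (\sum_(i < n) zval (F i))%R.
Proof. by rewrite zval_sum big_map -{1}(subn0 n) -/(index_iota 0 n) big_mkord. Qed.

Lemma znorm_sum_ord (F : nat -> zz) n :
  znorm (zsum [seq F i | i <- iota 0 n]) = \sum_(i < n) znorm (F i).
Proof. by rewrite znorm_sum big_map -{1}(subn0 n) -/(index_iota 0 n) big_mkord. Qed.

Lemma best_ok cs : cs != [::] -> best x lam cs \in cs /\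
  all (fun u => zval (ldot x lam u) <= zval (ldot x lam (best x lam cs)))%R cs.
Proof.
move=> cs0; set p := fun v => all (fun u => ~~ zlt (ldot x lam v) (ldot x lam u)) cs.
have : best x lam cs \in [seq v <- cs | p v].
  rewrite /best -/p; have [u uc hu] : exists2 u, u \in cs &
      all (fun w => zval (ldot x lam w) <= zval (ldot x lam u))%R cs.
    by case: cs cs0 {p} => // v cs _; exact: (argmax_ex (fun u => zval (ldot x lam u))).
  have : u \in [seq v <- cs | p v].
    by rewrite mem_filter uc andbT; apply: sub_all hu => w; rewrite zltE -leNgt.
  by case: [seq _ <- _ | _] => // w l _; exact: mem_head.
by rewrite mem_filter => /andP[h ->]; split=> //; apply: sub_all h => u; rewrite zltE -leNgt.
Qed.

Local Notation cR i q := (fun z => (rewardI M ini idx tgt jrow cfz (big x) i q z)%:~R%R : R).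
Local Notation la i := (cv R lam (nat_of_ord i).+1).
Local Notation lc q := (fun z => (\sum_(i < 2 * c0) la i * cR i q z)%R).

(** All table entries are below [2 ^ pad2], so truncation never changes a value. *)
Let pow_lt t k : t <= horizon x -> k <= (2 * big x).+1 -> D ^ t * k < 2 ^ pad2 x.
Proof.
move=> tH kb; apply: leq_trans big_pad; apply: (@leq_trans (D ^ t * (2 * big x).+2)).
  by rewrite ltn_pmul2l ?ltnS // expn_gt0 D0.
by rewrite leq_mul2r leq_pexp2l ?orbT.
Qed.

Lemma ldotE v : ((zval (ldot x lam v))%:~R = \sum_(i < 2 * c0) la i * (zval (at0 v i))%:~R :> R)%R.
Proof.
rewrite /ldot /dd ncE (zval_sum_ord (fun i => zmul (at0 lam i.+1) (at0 v i))) rmorph_sum.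
by apply: eq_bigr => i _; rewrite zval_mul rmorphM.
Qed.

(** One strategy [ch q] accounts for all rows of an entry simultaneously; only their combination
    with [lam] is optimal. *)
Definition table_ok (st : zz * seq (seq zz)) (t : nat) : Prop :=
  [/\ zval st.1 = Posz (D ^ t), znorm st.1 <= D ^ t &
  exists ch : Q -> nat -> Z -> option A, (forall q t z a, ch q t z = Some a -> enabled M z.1 a) /\
    forall q z, (forall i : 'I_(2 * c0), znorm (vat st.2 (ycode q z) i) <= D ^ t * (2 * big x) /\
      ((zval (vat st.2 (ycode q z) i))%:~R = D%:R ^+ t * run_value M (ch q) (cR i q) t z :> R)%R) /\
    (\sum_(i < 2 * c0) la i * (zval (vat st.2 (ycode q z) i))%:~R = D%:R ^+ t * vi M (lc q) t z)%R].

Lemma run_value_ext (c : Z -> R) ch ch' t z : (forall i z, i <= t -> ch i z = ch' i z) ->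
  run_value M ch c t z = run_value M ch' c t z.
Proof.
elim: t z => //= t IH z h; rewrite h //; case: (ch' t.+1 z) => // a.
by apply: eq_bigr => s _; rewrite IH // => i u it; apply: h; exact: leqW.
Qed.

Lemma table_ok0 : table_ok (ztrim (pad2 x) (znat 1), rew_tab x b) 0.
Proof.
have h1 : 1 < 2 ^ pad2 x by exact: (@pow_lt 0 1).
have bpad : 2 * big x < 2 ^ pad2 x by rewrite -[2 * big x]mul1n; apply: (@pow_lt 0).
split; first by rewrite [LHS](@zval_trim _ (znat 1)) ?zval_nat ?znorm_nat.
  by apply: leq_trans (znorm_trim _ _) _; rewrite znorm_nat.
exists (fun _ _ _ => None); split=> // q z; split=> [i|] /=.
  by have [-> h] := rewE q z i bpad; rewrite expn0 mul1n h mul1r.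
by rewrite mul1r; apply: eq_bigr => i _; have [-> _] := rewE q z i bpad.
Qed.

(** What the candidate [v] of state [z] must be when the choice [o] is made. *)
Let good (ch : Q -> nat -> Z -> option A) t q z (v : seq zz) (o : option A) : Prop :=
  [/\ forall a, o = Some a -> enabled M z.1 a,
      forall i : 'I_(2 * c0), znorm (at0 v i) <= D ^ t.+1 * (2 * big x) /\
        ((zval (at0 v i))%:~R = D%:R ^+ t.+1 *
           (if o is Some a then avg M (run_value M (ch q) (cR i q) t) z a else cR i q z) :> R)%R &
      ((zval (ldot x lam v))%:~R = D%:R ^+ t.+1 *
         (if o is Some a then avg M (vi M (lc q) t) z a else lc q z) :> R)%R].

Lemma vstep_ok st t : t < horizon x -> table_ok st t -> table_ok (vstep x b lam st) t.+1.
Proof.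
move=> tH [s1 s2 [ch [che hst]]].
have bpad : 2 * big x < 2 ^ pad2 x by rewrite -[2 * big x]mul1n; apply: (@pow_lt 0).
have n1 : znorm (zmul (znat D) st.1) <= D ^ t.+1 by rewrite znorm_mul znorm_nat expnS leq_mul2l s2 orbT.
have n1' : D ^ t.+1 < 2 ^ pad2 x by rewrite -[D ^ _]muln1; apply: pow_lt.
pose D' := ztrim (pad2 x) (zmul (znat D) st.1).
have d1 : zval D' = Posz (D ^ t.+1).
  by rewrite /D' zval_trim; [rewrite zval_mul zval_nat s1 expnS PoszM|exact: leq_ltn_trans n1 _].
have d2 : znorm D' <= D ^ t.+1 by exact: leq_trans (znorm_trim _ _) n1.
have d1R : ((zval D')%:~R = D%:R ^+ t.+1 :> R)%R by rewrite d1 -pmulrn natrX.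
pose cs q z := vcands x b (D', st.2) (ycode q z).
have commit q z : good ch t q z [seq zmul D' e | e <- nth [::] (rew_tab x b) (ycode q z)] None.
  have at0E i : at0 [seq zmul D' e | e <- nth [::] (rew_tab x b) (ycode q z)] i =
      (if i < dd x then zmul D' (vat (rew_tab x b) (ycode q z) i) else z0).
    have sz : size (nth [::] (rew_tab x b) (ycode q z)) = dd x.
      by rewrite (nth_map 0) ?size_iota ?ycode_lt // size_map size_iota.
    rewrite /at0; case: ifP => hi; first by rewrite (nth_map z0) ?sz.
    by rewrite nth_default // size_map sz leqNgt hi.
  have atE (i : 'I_(2 * c0)) : znorm (at0 [seq zmul D' e | e <- nth [::] (rew_tab x b) (ycode q z)] i) <= D ^ t.+1 * (2 * big x) /\
     ((zval (at0 [seq zmul D' e | e <- nth [::] (rew_tab x b) (ycode q z)] i))%:~R = D%:R ^+ t.+1 * cR i q z :> R)%R.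
    have hi : i < dd x by rewrite /dd ncE.
    have [e1 e2] := rewE q z i bpad; rewrite at0E hi zval_mul rmorphM /= d1R e1.
    by split=> //; rewrite znorm_mul leq_mul.
  split=> //; rewrite ldotE mulr_sumr; apply: eq_bigr => i _.
  by rewrite (atE i).2 mulrCA.
have move_ q z a : enabled M z.1 a -> good ch t q z (vavg x st.2 (ycode q z) (nat_of_ord a)) (Some a).
  move=> ea; pose u (i : 'I_(2 * c0)) s := vat st.2 (ycode q (succ z s)) i.
  have atE (i : 'I_(2 * c0)) : znorm (at0 (vavg x st.2 (ycode q z) a) i) = \sum_(s : S) tw x z.1 a s * znorm (u i s) /\
      zval (at0 (vavg x st.2 (ycode q z) a) i) = (\sum_(s : S) (tw x z.1 a s)%:R * zval (u i s))%R.
    have hi : i < dd x by rewrite /dd ncE.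
    rewrite /vavg /at0 (nth_map 0) ?size_iota // nth_iota // add0n -/(at0 _ _).
    rewrite ycode_div ycode_mod zcode_mod nnE znorm_sum_ord zval_sum_ord.
    by split; apply: eq_bigr => s _; rewrite zsucE ?znorm_mul ?znorm_nat ?zval_mul ?zval_nat ?natz.
  have avgE (f : Z -> R) (g : S -> R) : (forall s, g s = D%:R ^+ t * f (succ z s))%R ->
      (\sum_(s : S) (tw x z.1 a s)%:R * g s = D%:R ^+ t.+1 * avg M f z a)%R.
    move=> hg; rewrite /avg mulr_sumr; apply: eq_bigr => s _; rewrite hg twE /prb exprS; ring.
  split=> [a' [<-]//|i|].
    have [-> ->] := atE i; split.
      apply: (@leq_trans (\sum_(s : S) tw x z.1 a s * (D ^ t * (2 * big x)))).
        by apply: leq_sum => s _; rewrite leq_mul2l; case: (hst q (succ z s)) => /(_ i)[-> _] _; rewrite orbT.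
      rewrite -big_distrl /= expnS -mulnA leq_mul2r; apply/orP; right.
      rewrite -(ler_nat R) natr_sum (eq_bigr (fun s => D%:R * prb R M z a s)%R) => [|s _]; last exact: twE.
      by rewrite -mulr_sumr prb_sum // mulr1.
    rewrite rmorph_sum -(avgE _ (fun s => (zval (u i s))%:~R%R)); last by move=> s; case: (hst q (succ z s)) => /(_ i)[_ ->].
    by apply: eq_bigr => s _; rewrite rmorphM /= rmorph_nat.
  rewrite ldotE -(avgE _ (fun s => \sum_(i < 2 * c0) la i * (zval (u i s))%:~R)%R); last first.
    by move=> s; case: (hst q (succ z s)).
  transitivity (\sum_(i < 2 * c0) \sum_(s : S) la i * ((tw x z.1 a s)%:R * (zval (u i s))%:~R) : R)%R.
    apply: eq_bigr => i _; rewrite (atE i).2 rmorph_sum mulr_sumr; apply: eq_bigr => s _.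
    by rewrite rmorphM /= rmorph_nat.
  rewrite exchange_big /=; apply: eq_bigr => s _; rewrite mulr_sumr; apply: eq_bigr => i _.
  by rewrite mulrCA.
have cand q z v : v \in cs q z -> exists o, good ch t q z v o.
  rewrite inE => /orP[/eqP ->|]; first by exists None; exact: commit.
  move=> /mapP[a]; rewrite mem_filter mem_iota add0n ycode_mod zcode_mod naE => /andP[ea /= alt] ->.
  exists (Some (Ordinal alt)); apply: (move_ q z (Ordinal alt)).
  by rewrite -enE.
have DR : (0 < D%:R ^+ t.+1 :> R)%R by rewrite exprn_gt0 // ltr0n.
(* The candidates are committing and all enabled actions, so one that is maximal for [lam] attains
   the maximum in [vi]. *)
have hex (qz : Q * Z) : exists o : option A, good ch t qz.1 qz.2 (best x lam (cs qz.1 qz.2)) o /\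
    ((if o is Some a then avg M (vi M (lc qz.1) t) qz.2 a else lc qz.1 qz.2) = vi M (lc qz.1) t.+1 qz.2)%R.
  case: qz => q z; rewrite -[(q, z).1]/q -[(q, z).2]/z; have [//|bc bm] := @best_ok (cs q z).
  have [ot go] := cand q z _ bc; exists ot; split=> //; case: go => go1 go2 go3.
  apply: le_anti; apply/andP; split.
    by case: ot go1 {go2 go3} => [a /(_ a erefl) ea|_]; [exact: (vi_ge_avg (lc q) t ea)|exact: (vi_ge_c M (lc q) t.+1 z)].
  have ub v o' : v \in cs q z -> good ch t q z v o' ->
      ((if o' is Some a then avg M (vi M (lc q) t) z a else lc q z) <=
       (if ot is Some a then avg M (vi M (lc q) t) z a else lc q z))%R.
    move=> vc [_ _ gv]; have /allP/(_ v vc) := bm; rewrite -(ler_int R) gv go3.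
    by rewrite ler_pM2l.
  case: (vi_cases M (lc q) t z) => [->|[a ea ->]].
    by apply: (ub _ None _ (commit q z)); exact: mem_head.
  apply: (ub _ (Some a) _ (move_ q z a ea)); rewrite inE; apply/orP; right.
  apply: map_f; rewrite mem_filter mem_iota add0n ycode_mod zcode_mod naE enE ea /=; exact: ltn_ord.
have [ot ho] := choice hex.
split=> //.
exists (fun q i z => if i == t.+1 then ot (q, z) else ch q i z); split.
  move=> q i z a; case: eqP => _; last exact: che.
  by case: (ho (q, z)) => -[h _ _] _; exact: h.
move=> q z; case: (ho (q, z)) => -[g1 g2 g3] /= g4.
have vE (i : 'I_(2 * c0)) : vat [seq [seq ztrim (pad2 x) (at0 (best x lam (vcands x b (D', st.2) y)) i)
    | i <- iota 0 (dd x)] | y <- iota 0 (nk x * nn x * zn x)] (ycode q z) i =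
    ztrim (pad2 x) (at0 (best x lam (cs q z)) i).
  have hi : i < dd x by rewrite /dd ncE.
  by rewrite /vat (nth_map 0) ?size_iota ?ycode_lt // nth_iota ?ycode_lt // add0n /at0 (nth_map 0) ?size_iota // nth_iota.
have small (i : 'I_(2 * c0)) : znorm (at0 (best x lam (cs q z)) i) < 2 ^ pad2 x.
  by have [h _] := g2 i; apply: leq_ltn_trans h _; by apply: pow_lt => //; exact: leqnSn.
split=> [i|].
  rewrite vE zval_trim //; have [h1 h2] := g2 i; split; first exact: leq_trans (znorm_trim _ _) h1.
  rewrite h2 /= eqxx; congr (_ * _)%R; case: (ot (q, z)) => // a.
  apply: eq_bigr => s _; congr (_ * _)%R; apply: run_value_ext => j u jt.
  by rewrite ltn_eqF.
rewrite -g4 -g3 ldotE; apply: eq_bigr => i _; by rewrite vE zval_trim.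
Qed.

Lemma vtab_ok : table_ok (vtab x b lam) (horizon x).
Proof.
rewrite /vtab; suff h n : n <= horizon x ->
    table_ok (foldl (fun st _ => vstep x b lam st) (ztrim (pad2 x) (znat 1), rew_tab x b) (iota 0 n)) n.
  exact: h.
elim: n => [|n IH] nH; first exact: table_ok0.
by rewrite iota_rcons foldl_rcons; apply: vstep_ok => //; apply: IH; exact: ltnW.
Qed.

End one_objective.

Lemma sum_ord_mul (V : nmodType) n m (F : nat -> V) :
  (\sum_(u < n * m) F u = \sum_(i < n) \sum_(j < m) F (i * m + j)%N)%R.
Proof.
elim: n => [|n IH]; first by rewrite mul0n !big_ord0.
by rewrite big_ord_recr -IH /= mulSnr big_split_ord.
Qed.

Lemma sum_qcode (V : nmodType) (F : nat -> V) : (\sum_(u < nk x * nn x) F u = \sum_(q : Q) F (qcode q))%R.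
Proof. by rewrite nkE nnE sum_ord_mul sum_pair. Qed.

Local Notation zs q := (zof (nA := nA) ([::], snd q)).

Lemma start_atE (q : Q) : start_at x (qcode q) = ycode q (zs q).
Proof.
have h : qcode q %% nn x = q.2 by rewrite nnE /qcode modnMDl modn_small.
rewrite /start_at h /ycode /zcode /zof /visited /= tpowE ?(ltnW (ltn_ord _)) // nnE.
rewrite (_ : [set s in [::]] = finset.set0)%SET ?finset.setU0 ?cset1 //.
Qed.

Local Notation Th := (threshold nS k0 thz (big x)).
Local Notation val := (row_val ini idx tgt jrow cfz).
Local Notation payR i q := (fun V => (payI i q V)%:~R%R : R).
Local Notation st i := (row_strict x (nat_of_ord i)).

Lemma row_thE (i : 'I_(2 * c0)) : zval (row_th x b i) = Th i.
Proof. by rewrite /row_th zval_add zval_nat nkE nnE /threshold card_prod !card_ord natz. Qed.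

(** Bounds the absolute values of all thresholds and payoffs. *)
Definition range_bound : nat := 3 * (k0 * nS.+1) * big x + 2 * big x + 2 * (D * tot x) + 1.

Lemma norm_row_th (i : nat) : znorm (row_th x b i) <= 2 * (D * tot x) + k0 * nS.+1 * big x.
Proof.
rewrite /row_th /row_thr !znorm_add znorm_nat nkE nnE leq_add2r mul2n -addnn leq_add //;
  exact: leq_trans (norm_signed _ _) (norm_ratz _).
Qed.

Definition payoff (w : Q -> Z -> R) (i : 'I_(2 * c0)) : R :=
  (\sum_q \sum_z w q z * reward M (payR i q) z)%R.
Local Notation flows y w := (forall q : Q, flow M (zs q) (y q) (w q)).

Lemma payoff_bound (y : Q -> Z -> A -> R) w i : flows y w -> (0 <= payoff w i <= (k0 * nS.+1 * (2 * big x))%:R)%R.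
Proof.
move=> fl; have rw q z : (0 <= reward M (payR i q) z <= ((2 * big x)%:R : R))%R.
  rewrite -rewardIE /rewardI; case: ifP => _; last by rewrite lexx ler0n.
  have /andP[h1 h2] := pay_bound ini idx tgt jrow cfz_big i q z.2.
  by rewrite ler0z h1 -(rmorph_nat (intmul 1)) ler_int.
apply/andP; split.
  apply: sumr_ge0 => q _; apply: sumr_ge0 => z _; case: (fl q) => _ w0 _ _.
  by apply: mulr_ge0 => //; case/andP: (rw q z).
have -> : ((k0 * nS.+1 * (2 * big x))%:R = \sum_(q : Q) (2 * big x)%:R :> R)%R.
  by rewrite sumr_const card_prod !card_ord -mulrnA mulnC.
apply: ler_sum => q _.
apply: (weak_duality (x := fun=> (2 * big x)%:R%R) (fl q)) => [z|z a ea]; first by case/andP: (rw q z).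
by rewrite /avg -mulr_suml prb_sum // mul1r.
Qed.

Local Notation E := (pad1 x).
Local Notation G := ((D ^ horizon x)%:R%R : R).
(** Divided by [2 ^ (2 E + 1)] it is the excess of the payoff over the threshold, diminished by
    [2 ^ (-E)] in strict rows. *)
Definition coord (w : Q -> Z -> R) (i : 'I_(2 * c0)) : R :=
  (2 ^+ (2 * E).+1 * (payoff w i - (Th i)%:~R) - 2 ^+ E.+1 * (st i)%:R)%R.

Definition oracle_bound : nat := D ^ horizon x * (2 ^ (2 * E).+1 * range_bound + 2 ^ E.+1).

Lemma coord_bound (y : Q -> Z -> A -> R) w i : flows y w ->
  (`|coord w i| <= (2 ^ (2 * E).+1 * range_bound + 2 ^ E.+1)%:R)%R.
Proof.
move=> fl; have /andP[h1 h2] := payoff_bound i fl; rewrite natrD natrM !natrX.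
apply: le_trans (ler_normB _ _) _; apply: lerD; last first.
  by rewrite normrM ger0_norm ?exprn_ge0 // ler_piMr ?exprn_ge0 //; case: (st i); rewrite ?normr1 ?normr0.
rewrite normrM ger0_norm ?exprn_ge0 // ler_wpM2l ?exprn_ge0 //.
have ht : (`|(Th i)%:~R| <= (2 * (D * tot x) + k0 * nS.+1 * big x)%:R :> R)%R.
  rewrite -intr_norm -(rmorph_nat (intmul 1)) ler_int -row_thE; apply: le_trans (zval_le_norm _) _.
  by rewrite natz lez_nat; exact: norm_row_th.
apply: le_trans (ler_normB _ _) _; rewrite ger0_norm //; apply: le_trans (lerD h2 ht) _.
rewrite -natrD ler_nat /range_bound; move: (big x) (D * tot x) => u v; nia.
Qed.

(** Flows form a convex set and [coord] is affine in them, so nonnegative combinations of oracle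
    answers are again [m] times the vector of a single flow. *)
Definition cone (m : R) (v : nat -> R) : Prop :=
  [/\ (0 <= m)%R, (v 0 = G * m)%R, forall k, 2 * c0 < k -> v k = 0%R &
  exists y w, flows y w /\ forall i : 'I_(2 * c0), (v i.+1 = m * (G * coord w i))%R].

Lemma flows_ex : exists y (w : Q -> Z -> R), flows y w.
Proof.
have /choice[y /choice[w h]] := fun q : Q => run_flow R (M := M) (ch := fun _ _ => None) 0 (zs q)
  (fun _ _ _ (e : None = Some _) => match e with end).
by exists y, w => q; case: (h q).
Qed.

Lemma cone_comb (a a' m m' : R) (v v' : nat -> R) : (0 <= a -> 0 <= a' -> cone m v -> cone m' v' ->
  cone (a * m + a' * m') (fun k => a * v k + a' * v' k))%R.
Proof.
move=> a0 a'0 [m0' v0 vz [y [w [fl vE]]]] [m1' v1 vz' [y' [w' [fl' vE']]]].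
split; first by rewrite addr_ge0 ?mulr_ge0.
- by rewrite v0 v1 mulrDr !(mulrCA G).
- by move=> k hk; rewrite vz // vz' // !mulr0 addr0.
have [s0|s0] := eqVneq (a * m + a' * m')%R 0%R.
  exists y, w; split=> // i; move: (s0) => /eqP; rewrite paddr_eq0 ?mulr_ge0 // => /andP[/eqP e1 /eqP e2].
  by rewrite s0 vE vE' !mulrA e1 e2 !mul0r addr0.
set s := (a * m + a' * m')%R in s0 *.
pose e (j : bool) : R := if j then (a * m / s)%R else (a' * m' / s)%R.
have s1 : (0 < s)%R by rewrite lt_def s0 addr_ge0 ?mulr_ge0.
exists (fun q z c => \sum_j e j * (if j then y else y') q z c)%R, (fun q z => \sum_j e j * (if j then w else w') q z)%R.
split=> [q|i].
  apply: (@flow_convex _ _ _ _ _ _ e (fun j => (if j then y else y') q) (fun j => (if j then w else w') q)).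
  - by case; rewrite divr_ge0 ?mulr_ge0 ?(ltW s1).
  - by rewrite big_bool /= -mulrDl divff.
  - by case.
have pE : payoff (fun q z => \sum_j e j * (if j then w else w') q z)%R i = (e true * payoff w i + e false * payoff w' i)%R.
  rewrite /payoff !mulr_sumr -big_split; apply: eq_bigr => q _.
  rewrite !mulr_sumr -big_split; apply: eq_bigr => z _ /=; rewrite big_bool /=; ring.
have e1 : (s * e true = a * m)%R by rewrite /e mulrC divfK.
have e2 : (s * e false = a' * m')%R by rewrite /e mulrC divfK.
rewrite vE vE' /coord pE.
transitivity (G * (2 ^+ (2 * E).+1 * ((s * e true) * payoff w i + (s * e false) * payoff w' i - s * (Th i)%:~R)
   - s * (2 ^+ E.+1 * (st i)%:R)))%R; last by ring.
by rewrite e1 e2 /s; ring.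
Qed.

Lemma cone_zero : cone 0%R (fun=> 0%R).
Proof.
have [y [w fl]] := flows_ex; split=> //; first by rewrite mulr0.
by exists y, w; split=> // i; rewrite mul0r.
Qed.

Lemma cone_bd (m : R) (v : nat -> R) k : cone m v -> (`|v k| <= oracle_bound%:R * m)%R.
Proof.
move=> [m0' v0 vz [y [w [fl vE]]]]; rewrite /oracle_bound natrM.
case: k => [|k].
  rewrite v0 normrM ger0_norm ?ler0n // ger0_norm // ler_wpM2r // ler_peMr ?ler0n // ler1n.
  by rewrite addn_gt0 !expn_gt0 orbT.
have [kd|dk] := ltnP k (2 * c0); last first.
  by rewrite vz // normr0 !mulr_ge0.
rewrite -[k]/(nat_of_ord (Ordinal kd)) vE normrM ger0_norm // mulrC ler_wpM2r // normrM ger0_norm ?ler0n //.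
by rewrite ler_wpM2l ?ler0n //; exact: coord_bound fl.
Qed.

(** The strategy behind the table is turned into a flow by [run_flow]. This places the answer in the
    cone and identifies its value for [lam] with the truncated optimum. *)
Lemma oracle_coord lam : exists y (w : Q -> Z -> R),
    [/\ flows y w, (cv R (oracle x b lam) 0 = G)%R,
    forall k, 2 * c0 < k -> cv R (oracle x b lam) k = 0%R,
    forall i : 'I_(2 * c0), (cv R (oracle x b lam) i.+1 = G * coord w i)%R &
    (\sum_(i < 2 * c0) cv R lam i.+1 * payoff w i = \sum_(q : Q) vi M
      (fun z => \sum_(i < 2 * c0) cv R lam i.+1 * (rewardI M ini idx tgt jrow cfz (big x) i q z)%:~R)
      (horizon x) (zs q))%R].
Proof.
have [g1 g2 [ch [che hch]]] := vtab_ok lam.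
have /choice[y /choice[w h]] := fun q : Q => run_flow R (M := M) (ch := ch q) (horizon x) (zs q) (che q).
have pE i : payoff w i = (\sum_(q : Q) run_value M (ch q)
    (fun z => (rewardI M ini idx tgt jrow cfz (big x) i q z)%:~R) (horizon x) (zs q))%R.
  apply: eq_bigr => q _; case: (h q) => _ <-; apply: eq_bigr => z _; by rewrite rewardIE.
have G0 : G != 0%R by rewrite pnatr_eq0 expn_eq0 negb_and (gtn_eqF D0).
exists y, w; split.
- by move=> q; case: (h q).
- by rewrite /cv /oracle /oracle_of /at0 /= g1 -pmulrn.
- by move=> [//|k] hk; rewrite /cv /at0 nth_default //= size_map size_iota /dd ncE.
- move=> i; have hi : i < dd x by rewrite /dd ncE.
  rewrite /cv /at0 /= (nth_map 0) ?size_iota // nth_iota // add0n zval_add zval_mul zval_add zval_opp zval_mul.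
  rewrite zval_sum_ord (sum_qcode (fun u => zval (vat (vtab x b lam).2 (start_at x u) i))) row_thE g1 zval_pow2.
  have -> : zval (if row_strict x i then zopp (zmul (zpow2 E.+1) (vtab x b lam).1) else z0) =
      (- ((Posz (2 ^ E.+1)) * Posz (D ^ horizon x) * (st i)%:R))%R.
    by case: (row_strict x i); rewrite ?mulr1 ?mulr0 ?oppr0 // zval_opp zval_mul zval_pow2 g1.
  rewrite /coord pE; move: (Th i) => th.
  rewrite !(rmorphD, rmorphN, rmorphM, rmorph_sum) /= !rmorph_nat.
  rewrite (eq_bigr (fun q : Q => G * run_value M (ch q)
    (fun z => (rewardI M ini idx tgt jrow cfz (big x) i q z)%:~R) (horizon x) (zs q))%R); last first.
    by move=> q _; rewrite start_atE; case: (hch q (zs q)) => /(_ i)[_ ->]; rewrite natrX.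
  rewrite -mulr_sumr -!pmulrn !natrX; ring.
under eq_bigr do rewrite pE mulr_sumr; rewrite exchange_big /=; apply: eq_bigr => q _.
apply: (mulfI G0); case: (hch q (zs q)) => h1 h2; rewrite natrX -h2 mulr_sumr.
by apply: eq_bigr => i _; case: (h1 i) => _ ->; rewrite mulrCA.
Qed.

Lemma oracle_norm lam k : znorm (at0 (oracle x b lam) k) <= oracle_bound.
Proof.
have [g1 g2 [ch [_ hch]]] := vtab_ok lam; rewrite /oracle_bound.
case: k => [|k].
  by apply: leq_trans g2 _; rewrite leq_pmulr // addn_gt0 !expn_gt0 orbT.
have [kd|dk] := ltnP k (2 * c0); last by rewrite /at0 nth_default //= size_map size_iota /dd ncE.
have hi : k < dd x by rewrite /dd ncE.
rewrite /at0 /= (nth_map 0) ?size_iota // nth_iota // add0n znorm_add znorm_mul znorm_add znorm_opp znorm_mul.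
rewrite znorm_sum_ord (sum_qcode (fun u => znorm (vat (vtab x b lam).2 (start_at x u) k))) znorm_pow2.
have h1 : \sum_(q : Q) znorm (vat (vtab x b lam).2 (start_at x (qcode q)) k) <= D ^ horizon x * (k0 * nS.+1 * (2 * big x)).
  apply: (@leq_trans (\sum_(q : Q) D ^ horizon x * (2 * big x))); last first.
    by rewrite sum_nat_const card_prod !card_ord mulnCA.
  apply: leq_sum => q _; rewrite start_atE; case: (hch q (zs q)) => /(_ (Ordinal kd))[h _] _; exact: h.
have h2 := norm_row_th k.
have h3 : znorm (if row_strict x k then zopp (zmul (zpow2 E.+1) (vtab x b lam).1) else z0) <= D ^ horizon x * 2 ^ E.+1.
  by case: ifP => // _; rewrite znorm_opp znorm_mul znorm_pow2 mulnC leq_mul2r g2 orbT.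
rewrite [leqRHS]mulnDr; apply: leq_add h3; rewrite [leqRHS]mulnCA leq_mul2l; apply/orP; right.
apply: leq_trans (leq_add h1 (leq_mul g2 h2)) _; rewrite -mulnDr leq_mul2l; apply/orP; right.
rewrite /range_bound; move: (big x) (D * tot x) (k0 * nS.+1) => u v r; nia.
Qed.

(** * Soundness and completeness of the search *)

Lemma foldl_iota (T : Type) (f : T -> T) s N : foldl (fun s _ => f s) s (iota 0 N) = iter N f s.
Proof. by elim: N => // N IH; rewrite iota_rcons foldl_rcons IH. Qed.

Hypothesis c_pos : 0 < c0.
Hypothesis end_pad : 2 * c0 * (2 ^ (2 * E).+1 * range_bound + 2 ^ E.+1) <= 2 ^ (8 * E).
Hypothesis cut_pad : (2 * oracle_bound) ^ (2 ^ (2 * c0)) <= 2 ^ pad2 x.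
Hypothesis trim_pad : 8 * E < pad2 x.
Hypothesis steps_pad : (8 * E + 2) ^ (2 * c0).+1 <= pad2 x.
Hypothesis rate_pad : D ^ (nS.+1 * nS.+2) <= E.
Hypothesis gap_pad : (#|lp_row nS k0 (2 * c0)|).+1 * (gap_bound nS k0 (2 * c0) (range_bound + 2 * D)).+1 < 2 ^ E.
Hypothesis limit_pad : k0 * nS.+1 * (2 * c0) * (2 * big x) * 2 ^ (2 * E).+1 < 2 ^ (8 * E).

Let strict_ok (sigma : 'I_k0 -> scheduler R M) : Prop := forall i : 'I_(2 * c0),
  if st i then ((thz i)%:~R < val sigma i :> R)%R else ((thz i)%:~R <= val sigma i :> R)%R.

Let PI (s : S) (a : A) (s' : S) : int := Posz (tw x s a s').
Let PIE s a s' : ((PI s a s')%:~R = D%:R * ratr (trans M s a s') :> R)%R.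
Proof. by rewrite -twE -pmulrn. Qed.
Let Th_le i : (`|Th i| <= (range_bound + 2 * D)%:R)%R.
Proof.
rewrite -row_thE; apply: le_trans (zval_le_norm _) _; rewrite natz lez_nat.
apply: leq_trans (norm_row_th _) _; rewrite /range_bound; move: (big x) (D * tot x) => u v; nia.
Qed.
Let e : R := (2 ^+ E)%R.
Let e0 : (0 < e)%R. Proof. by rewrite exprn_gt0. Qed.
Let gapB := gap_bound nS k0 (2 * c0) (range_bound + 2 * D).
Let bigB : 2 * big x <= range_bound + 2 * D.
Proof. by rewrite /range_bound; move: (big x) (D * tot x) => u v; lia. Qed.

(** The flow found meets the rows up to an error; [achieves_gap] makes it exact before schedulers
    are extracted. *)
Let feasible_sound (m : R) v : (0 < m)%R -> cone m v ->
  (forall k, 0 < k <= 2 * c0 -> (- ((G + (2 * c0)%:R * oracle_bound%:R / 2 ^+ (8 * E)) * m) <= v k)%R) ->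
  exists sigma, strict_ok sigma.
Proof.
move=> m0' [_ _ _ [y [w [fl vE]]]] hv.
have G0 : (0 < G)%R by rewrite ltr0n expn_gt0 D0.
have err : ((2 * c0)%:R * oracle_bound%:R / 2 ^+ (8 * E) <= G)%R.
  rewrite ler_pdivrMr ?exprn_gt0 // -natrX -!natrM ler_nat /oracle_bound mulnCA leq_mul2l.
  by rewrite end_pad orbT.
(* All errors amount to at most [2 * G] per unit of mass, hence to [coord w i >= -2]; after division
   by [2 * e ^ 2] this is an error of [e^-1 * e^-1] against a margin of [e^-1]. *)
have hp i : ((Th i)%:~R + e^-1 * (st i)%:R - e^-1 * e^-1 <= payoff w i)%R.
  have := hv i.+1; rewrite ltn_ord => /(_ isT); rewrite vE.
  have h2 : ((G + (2 * c0)%:R * oracle_bound%:R / 2 ^+ (8 * E)) * m <= m * (G * 2))%R.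
    by rewrite mulrC ler_wpM2l ?(ltW m0') //; move: err; lra.
  move=> /(le_trans _) h; have {h}: (- (m * (G * 2)) <= m * (G * coord w i))%R by apply: h; rewrite lerN2.
  have -> : (- (m * (G * 2)) = m * (G * (-2)))%R by ring.
  rewrite ler_pM2l // ler_pM2l // /coord.
  have -> : (2 ^+ (2 * E).+1 = 2 * (e * e) :> R)%R by rewrite exprS mul2n -addnn exprD.
  have -> : (2 ^+ E.+1 = 2 * e :> R)%R by rewrite exprS.
  move: (payoff w i) ((Th i)%:~R : R)%R ((st i)%:R : R)%R => P th s h.
  have -> : P = (th + e^-1 * s - e^-1 * e^-1 + (e^-1 * e^-1) * (e * e * (P - th) - e * s + 1))%R.
    by field; exact: lt0r_neq0.
  rewrite lerDl; apply: mulr_ge0; first by rewrite mulr_ge0 // invr_ge0 ltW.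
  by move: h; lra.
have ach : achieves M ini idx tgt jrow cfz (big x) y w (fun i => (Th i)%:~R + e^-1 * (st i)%:R - e^-1 * e^-1)%R.
  by split=> [q|i]; [exact: fl|exact: hp].
have e1 : (1 <= e)%R by rewrite exprn_ege1 // ler1n.
have [] := @achieves_gap _ _ _ _ _ _ _ _ _ _ _ _ _ _ _ cfz_big D (range_bound + 2 * D) PI (fun i => st i) D0 PIE (leq_addl _ _) bigB Th_le _ _ _ _ ach.
- by rewrite invr_gt0 e0 invf_le1.
- by rewrite mulr_ge0 // invr_ge0 ltW.
- rewrite -mulrA gtr_pMr ?invr_gt0 // ltr_pdivrMl // mulr1 /e -natrX ltr_nat.
  apply: leq_ltn_trans gap_pad; apply: leq_trans (leqnSn _) _; exact: leq_pmull.
move=> y' [w' [tau [/andP[t1 _] ach']]].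
have [sigma hs] := schedulers_of_achieves cfz_big ach'.
exists sigma => i; have := hs i; case: (st i); rewrite ?mul0r ?addr0 //.
apply: lt_le_trans; rewrite ltrDl divr_gt0 //; exact: lt_le_trans t1.
Qed.

Let p : R := (D%:R^-1)%R.
Let p01 : (0 < p <= 1)%R.
Proof. by rewrite invr_gt0 ltr0n D0 invf_le1 ?ltr0n // ler1n. Qed.
Let p_min s a s' : trans M s a s' != 0%R -> (p <= ratr (trans M s a s'))%R.
Proof.
move=> h; rewrite -[leLHS]mul1r ler_pdivrMr ?ltr0n // mulrC -twE ler1n lt0n.
by rewrite tw_eq0.
Qed.

(** Schedulers give a flow with margin above [e^-1]; by weak duality no weights can make the optimal
    payoff fall below the weighted thresholds, so the oracle cannot answer with a negative
    vector. *)
Let feasible_complete lam sigma : strict_ok sigma -> valid_point R (2 * c0) (8 * E) lam ->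
  (0 <= \sum_(k < (2 * c0).+1) cv R lam k * cv R (oracle x b lam) k)%R.
Proof.
move=> hs [_ l0 lk].
(* The least margin of the strict rows, capped at 1: positive, but without any lower bound until the
   gap is applied. *)
pose gam : R := (\big[Num.min/1]_(i : 'I_(2 * c0) | st i) (val sigma i - (thz i)%:~R))%R.
have g0 : (0 < gam)%R.
  by apply: lt_bigmin => // i si; have := hs i; rewrite si subr_gt0.
have g1 : (gam <= 1)%R by exact: bigmin_le_id.
have hg i : ((thz i)%:~R + gam * (st i)%:R <= val sigma i)%R.
  have := hs i; case si: (st i); rewrite ?mulr0 ?addr0 // mulr1 => _.
  have := @bigmin_le_cond _ _ _ (1 : R)%R i (fun i => st i) (fun i => val sigma i - (thz i)%:~R)%R si.
  by rewrite -/gam; move: gam {g0 g1} => g; lra.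
pose eta : R := (gam / (gapB.+2)%:R)%R.
have eta0 : (0 < eta)%R by rewrite divr_gt0.
have [y [w ach]] := achieves_of_schedulers cfz_big p01 p_min hg eta0.
have [] := @achieves_gap _ _ _ _ _ _ _ _ _ _ _ _ _ _ _ cfz_big D (range_bound + 2 * D) PI (fun i => st i) D0 PIE (leq_addl _ _) bigB Th_le _ _ _ _ ach.
- by rewrite g0.
- exact: ltW.
- by rewrite /eta -mulrA gtr_pMr // ltr_pdivrMl ?mulr1 ?ltr_nat.
move=> {y w ach} y [w [tau [/andP[t1 t2] [fl hp]]]].
have te : (e^-1 <= tau^-1)%R.
  rewrite lef_pV2 ?posrE //; last exact: lt_le_trans t1.
  apply: le_trans t2 _; rewrite -natrM /e -natrX ler_nat; apply: ltnW; apply: leq_ltn_trans gap_pad.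
  by rewrite leq_mul.
have [y2 [w2 [fl2 o0 oz oE oV]]] := oracle_coord lam.
pose lc q z : R := (\sum_(i < 2 * c0) cv R lam i.+1 * (rewardI M ini idx tgt jrow cfz (big x) i q z)%:~R)%R.
pose K : R := ((2 * c0)%:R * 2 ^+ (8 * E) * (2 * big x)%:R)%R.
have rI i q z : (0 <= ((rewardI M ini idx tgt jrow cfz (big x) i q z)%:~R : R) <= ((2 * big x)%:R : R))%R.
  rewrite /rewardI; case: ifP => _; last by rewrite lexx ler0n.
  have /andP[h1 h2] := pay_bound ini idx tgt jrow cfz_big i q z.2.
  by rewrite ler0z h1 -(rmorph_nat (intmul 1)) ler_int.
have lc0 q z : (0 <= lc q z)%R.
  apply: sumr_ge0 => i _; apply: mulr_ge0; first by case/andP: (lk i.+1).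
  by case/andP: (rI i q z).
have lcK q z : (lc q z <= K)%R.
  apply: (@le_trans _ _ (\sum_(i < 2 * c0) 2 ^+ (8 * E) * (2 * big x)%:R)%R); last first.
    by rewrite sumr_const card_ord /K -[leRHS]mulrA [leRHS]mulr_natl.
  apply: ler_sum => i _; have /andP[r1 r2] := rI i q z; have /andP[a1 a2] := lk i.+1.
  by rewrite ler_pM.
have rate (q : Q) : (vlim M (lc q) (zs q) <= vi M (lc q) (horizon x) (zs q) + K / 2 ^+ (8 * E))%R.
  rewrite /horizon nnE; apply: (vi_rate (lc0 q) (lcK q) p01).
    by move=> z a s; rewrite /prb => h; apply: p_min; apply: contraTneq h => ->; rewrite rmorph0 ltxx.
  by rewrite /p exprVn ler_pdivlMr ?exprn_gt0 ?ltr0n // mul1r -natrX ler_nat.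
have wd : (\sum_(i < 2 * c0) cv R lam i.+1 * payoff w i <= \sum_(q : Q) vlim M (lc q) (zs q))%R.
  rewrite [leLHS](_ : _ = \sum_(q : Q) \sum_z w q z * lc q z)%R.
    apply: ler_sum => q _; apply: (weak_duality (fl q)) => [z|z a ea].
      exact: (vi_le_vlim M (lcK q) 0 z).
    exact: (avg_le_vlim (lcK q) ea).
  rewrite /payoff; under eq_bigr do rewrite mulr_sumr.
  rewrite exchange_big /=; apply: eq_bigr => q _; under eq_bigr do rewrite mulr_sumr.
  rewrite exchange_big /=; apply: eq_bigr => z _; rewrite /lc mulr_sumr; apply: eq_bigr => i _.
  by rewrite mulrCA rewardIE.
have lower : (\sum_(i < 2 * c0) cv R lam i.+1 * ((Th i)%:~R + e^-1 * (st i)%:R) <=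
    \sum_(i < 2 * c0) cv R lam i.+1 * payoff w i)%R.
  apply: ler_sum => i _; apply: ler_wpM2l; first by case/andP: (lk i.+1).
  apply: le_trans (hp i); rewrite lerD2l mulrC ler_wpM2l //.
have cardK : (\sum_(q : Q) K / 2 ^+ (8 * E) = (k0 * nS.+1 * (2 * c0) * (2 * big x))%:R :> R)%R.
  rewrite sumr_const card_prod !card_ord -[LHS]mulr_natl /K.
  have : (2 ^+ (8 * E) != 0 :> R)%R by rewrite expf_neq0.
  move: (2 ^+ (8 * E) : R)%R => T Tn; rewrite !natrM; field.
  exact: Tn.
have total : (\sum_(i < 2 * c0) cv R lam i.+1 * ((Th i)%:~R + e^-1 * (st i)%:R) <=
    \sum_(i < 2 * c0) cv R lam i.+1 * payoff w2 i + (k0 * nS.+1 * (2 * c0) * (2 * big x))%:R)%R.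
  rewrite oV -cardK -big_split /=; apply: le_trans lower (le_trans wd _); apply: ler_sum => q _; exact: rate.
have bound : ((k0 * nS.+1 * (2 * c0) * (2 * big x))%:R * (2 * (e * e)) <= 2 ^+ (8 * E) :> R)%R.
  have -> : (2 * (e * e) = 2 ^+ (2 * E).+1 :> R)%R by rewrite exprS mul2n -addnn exprD.
  by rewrite -!natrX -natrM ler_nat ltnW.
(* The constant coordinate contributes [2 ^ (8 * E) * G], which outweighs the scaled truncation
   error of value iteration by [bound]. *)
rewrite big_ord_recl l0 o0 /=.
rewrite (eq_bigr (fun i : 'I_(2 * c0) => G * (2 * (e * e) * (cv R lam i.+1 * payoff w2 i - cv R lam i.+1 * ((Th i)%:~R + e^-1 * (st i)%:R))))%R); last first.
  move=> i _; rewrite /bump /= add1n oE /coord.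
  have -> : (2 ^+ (2 * E).+1 = 2 * (e * e) :> R)%R by rewrite exprS mul2n -addnn exprD.
  have -> : (2 ^+ E.+1 = 2 * e :> R)%R by rewrite exprS.
  by field; exact: lt0r_neq0.
rewrite -!mulr_sumr sumrB [(2 ^+ _ * _)%R]mulrC -mulrDr; apply: mulr_ge0; first exact: ler0n.
move: total bound; move: (\sum_(i < _) _)%R (\sum_(i < _) _)%R => u v; move: (_%:R)%R => r h1 h2.
have e2 : (0 <= 2 * (e * e))%R by rewrite !mulr_ge0 ?(ltW e0).
have := ler_wpM2l e2 h1; move: h2; rewrite mulrDr; move: (2 * (e * e))%R => f; nra.
Qed.

Lemma found_iff : found x b <-> exists sigma : 'I_k0 -> scheduler R M, forall i : 'I_(2 * c0),
  if st i then ((thz i)%:~R < val sigma i :> R)%R else ((thz i)%:~R <= val sigma i :> R)%R.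
Proof.
have sE : search x b = srun (2 * c0) (8 * E) (pad2 x) (oracle x b) (pad2 x).
  by rewrite /search /dd ncE foldl_iota.
have Epos : 0 < E by apply: leq_trans pow_pad; rewrite expn_gt0.
have ob : 0 < oracle_bound by rewrite muln_gt0 expn_gt0 D0 addn_gt0 !expn_gt0 orbT.
have := @search_correct R (2 * c0) (8 * E) (pad2 x) oracle_bound (oracle x b) oracle_bound%:R G cone.
case/(_ _ _ _ _ _ _ _ _ _ _ _ (pad2 x)) => //.
- by move=> a a' m m' v v'; exact: cone_comb.
- exact: cone_zero.
- by move=> m v k; exact: cone_bd.
- by move=> m v [].
- move=> lam _; have [y [w [fl o0 oz oE _]]] := oracle_coord lam.
  split=> //; first by rewrite mulr1.
  by exists y, w; split=> // i; rewrite mul1r.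
- by move=> lam k _; exact: oracle_norm.
- by rewrite muln_gt0.
- by rewrite /= subn0.
- by rewrite muln_gt0 c_pos.
move=> r; rewrite /found -sE => ->; case: r => [[m [v [m0' cm hv]]]|[lam [vl neg]]].
  by split=> // _; exact: (feasible_sound m0' cm hv).
split=> // -[sigma hs]; move: neg; rewrite ltNge; case/negP.
exact: feasible_complete hs vl.
Qed.

End decoding.

(** * Reading an instance back from its code *)

Definition offset n (f : 'I_n -> seq nat) (i : nat) : nat := sumn (take i [seq size (f j) | j <- enum 'I_n]).

Lemma nth_table n (f : 'I_n -> seq nat) (r : seq nat) (i : 'I_n) k : k < size (f i) ->
  nth 0 (table f ++ r) (offset f i + k) = nth 0 (f i) k.
Proof.
move=> hk; pose ss := [seq f j | j <- enum 'I_n].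
have sh : shape ss = [seq size (f j) | j <- enum 'I_n] by rewrite /shape -map_comp.
have si : nth [::] ss i = f i by rewrite (nth_map i) ?size_enum_ord // nth_ord_enum.
have hi : k < nth 0 (shape ss) i by rewrite nth_shape si.
have E : offset f i + k = flatten_index (shape ss) i k by rewrite /offset -sh /flatten_index.
rewrite nth_cat E; case: ltnP => [_|].
  by rewrite /table nth_flatten flatten_indexKl // flatten_indexKr // si.
rewrite size_flatten leqNgt => /negP[]; rewrite /flatten_index.
have lti : i < size (shape ss) by rewrite sh size_map size_enum_ord.
rewrite -{2}(cat_take_drop i (shape ss)) sumn_cat ltn_add2l (drop_nth 0) //=.
exact: leq_trans hi (leq_addr _ _).
Qed.

Lemma offset_const n (f : 'I_n -> seq nat) w i : (forall j, size (f j) = w) -> i <= n -> offset f i = i * w.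
Proof.
move=> hw hi; rewrite /offset (eq_map (g := fun=> w)) // -map_take.
have : size (take i (enum 'I_n)) = i by rewrite size_take_min size_enum_ord; apply/minn_idPl.
move: (take i _) => s <-; elim: s => //= a s ->; by rewrite mulSn.
Qed.

Lemma size_table_const n (f : 'I_n -> seq nat) w : (forall j, size (f j) = w) -> size (table f) = n * w.
Proof.
move=> hw; rewrite /table size_flatten /shape -map_comp -(offset_const hw (leqnn n)) /offset take_oversize //.
by rewrite size_map size_enum_ord.
Qed.

Lemma nth_table_const n (f : 'I_n -> seq nat) w (r : seq nat) (i : 'I_n) k :
  (forall j, size (f j) = w) -> k < w -> nth 0 (table f ++ r) (i * w + k) = nth 0 (f i) k.
Proof.
by move=> hw kw; rewrite -(offset_const hw (ltnW (ltn_ord i))) nth_table // hw.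
Qed.

Lemma nth_catr (s t : seq nat) a k : size s = a -> nth 0 (s ++ t) (a + k) = nth 0 t k.
Proof. by move=> <-; rewrite nth_cat ltnNge leq_addr /= addKn. Qed.

Lemma offsetS n (f : 'I_n -> seq nat) (i : 'I_n) : offset f i.+1 = offset f i + size (f i).
Proof.
rewrite /offset; set s := [seq _ | _ <- _].
have -> : take i.+1 s = rcons (take i s) (nth 0 s i) by apply: take_nth; rewrite size_map size_enum_ord.
by rewrite -cats1 sumn_cat /= addn0 (nth_map i) ?size_enum_ord // nth_ord_enum.
Qed.

Lemma size_table n (f : 'I_n -> seq nat) : size (table f) = offset f n.
Proof.
by rewrite /table size_flatten /shape -map_comp /offset take_oversize // size_map size_enum_ord.
Qed.

Section reading.
Variables (I : instance) (P1 P2 : nat).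
Let x : inp := (instance_code I, (P1, P2)).
Local Notation n := (nS I).+1.
Local Notation m := (nA I).+1.
Local Notation c := (nconj I).
Local Notation ms_ := (nsummand I).

Lemma read_nn : nn x = n. Proof. by []. Qed.
Lemma read_na : na x = m. Proof. by []. Qed.
Lemma read_nc : nc x = c. Proof. by []. Qed.
Lemma read_ms : ms x = ms_. Proof. by []. Qed.
Lemma read_nk : nk x = nsched I. Proof. by []. Qed.

Let T1 := table (fun s => table (fun a => table (fun s' => rat_code (trans (model I) s a s')))).
Let T2 := table (fun j => cmp_code (op I j)).
Let T3 := table (fun j => rat_code (bnd I j)).
Let T4 := table (fun i => table (fun j => rat_code (coef I i j))).
Let T5 := table (fun i => table (fun j => [:: init_state I i j : nat])).
Let T6 := table (fun i => table (fun j => [:: sched_idx I i j : nat])).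
Let T7 := table (fun i => table (fun j => set_code (target I i j))).

Let sz1 : size T1 = 3 * (n * m * n).
Proof.
rewrite (size_table_const (w := m * (n * 3))) => [|s]; first by rewrite mulnA mulnA mulnC.
rewrite (size_table_const (w := n * 3)) // => a; exact: size_table_const.
Qed.
Let sz3 : size T3 = 3 * c.
Proof. by rewrite (size_table_const (w := 3)) // mulnC. Qed.
Let sz4 : size T4 = 3 * (ms_ * c).
Proof.
rewrite (size_table_const (w := c * 3)) => [|i]; first by rewrite mulnA mulnC.
exact: size_table_const.
Qed.
Let sz5 : size T5 = ms_ * c.
Proof.
rewrite (size_table_const (w := c * 1)) => [|i]; first by rewrite muln1.
exact: size_table_const.
Qed.
Let sz6 : size T6 = ms_ * c.
Proof.
rewrite (size_table_const (w := c * 1)) => [|i]; first by rewrite muln1.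
exact: size_table_const.
Qed.
Let sz7 : size T7 = ms_ * c * n.
Proof.
rewrite (size_table_const (w := c * (n * 1))) => [|i]; first by rewrite muln1 mulnA.
rewrite (size_table_const (w := n * 1)) // => j; exact: size_table_const.
Qed.

Let rd1 k : rd x (5 + k) = nth 0 (T1 ++ T2 ++ T3 ++ T4 ++ T5 ++ T6 ++ T7) k.
Proof. by []. Qed.

Let rdP (P r : seq nat) k : T1 ++ T2 ++ T3 ++ T4 ++ T5 ++ T6 ++ T7 = P ++ r ->
  rd x (5 + size P + k) = nth 0 r k.
Proof. by move=> E; rewrite -(addnA 5) rd1 E nth_catr. Qed.

Lemma read_trans (s : 'I_n) (a : 'I_m) (s' : 'I_n) k : k < 3 ->
  rd x (5 + 3 * ((s * m + a) * n + s') + k) = nth 0 (rat_code (trans (model I) s a s')) k.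
Proof.
move=> k3; rewrite -(addnA 5) rd1.
have -> : 3 * ((s * m + a) * n + s') + k = s * (m * (n * 3)) + (a * (n * 3) + (s' * 3 + k)) by ring.
have w2 (t : 'I_n) (b : 'I_m) : size (table (fun s' => rat_code (trans (model I) t b s'))) = n * 3.
  exact: size_table_const.
have w1 (t : 'I_n) : size (table (fun a => table (fun s' => rat_code (trans (model I) t a s')))) = m * (n * 3).
  exact: size_table_const.
have l3 : s' * 3 + k < n * 3 by have := ltn_ord s'; lia.
have l2 : a * (n * 3) + (s' * 3 + k) < m * (n * 3) by have := ltn_ord a; nia.
rewrite /T1 (nth_table_const (w := m * (n * 3))) // -[table _ in LHS]cats0 (nth_table_const (w := n * 3)) //.
by rewrite -[table _ in LHS]cats0 nth_table_const.
Qed.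

Let op_off (j : nat) : j <= c -> op_at x j = 5 + size T1 + offset (fun j => cmp_code (op I j)) j.
Proof.
rewrite /op_at sz1; elim: j => [|j IH] jc; first by rewrite /offset take0 addn0.
rewrite iota_rcons foldl_rcons IH ?(ltnW jc) // (offsetS (fun j => cmp_code (op I j)) (Ordinal jc)) addnA.
congr (_ + _).
rewrite -sz1 (rdP (r := T2 ++ T3 ++ T4 ++ T5 ++ T6 ++ T7)) // -[offset _ j]addn0.
rewrite (nth_table (f := fun j => cmp_code (op I j)) _ (i := Ordinal jc)); last by case: (op I _).
by case: (op I _).
Qed.

Lemma read_op (j : 'I_c) k : k < size (cmp_code (op I j)) -> rd x (op_at x j + k) = nth 0 (cmp_code (op I j)) k.
Proof.
move=> hk; rewrite op_off ?(ltnW (ltn_ord j)) // -addnA (rdP (r := T2 ++ T3 ++ T4 ++ T5 ++ T6 ++ T7)) //.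
exact: (nth_table (f := fun j => cmp_code (op I j))).
Qed.

Let bndE : bnd_at x = 5 + size (T1 ++ T2).
Proof. by rewrite /bnd_at read_nc op_off // -size_table size_cat addnA. Qed.
Let coefE : coef_at x = 5 + size (T1 ++ T2 ++ T3).
Proof. by rewrite /coef_at bndE read_nc -sz3 !size_cat !addnA. Qed.
Let iniE : ini_at x = 5 + size (T1 ++ T2 ++ T3 ++ T4).
Proof. by rewrite /ini_at coefE read_nc read_ms -sz4 !size_cat !addnA. Qed.
Let idxE : idx_at x = 5 + size (T1 ++ T2 ++ T3 ++ T4 ++ T5).
Proof. by rewrite /idx_at iniE read_nc read_ms -sz5 !size_cat !addnA. Qed.
Let tgtE : tgt_at x = 5 + size (T1 ++ T2 ++ T3 ++ T4 ++ T5 ++ T6).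
Proof. by rewrite /tgt_at idxE read_nc read_ms -sz6 !size_cat !addnA. Qed.

Lemma read_bnd (j : 'I_c) k : k < 3 -> rd x (bnd_at x + 3 * j + k) = nth 0 (rat_code (bnd I j)) k.
Proof.
move=> k3; rewrite -addnA bndE (rdP (r := T3 ++ T4 ++ T5 ++ T6 ++ T7)); last by rewrite -?catA.
rewrite mulnC /T3.
exact: nth_table_const.
Qed.

Lemma read_coef (i : 'I_ms_) (j : 'I_c) k : k < 3 ->
  rd x (coef_at x + 3 * (i * c + j) + k) = nth 0 (rat_code (coef I i j)) k.
Proof.
move=> k3; rewrite -addnA coefE (rdP (r := T4 ++ T5 ++ T6 ++ T7)); last by rewrite -?catA.
rewrite /T4.
have -> : 3 * (i * c + j) + k = i * (c * 3) + (j * 3 + k) by ring.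
rewrite (nth_table_const (w := c * 3)) => [|i'|]; last by have := ltn_ord j; lia.
  by rewrite -[table _ in LHS]cats0 nth_table_const.
exact: size_table_const.
Qed.

Let index1 (i : 'I_ms_) (j : 'I_c) : i * c + j = i * (c * 1) + (j * 1 + 0).
Proof. by rewrite !muln1 addn0. Qed.

Lemma read_ini (i : 'I_ms_) (j : 'I_c) : rd x (ini_at x + (i * c + j)) = init_state I i j.
Proof.
rewrite iniE (rdP (r := T5 ++ T6 ++ T7)); last by rewrite -?catA.
rewrite index1 /T5.
rewrite (nth_table_const (w := c * 1)) => [|i'|]; last by rewrite addn0 !muln1.
  by rewrite -[table _ in LHS]cats0 nth_table_const.
exact: size_table_const.
Qed.

Lemma read_idx (i : 'I_ms_) (j : 'I_c) : rd x (idx_at x + (i * c + j)) = sched_idx I i j.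
Proof.
rewrite idxE (rdP (r := T6 ++ T7)); last by rewrite -?catA.
rewrite index1 /T6.
rewrite (nth_table_const (w := c * 1)) => [|i'|]; last by rewrite addn0 !muln1.
  by rewrite -[table _ in LHS]cats0 nth_table_const.
exact: size_table_const.
Qed.

Lemma read_tgt (i : 'I_ms_) (j : 'I_c) (s : 'I_n) :
  rd x (tgt_at x + ((i * c + j) * n + s)) = (s \in target I i j).
Proof.
rewrite tgtE (rdP (r := T7)); last by rewrite -?catA.
have -> : (i * c + j) * n + s = i * (c * (n * 1)) + (j * (n * 1) + (s * 1 + 0)) by ring.
have w2 (u : 'I_ms_) (v : 'I_c) : size (set_code (target I u v)) = n * 1 by exact: size_table_const.
have w1 (u : 'I_ms_) : size (table (fun j => set_code (target I u j))) = c * (n * 1) by exact: size_table_const.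
have l3 : s * 1 + 0 < n * 1 by have := ltn_ord s; lia.
have l2 : j * (n * 1) + (s * 1 + 0) < c * (n * 1) by have := ltn_ord j; nia.
rewrite -[T7]cats0 /T7 (nth_table_const (w := c * (n * 1))) // -[table _ in LHS]cats0 (nth_table_const (w := n * 1)) //.
by rewrite -[set_code _]cats0 nth_table_const.
Qed.

Lemma read_end : end_at x = size (instance_code I).
Proof.
by rewrite /end_at tgtE read_ms read_nc read_nn -sz7 -addnA -size_cat -!catA -/([:: nS I; nA I; c; ms_; nsched I]).
Qed.

End reading.

(** The product of all nonzero numbers of the code is a crude common denominator, but it is at most
    exponential in the length of the encoding. *)
Definition nzprod (l : seq nat) : nat := \prod_(v <- l) maxn v 1.

Lemma nzprod_gt0 l : 0 < nzprod l.
Proof. by rewrite prodn_gt0 // => v; rewrite leq_max orbT. Qed.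

Lemma dvdn_nzprod l v : v \in l -> v != 0 -> v %| nzprod l.
Proof.
move=> vl v0; rewrite /nzprod (perm_big _ (perm_to_rem vl)) big_cons dvdn_mulr //.
by rewrite (maxn_idPl _) // lt0n.
Qed.

Lemma dnE (x : inp) : nzprod x.1 <= pad1 x -> dn x = nzprod x.1.
Proof.
rewrite /dn /nzprod; elim/last_ind: x.1 => [|l v IH]; first by rewrite big_nil.
rewrite foldl_rcons big_rcons /= => h; rewrite IH; last first.
  by apply: leq_trans h; rewrite leq_pmulr // leq_max orbT.
case: v h => [|v] h; first by rewrite muln1.
by rewrite (minn_idPl h) maxnC.
Qed.

Lemma tpow_pow (x : inp) s : 2 ^ s <= pad1 x -> tpow x s = 2 ^ s.
Proof.
rewrite /tpow; elim: s => [|s IH] sn //.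
rewrite iota_rcons foldl_rcons IH; last by apply: leq_trans sn; rewrite leq_exp2l.
by rewrite addnn -mul2n -expnS; apply/minn_idPl.
Qed.

Lemma ratr_code (R : realType) (r : rat) :
  (ratr r = (-1) ^+ (r < 0)%R * (`|numq r|%N)%:R / (`|denq r|%N)%:R :> R)%R.
Proof.
have d : ((denq r)%:~R = (`|denq r|%N)%:R :> R)%R by rewrite -{1}(gtz0_abs (denq_gt0 r)) -pmulrn.
have nu : ((numq r)%:~R = (-1) ^+ (r < 0)%R * (`|numq r|%N)%:R :> R)%R.
  by rewrite {1}[numq r]intEsign numq_lt0 rmorphM rmorphXn rmorphN1 /= -pmulrn.
by rewrite /ratr d nu.
Qed.

Lemma ratzE (R : realType) (x : inp) o (r : rat) : dn x = nzprod x.1 ->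
  (forall k, k < 3 -> rd x (o + k) = nth 0 (rat_code r) k) ->
  ((zval (ratz x o))%:~R = (dn x)%:R * ratr r :> R)%R.
Proof.
move=> dE h; have := h 0 isT; have := h 1 isT; have := h 2 isT; rewrite /= addn0 addn1 addn2 => h2 h1 h0.
have d0 : `|denq r|%N != 0 by rewrite -lt0n absz_gt0 denq_neq0.
have dv : `|denq r|%N %| dn x.
  rewrite dE -h2; apply: dvdn_nzprod; last by rewrite h2.
  rewrite /rd; case: (ltnP o.+2 (size x.1)) => [/(mem_nth 0)//|/(nth_default 0) e].
  by move: d0; rewrite -h2 /rd e.
have E : ((ratn x o)%:R = (dn x)%:R * ((`|numq r|%N)%:R / (`|denq r|%N)%:R) :> R)%R.
  rewrite /ratn h1 h2 natrM; have -> : ((dn x)%:R = (dn x %/ `|denq r|%N)%:R * (`|denq r|%N)%:R :> R)%R.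
    by rewrite -natrM divnK.
  by field; rewrite pnatr_eq0.
rewrite ratr_code /ratz h0 -mulrA.
case: (r < 0)%R; rewrite /= ?zval_opp zval_nat ?rmorphN /= -pmulrn E ?expr1 ?expr0; ring.
Qed.

(** * Conjuncts and rows *)

Section rows_of_instance.
Context (R : realType) (I : instance) (P1 P2 : nat).
Let x : inp := (instance_code I, (P1, P2)).
Hypothesis dE : dn x = nzprod (instance_code I).
Local Notation c := (nconj I).
Local Notation D := ((dn x)%:R%R : R).
Variable b : nat.
Variable sigma : 'I_(nsched I) -> scheduler R (model I).

Let D0 : (0 < D)%R. Proof. by rewrite ltr0n dE nzprod_gt0. Qed.

Definition lhs (j : 'I_c) : R := (\sum_(i < nsummand I) ratr (coef I i j) *
  Pr_reach (sigma (sched_idx I i j)) (init_state I i j) (target I i j))%R.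

Let sg (g : nat) : R := if g == 0 then 0%R else if g == 1 then 1%R else (-1)%R.

Let signedE g z : ((zval (signed g z))%:~R = sg g * (zval z)%:~R :> R)%R.
Proof.
rewrite /signed /sg; case: (g == 0); first by rewrite mul0r.
by case: (g == 1); rewrite ?mul1r // zval_opp rmorphN mulN1r.
Qed.

Definition row_holds (i : 'I_(2 * c)) : Prop :=
  if row_strict x i then ((thz x b i)%:~R < row_val (init_state I) (sched_idx I) (target I) (@row_conj c) (cfz x b) sigma i :> R)%R
  else ((thz x b i)%:~R <= row_val (init_state I) (sched_idx I) (target I) (@row_conj c) (cfz x b) sigma i :> R)%R.

Let valE (i : 'I_(2 * c)) : row_val (init_state I) (sched_idx I) (target I) (@row_conj c) (cfz x b) sigma i =
  (sg (row_sign x b i) * (D * lhs (row_conj i)))%R.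
Proof.
rewrite /row_val /lhs !mulr_sumr; apply: eq_bigr => m _.
rewrite /cfz /row_coef signedE (ratzE R (r := coef I m (row_conj i)) dE); last first.
  by move=> k k3; exact: (@read_coef I P1 P2 m (row_conj i)).
by rewrite !mulrA.
Qed.

Let eps_val (cc : cmp_op) : rat := match cc with CmpApprox e => sval e | CmpNotApprox e => sval e | _ => 0%R end.

Let thrE (i : 'I_(2 * c)) : ((thz x b i)%:~R = sg (row_sign x b i) * (D * ratr (bnd I (row_conj i))) +
  sg (eps_sign x i) * (D * ratr (eps_val (op I (row_conj i)))) :> R)%R.
Proof.
rewrite /thz /row_thr zval_add rmorphD /= !signedE; congr (_ + _)%R.
  by rewrite (ratzE R (r := bnd I (row_conj i)) dE) // => k k3; exact: (@read_bnd I P1 P2 (row_conj i)).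
have ro := @read_op I P1 P2 (row_conj i).
have c0 : opc x (i %/ 2) = nth 0 (cmp_code (op I (row_conj i))) 0.
  by rewrite /opc -[op_at _ _]addn0; apply: ro; case: (op I _).
rewrite /eps_sign c0; move: ro; case: (op I (row_conj i)) => [||e|e] ro; rewrite ?[nth 0 _ 0]/= /=.
- by rewrite /sg /= !mul0r.
- by rewrite /sg /= !mul0r.
- congr (_ * _)%R; apply: (ratzE R (r := sval e) dE) => k k3.
  by rewrite -addn1 -addnA add1n (ro k.+1).
- congr (_ * _)%R; apply: (ratzE R (r := sval e) dE) => k k3.
  by rewrite -addn1 -addnA add1n (ro k.+1).
Qed.

Lemma row_holdsE (i : 'I_(2 * c)) : let j := row_conj i in let q := ratr (bnd I j) : R in
  row_holds i <-> match op I j with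
  | CmpGt => i %% 2 = 0 -> (q < lhs j)%R
  | CmpGe => i %% 2 = 0 -> (q <= lhs j)%R
  | CmpApprox e => if i %% 2 == 0 then (q - ratr (sval e) <= lhs j)%R else (lhs j <= q + ratr (sval e))%R
  | CmpNotApprox e => i %% 2 = 0 -> if bit x b j then (q + ratr (sval e) < lhs j)%R else (lhs j < q - ratr (sval e))%R
  end.
Proof.
move=> j q; rewrite /row_holds valE thrE /row_strict /row_sign /eps_sign.
have c0 : opc x (i %/ 2) = nth 0 (cmp_code (op I j)) 0.
  by rewrite /opc -[op_at _ _]addn0; apply: (@read_op I P1 P2 j); case: (op I _).
rewrite c0 -/j -[(i %/ 2)]/(nat_of_ord j) -/q; have [h|h] : i %% 2 = 0 \/ i %% 2 = 1.
- by have := ltn_pmod i (isT : 0 < 2); case: (i %% 2) => [|[|//]]; [left|right].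
- rewrite h; case: (op I j) => [||e|e]; rewrite /= /sg /= ?mul1r ?mul0r ?addr0 ?mulN1r.
  + by rewrite ltr_pM2l //; split=> // ->.
  + by rewrite ler_pM2l //; split=> // ->.
  + by rewrite -mulrBr ler_pM2l.
  + case: (bit x b j); rewrite /= ?mul1r ?mulN1r.
      by rewrite -mulrDr ltr_pM2l //; split=> // ->.
    rewrite -mulrN -[X in (_ < X)%R]mulrN -mulrDr ltr_pM2l //.
    by split=> [hh _|/(_ erefl)]; [move: hh|]; move: q (lhs j) (ratr _ : R) => u v w; lra.
- rewrite h; case: (op I j) => [||e|e]; rewrite /= /sg /= ?mul1r ?mul0r ?addr0 ?mulN1r ?lexx //.
  have -> : (- (D * q) - D * ratr (sval e) = D * (- q - ratr (sval e)))%R by ring.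
  rewrite -[X in (_ <= X)%R]mulrN ler_pM2l //.
  by split; move: q (lhs j) (ratr _ : R) => u v w; lra.
Qed.

End rows_of_instance.

Section decide_instance.
Context (R : realType) (I : instance) (P1 P2 : nat).
Let x : inp := (instance_code I, (P1, P2)).
Hypothesis dE : dn x = nzprod (instance_code I).
Local Notation c := (nconj I).
Hypothesis cP : 2 ^ c <= P1.

Let even_row (j : 'I_c) : 2 * j < 2 * c. Proof. by rewrite ltn_mul2l ltn_ord. Qed.
Let odd_row (j : 'I_c) : 2 * j + 1 < 2 * c. Proof. by have := ltn_ord j; lia. Qed.

Lemma solvable_rows : solvable R I <-> exists2 b, b < 2 ^ c &
  exists sigma : 'I_(nsched I) -> scheduler R (model I), forall i, row_holds P1 P2 b sigma i.
Proof.
have jE (j : 'I_c) : row_conj (Ordinal (even_row j)) = j by apply: val_inj; rewrite /= mulKn.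
have jO (j : 'I_c) : row_conj (Ordinal (odd_row j)) = j by apply: val_inj; rewrite /= mulnC divnMDl // addn0.
split=> [[sigma hs]|[b _ [sigma hs]]]; last first.
  exists sigma => j; rewrite -/(lhs sigma j).
  have := (row_holdsE dE b sigma (Ordinal (even_row j))).1 (hs _).
  have := (row_holdsE dE b sigma (Ordinal (odd_row j))).1 (hs _).
  rewrite jE jO; have -> : Ordinal (even_row j) %% 2 = 0 by rewrite /= mulnC modnMl.
  have -> : Ordinal (odd_row j) %% 2 = 1 by rewrite /= mulnC modnMDl.
  case: (op I j) => [||e|e] /= h1 h2; rewrite ?h2 //.
    by rewrite ler_distl addrC -lerBlDr; apply/andP; split; [move: h2|move: h1]; move: (lhs sigma j) (ratr _ : R) (ratr _ : R) => u v w; lra.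
  move: (h2 erefl) => {h1 h2}; case: (bit x b j) => h; rewrite ltr_normr; apply/orP; [left|right];
    by move: h; move: (lhs sigma j) (ratr _ : R) (ratr _ : R) => u v w; lra.
(* The sign pattern is read off the given schedulers: bit [j] tells whether the left side of
   conjunct [j] exceeds its bound. *)
pose beta (j : nat) : bool := if @insub _ _ 'I_c j is Some j' then (ratr (bnd I j') < lhs sigma j')%R else false.
exists (bval [seq beta j | j <- iota 0 c]).
  by have := bval_lt [seq beta j | j <- iota 0 c]; rewrite size_map size_iota.
exists sigma => i; apply/(row_holdsE dE).
have bE : bit x (bval [seq beta j | j <- iota 0 c]) (row_conj i) = (ratr (bnd I (row_conj i)) < lhs sigma (row_conj i))%R.
  rewrite /bit tpow_pow; last by apply: leq_trans cP; rewrite leq_exp2l // ltnW.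
  rewrite (eqP (bval_bit _ _)) (nth_map 0) ?size_iota // nth_iota // add0n /beta valK.
  by case: (_ < _)%R.
have := hs (row_conj i); rewrite -/(lhs sigma (row_conj i)) bE.
case: (op I (row_conj i)) => [||e|e] //= h.
  move: h; rewrite ler_distl => /andP[h1 h2]; case: (i %% 2 == 0);
    by move: h1 h2; move: (lhs sigma _) (ratr _ : R) (ratr _ : R) => u v w; lra.
move=> _; move: h; rewrite ltr_normr; have e0 : (0 <= ratr (sval e) :> R)%R by rewrite ler0q; exact: (valP e).
case: ifP => hb /orP[] h.
- by move: h; move: (lhs sigma _) (ratr _ : R) (ratr _ : R) => u v w; lra.
- by move: h hb e0; move: (lhs sigma _) (ratr _ : R) (ratr _ : R) => u v w; lra.
- by move/negbT: hb; move: h e0; move: (lhs sigma _) (ratr _ : R) (ratr _ : R) => u v w; lra.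
- by move: h; move: (lhs sigma _) (ratr _ : R) (ratr _ : R) => u v w; lra.
Qed.

Lemma read_tw (s : 'I_(nS I).+1) (a : 'I_(nA I).+1) (s' : 'I_(nS I).+1) :
  ((tw x s a s')%:R = (dn x)%:R * ratr (trans (model I) s a s') :> R)%R.
Proof.
have rt k : k < 3 -> rd x (5 + 3 * ((s * na x + a) * nn x + s') + k) = nth 0 (rat_code (trans (model I) s a s')) k.
  exact: (@read_trans I P1 P2 s a s').
have /andP[h _] := trans_itv (model I) s a s'.
rewrite -(ratzE R (r := trans (model I) s a s') dE rt) /ratz.
have -> : rd x (5 + 3 * ((s * na x + a) * nn x + s')) = 0.
  by rewrite -[X in rd x X]addn0 (rt 0 isT) /= ltNge h.
by rewrite zval_nat -pmulrn.
Qed.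

End decide_instance.

(** * Sizes of the pads *)

Lemma le2_mul a b p q : a <= 2 ^ p -> b <= 2 ^ q -> a * b <= 2 ^ (p + q).
Proof. by move=> h1 h2; rewrite expnD leq_mul. Qed.

Lemma le2_add a b p : a <= 2 ^ p -> b <= 2 ^ p -> a + b <= 2 ^ p.+1.
Proof. by move=> h1 h2; rewrite expnS mul2n -addnn leq_add. Qed.

Lemma le2_weak a p q : a <= 2 ^ p -> p <= q -> a <= 2 ^ q.
Proof. by move=> h pq; apply: leq_trans h _; rewrite leq_exp2l. Qed.

Lemma le2_pow a p k : a <= 2 ^ p -> a ^ k <= 2 ^ (p * k).
Proof. by move=> h; rewrite expnM; exact: leq_exp_mono. Qed.

Lemma le2_self a : a <= 2 ^ a. Proof. exact: ltnW (ltn_expl a (ltnSn 1)). Qed.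

Lemma pad_arith1 Y : 7 <= Y -> 7 * Y + 5 <= 20 * Y. Proof. lia. Qed.

Lemma pad_arith2 Y a : 7 <= Y -> Y <= 2 ^ Y -> a <= 2 ^ (4 + Y + 5 * Y) ->
  (5 * Y).+1 + a.+1 < 2 ^ (7 * Y + 5).
Proof.
move=> Y7 Y2; have -> : 7 * Y + 5 = (4 + Y + 5 * Y) + (Y + 1) by lia.
have : Y <= 2 ^ (4 + Y + 5 * Y) by apply: leq_trans Y2 _; rewrite leq_exp2l //; lia.
by rewrite (expnD 2 (4 + Y + 5 * Y)) (expnD 2 Y 1) expn1; move: (2 ^ (4 + _ + _)) (2 ^ Y) Y2 => d w; nia.
Qed.

Section pad_arithmetic.
Variables (Y E P : nat).
Hypothesis Y7 : 7 <= Y.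
Hypothesis YE : 2 ^ (20 * Y) <= E.
Hypothesis EP : E ^ (Y ^ 3) <= P.

Let Y2 : Y <= 2 ^ Y. Proof. exact: le2_self. Qed.
Let E20 : 20 * Y <= E. Proof. exact: leq_trans (le2_self _) YE. Qed.

Variables (n c k m D t : nat).
Hypothesis nY : n.+2 <= Y.
Hypothesis cY : c.+1 <= Y.
Hypothesis kY : k <= Y.
Hypothesis mY : m <= Y.
Hypothesis DY : D <= 2 ^ Y.
Hypothesis tY : t <= 2 ^ Y.
Let big := D * m * t.
Let rb := 3 * (k * n.+1) * big + 2 * big + 2 * (D * t) + 1.
Let ho := n.+1 * n.+2 * (E * (8 * E)).

Let to2 a : a <= Y -> a <= 2 ^ Y. Proof. by move=> h; exact: leq_trans h Y2. Qed.

Lemma pad_big : big <= 2 ^ (3 * Y).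
Proof. by rewrite (_ : 3 * Y = Y + Y + Y); [do 2?apply: le2_mul => //; exact: to2|lia]. Qed.

Lemma pad_range : rb <= 2 ^ (6 * Y).
Proof.
have h1 : 3 * (k * n.+1) * big <= 2 ^ (2 + (Y + Y) + 3 * Y).
  by apply: le2_mul pad_big; apply: le2_mul => //; apply: le2_mul; apply: to2 => //; lia.
have h2 : 2 * big <= 2 ^ (1 + 3 * Y) by apply: le2_mul pad_big.
have h3 : 2 * (D * t) <= 2 ^ (1 + (Y + Y)) by apply: le2_mul => //; exact: le2_mul.
have H1 : 3 * (k * n.+1) * big <= 2 ^ (5 * Y + 2) by apply: le2_weak h1 _; lia.
have H2 : 2 * big <= 2 ^ (5 * Y + 2) by apply: le2_weak h2 _; lia.
have H3 : 2 * (D * t) <= 2 ^ (5 * Y + 2) by apply: le2_weak h3 _; lia.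
have H4 : 1 <= 2 ^ (5 * Y + 2) by rewrite expn_gt0.
apply: leq_trans (leq_add (leq_add (leq_add H1 H2) H3) H4) _.
apply: (@leq_trans (2 ^ (5 * Y + 4))); last by rewrite leq_exp2l //; lia.
by rewrite !(expnD 2 (5 * Y)); move: (2 ^ (5 * Y)) => w; lia.
Qed.

Let nn2 : n.+1 * n.+2 <= Y * Y. Proof. by apply: leq_mul; lia. Qed.

Lemma pad_rate : D ^ (n.+1 * n.+2) <= 2 ^ (Y ^ 3).
Proof.
apply: le2_weak (le2_pow (n.+1 * n.+2) DY) _.
by rewrite !expnS expn0 muln1 leq_mul2l nn2 orbT.
Qed.

Lemma pad_horizon : D ^ ho <= 2 ^ (8 * Y ^ 3 * E ^ 2).
Proof.
apply: le2_weak (le2_pow ho DY) _.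
have -> : 8 * Y ^ 3 * E ^ 2 = Y * (Y * Y * (E * (8 * E))) by ring.
by rewrite leq_mul2l leq_mul2r nn2 !orbT.
Qed.

Let E2 a : a <= 20 * Y -> 2 ^ a <= E.
Proof. by move=> h; apply: leq_trans YE; rewrite leq_exp2l. Qed.
Let cube : 8 * Y ^ 3 + 6 * Y + 5 <= E.
Proof.
apply: leq_trans (E2 (a := 3 * Y + 4) _); last lia.
have h := leq_exp_mono 3 Y2; rewrite -expnM in h; have := Y2.
have : 2 ^ Y <= 2 ^ (3 * Y) by rewrite leq_exp2l //; lia.
rewrite expnD mulnC in h *; move: h; rewrite (mulnC 3 Y); move: (2 ^ (Y * 3)) (2 ^ Y) (Y ^ 3) => a b d.
have : 7 <= Y by []. lia.
Qed.

Lemma E_pow a : a <= Y ^ 3 -> E ^ a <= P.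
Proof.
move=> h; apply: leq_trans EP; rewrite leq_pexp2l //.
by apply: leq_trans E20; rewrite muln_gt0; apply: leq_trans Y7.
Qed.

Let Y3 : 4 * Y + 8 <= Y ^ 3.
Proof. by rewrite !expnS expn0 muln1; have := Y7; move: Y => y; nia. Qed.

(** The demanding condition on [P]: the bit length of the oracle's answers, dominated by the power
    of the denominator over the horizon, times [2 ^ (2 * Y)] for the repeated squaring in the
    eliminations. *)
Let exps : (8 * Y ^ 3 * E ^ 2 + (2 * E + (6 * Y + 4))) * 2 ^ (2 * Y) <= P.
Proof.
apply: leq_trans (E_pow (a := 4) _); last by have := Y3; have := Y7; lia.
rewrite (expnD E 3 1) expn1; apply: leq_mul; last by apply: E2; lia.
have E1 : 1 <= E by apply: leq_trans cube; lia.
have h : (8 * Y ^ 3 + 6 * Y + 5) * E ^ 2 <= E ^ 3 by rewrite (expnS E 2) leq_mul2r cube orbT.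
apply: leq_trans h; rewrite (expnS E 1) expn1; move: (Y ^ 3) => y3; have := Y7; nia.
Qed.

Lemma pad_big_bits : D ^ ho * (2 * big).+2 <= 2 ^ P.
Proof.
have h2 : (2 * big).+2 <= 2 ^ (3 * Y + 2).
  rewrite expnD; have := pad_big; have : 1 <= 2 ^ (3 * Y) by rewrite expn_gt0.
  by move: (2 ^ _) big => a b'; lia.
apply: le2_weak (le2_mul pad_horizon h2) _; apply: leq_trans exps.
apply: leq_trans (leq_pmulr _ _); last by rewrite expn_gt0.
by move: (8 * _ * _) => a; lia.
Qed.

Let inner : 2 ^ (2 * E).+1 * rb + 2 ^ E.+1 <= 2 ^ (2 * E + 6 * Y + 2).
Proof.
have h1 : 2 ^ (2 * E).+1 * rb <= 2 ^ (2 * E + 6 * Y + 1).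
  by apply: le2_weak (le2_mul (leqnn _) pad_range) _; lia.
have h2 : 2 ^ E.+1 <= 2 ^ (2 * E + 6 * Y + 1) by rewrite leq_exp2l //; lia.
by apply: le2_weak (le2_add h1 h2) _; lia.
Qed.

Lemma pad_end : 2 * c * (2 ^ (2 * E).+1 * rb + 2 ^ E.+1) <= 2 ^ (8 * E).
Proof.
have h1 : 2 * c <= 2 ^ (1 + Y) by apply: le2_mul => //; apply: to2; lia.
by apply: le2_weak (le2_mul h1 inner) _; have := E20; have := Y7; lia.
Qed.

Lemma pad_cut : (2 * (D ^ ho * (2 ^ (2 * E).+1 * rb + 2 ^ E.+1))) ^ (2 ^ (2 * c)) <= 2 ^ P.
Proof.
have h1 : 2 * (D ^ ho * (2 ^ (2 * E).+1 * rb + 2 ^ E.+1)) <= 2 ^ (1 + (8 * Y ^ 3 * E ^ 2 + (2 * E + 6 * Y + 2))).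
  by apply: le2_mul => //; exact: le2_mul pad_horizon inner.
apply: le2_weak (le2_pow _ h1) _; apply: leq_trans exps; apply: leq_mul; last by rewrite leq_exp2l //; lia.
by move: (8 * _ * _) => a; lia.
Qed.

Lemma pad_trim : 8 * E < P.
Proof.
apply: leq_trans (E_pow (a := 2) _); last by have := Y3; have := Y7; lia.
by rewrite expnS expn1; have := cube; have := Y7; nia.
Qed.

Lemma pad_steps : (8 * E + 2) ^ (2 * c).+1 <= P.
Proof.
have h : 8 * E + 2 <= E ^ 2.
  by rewrite expnS expn1; have := cube; have := Y7; nia.
apply: leq_trans (leq_exp_mono _ h) _; rewrite -expnM; apply: E_pow.
by apply: leq_trans Y3; lia.
Qed.

Lemma pad_limit : k * n.+1 * (2 * c) * (2 * big) * 2 ^ (2 * E).+1 < 2 ^ (8 * E).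
Proof.
have h : k * n.+1 * (2 * c) * (2 * big) * 2 ^ (2 * E).+1 <= 2 ^ (Y + Y + (1 + Y) + (1 + 3 * Y) + (2 * E).+1).
  apply: le2_mul => //; apply: le2_mul; last exact: le2_mul pad_big.
  by apply: le2_mul; apply: le2_mul => //; apply: to2; lia.
by apply: leq_ltn_trans h _; rewrite ltn_exp2l //; have := E20; have := Y7; lia.
Qed.

(** The program has exponentially many rows, so its Cramer bound is doubly exponential in [Y]; it
    has to fit below [2 ^ E], which is what forces [E] itself to be exponential. *)
Lemma pad_gap kk : kk <= k * n.+1 * (n.+1 * 2 ^ n.+1) + 2 * c + 1 ->
  kk.+1 * (kk`! * (rb + 2 * D) ^ kk).+1 < 2 ^ E.
Proof.
move=> hk; have k1 : kk <= 2 ^ (5 * Y).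
  have h1 : k * n.+1 * (n.+1 * 2 ^ n.+1) <= 2 ^ (Y + Y + (Y + Y)).
    apply: le2_mul; apply: le2_mul; try (by apply: to2 => //; lia).
    by rewrite leq_exp2l //; lia.
  have h2 : 2 * c + 1 <= 2 ^ (Y + Y + (Y + Y)).
    apply: (@leq_trans (2 ^ (1 + Y))); last by rewrite leq_exp2l //; lia.
    by rewrite expnD; have := Y2; have := cY; move: (2 ^ Y) => w; lia.
  by apply: leq_trans hk _; rewrite -addnA; apply: le2_weak (le2_add h1 h2) _; have := Y7; lia.
have B1 : rb + 2 * D <= 2 ^ (7 * Y).
  have h2 : 2 * D <= 2 ^ (6 * Y) by apply: le2_weak (le2_mul (leqnn (2 ^ 1)) DY) _; have := Y7; lia.
  by apply: le2_weak (le2_add pad_range h2) _; have := Y7; lia.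
have f1 : kk`! <= 2 ^ (5 * Y * kk).
  apply: leq_trans (le2_pow kk k1); elim: (kk) => // j IH; rewrite factS expnS.
  by apply: leq_mul => //; apply: leq_trans IH (leq_exp_mono _ (leqnSn j)).
have g1 : (kk`! * (rb + 2 * D) ^ kk).+1 <= 2 ^ (12 * Y * kk).+1.
  have : kk`! * (rb + 2 * D) ^ kk <= 2 ^ (12 * Y * kk).
    by apply: le2_weak (le2_mul f1 (le2_pow kk B1)) _; lia.
  by move=> h; apply: leq_ltn_trans h _; rewrite expnS ltn_Pmull // expn_gt0.
have k2 : kk.+1 <= 2 ^ (5 * Y).+1.
  by apply: leq_ltn_trans k1 _; rewrite expnS ltn_Pmull // expn_gt0.
apply: leq_ltn_trans (leq_mul k2 g1) _; rewrite -expnD ltn_exp2l //.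
have e1 : 12 * Y * kk <= 2 ^ (4 + Y + 5 * Y) by apply: le2_mul => //; apply: le2_mul.
apply: leq_trans (E2 (a := 7 * Y + 5) _); last exact: pad_arith1.
exact: (pad_arith2 Y7 Y2 e1).
Qed.

End pad_arithmetic.

(** * Pads for a concrete instance *)

Lemma size_encode_nat v : size (encode_nat v) = (2 * size (bits v)).+1.
Proof.
rewrite /encode_nat size_rcons; congr _.+1.
by elim: (bits v) => //= b s ->; rewrite mulnS.
Qed.

Lemma lt_bits v : v < 2 ^ size (bits v).
Proof. by rewrite -{1}(bval_bits v) bval_lt. Qed.

Local Notation bits_of l := (flatten [seq encode_nat v | v <- l]).

Lemma size_code_ge l : size l <= size (bits_of l).
Proof. by elim: l => //= v l IH; rewrite size_cat size_encode_nat; lia. Qed.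

Lemma nzprod_code l : nzprod l <= 2 ^ size (bits_of l).
Proof.
rewrite /nzprod; elim: l => [|v l IH]; first by rewrite big_nil expn_gt0.
rewrite big_cons /= size_cat expnD; apply: leq_mul => //; rewrite geq_max expn_gt0 andbT.
apply: ltnW; apply: leq_trans (lt_bits v) _; rewrite leq_exp2l // size_encode_nat; lia.
Qed.

Lemma sumn_code l : sumn l < 2 ^ size (bits_of l).
Proof.
elim: l => [|v l IH]; first by rewrite expn_gt0.
rewrite /= size_cat expnD; have h : v.+1 <= 2 ^ size (encode_nat v).
  by apply: leq_trans (lt_bits v) _; rewrite leq_exp2l // size_encode_nat; lia.
by have := leq_mul h IH; move: (2 ^ _) (2 ^ _) (sumn l) => a b s; lia.
Qed.

Lemma op_at_ge (x : inp) j : 5 + 3 * (nn x * na x * nn x) <= op_at x j.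
Proof.
rewrite /op_at; elim: j => [|j IH] //; rewrite iota_rcons foldl_rcons; exact: leq_trans IH (leq_addr _ _).
Qed.

Lemma tot_sumn (x : inp) : tot x = sumn x.1.
Proof. by rewrite /tot; elim: x.1 => //= v l IH; rewrite size_cat size_nseq IH. Qed.

Section decide_correct.
Context (R : realType) (I : instance).
Local Notation Y := (size (encode I)).+2.
Local Notation E := (2 ^ (Y ^ 6)).
Local Notation P := (2 ^ (Y ^ 9)).
Let x : inp := (instance_code I, (E, P)).
Local Notation n := (nS I).
Local Notation c := (nconj I).

Let sz : end_at x <= size (encode I).
Proof. by rewrite (read_end I E P) size_code_ge. Qed.

Let sz2 : 5 + 3 * (n.+1 * (nA I).+1 * n.+1) + 3 * c + 3 * (nsummand I * c) <= size (encode I).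
Proof.
apply: leq_trans sz; rewrite /end_at /tgt_at /idx_at /ini_at /coef_at /bnd_at read_nc read_ms.
by have := op_at_ge x c; rewrite read_nn read_na; lia.
Qed.

Let Y7 : 7 <= Y. Proof. by have := sz2; lia. Qed.
Let nY : n.+2 <= Y. Proof. by have := sz2; nia. Qed.
Let cY : c.+1 <= Y. Proof. by have := sz2; lia. Qed.
Let mcY : nsummand I * c <= Y. Proof. by have := sz2; lia. Qed.
(** With at least one conjunct there is a table entry for every summand; without conjuncts their
    number occurs only in binary and can exceed the length of the code. *)
Let mY : 0 < c -> nsummand I <= Y.
Proof. by move=> c0; apply: leq_trans mcY; rewrite leq_pmulr. Qed.
(** The number of schedulers is written in binary, but every index occurs in the table, so their
    number is bounded by the number of table entries. *)
Let kY : nsched I <= Y.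
Proof.
apply: leq_trans mcY; pose f (p : 'I_(nsummand I) * 'I_c) := sched_idx I p.1 p.2.
have : #|[set: 'I_(nsched I)]%SET| <= #|(f @: [set: 'I_(nsummand I) * 'I_c])%SET|.
  apply: subset_leq_card; apply/fintype.subsetP => k _.
  by have [i [j <-]] := sched_idx_surj k; apply/imsetP; exists (i, j).
move=> h; have := leq_trans h (leq_imset_card _ _).
by rewrite !cardsT card_prod !card_ord.
Qed.
(** The exponents 6 and 9 in the pads are chosen for this inequality and for [E ^ (Y ^ 3) = P]. *)
Let YE : 2 ^ (20 * Y) <= E.
Proof.
rewrite leq_exp2l // expnS mulnC leq_mul2l /=; apply: (@leq_trans (7 ^ 5)) => //.
exact: leq_exp_mono.
Qed.
Let EP : E ^ (Y ^ 3) <= P.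
Proof. by rewrite -expnM -expnD. Qed.
Let YY6 a : a <= Y ^ 3 -> 2 ^ a <= E.
Proof. by move=> h; rewrite leq_exp2l //; apply: leq_trans h _; rewrite leq_exp2l //; apply: leq_trans Y7. Qed.
Let Y_le3 : Y <= Y ^ 3.
Proof. by rewrite -{1}[Y]expn1 leq_exp2l //; apply: leq_trans Y7. Qed.

Let DY : nzprod (instance_code I) <= 2 ^ Y.
Proof. by apply: leq_trans (nzprod_code _) _; rewrite leq_exp2l //; exact: leqW (leqnSn _). Qed.
Let dE : dn x = nzprod (instance_code I).
Proof. by apply: dnE; apply: leq_trans DY _; exact: YY6. Qed.
Let tY : tot x <= 2 ^ Y.
Proof.
rewrite tot_sumn.
by apply: leq_trans (ltnW (sumn_code _)) _; rewrite leq_exp2l //; exact: leqW (leqnSn _).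
Qed.
Let cP : 2 ^ c <= E. Proof. by apply: YY6; apply: leq_trans Y_le3; lia. Qed.

Let row_card : #|lp_row n (nsched I) (2 * c)| <= nsched I * n.+1 * (n.+1 * 2 ^ n.+1) + 2 * c + 1.
Proof.
have cs : #|{set 'I_n.+1}| = 2 ^ n.+1.
  by rewrite -cardsT -powersetT card_powerset cardsT card_ord.
by rewrite /lp_row card_sum card_prod card_prod card_prod card_sum !card_ord card_unit cs addnA.
Qed.

Lemma decide_instance : decide x <-> solvable R I.
Proof.
have [c0|c0] := posnP c.
  have -> : decide x by rewrite /decide read_nc c0.
  split=> // _; have k0 : forall k : 'I_(nsched I), False.
    by move=> k; have [_ [j _]] := sched_idx_surj k; have := ltn_ord j; rewrite {2}c0.
  by exists (fun k => match k0 k with end) => j; have := ltn_ord j; rewrite {2}c0.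
have f b := @found_iff R n (nA I) (model I) (nsched I) (nsummand I) c x (init_state I) (sched_idx I) (target I)
  (read_nn I E P) (read_na I E P) (read_nc I E P) (read_ms I E P) (read_nk I E P)
  (@read_ini I E P) (@read_idx I E P).
have D0 : 0 < dn x by rewrite dE nzprod_gt0.
have DY' : dn x <= 2 ^ Y by rewrite dE.
have m0 := mY c0.
have {}f b : found x b <-> exists sigma : 'I_(nsched I) -> scheduler R (model I), forall i, row_holds E P b sigma i.
  apply: f => //.
  - by move=> m j s; rewrite (@read_tgt I E P); case: (s \in _).
  - by move=> s a s'; exact: read_tw.
  - by apply: YY6; apply: leq_trans Y_le3; apply: leq_trans nY.
  - exact: (pad_big_bits Y7 YE EP nY cY kY m0 DY' tY).
  - exact: (pad_end Y7 YE EP nY cY kY m0 DY' tY).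
  - exact: (pad_cut Y7 YE EP nY cY kY m0 DY' tY).
  - exact: (pad_trim Y7 YE EP nY cY kY m0 DY' tY).
  - exact: (pad_steps Y7 YE EP nY cY kY m0 DY' tY).
  - by apply: leq_trans (pad_rate Y7 YE EP nY cY kY m0 DY' tY) _; exact: YY6.
  - exact: (pad_gap Y7 YE EP nY cY kY m0 DY' tY row_card).
  - exact: (pad_limit Y7 YE EP nY cY kY m0 DY' tY).
rewrite (solvable_rows R dE cP) /decide read_nc (gtn_eqF c0) /= tpow_pow //.
split=> [/hasP[b]|[b bc hb]].
  by rewrite mem_iota add0n => /= bc /f h; exists b.
by apply/hasP; exists b; [rewrite mem_iota|exact/f].
Qed.

End decide_correct.

(** * Recognising codes of instances *)

Section validity.
Variable x : inp.

Definition rd3 (o : nat) : seq nat := [:: rd x o; rd x o.+1; rd x o.+2].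
Definition op_entry (j : nat) : seq nat :=
  if opc x j <= 1 then [:: opc x j] else opc x j :: rd3 (op_at x j).+1.
Definition trans_at (s a s' : nat) : nat := 5 + 3 * ((s * na x + a) * nn x + s').

(** The code is rebuilt from the entries at their expected places. Comparing the result with the
    input checks its length and layout at once. *)
Definition recode : seq nat :=
  [:: rd x 0; rd x 1; rd x 2; rd x 3; rd x 4] ++
  flatten [seq flatten [seq flatten [seq rd3 (trans_at s a s') | s' <- iota 0 (nn x)]
    | a <- iota 0 (na x)] | s <- iota 0 (nn x)] ++
  flatten [seq op_entry j | j <- iota 0 (nc x)] ++
  flatten [seq rd3 (bnd_at x + 3 * j) | j <- iota 0 (nc x)] ++
  flatten [seq flatten [seq rd3 (coef_at x + 3 * (i * nc x + j)) | j <- iota 0 (nc x)] | i <- iota 0 (ms x)] ++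
  flatten [seq flatten [seq [:: rd x (ini_at x + (i * nc x + j))] | j <- iota 0 (nc x)] | i <- iota 0 (ms x)] ++
  flatten [seq flatten [seq [:: rd x (idx_at x + (i * nc x + j))] | j <- iota 0 (nc x)] | i <- iota 0 (ms x)] ++
  flatten [seq flatten [seq flatten [seq [:: rd x (tgt_at x + ((i * nc x + j) * nn x + s))]
    | s <- iota 0 (nn x)] | j <- iota 0 (nc x)] | i <- iota 0 (ms x)].

Definition coprime_check (a d : nat) : bool := all (fun k => ~~ ((k %| a) && (k %| d))) (iota 2 d).
(** Accepts only the reduced triples that [rat_code] produces, including the sign bit 0 for the
    number 0, so that equal codes and equal rationals correspond. *)
Definition rat_ok (o : nat) : bool :=
  [&& rd x o <= 1, 0 < rd x o.+2, coprime_check (rd x o.+1) (rd x o.+2) & (rd x o == 0) || (0 < rd x o.+1)].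
Definition prob_ok (o : nat) : bool := [&& rat_ok o, rd x o == 0 & rd x o.+1 <= rd x o.+2].
Definition weight (s a : nat) : nat := size (flatten [seq nseq (tw x s a s') tt | s' <- iota 0 (nn x)]).
Definition op_ok (j : nat) : bool :=
  (opc x j <= 3) && ((opc x j <= 1) || rat_ok (op_at x j).+1 && (rd x (op_at x j).+1 == 0)).

Definition valid : bool :=
  [&& eqs (fun z => z.1 == z.2) recode x.1,
   all (fun s => all (fun a => all (fun s' => prob_ok (trans_at s a s')) (iota 0 (nn x)) &&
        ((weight s a == 0) || (weight s a == dn x))) (iota 0 (na x)) &&
      has (fun a => weight s a == dn x) (iota 0 (na x))) (iota 0 (nn x)),
   all op_ok (iota 0 (nc x)),
   all (fun j => rat_ok (bnd_at x + 3 * j)) (iota 0 (nc x)),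
   all (fun i => all (fun j => [&& rat_ok (coef_at x + 3 * (i * nc x + j)),
      rd x (ini_at x + (i * nc x + j)) < nn x, rd x (idx_at x + (i * nc x + j)) < nk x &
      all (fun s => rd x (tgt_at x + ((i * nc x + j) * nn x + s)) <= 1) (iota 0 (nn x))])
      (iota 0 (nc x))) (iota 0 (ms x)) &
   all (fun k => has (fun i => has (fun j => rd x (idx_at x + (i * nc x + j)) == k) (iota 0 (nc x)))
      (iota 0 (ms x))) (iota 0 (nk x))].

End validity.

Lemma FP_rat_ok : FP (fun z : inp * nat => rat_ok z.1 z.2).
Proof. by rewrite /rat_ok /coprime_check; fp. Qed.

Ltac fp_valid := match goal with
  | |- FP (fun u => rat_ok (@?x u) (@?s u)) => apply: (FP_comp2 (g := rat_ok) (f1 := x) (f2 := s) FP_rat_ok)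
  | |- FP (fun u => trans_at _ _ _ _) => rewrite /trans_at
  | |- FP (fun u => rd3 _ _) => rewrite /rd3
  end.
Ltac fp_hook ::= first [fp_alg | fp_valid].

Lemma FP_recode : FP recode.
Proof. by rewrite /recode /op_entry; fp. Qed.

Lemma FP_valid : FP valid.
Proof.
rewrite /valid /prob_ok /weight /op_ok; apply: FP_andb; last by fp.
by apply: FP_eqs; [fp|exact: FP_recode|fp].
Qed.

Lemma coprime_checkP a d : 0 < d -> coprime_check a d = coprime a d.
Proof.
move=> d0; apply/idP/idP => [/allP h|co].
  rewrite /coprime eqn_leq gcdn_gt0 d0 orbT andbT leqNgt; apply/negP => g1.
  have := h (gcdn a d); rewrite mem_iota g1 dvdn_gcdl dvdn_gcdr /=; apply/implyP.
  by have := dvdn_leq d0 (dvdn_gcdr a d); lia.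
apply/allP => k; rewrite mem_iota => /andP[k2 _]; apply/negP => /andP[ka kd].
have : k %| gcdn a d by rewrite dvdn_gcd ka.
by rewrite (eqP co) dvdn1 => /eqP k1; rewrite k1 in k2.
Qed.

Section valid_code.
Variable x : inp.

Definition rat_at (o : nat) : rat := ((-1) ^+ rd x o * (rd x o.+1)%:R / (rd x o.+2)%:R)%R.

Lemma rat_at_code o : rat_ok x o -> rat_code (rat_at o) = rd3 x o.
Proof.
move=> /and4P[s1 d0]; rewrite coprime_checkP // => co sg; rewrite /rat_at /rd3.
set a := rd x o.+1 in co sg *; set d := rd x o.+2 in d0 co *.
have E : ((-1) ^+ rd x o * a%:R / d%:R = ((-1) ^+ rd x o * a%:Z)%:~R / (d%:Z)%:~R :> rat)%R.
  by rewrite rmorphM rmorphXn rmorphN1 /= -!pmulrn.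
have ab : `|((-1) ^+ rd x o * a%:Z)%R|%N = a by rewrite abszMsign.
have co' : coprime `|((-1) ^+ rd x o * a%:Z)%R|%N `|Posz d|%N by rewrite ab.
have nE : numq ((-1) ^+ rd x o * a%:R / d%:R)%R = ((-1) ^+ rd x o * a%:Z)%R.
  by rewrite E coprimeq_num // gtr0_sg ?mul1r // ltz_nat.
have qE : denq ((-1) ^+ rd x o * a%:R / d%:R)%R = Posz d.
  by rewrite E coprimeq_den // -[_ == 0%R]/(d == 0) (gtn_eqF d0).
rewrite /rat_code nE qE ab -numq_lt0 nE; congr [:: _; _; _].
move: s1 sg; case: (rd x o) => [|[|//]] _; first by rewrite expr0 mul1r ltz_nat.
by move=> /= a0; rewrite expr1 mulN1r oppr_lt0 ltz_nat a0.
Qed.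

Lemma rat_at_ge0 o : rat_ok x o -> rd x o = 0 -> (0 <= rat_at o)%R.
Proof. by move=> _ h; rewrite /rat_at h expr0 mul1r divr_ge0. Qed.

Hypothesis dE : dn x = nzprod x.1.

Lemma tw_rat_at s a s' : prob_ok x (trans_at x s a s') ->
  ((tw x s a s')%:R = (dn x)%:R * rat_at (trans_at x s a s') :> rat)%R.
Proof.
move=> /and3P[/and4P[_ d0 _ _] /eqP s0 _]; rewrite /tw -/(trans_at x s a s') /ratn /rat_at s0 expr0 mul1r natrM.
set o := trans_at x s a s' in d0 *.
have dv : rd x o.+2 %| dn x.
  rewrite dE; apply: dvdn_nzprod; last by rewrite -lt0n.
  rewrite /rd; case: (ltnP o.+2 (size x.1)) => [/(mem_nth 0)//|/(nth_default 0) e].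
  by move: d0; rewrite /rd e.
have {2}-> : dn x = (dn x %/ rd x o.+2) * rd x o.+2 by rewrite divnK.
by rewrite natrM; field; rewrite pnatr_eq0 -lt0n.
Qed.

Lemma weightE s a : (forall s', s' < nn x -> prob_ok x (trans_at x s a s')) ->
  ((weight x s a)%:R = (dn x)%:R * \sum_(s' < nn x) rat_at (trans_at x s a s') :> rat)%R.
Proof.
move=> h; have -> : weight x s a = \sum_(s' < nn x) tw x s a s'.
  rewrite /weight size_flatten /shape -map_comp sumnE big_map -{1}(subn0 (nn x)) -/(index_iota 0 (nn x)) big_mkord.
  by apply: eq_bigr => i _; rewrite /= size_nseq.
by rewrite natr_sum mulr_sumr; apply: eq_bigr => i _; apply: tw_rat_at; exact: h.
Qed.

Let allord n (p : pred nat) : all p (iota 0 n) -> forall i : 'I_n, p i.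
Proof. by move=> /allP h i; apply: h; rewrite mem_iota ltn_ord. Qed.

Lemma valid_instance : valid x -> exists I : instance, instance_code I = x.1.
Proof.
case/and5P=> hcode htr hop hbnd /andP[hco hsurj].
have {}hcode : recode x = x.1 by apply/eqP; rewrite -(eqsE (e := fun z : nat * nat => z.1 == z.2)).
have D0 : ((dn x)%:R != 0 :> rat)%R by rewrite pnatr_eq0 dE -lt0n nzprod_gt0.
pose tr (s : 'I_(nn x)) (a : 'I_(na x)) (s' : 'I_(nn x)) : rat := rat_at (trans_at x s a s').
have pr (s : 'I_(nn x)) (a : 'I_(na x)) (s' : 'I_(nn x)) : prob_ok x (trans_at x s a s').
  by have /andP[/allord/(_ a)/andP[/allord/(_ s')]] := allord htr s.
have tr01 s a s' : (0 <= tr s a s' <= 1)%R.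
  have /and3P[r1 /eqP r2 r3] := pr s a s'; rewrite /tr rat_at_ge0 //= /rat_at r2 expr0 mul1r.
  by have /and4P[_ d0 _ _] := r1; rewrite ler_pdivrMr ?ltr0n // mul1r ler_nat.
have wE (s : 'I_(nn x)) (a : 'I_(na x)) : ((weight x s a)%:R = (dn x)%:R * \sum_s' tr s a s' :> rat)%R.
  by apply: weightE => s' hs; exact: (pr s a (Ordinal hs)).
have tsum s a : (\sum_s' tr s a s' = 1)%R \/ (\sum_s' tr s a s' = 0)%R.
  have /andP[/allord/(_ a)/andP[_ /orP[/eqP w|/eqP w]] _] := allord htr s; [right|left];
    apply: (mulfI D0); rewrite -wE w ?mulr0 ?mulr1 //.
have ten s : exists a, (\sum_s' tr s a s' = 1)%R.
  have /andP[_ /hasP[a]] := allord htr s; rewrite mem_iota => /= an /eqP w.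
  by exists (Ordinal an); apply: (mulfI D0); rewrite -wE w mulr1.
have /choice[ops opsE] : forall j : 'I_(nc x), exists cc, cmp_code cc = op_entry x j.
  move=> j; have /andP[h3 h] := allord hop j; rewrite /op_entry.
  move: h h3; case E : (opc x j) => [|[|[|[|//]]]] /=; [by exists CmpGt|by exists CmpGe| |].
    move=> /andP[r /eqP s0] _; have e0 := rat_at_ge0 r s0.
    by exists (CmpApprox (exist (fun e : rat => is_true (0 <= e)%R) _ e0)); rewrite /= rat_at_code.
  move=> /andP[r /eqP s0] _; have e0 := rat_at_ge0 r s0.
  by exists (CmpNotApprox (exist (fun e : rat => is_true (0 <= e)%R) _ e0)); rewrite /= rat_at_code.
have hij (i : 'I_(ms x)) (j : 'I_(nc x)) := allord (allord hco i) j.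
have inil (i : 'I_(ms x)) (j : 'I_(nc x)) : rd x (ini_at x + (i * nc x + j)) < nn x by case/and4P: (hij i j).
have idxl (i : 'I_(ms x)) (j : 'I_(nc x)) : rd x (idx_at x + (i * nc x + j)) < nk x by case/and4P: (hij i j).
have surj (k : 'I_(nk x)) : exists i j, Ordinal (idxl i j) = k.
  have /hasP[i] := allord hsurj k; rewrite mem_iota => /= im /hasP[j]; rewrite mem_iota => /= jm /eqP e.
  by exists (Ordinal im), (Ordinal jm); apply: val_inj.
exists (@Instance (rd x 0) (rd x 1) (@MDP (rd x 0) (rd x 1) tr tr01 tsum ten) (nc x) (ms x) (nk x)
  (fun i j => rat_at (coef_at x + 3 * (i * nc x + j))) (fun j => rat_at (bnd_at x + 3 * j))
  (fun i j => Ordinal (inil i j)) (fun i j => Ordinal (idxl i j)) surj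
  (fun i j => [set s : 'I_(nn x) | rd x (tgt_at x + ((i * nc x + j) * nn x + s)) == 1]%SET) ops).
rewrite -hcode /instance_code /recode; congr (_ ++ _ ++ _ ++ _ ++ _ ++ _ ++ _ ++ _).
- rewrite -table_iota; congr table; apply/funext => s; rewrite -table_iota; congr table; apply/funext => a.
  rewrite -table_iota; congr table; apply/funext => s' /=; rewrite /tr rat_at_code //.
  by case/and3P: (pr s a s').
- by rewrite -table_iota; congr table; apply/funext => j; exact: opsE.
- rewrite -table_iota; congr table; apply/funext => j /=; rewrite rat_at_code //.
  exact: (allord hbnd j).
- rewrite -table_iota; congr table; apply/funext => i; rewrite -table_iota; congr table; apply/funext => j /=.
  by rewrite rat_at_code //; case/and4P: (hij i j).
- by rewrite -table_iota; congr table; apply/funext => i; rewrite -table_iota; congr table; apply/funext => j.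
- by rewrite -table_iota; congr table; apply/funext => i; rewrite -table_iota; congr table; apply/funext => j.
rewrite -table_iota; congr table; apply/funext => i; rewrite -table_iota; congr table; apply/funext => j.
rewrite /set_code -table_iota; congr table; apply/funext => s; rewrite finset.inE.
have /and4P[_ _ _ /allord/(_ s)] := hij i j.
by case: (rd x _) => [|[|//]].
Qed.

End valid_code.

Lemma instance_valid (I : instance) P1 P2 : let x := (instance_code I, (P1, P2)) in
  dn x = nzprod x.1 -> valid x.
Proof.
move=> x dE.
have rc o r : (forall k, k < 3 -> rd x (o + k) = nth 0 (rat_code r) k) ->
    rd3 x o = rat_code r /\ rat_ok x o.
  move=> h; have := h 0 isT; have := h 1 isT; have := h 2 isT; rewrite /= addn0 addn1 addn2 => h2 h1 h0.
  rewrite /rd3 /rat_ok h0 h1 h2 leq_b1 absz_gt0 denq_neq0 coprime_checkP ?absz_gt0 ?denq_neq0 //.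
  rewrite coprime_num_den /= numq_eq0; split=> //.
  by case: ltgtP.
have rt s a s' := rc _ _ (@read_trans I P1 P2 s a s').
have rb j := rc _ _ (@read_bnd I P1 P2 j).
have rco i j := rc _ _ (@read_coef I P1 P2 i j).
have ro j := @read_op I P1 P2 j.
have op0 (j : 'I_(nconj I)) : opc x j = nth 0 (cmp_code (op I j)) 0.
  by rewrite /opc -[op_at _ _]addn0; apply: ro; case: (op I _).
have op3 (j : 'I_(nconj I)) e : behead (cmp_code (op I j)) = rat_code e -> 
    rd3 x (op_at x j).+1 = rat_code e /\ rat_ok x (op_at x j).+1.
  move=> he; apply: rc => k k3; rewrite -addn1 -addnA add1n ro -?he ?nth_behead //.
  by rewrite -(ltn_add2r 1) addn1 in k3; move: he; case: (op I j) => //=.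
have allord n (p : pred nat) : (forall i : 'I_n, p i) -> all p (iota 0 n).
  by move=> h; apply/allP => i; rewrite mem_iota add0n => /= ilt; exact: (h (Ordinal ilt)).
have pok (s : 'I_(nS I).+1) (a : 'I_(nA I).+1) (s' : 'I_(nS I).+1) : prob_ok x (trans_at x s a s').
  have [_ r] := rt s a s'; rewrite /prob_ok r /=.
  have := @read_trans I P1 P2 s a s'; have /andP[t0 t1] := trans_itv (model I) s a s'.
  move=> h; have := h 0 isT; have := h 1 isT; have := h 2 isT; rewrite /= addn0 addn1 addn2 => h2 h1 h0.
  rewrite /trans_at read_na read_nn h0 h1 h2 ltNge t0 /= -lez_nat.
  rewrite (gez0_abs (ltW (denq_gt0 _))) gez0_abs ?numq_ge0 //.
  move: t1; rewrite -{1}(divq_num_den (trans (model I) s a s')) ler_pdivrMr ?ltr0z ?denq_gt0 // mul1r.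
  by rewrite ler_int.
have wt (s : 'I_(nS I).+1) (a : 'I_(nA I).+1) : ((weight x s a)%:R = (dn x)%:R * \sum_s' trans (model I) s a s' :> rat)%R.
  rewrite weightE // => [|s' hs]; last exact: (pok s a (Ordinal hs)).
  congr (_ * _)%R; apply: eq_bigr => s' _.
  have [e r] := rt s a s'; have := rat_at_code r; rewrite e => h.
  by have [] := @rat_code_readable _ _ [::] [::] (congr1 (fun z => z ++ [::]) h).
have D0 : ((dn x)%:R != 0 :> rat)%R by rewrite pnatr_eq0 dE -lt0n nzprod_gt0.
apply/and5P; split; [|apply: (allord _ _) => s; apply/andP; split|apply: (allord _ _) => j|apply: (allord _ _) => j|apply/andP; split].
- rewrite (eqsE (e := fun z : nat * nat => z.1 == z.2)) //; apply/eqP; rewrite [RHS]/= /instance_code /recode.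
  congr (_ ++ _ ++ _ ++ _ ++ _ ++ _ ++ _ ++ _).
  + rewrite -table_iota; congr table; apply/funext => s; rewrite -table_iota; congr table; apply/funext => a.
    rewrite -table_iota; congr table; apply/funext => s'; by case: (rt s a s').
  + rewrite -table_iota; congr table; apply/funext => j; rewrite /op_entry op0.
    have := op3 j; case: (op I j) => [||e|e] //= h; by case: (h (sval e) erefl) => ->.
  + by rewrite -table_iota; congr table; apply/funext => j; case: (rb j).
  + rewrite -table_iota; congr table; apply/funext => i; rewrite -table_iota; congr table; apply/funext => j.
    by case: (rco i j).
  + rewrite -table_iota; congr table; apply/funext => i; rewrite -table_iota; congr table; apply/funext => j.
    by congr [:: _]; exact: (@read_ini I P1 P2 i j).
  + rewrite -table_iota; congr table; apply/funext => i; rewrite -table_iota; congr table; apply/funext => j.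
    by congr [:: _]; exact: (@read_idx I P1 P2 i j).
  rewrite -table_iota; congr table; apply/funext => i; rewrite -table_iota; congr table; apply/funext => j.
  rewrite /set_code -table_iota; congr table; apply/funext => s.
  by congr [:: _]; exact: (@read_tgt I P1 P2 i j s).
- apply: (allord _ _) => a; apply/andP; split; first by apply: (allord _ _) => s'; exact: pok.
  have [e|e] := trans_sum (model I) s a; apply/orP; [right|left]; rewrite -(eqr_nat rat) wt e ?mulr1 ?mulr0 //.
- have [a e] := trans_enabled (model I) s; apply/hasP; exists (a : nat); first by rewrite mem_iota ltn_ord.
  by rewrite -(eqr_nat rat) wt e mulr1.
- rewrite /op_ok op0; have := op3 j; have := ro j; case: (op I j) => [||e|e] //= hr h;
    case: (h (sval e) erefl) => h3 ->; rewrite -[(op_at x j).+1]addn1 hr //= eqb0 -leNgt; exact: (valP e).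
- by case: (rb j).
- apply: (allord _ _) => i; apply: (allord _ _) => j; case: (rco i j) => _ r; apply/and4P; split.
  + exact: r.
  + by have e := @read_ini I P1 P2 i j; rewrite [X in X < _]e; exact: ltn_ord.
  + by have e := @read_idx I P1 P2 i j; rewrite [X in X < _]e; exact: ltn_ord.
  by apply: (allord _ _) => s; have e := @read_tgt I P1 P2 i j s; rewrite [X in X <= _]e leq_b1.
apply: (allord _ _) => k; have [i [j e]] := sched_idx_surj k.
apply/hasP; exists (i : nat); first by rewrite mem_iota ltn_ord.
apply/hasP; exists (j : nat); first by rewrite mem_iota ltn_ord.
by have h := @read_idx I P1 P2 i j; rewrite [X in X == _]h e.
Qed.

(** * Padding *)

Definition ebd (A : encType) (f : A -> nat) : Prop := exists k, forall x, f x <= 2 ^ ((esz x + 2) ^ k).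

Definition FE (A B : encType) (f : A -> B) : Prop :=
  (exists2 T, runsF f T & ebd T) /\ ebd (fun x => esz (f x)).

Section exponential_bounds.
Context (A : encType).
Implicit Types f g : A -> nat.

Lemma ebd_le f g : ebd g -> (forall x, f x <= g x) -> ebd f.
Proof. by move=> [k h] le; exists k => x; exact: leq_trans (le x) (h x). Qed.

Lemma ebd_pow2 f : pbd f -> ebd (fun x => 2 ^ f x).
Proof. by move=> [k h]; exists k => x; rewrite leq_exp2l. Qed.

Lemma ebd_pbd f : pbd f -> ebd f.
Proof. by move=> /ebd_pow2 h; apply: ebd_le h _ => x; exact/ltnW/ltn_expl. Qed.

Lemma ebd_mul f g : ebd f -> ebd g -> ebd (fun x => f x * g x).
Proof.
move=> [a ha] [b hb]; apply: (ebd_le (g := fun x => 2 ^ ((esz x + 2) ^ a + (esz x + 2) ^ b))).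
  by apply: ebd_pow2; apply: pbd_add; [exists a|exists b].
by move=> x; rewrite expnD leq_mul.
Qed.

Lemma ebd_add f g : ebd f -> ebd g -> ebd (fun x => f x + g x).
Proof.
move=> [a ha] [b hb].
apply: (ebd_le (g := fun x => 2 * (2 ^ ((esz x + 2) ^ a) * 2 ^ ((esz x + 2) ^ b)))).
  apply: ebd_mul; first exact/ebd_pbd/pbd_const.
  by apply: ebd_mul; apply: ebd_pow2; [exists a|exists b].
move=> x; have := ha x; have := hb x.
have : 0 < 2 ^ ((esz x + 2) ^ a) by rewrite expn_gt0.
have : 0 < 2 ^ ((esz x + 2) ^ b) by rewrite expn_gt0.
move: (2 ^ _) (2 ^ _) (f x) (g x) => p q u v; nia.
Qed.

Lemma ebd_exp f k : ebd f -> ebd (fun x => f x ^ k).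
Proof.
elim: k => [|k IH] h; first exact/ebd_pbd/pbd_const.
by apply: (ebd_le (ebd_mul h (IH h))) => x; rewrite expnS.
Qed.

Lemma pbd_comp_ebd (B : encType) (f : A -> B) (g : B -> nat) :
  ebd (fun x => esz (f x)) -> pbd g -> ebd (fun x => g (f x)).
Proof.
move=> hf [k h]; apply: (ebd_le (g := fun x => (esz (f x) + 2) ^ k)) => [|x]; last exact: h.
by apply: ebd_exp; apply: ebd_add => //; exact/ebd_pbd/pbd_const.
Qed.

End exponential_bounds.

Lemma FE_FP (A B : encType) (f : A -> B) : FP f -> FE f.
Proof. by move=> [[T r bT] bf]; split; [exists T => //|]; exact: ebd_pbd. Qed.

Lemma FE_pair (A B C : encType) (f : A -> B) (g : A -> C) :
  FE f -> FE g -> FE (fun x => (f x, g x)).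
Proof.
move=> [[T1 r1 b1] s1] [[T2 r2 b2] s2]; split.
  eexists; first exact: runsF_pair r1 r2.
  apply: ebd_add; first exact: ebd_add.
  apply: ebd_mul; first exact/ebd_pbd/pbd_const.
  by apply: ebd_add => //; apply: ebd_add => //; exact/ebd_pbd/pbd_esz.
apply: (ebd_le (g := fun x => 1 + (esz (f x) + esz (g x)))) => [|x]; last by rewrite esz_pair.
by apply: ebd_add; [exact/ebd_pbd/pbd_const|exact: ebd_add].
Qed.

(** A polynomial of a single exponential is again a single exponential; two exponential stages in a
    row would not be. *)
Lemma FE_comp (A B C : encType) (f : A -> B) (g : B -> C) :
  FE f -> FP g -> FE (fun x => g (f x)).
Proof.
move=> [[T1 r1 b1] s1] [[T2 r2 b2] s2]; split; last exact: (pbd_comp_ebd s1 s2).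
eexists; first exact: runsF_comp r1 r2.
apply: (ebd_le (g := fun x => 1 + (T1 x + T2 (f x)))) => [|x]; last by [].
apply: ebd_add; first exact/ebd_pbd/pbd_const.
by apply: ebd_add => //; exact: (pbd_comp_ebd s1 b2).
Qed.

(** Repeated doubling of a unary number. The cost of the loop comes from [runsF_foldl], as the
    accumulator has exponential size. *)
Lemma FE_pow2 (A : encType) (n : A -> nat) : FP n -> FE (fun x => 2 ^ n x).
Proof.
move=> hn; pose h (z : A * unit * nat) := z.2 + z.2.
have E x (s : seq unit) : foldx (fun=> 1) h x s = 2 ^ size s.
  elim/last_ind: s => [|s u IH] //; rewrite /foldx foldl_rcons -/(foldx _ h x s) IH size_rcons expnS.
  by rewrite /h /= mul2n addnn.
have pn : pbd n by apply: (pbd_le (g := fun x => esz (n x))) => [|x]; [case: hn|rewrite esz_nat; lia].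
split; last first.
  apply: (ebd_le (g := fun x => 1 + 2 * 2 ^ n x)) => [|x]; last by rewrite esz_nat.
  apply: ebd_add; [exact/ebd_pbd/pbd_const|apply: ebd_mul; [exact/ebd_pbd/pbd_const|exact: ebd_pow2]].
have [[Tl rl bl] sl] := FP_units hn.
have [[Tc rc bc] _] := FP_const A (1 : nat).
have [[Th rh [k bh]] _] : FP h by rewrite /h; fp.
pose Bc x := 1 + 2 * 2 ^ n x.
have eBc : ebd Bc.
  apply: ebd_add; [exact/ebd_pbd/pbd_const|apply: ebd_mul; [exact/ebd_pbd/pbd_const|exact: ebd_pow2]].
pose Bh x := (esz x + (Bc x + 5)) ^ k.
have eBh : ebd Bh.
  apply: ebd_exp; apply: ebd_add; first exact/ebd_pbd/pbd_esz.
  by apply: ebd_add => //; exact/ebd_pbd/pbd_const.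
have sz x s1 s2 : nseq (n x) tt = s1 ++ s2 -> esz (foldx (fun=> 1) h x s1) <= Bc x.
  move=> e; rewrite E esz_nat /Bc add1n ltnS leq_mul2l leq_exp2l //.
  by rewrite -(size_nseq (n x) tt) e size_cat leq_addr.
have [c hc] : runsF (fun x => foldx (fun=> 1) h x (nseq (n x) tt)) (fun x => Tl x + Tc x +
    (size (nseq (n x) tt)).+1 * (3000 * (esz x + esz (nseq (n x) tt) + Bc x + 1) + Bh x)).
  apply: (runsF_foldl rl rc rh sz) => x s1 b s2 e; apply: leq_trans (bh _) _; apply: leq_exp_mono.
  have := sz x s1 _ e; rewrite !esz_pair /= -[esz b]/1; lia.
eexists; first by exists c => x S; have := hc x S; rewrite E size_nseq; exact.
apply: ebd_add; first by apply: ebd_add; exact: ebd_pbd.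
apply: ebd_mul; first by apply: (ebd_le (g := fun x => 1 + n x)) => //; apply: ebd_pbd;
  exact: pbd_add (pbd_const _ 1) pn.
apply: ebd_add => //; apply: ebd_mul; first exact/ebd_pbd/pbd_const.
apply: ebd_add; last exact/ebd_pbd/pbd_const.
apply: ebd_add => //; apply: ebd_add; apply: ebd_pbd => //; exact: pbd_esz.
Qed.

Lemma EXPTIME_FE (f : seq bool -> bool) (L : language) :
  FE f -> (forall x, f x <-> L x) -> EXPTIME L.
Proof.
move=> [[T r [k bT]] _]; apply: EXPTIME_runsF (3 * k) r _ => x; apply: leq_trans (bT x) _.
rewrite leq_exp2l // expnM; apply: leq_exp_mono; apply: leq_trans (_ : 4 * size x + 3 <= _).
  by rewrite -[3]/(1 + 2) addnA leq_add2r; exact: esz_bits.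
rewrite !expnS expn0 muln1; move: (size x) => m; nia.
Qed.

(** * Parsing the input *)

Definition bits_val (P : nat) (s : seq bool) : nat := foldl (fun acc b => minn (acc * 2 + nat_of_bool b) P) 0 s.

(** The state consists of the numbers read so far, the bits of the current number in reverse, and a
    flag that the last bit announced another bit. The clamp at [P] keeps the unary values within the
    pad. *)
Definition parse_step (P : nat) (b : bool) (c : seq nat * (seq bool * bool)) : seq nat * (seq bool * bool) :=
  if c.2.2 then (c.1, (b :: c.2.1, false))
  else if b then (c.1, (c.2.1, true)) else (bits_val P c.2.1 :: c.1, ([::], false)).

Definition parse (P : nat) (w : seq bool) : seq nat :=
  rev (foldl (fun c b => parse_step P b c) ([::], ([::], false)) w).1.

Lemma bits_valE P s : bits_val P (rev s) = minn (bval s) P.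
Proof.
elim: s => [|b s IH]; first by rewrite /bits_val min0n.
by rewrite rev_cons /bits_val foldl_rcons -/(bits_val P (rev s)) IH bval_cons; lia.
Qed.

Lemma bits_val_le P s : bits_val P s <= P.
Proof. by rewrite -[s]revK bits_valE geq_minr. Qed.

Lemma parse_code P l : all (fun v => v <= P) l ->
  parse P (flatten [seq encode_nat v | v <- l]) = l.
Proof.
rewrite /parse => h; suff -> c : foldl (fun c b => parse_step P b c) (c, ([::], false))
    (flatten [seq encode_nat v | v <- l]) = (catrev l c, ([::], false)) by rewrite /= -/(rev l) revK.
elim: l c h => //= v l IH c /andP[vP /IH h]; rewrite foldl_cat.
suff -> : foldl (fun c b => parse_step P b c) (c, ([::], false)) (encode_nat v) = (v :: c, ([::], false)) by rewrite h.
rewrite /encode_nat foldl_rcons.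
have E s t : foldl (fun c b => parse_step P b c) (c, (t, false)) (flatten [seq [:: true; b] | b <- s])
    = (c, (catrev s t, false)) by elim: s t => //= b s IHs t; rewrite IHs.
by rewrite E /parse_step /= -/(rev (bits v)) bits_valE bval_bits (minn_idPl vP).
Qed.

Lemma FP_bits_val : FP (fun z : nat * seq bool => bits_val z.1 z.2).
Proof.
rewrite /bits_val.
apply: (FP_foldl_inv (h := fun z (b : bool) acc => minn (acc * 2 + nat_of_bool b) z.1)
  (bd := fun z : nat * seq bool => esz z) (P := fun z acc => acc <= z.1)); try by fp.
- exact: pbd_esz.
- by move=> z b acc _; rewrite geq_minr.
by move=> z acc h; rewrite esz_pair !esz_nat; lia.
Qed.

Lemma FP_parse : FP (fun z : nat * seq bool => parse z.1 z.2).
Proof.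
rewrite /parse; apply: FP_rev; apply: FP_fst_of.
apply: (FP_foldl2 (h := fun z (b : bool) c => parse_step z.1 b c) (l := fun z : nat * seq bool => z.2)
  (c0 := fun=> ([::], ([::], false)))
  (bd := fun z => size z.2 * (2 * z.1 + 2) + 4 * size z.2 + 7)).
- by fp.
- by fp.
- rewrite /parse_step; fp.
  by apply: (FP_comp2 (g := bits_val)) FP_bits_val _ _; fp.
- by apply: (pbd_nat (n := fun z : nat * seq bool => size z.2 * (2 * z.1 + 2) + 4 * size z.2 + 7)); fp.
move=> [P w] s1 s2 /= e; have {e s2} : size s1 <= size w by rewrite e size_cat leq_addr.
set c := foldl _ _ _ => h.
have [h1 h2 h3] : [/\ size c.1 <= size s1, all (fun u => esz u <= 2 * P + 1) c.1 & size c.2.1 <= size s1].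
  rewrite /c; elim/last_ind: s1 {c h} => [|s b [h1 h2 h3]] //; rewrite foldl_rcons size_rcons.
  move: (foldl _ _ _) h1 h2 h3 => [d [t fl]] /= h1 h2 h3; rewrite /parse_step /=.
  case: fl; case: b => //=; rewrite ?h2 ?andbT; split=> //; try exact: leqW.
  by rewrite esz_nat; have := bits_val_le P t; lia.
have := esz_seq_bd (leq_trans h1 h) h2; have := esz_bits c.2.1.
have : esz c.2.2 <= 3 by case: c.2.2.
have := leq_trans h3 h; rewrite (_ : (2 * P + 1).+1 = 2 * P + 2); last by rewrite -addnS.
rewrite !esz_pair; move: (size w * (2 * P + 2)) (size w) (size c.2.1) (esz c.1) (esz c.2.1) (esz c.2.2).
move=> q m n u v t; lia.
Qed.

(** The parser never fails, so encoding its result again and comparing it with the input rejects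
    everything that is not a sequence of codes of numbers. *)
Definition accepts (z : seq bool * (nat * nat)) : bool :=
  let l := parse z.2.1 z.1 in
  eqs (fun u => u.1 == u.2) (flatten [seq encode_nat v | v <- l]) z.1 && (valid (l, z.2) && decide (l, z.2)).

Lemma FP_accepts : FP accepts.
Proof.
have hp : FP (fun z : seq bool * (nat * nat) => parse z.2.1 z.1).
  by apply: (FP_comp2 (g := parse)) FP_parse _ _; fp.
rewrite /accepts; apply: FP_andb; last apply: FP_andb.
- apply: FP_eqs; [by fp| |by fp].
  by apply: FP_flatten; apply: (FP_map2 (h := fun _ v => encode_nat v)) => //; apply: FP_encode_nat; fp.
- by apply: (FP_comp (g := valid)); [fp|exact: FP_valid].
by apply: (FP_comp (g := decide)); [fp|exact: FP_decide].
Qed.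

Section EXPTIME.
Context (R : realType).

Lemma code_le_pad (l : seq nat) (w : seq bool) : flatten [seq encode_nat v | v <- l] = w ->
  2 ^ size w <= 2 ^ ((size w).+2 ^ 6) /\ all (fun v => v <= 2 ^ ((size w).+2 ^ 6)) l.
Proof.
move=> e; have h : 2 ^ size w <= 2 ^ ((size w).+2 ^ 6).
  by rewrite leq_exp2l // expnS -{1}[size w]muln1 leq_mul // ?expn_gt0 //; exact: leqW (leqnSn _).
split=> //; apply/allP => v /= vl; apply: leq_trans h; rewrite -e; apply: ltnW.
apply: leq_ltn_trans (sumn_code l); elim: l vl {e} => //= a l IH; rewrite inE => /orP[/eqP<-|/IH h].
  exact: leq_addr.
exact: leq_trans h (leq_addl _ _).
Qed.

(** For a code of length [size w] all numbers are below [2 ^ size w], so with these pads neither the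
    parser nor the common denominator is affected by clamping. *)
Lemma acceptsP (w : seq bool) :
  accepts (w, (2 ^ ((size w).+2 ^ 6), 2 ^ ((size w).+2 ^ 9))) <-> ConjRelReach R w.
Proof.
rewrite /accepts /=; set l := parse _ w; set P := 2 ^ _; set Q := 2 ^ _.
have dE l' : flatten [seq encode_nat v | v <- l'] = w -> dn (l', (P, Q)) = nzprod l'.
  move=> e; have [h _] := code_le_pad e; apply: (@dnE (l', (P, Q))) => /=.
  by apply: leq_trans (nzprod_code _) _; rewrite e.
split=> [/and3P[+ hv hd]|[I e hs]].
  rewrite eqsE // => /eqP e; have [I eI] := @valid_instance (l, (P, Q)) (dE _ e) hv.
  have eIw : encode I = w by rewrite /encode eI.
  by exists I => //; apply/(decide_instance R); rewrite eI eIw.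
have [_ h] := code_le_pad e; have lE : l = instance_code I by rewrite /l -e parse_code // e.
have d := dE _ e; rewrite eqsE // lE -/(encode I) e eqxx /=; apply/andP; split.
  exact: instance_valid d.
by have /(decide_instance R) := hs; rewrite e.
Qed.

Lemma ConjRelReach_EXPTIME : EXPTIME (ConjRelReach R).
Proof.
apply: (EXPTIME_FE (f := fun w => accepts (w, (2 ^ ((size w).+2 ^ 6), 2 ^ ((size w).+2 ^ 9))))); last exact: acceptsP.
apply: (FE_comp (f := fun w => (w, (2 ^ ((size w).+2 ^ 6), 2 ^ ((size w).+2 ^ 9))))) FP_accepts.
apply: FE_pair; first by apply: FE_FP; fp.
by apply: FE_pair; apply: FE_pow2; fp.
Qed.

End EXPTIME.

Theorem theorem7p27 (R : realType) :
  PSPACE_hard (ConjRelReach R) /\ EXPTIME (ConjRelReach R).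
Proof. by split; [exact: ConjRelReach_hard|exact: ConjRelReach_EXPTIME]. Qed.
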